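(* Let $\pi$ be an $R$-representation of Whittaker type of $G_n$, and $\pi'$ an $R$-representation of Whittaker type of $G_m$, for $1\le m\le n$. - If $n=m$, the $R$-submodule spanned by the Laurent series $I(X,W,W',\Phi)$ as $W$ varies in $W(\pi,\theta)$, $W'$ varies in $W(\pi',\theta^{-1})$, and $\Phi$ varies in $\mathcal{C}_c^\infty(F^n)$, is a fractional ideal $I(\pi,\pi')$ of $R[X^{\pm1}]$, and it has a unique generator which is an Euler factor $L(X,\pi,\pi')$. - If $1\le m\le n-1$, fix $j$ between $0$ and $n-m-1$. The $R$-submodule spanned by the Laurent series $I(X,W,W';j)$ as $W$ varies in $W(\pi,\theta)$ and $W'$ varies in $W(\pi',\theta^{-1})$ is a fractional ideal $I(\pi,\pi')$ of $R[X^{\pm1}]$, is independent of $j$, and it has a unique generator which is an Euler factor $L(X,\pi,\pi')$.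
   Context: **Notation.** $F$ is a non-archimedean local field of residual characteristic $p$, with valuation $v$, absolute value $|\cdot|$, residue cardinality $q$; $\ell\neq p$ is a prime; $R$ is $\overline{\mathbb{Q}_\ell}$ or $\overline{\mathbb{F}_\ell}$, with a fixed square root $q^{1/2}\in R$. $G_n=\mathrm{GL}_n(F)$; representations are smooth; $\nu=|\det|$; $G_n^k=\{g\in G_n:v(\det g)=k\}$. $\times$ denotes normalised parabolic induction from standard parabolics. $N_n$ is the group of upper triangular unipotent matrices; $\theta:F\to R^\times$ is a fixed nontrivial smooth character, also viewed as the character $u\mapsto\theta(\sum_iu_{i,i+1})$ of $N_n$. $\mathcal{C}_c^\infty(F^n)$ is the space of locally constant compactly supported $R$-valued functions. **Whittaker type.** An irreducible $\pi$ is generic if $\mathrm{Hom}_{N_n}(\pi,\theta)\neq0$; it is cuspidal if it is not a subrepresentation of a properly parabolically induced representation. For cuspidal $\rho$ let $o(\rho)=|\{\nu^r\rho:r\in\mathbb{Z}\}|$ (up to isomorphism), $e(\rho)=+\infty$ if $R=\overline{\mathbb{Q}_\ell}$, and for $R=\overline{\mathbb{F}_\ell}$: $e(\rho)=o(\rho)$ if $o(\rho)>1$, $e(\rho)=\ell$ if $o(\rho)=1$. For $a\le b$, $St(\rho,[a,b])$ is the unique generic subquotient of $\nu^a\rho\times\cdots\times\nu^b\rho$. A generic segment is $\Delta=[a,b]_\rho$ with $b-a+1<e(\rho)$, and then $\mathcal{L}(\Delta)=St(\rho,[a,b])$. A representation is of Whittaker type if it is $\mathcal{L}(\Delta_1)\times\cdots\times\mathcal{L}(\Delta_t)$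 with $\Delta_i$ generic segments; then $\dim\mathrm{Hom}_{N_n}(\pi,\theta)=1$ and $W(\pi,\theta)\subset\mathrm{Ind}_{N_n}^{G_n}\theta$ is its Whittaker model (the image of $\pi$). **Integrals.** Integrals are with respect to $R$-valued Haar measures (nonzero translation-invariant $R$-linear forms on locally constant compactly supported functions) and right invariant quotient measures on $N_m\backslash G_m$. Put $\eta=(0,\dots,0,1)\in F^n$. For $W\in W(\pi,\theta)$, $W'\in W(\pi',\theta^{-1})$: if $n=m$ and $\Phi\in\mathcal{C}_c^\infty(F^n)$, put $I(X,W,W',\Phi)=\sum_{k\in\mathbb{Z}}\left(\int_{N_n\backslash G_n^k}W(g)W'(g)\Phi(\eta g)dg\right)X^k$. If $m\le n-1$ and $0\le j\le n-m-1$, put $$I(X,W,W';j)=\sum_{k\in\mathbb{Z}}\left(\int_{\mathrm{Mat}_{j,m}(F)}\int_{N_m\backslash G_m^k}W\begin{pmatrix} g & & \\ x & I_j & \\ & & I_{n-m-j}\end{pmatrix}W'(g)\,dg\,dx\right)q^{k(n-m)/2}X^k.$$ The coefficients are well defined and vanish for $k\ll0$, so these lie in $R((X))$. An Euler factor is an element $1/P(X)$ with $P\in R[X]$ and $P(0)=1$. *)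

(* Defs.v *)
From HB Require Import structures.
From mathcomp Require Import all_boot all_order all_algebra.
From mathcomp Require Import all_classical topology.

Set Implicit Arguments.
Unset Strict Implicit.
Unset Printing Implicit Defensive.

Import Order.TTheory GRing.Theory Num.Theory.

Local Open Scope classical_set_scope.
Local Open Scope ring_scope.

(* A non-archimedean local field: complete for a normalised discrete valuation
   with finite residue field. The value [lfval 0] is irrelevant;
   [(x == 0) || (k <= lfval x)] reads "v(x) >= k" with v(0) = +oo. *)
HB.mixin Record isLocalField F of GRing.Field F & Complete F := {
  lfval : F -> int;
  resq : nat;
  lfvalM : forall x y : F, x != 0 -> y != 0 -> lfval (x * y) = lfval x + lfval y;
  lfvalD : forall x y : F, x != 0 -> y != 0 -> x + y != 0 ->
    Num.min (lfval x) (lfval y) <= lfval (x + y);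
  lfval_normalised : exists2 x : F, x != 0 & lfval x = 1;
  (* [resq] elements of the ring of integers represent its classes modulo the
     maximal ideal *)
  resqP : exists s : 'I_resq -> F,
    (forall i, (s i == 0) || (0 <= lfval (s i))) /\
    (forall x, (x == 0) || (0 <= lfval x) ->
       exists! i, (x - s i == 0) || (1 <= lfval (x - s i)));
  entourage_lfval : entourage = filter_from [set: int]
    (fun k => [set xy : F * F | (xy.1 - xy.2 == 0) || (k <= lfval (xy.1 - xy.2))])
}.

#[short(type="localFieldType")]
HB.structure Definition LocalField :=
  {F of isLocalField F & GRing.Field F & Complete F}.

Arguments resq : clear implicits.

Definition residue_char (F : localFieldType) (p : nat) :=
  prime p /\ ((p%:R == 0 :> F) || (1 <= lfval (p%:R : F))).

(* Q_l as the completion of the rationals for the l-adic valuation *)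
Definition is_Ql (l : nat) (K : localFieldType) :=
  [/\ forall a : nat, (0 < a)%N -> a%:R != 0 :> K,
      forall a : nat, (0 < a)%N -> lfval (a%:R : K) = (logn l a)%:Z &
      dense (range (ratr : rat -> K))].

Definition is_Qlbar (l : nat) (R : closedFieldType) :=
  exists2 K : localFieldType, is_Ql l K &
  exists f : {rmorphism K -> R}, forall x : R, algebraicOver f x.

Definition is_Flbar (l : nat) (R : closedFieldType) :=
  exists f : {rmorphism 'F_l -> R}, forall x : R, algebraicOver f x.

(* A chosen square root of the residue cardinality; it is nonzero as soon as the
   characteristic of R is not the residual one. *)
Record sqrt_resq (F : localFieldType) (R : fieldType) := SqrtResq {
  sqrtq :> R;
  sqrtq_sqr : sqrtq ^+ 2 = (resq F)%:R;
  sqrtq_neq0 : sqrtq != 0 }.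

(* Types with both a group law and a topology. Continuity of the operations is
   not part of the interface; it is only used for [GL F n] and [levi n_]. *)
#[short(type="groupTopType")]
HB.structure Definition GroupTop := {G of Group G & Topological G}.

Section GeneralLinear.
Variable F : localFieldType.

Record GL (n : nat) := MkGL { glmx :> 'M[F]_n; gl_unit : glmx \in unitmx }.

HB.instance Definition _ n := [isSub for @glmx n].
HB.instance Definition _ n := [Choice of GL n by <:].
HB.instance Definition _ n :=
  Topological.copy (GL n) (initial_topology (@glmx n)).

Lemma unitmx1P n : (1%:M : 'M[F]_n) \in unitmx. Proof. exact: unitmx1. Qed.
Lemma unitmxM n (g h : GL n) : g *m h \in unitmx.
Proof. by rewrite unitmx_mul !gl_unit. Qed.
Lemma unitmxV n (g : GL n) : invmx g \in unitmx.
Proof. by rewrite unitmx_inv gl_unit. Qed.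

Definition gl1 n := MkGL (unitmx1P n).
Definition glM n (g h : GL n) := MkGL (unitmxM g h).
Definition glV n (g : GL n) := MkGL (unitmxV g).

Lemma glMA n : associative (@glM n).
Proof. by move=> f g h; apply: val_inj; rewrite /= mulmxA. Qed.
Lemma gl1M n : left_id (gl1 n) (@glM n).
Proof. by move=> g; apply: val_inj; rewrite /= mul1mx. Qed.
Lemma glM1 n : right_id (gl1 n) (@glM n).
Proof. by move=> g; apply: val_inj; rewrite /= mulmx1. Qed.
Lemma glVM n : left_inverse (gl1 n) (@glV n) (@glM n).
Proof. by move=> g; apply: val_inj; rewrite /= mulVmx ?gl_unit. Qed.
Lemma glMV n : right_inverse (gl1 n) (@glV n) (@glM n).
Proof. by move=> g; apply: val_inj; rewrite /= mulmxV ?gl_unit. Qed.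

HB.instance Definition _ n :=
  isGroup.Build (GL n) (@glMA n) (@gl1M n) (@glM1 n) (@glVM n) (@glMV n).


(* The product of the GL_{n_i}(F), i.e. the standard Levi subgroup attached to
   the composition (n_0, ..., n_{t-1}). *)
Definition levi t (n_ : 'I_t -> nat) : Type := forall i, GL (n_ i).

HB.instance Definition _ t (n_ : 'I_t -> nat) :=
  Topological.copy (levi n_) (prod_topology (fun i => GL (n_ i))).

Section LeviGroup.
Variables (t : nat) (n_ : 'I_t -> nat).
Implicit Types l : levi n_.
Local Open Scope group_scope.

Definition levi1 : levi n_ := fun=> 1.
Definition leviM l1 l2 : levi n_ := fun i => l1 i * l2 i.
Definition leviV l : levi n_ := fun i => (l i)^-1.

Fact leviMA : associative leviM.
Proof. by move=> f g h; apply: functional_extensionality_dep => i; exact: mulgA. Qed.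
Fact levi1M : left_id levi1 leviM.
Proof. by move=> g; apply: functional_extensionality_dep => i; exact: mul1g. Qed.
Fact leviM1 : right_id levi1 leviM.
Proof. by move=> g; apply: functional_extensionality_dep => i; exact: mulg1. Qed.
Fact leviVM : left_inverse levi1 leviV leviM.
Proof. by move=> g; apply: functional_extensionality_dep => i; exact: mulVg. Qed.
Fact leviMV : right_inverse levi1 leviV leviM.
Proof. by move=> g; apply: functional_extensionality_dep => i; exact: mulgV. Qed.

HB.instance Definition _ :=
  isGroup.Build (levi n_) leviMA levi1M leviM1 leviVM leviMV.

End LeviGroup.

End GeneralLinear.

Section Representations.
Variable R : fieldType.

Record rep (G : groupType) : Type := Rep {
  rspace :> lmodType R;
  ract : G -> {linear rspace -> rspace};
  ract1 : forall x, ract 1%g x = x;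
  ractM : forall g h x, ract (g * h)%g x = ract g (ract h x) }.

Arguments ract {G} r g.

Section Morphisms.
Variable G : groupType.
Implicit Types r s : rep G.

Definition equivariant r s (f : r -> s) := forall g x, f (ract r g x) = ract s g (f x).

Definition rep_iso r s :=
  exists2 f : {linear r -> s}, equivariant f & bijective f.

Definition irreducible r :=
  (exists x : r, x != 0) /\
  forall U : set r, U 0 -> (forall a x y, U x -> U y -> U (a *: x + y)) ->
    (forall g x, U x -> U (ract r g x)) -> U = [set 0] \/ U = setT.

Definition subquotient r s :=
  exists u : rep G,
    (exists2 i : {linear u -> s}, equivariant i & injective i) /\
    (exists2 p : {linear u -> r}, equivariant p & range p = setT).

End Morphisms.

Definition smooth (G : groupTopType) (r : rep G) :=
  forall x : r, open [set g : G | ract r g x = x].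

Definition multilinear t (V_ : 'I_t -> lmodType R) (U : lmodType R)
    (b : (forall i, V_ i) -> U) :=
  forall (v : forall i, V_ i) i a (x y : V_ i),
    b (dfwith v i (a *: x + y)) = a *: b (dfwith v i x) + b (dfwith v i y).

Definition is_tensor t (V_ : 'I_t -> lmodType R) (T : lmodType R)
    (b : (forall i, V_ i) -> T) :=
  multilinear b /\
  forall (U : lmodType R) (c : (forall i, V_ i) -> U), multilinear c ->
    exists2 f : {linear T -> U}, forall v, f (b v) = c v &
      forall h : {linear T -> U}, (forall v, h (b v) = c v) -> h =1 f.

End Representations.

Section Whittaker.
Variables (F : localFieldType) (R : closedFieldType) (sq : sqrt_resq F R).

Local Notation G n := (GL F n).
Local Notation vdet g := (lfval (\det (glmx g))).

Fact resq_neq0 : (resq F)%:R != 0 :> R.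
Proof. by rewrite -(sqrtq_sqr sq) expf_neq0 ?sqrtq_neq0. Qed.

Fact vdet1 n : vdet (1%g : G n) = 0.
Proof.
have /(congr1 (+%R (- lfval (1 : F)))) := @lfvalM F 1 1 (oner_neq0 F) (oner_neq0 F).
by rewrite mulr1 addKr addNr => e; rewrite /= det1 -e.
Qed.

Fact vdetM n (g h : G n) : vdet (g * h)%g = vdet g + vdet h.
Proof.
have gu (k : G n) : \det (glmx k) != 0.
  by have := gl_unit k; rewrite unitmxE unitfE.
by rewrite /= det_mulmx lfvalM.
Qed.

Section Twist.
Variables (n : nat) (r : rep R (G n)) (s : int).

Definition twist_act (g : G n) : {linear r -> r} :=
  ((resq F)%:R ^ (- (s * vdet g))) \*: ract r g.

Fact twist_act1 x : twist_act 1%g x = x.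
Proof. by rewrite /= ract1 vdet1 mulr0 oppr0 expr0z scale1r. Qed.

Fact twist_actM g h x : twist_act (g * h)%g x = twist_act g (twist_act h x).
Proof.
rewrite /= ractM linearZ /= scalerA -expfzDr ?resq_neq0 //.
by rewrite vdetM mulrDr opprD.
Qed.

(* nu^s r, where nu = |det| and |x| = q^(- v(x)) *)
Definition twist := Rep twist_act1 twist_actM.

End Twist.

Section Induction.
Variables (n t : nat) (n_ : 'I_t -> nat) (e : (\sum_(i < t) n_ i)%N = n).

(* p is an element of the standard (block upper triangular) parabolic subgroup
   with blocks of sizes n_i, and l is its image in the Levi quotient. *)
Definition levi_part (p : G n) (l : levi F n_) :=
  let M := castmx (esym e, esym e) (glmx p) in
  (forall i j : 'I_t, (j < i)%N -> submxblock M i j = 0) /\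
  (forall i, submxblock M i i = glmx (l i)).

(* Square root of the modulus
   |det (Ad p | Lie N)| = \prod_(i < j) |det l_i| ^ n_j |det l_j| ^ - n_i. *)
Definition modulus_sqrt (l : levi F n_) : R :=
  sqrtq sq ^ (- \sum_(i < t) \sum_(j < t | (i < j)%N)
                 ((n_ j)%:Z * vdet (l i) - (n_ i)%:Z * vdet (l j))).

Variable s : rep R (levi F n_).

(* The space of the normalised parabolic induction of s; G n acts on it by right
   translations. *)
Definition induced_space : set (G n -> s) :=
  [set f | (forall p l g, levi_part p l ->
              f (p * g)%g = modulus_sqrt l *: ract s l (f g)) /\
           (\forall u \near (1%g : G n), forall g, f (g * u)%g = f g)].

Definition right_equivariant (r : rep R (G n)) (f : r -> G n -> s) :=
  forall g x h, f (ract r g x) h = f x (h * g)%g.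

Definition embeds_in_induced (r : rep R (G n)) :=
  exists f : {linear r -> (G n -> s)},
    [/\ right_equivariant f, injective f & range f `<=` induced_space].

Definition is_induced (r : rep R (G n)) :=
  exists f : {linear r -> (G n -> s)},
    [/\ right_equivariant f, injective f & range f = induced_space].

End Induction.

(* s is an external tensor product of the r_i *)
Definition is_outer_tensor t (n_ : 'I_t -> nat) (r_ : forall i, rep R (G (n_ i)))
    (s : rep R (levi F n_)) :=
  exists2 b : (forall i, r_ i) -> s, is_tensor b &
    forall (l : levi F n_) v, ract s l (b v) = b (fun i => ract (r_ i) (l i) (v i)).

(* r is isomorphic to r_0 \times ... \times r_(t-1) *)
Definition is_product n t (n_ : 'I_t -> nat) (r_ : forall i, rep R (G (n_ i)))
    (r : rep R (G n)) :=
  exists (e : (\sum_(i < t) n_ i)%N = n) (s : rep R (levi F n_)),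
    is_outer_tensor r_ s /\ is_induced e s r.

Definition cuspidal n (r : rep R (G n)) :=
  [/\ smooth r, irreducible r &
   forall t (n_ : 'I_t -> nat) (e : (\sum_(i < t) n_ i)%N = n)
       (s : rep R (levi F n_)),
     (1 < t)%N -> (forall i, (0 < n_ i)%N) -> smooth s ->
     ~ embeds_in_induced e s r].

Definition upper_unipotent n (u : G n) :=
  forall i j : 'I_n, (j <= i)%N -> glmx u i j = (i == j)%:R.

Definition locally_constant (T : topologicalType) (f : T -> R) :=
  forall x, \forall y \near x, f y = f x.

Definition nontrivial_smooth_character (theta : F -> R) :=
  [/\ forall x y, theta (x + y) = theta x * theta y,
      forall x, theta x != 0,
      locally_constant theta &
      exists x, theta x != 1].

Definition char_of_unipotent (theta : F -> R) n (u : G n) : R :=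
  theta (\sum_(i < n) \sum_(j < n | j == i.+1 :> nat) glmx u i j).

Definition whittaker_functional (theta : F -> R) n (r : rep R (G n))
    (lambda : {scalar r}) :=
  forall u x, upper_unipotent u ->
    lambda (ract r u x) = char_of_unipotent theta u * lambda x.

Definition generic (theta : F -> R) n (r : rep R (G n)) :=
  exists2 lambda : {scalar r}, whittaker_functional theta lambda &
    exists x, lambda x != 0.

(* W(r, theta). By Frobenius reciprocity the nonzero morphisms from r to
   Ind_N^G theta are the maps below, for nonzero lambda in Hom_N(r, theta); this
   space is a line when r is of Whittaker type, so that all of them have the same
   image. *)
Definition whittaker_model (theta : F -> R) n (r : rep R (G n)) :
    set (G n -> R) :=
  [set W | exists lambda : {scalar r},
     [/\ whittaker_functional theta lambda, exists x, lambda x != 0 &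
         exists x, forall g, W g = lambda (ract r g x)]].

Section Types.
Variables (ell : nat) (theta : F -> R).

(* r is isomorphic to St(rho, [a, b]) *)
Definition is_St k (rho : rep R (G k)) (a b : int) n (r : rep R (G n)) :=
  [/\ irreducible r, generic theta r &
   exists2 s : rep R (G n),
     is_product (fun i : 'I_(`|b - a|.+1) => twist rho (a + i%:Z)) s &
     subquotient r s].

(* o(rho) = o: the classes of o of the twists nu^s rho are representatives *)
Definition has_twist_order k (rho : rep R (G k)) (o : nat) :=
  exists s_ : 'I_o -> int, forall s : int,
    exists! i : 'I_o, rep_iso (twist rho s) (twist rho (s_ i)).

(* d < e(rho), where e(rho) = +oo unless R is an algebraic closure of F_ell *)
Definition lt_e k (rho : rep R (G k)) (d : nat) :=
  is_Flbar ell R ->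
  exists2 o, has_twist_order rho o & (d < (if (1 < o)%N then o else ell))%N.

Definition is_generic_segment_rep n (r : rep R (G n)) :=
  exists k (rho : rep R (G k)) (a b : int),
    [/\ (0 < k)%N, cuspidal rho, a <= b, lt_e rho `|b - a|.+1 &
        is_St rho a b r].

Definition whittaker_type n (r : rep R (G n)) :=
  exists t (n_ : 'I_t -> nat) (r_ : forall i, rep R (G (n_ i))),
    (forall i, is_generic_segment_rep (r_ i)) /\ is_product r_ r.

End Types.

Definition compact_support (T : topologicalType) (f : T -> R) :=
  exists2 C : set T, compact C & forall x, f x != 0 -> C x.

Definition Cc (T : topologicalType) : set (T -> R) :=
  [set f | locally_constant f /\ compact_support f].

(* The locally constant functions on N_n \ G_n with compact support, seen as
   left N_n-invariant functions on G_n. *)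
Definition Cc_quotient n : set (G n -> R) :=
  [set f | [/\ forall u g, upper_unipotent u -> f (u * g)%g = f g,
               locally_constant f &
               exists2 C : set (G n), compact C & forall g, f g != 0 ->
                 exists u c, [/\ upper_unipotent u, C c & g = (u * c)%g]]].

(* mu restricts to a nonzero linear form on the space S of functions on T, which
   is invariant under the translations tr y; its values out of S are irrelevant. *)
Definition invariant_form (T Y : Type) (S : set (T -> R)) (tr : Y -> T -> T)
    (mu : (T -> R) -> R) :=
  [/\ forall a f g, S f -> S g ->
        mu (fun x => a * f x + g x) = a * mu f + mu g,
      forall y f, S f -> mu (fun x => f (tr y x)) = mu f &
      exists2 f, S f & mu f != 0].

Definition haar_measure j m (mu : ('M[F]_(j, m) -> R) -> R) :=
  invariant_form (@Cc 'M[F]_(j, m)) +%R mu.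

Definition quotient_measure n (mu : (G n -> R) -> R) :=
  invariant_form (@Cc_quotient n) (fun h g => (g * h)%g) mu.

(* Elements of R((X)), and more generally two-sided formal series, are encoded
   by the function sending k to the coefficient of X^k. *)
Definition zeta_eq n (mu : (G n -> R) -> R) (W W' : G n -> R)
    (Phi : 'rV[F]_n -> R) : int -> R :=
  fun k => mu (fun g => if vdet g == k then
    W g * W' g * Phi ((\row_i (i.+1 == n)%:R) *m glmx g) else 0).

(* The n x n matrix with rows (g, 0, 0), (x, I_j, 0), (0, 0, I_(n-m-j)), where
   j <= n - m: [pid_mx j *m x] is x completed by n - m - j zero rows. *)
Definition corner_mx m n (le_mn : (m <= n)%N) j (g : 'M[F]_m)
    (x : 'M[F]_(j, m)) : 'M[F]_n :=
  castmx (subnKC le_mn, subnKC le_mn)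
    (block_mx g 0 ((pid_mx j : 'M_(n - m, j)) *m x) 1%:M).

Fact corner_unit m n (le_mn : (m <= n)%N) j (g : G m) (x : 'M[F]_(j, m)) :
  corner_mx le_mn (glmx g) x \in unitmx.
Proof.
have castE a b (e : a = b) (M : 'M[F]_a) :
  (castmx (e, e) M \in unitmx) = (M \in unitmx) by case: b / e; rewrite castmx_id.
by rewrite castE unitmxE det_lblock det1 mulr1 -unitmxE gl_unit.
Qed.

Definition corner m n (le_mn : (m <= n)%N) j (g : G m) (x : 'M[F]_(j, m)) : G n :=
  MkGL (corner_unit le_mn g x).

(* q^(k (n - m) / 2) is the power k (n - m) of the chosen square root of q *)
Definition zeta_lt m n (le_mn : (m <= n)%N) j (muM : ('M[F]_(j, m) -> R) -> R)
    (mu : (G m -> R) -> R) (W : G n -> R) (W' : G m -> R) : int -> R :=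
  fun k => muM (fun x => mu (fun g => if vdet g == k then
    W (corner le_mn g x) * W' g else 0)) * sqrtq sq ^ (k * (n - m)%N%:Z).

End Whittaker.

Section LaurentSeries.
Variable R : fieldType.
Implicit Types (f g : int -> R) (I : set (int -> R)).

Definition laurent_series : set (int -> R) :=
  [set f | exists k0, forall k, k < k0 -> f k = 0].

Definition laurent_poly : set (int -> R) :=
  [set f | finite_set [set k | f k != 0]].

(* Product in R((X)); the sum has finite support if f and g are Laurent series,
   or if one of them is a Laurent polynomial. *)
Definition lmul f g : int -> R :=
  fun k => \sum_(i \in [set: int]) f i * g (k - i).

Definition lone : int -> R := fun k => (k == 0)%:R.

Definition laurent_of_poly (P : {poly R}) : int -> R :=
  fun k => if k is Posz i then P`_i else 0.

Definition lspan (S : set (int -> R)) : set (int -> R) :=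
  [set f | exists d (c : 'I_d -> R) (s : 'I_d -> int -> R),
     (forall i, S (s i)) /\ forall k, f k = \sum_(i < d) c i * s i k].

(* fractional ideals of R[X, X^-1], inside the field R((X)) *)
Definition fractional_ideal I :=
  [/\ I `<=` laurent_series, I (fun=> 0),
      forall f g, I f -> I g -> I (fun k => f k + g k),
      forall Q f, laurent_poly Q -> I f -> I (lmul Q f) &
      exists Q, [/\ laurent_poly Q, exists k, Q k != 0 &
                    forall f, I f -> laurent_poly (lmul Q f)]].

Definition principal_ideal f : set (int -> R) :=
  [set lmul Q f | Q in laurent_poly].

Definition euler_factor f :=
  laurent_series f /\
  exists2 P : {poly R}, P.[0] = 1 & lmul (laurent_of_poly P) f = lone.

Definition has_unique_euler_generator I :=
  exists! L, euler_factor L /\ I = principal_ideal L.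

End LaurentSeries.

Definition zeta_span_eq (F : localFieldType) (R : closedFieldType)
    (theta : F -> R) n (pi pi' : rep R (GL F n)) (mu : (GL F n -> R) -> R) :
    set (int -> R) :=
  lspan [set Z | exists W W' Phi,
    [/\ whittaker_model theta pi W,
        whittaker_model (fun x => (theta x)^-1) pi' W',
        @Cc R 'rV[F]_n Phi & Z = zeta_eq mu W W' Phi]].

Definition zeta_span_lt (F : localFieldType) (R : closedFieldType)
    (sq : sqrt_resq F R) (theta : F -> R) m n (le_mn : (m <= n)%N)
    (pi : rep R (GL F n)) (pi' : rep R (GL F m)) j
    (muM : ('M[F]_(j, m) -> R) -> R) (mu : (GL F m -> R) -> R) :
    set (int -> R) :=
  lspan [set Z | exists W W',
    [/\ whittaker_model theta pi W,
        whittaker_model (fun x => (theta x)^-1) pi' W' &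
        Z = zeta_lt sq le_mn muM mu W W']].

(* Main.v *)
Require Import Defs.
From HB Require Import structures.
From mathcomp Require Import all_boot all_order all_algebra.
From mathcomp Require Import all_classical topology.
From mathcomp Require Import perm zify ring.

(** The integrals are rational for an elementary reason, which is the same for all
coefficient fields.

By the Iwasawa decomposition the coefficient of [X^k] is a finite sum, over the
elements [a] of the diagonal torus with [v (det a) = k] and over finitely many
elements [h] of the maximal compact subgroup, of the values of the integrand at [a h],
weighted by the volume of a double coset ([mu_formula]). Write [a] as a product of
powers, with exponents [y i], of the elements [zt i = diag (pi, ..., pi, 1, ..., 1)].
The volume is geometric in each [y i]. The integrand vanishes when some [y i] is very
negative ([whittaker_decay]), and as a function of each large [y i] it satisfies a
linear recurrence: a nonzero polynomial in [zt i] sends the representation into the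
span [V(U_i)] of the vectors [u w - w], where [u] is in the unipotent radical of a maximal
parabolic subgroup ([jacquet_finite]), and the Whittaker functions of vectors of [V(U_i)]
vanish on the torus for large [y i] ([jac_decay]). A product of two sequences satisfying
recurrences satisfies one again ([product_recurrence]). Since the recurrences depend
only on the two representations, all the integrals have a common denominator
([torus_rational]).

The finiteness of the Jacquet modules comes from admissibility and finite generation.
A cuspidal representation equals [V(U)] for every [U] ([cuspidal_jac]), so that by the
Cartan decomposition its [K]-fixed vectors are spanned, up to the centre, by a finite
family ([cuspidal_fixd_span]); the centre acts by scalars ([pact_nakayama],
[cuspidal_adm]). Admissibility passes to tensor products, induced representations and
subquotients. Finite generation passes to induced representations because a central
element of the Levi subgroup contracts the opposite unipotent radical ([ind_fgen]).
Nonzero Whittaker functionals on induced representations are obtained from averages over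
larger and larger subgroups of the opposite radical ([whittaker_of_levi]).

The span of the integrals is stable under multiplication by [X] and its inverse
(translate all the data by an element whose determinant has valuation one) and it
contains [1]: there are vectors whose Whittaker function, restricted to a smaller linear
group, has support [N C] with [C] a small group, and is equal to [1] on [C] ([kirillov]). As [R[X]] is
principal, a fractional ideal which contains [1] is generated by the inverse of a
polynomial with constant term [1], and this generator is unique ([lspan_euler]).

If [m < n], the additional integration over [x] does not change the span. The
support of a Whittaker function bounds the rows of [x], from the last to the first ([nm_bounded]), so that the
integral is a finite sum of integrals without [x]; conversely every integral without [x]
arises from a vector which is cut so that its Whittaker function sees only a small
neighbourhood of [x = 0] ([nm_cut]). *)

Set Implicit Arguments.
Unset Strict Implicit.
Unset Printing Implicit Defensive.

Import Order.TTheory GRing.Theory Num.Theory.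

Local Open Scope classical_set_scope.
Local Open Scope ring_scope.

(** * Finite transversals in an abstract group *)

Definition mulgE :=
  (@invgM, @invgK, @mulgA, @mulVg, @mulgV, @mul1g, @mulg1, @mulgK, @mulgVK, @invg1).

Section Transversals.
Variable G : groupType.
Implicit Types (H K L : set G) (g k : G).
Local Open Scope group_scope.

Definition subgr H :=
  [/\ H 1, forall x y, H x -> H y -> H (x * y) & forall x, H x -> H x^-1].

(** A family indexed by a finite type stands for the coset space [K / H], so that averages over
infinite groups are finite sums over [T]. *)
Definition transv (T : finType) (f : T -> G) K H :=
  (forall i, K (f i)) /\ forall k, K k -> exists! i, H ((f i)^-1 * k).

Definition tindex (T : finType) (f : T -> G) H (i0 : T) k : T :=
  xget i0 [set i | H ((f i)^-1 * k)].

Lemma tindexP (T : finType) (f : T -> G) K H i0 k :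
  transv f K H -> K k -> H ((f (tindex f H i0 k))^-1 * k).
Proof.
move=> [_ h] Kk; rewrite /tindex; case: xgetP => [i _ //|no].
by have [i [Hi _]] := h _ Kk; case: (no i).
Qed.

Lemma tindex_uniq (T : finType) (f : T -> G) K H i0 k i :
  transv f K H -> K k -> H ((f i)^-1 * k) -> i = tindex f H i0 k.
Proof.
move=> tr Kk Hi; have [j [_ u]] := tr.2 _ Kk.
by rewrite -(u _ Hi) -(u _ (tindexP i0 tr Kk)).
Qed.

Lemma transv_inhabited (T : finType) (f : T -> G) K H :
  transv f K H -> K 1 -> exists i0 : T, True.
Proof. by move=> [_ h] /h [i _]; exists i. Qed.

Section Sums.
Variables (V : zmodType) (phi : G -> V) (K H : set G).
Hypotheses (sK : subgr K) (sH : subgr H) (sHK : H `<=` K).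
Hypothesis phiH : forall k h, K k -> H h -> phi (k * h) = phi k.

Lemma sum_transv (T T' : finType) (f : T -> G) (f' : T' -> G) :
  transv f K H -> transv f' K H -> (\sum_i phi (f i))%R = (\sum_i phi (f' i))%R.
Proof.
move=> tr tr'; case: sK => K1 KM KV; case: (sH) => H1 HM HV.
have [i0 _] := transv_inhabited tr K1; have [j0 _] := transv_inhabited tr' K1.
pose a i := tindex f' H j0 (f i); pose b j := tindex f H i0 (f' j).
have aP i : H ((f' (a i))^-1 * f i) by apply: (tindexP j0 tr'); exact: tr.1.
have bP j : H ((f (b j))^-1 * f' j) by apply: (tindexP i0 tr); exact: tr'.1.
have inv x y : H (x^-1 * y) -> H (y^-1 * x).
  by move=> /HV; rewrite invgM invgK.
have aK : cancel a b.
  move=> i; symmetry; apply: (tindex_uniq i0 tr); first exact: tr'.1.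
  exact: inv.
have bK : cancel b a.
  move=> j; symmetry; apply: (tindex_uniq j0 tr'); first exact: tr.1.
  exact: inv.
rewrite (reindex b) /=; last by exists a => ? _; [exact: bK|exact: aK].
apply: eq_bigr => j _.
by rewrite -[f' j](mulVKg (f (b j))) phiH //; exact: tr.1.
Qed.

Lemma transv_mul (T : finType) (f : T -> G) k0 :
  K k0 -> transv f K H -> transv (fun i => k0 * f i) K H.
Proof.
move=> Kk0 [f1 f2]; case: sK => K1 KM KV; split=> [i|k Kk]; first exact: KM.
have [i [Hi u]] := f2 (k0^-1 * k) (KM _ _ (KV _ Kk0) Kk).
by exists i; split=> [|j]; rewrite invgM -mulgA //; exact: u.
Qed.

Lemma sum_transv_mul (T : finType) (f : T -> G) k0 : K k0 -> transv f K H ->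
  (\sum_i phi (k0 * f i))%R = (\sum_i phi (f i))%R.
Proof. by move=> Kk0 tr; apply: sum_transv (transv_mul Kk0 tr) tr. Qed.

End Sums.

Lemma transv_card K H (T T' : finType) (f : T -> G) (f' : T' -> G) :
  subgr K -> subgr H -> H `<=` K ->
  transv f K H -> transv f' K H -> #|T| = #|T'|.
Proof.
move=> sK sH sHK tr tr'.
have := @sum_transv int (fun=> 1%R) K H sK sH (fun _ _ _ _ => erefl) _ _ _ _ tr tr'.
by rewrite !sumr_const => /eqP; rewrite eqr_nat => /eqP.
Qed.

Lemma transv_tower K L H (T T' : finType) (f : T -> G) (f' : T' -> G) :
  subgr K -> subgr L -> subgr H -> L `<=` K -> H `<=` L ->
  transv f K L -> transv f' L H ->
  transv (fun ij : T * T' => f ij.1 * f' ij.2) K H.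
Proof.
move=> [K1 KM KV] [L1 LM LV] [H1 HM HV] LK HL [f1 f2] [g1 g2]; split.
  by move=> ij; apply: KM => //; exact: LK.
move=> k Kk; have [i [Li ui]] := f2 _ Kk; have [j [Hj uj]] := g2 _ Li.
exists (i, j); split=> /=; first by rewrite invgM -mulgA.
case=> i' j' /=; rewrite invgM -mulgA => Hij.
have e : i = i'.
  apply: ui; rewrite -[X in L X](mulVKg (f' j')); apply: LM; first exact: g1.
  exact: HL.
by subst i'; rewrite (uj _ Hij).
Qed.

(** The function [c] separates the cosets; one representative is chosen in each fibre. *)
Lemma transv_exists K H (C : finType) (c : G -> C) :
  (forall k k', K k -> K k' -> c k = c k' -> H (k^-1 * k')) ->
  (forall k h, K k -> H h -> K (k * h) -> c (k * h) = c k) ->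
  exists (T : finType) (f : T -> G), transv f K H.
Proof.
move=> cP cP'; pose P := [pred x : C | `[< exists2 k, K k & c k = x >]].
have Pf (x : {x | P x}) : exists2 k, K k & c k = val x.
  by have /asboolP := valP x.
pose f x := s2val (cid2 (Pf x)).
have fK x : K (f x) by exact: (s2valP (cid2 (Pf x))).
have fc x : c (f x) = val x by exact: (s2valP' (cid2 (Pf x))).
exists {x | P x}, f; split=> // k Kk.
have Pk : P (c k) by apply/asboolP; exists k.
exists (Sub (c k) Pk); split=> [|x Hx].
  by apply: cP => //; rewrite fc.
apply: val_inj; rewrite /= -fc -[k](mulVKg (f x)) cP' //; first by rewrite mulVKg.
Qed.

Lemma transv_sub K L H (T : finType) (f : T -> G) :
  subgr K -> subgr L -> subgr H -> L `<=` K -> H `<=` L -> transv f K H ->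
  (exists (T' : finType) (f' : T' -> G), transv f' L H) /\
  (exists (T' : finType) (f' : T' -> G), transv f' K L).
Proof.
move=> sK sL sH LK HL tr; have [K1 KM KV] := sK; have [L1 LM LV] := sL.
have [H1 HM HV] := sH; have [i0 _] := transv_inhabited tr K1.
have inv x y : H (x^-1 * y) -> H (y^-1 * x).
  by move=> /HV; rewrite invgM invgK.
have tP k k' : K k -> K k' -> tindex f H i0 k = tindex f H i0 k' -> H (k^-1 * k').
  move=> Kk Kk' e; have h := tindexP i0 tr Kk; have := tindexP i0 tr Kk'.
  rewrite -e => h'; rewrite -[k'](mulVKg (f (tindex f H i0 k))) mulgA.
  by apply: HM => //; exact: inv.
split; first apply: (@transv_exists L H T (tindex f H i0)).
- by move=> k k' Lk Lk'; apply: tP; exact: LK.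
- move=> k h Lk Hh _; symmetry; apply: (tindex_uniq i0 tr).
    by apply: KM; [exact: LK|apply: LK; exact: HL].
  rewrite mulgA; apply: HM => //; apply: (tindexP i0 tr); exact: LK.
pose c k := [set i | `[< L ((f i)^-1 * k) >]]%SET.
apply: (@transv_exists K L {set T} c) => [k k' Kk Kk' e|k h Kk Lh Kkh].
  have ik := tindexP i0 tr Kk; set i := tindex _ _ _ _ in ik.
  have : i \in c k' by rewrite -e inE; apply/asboolP; exact: HL.
  rewrite inE => /asboolP ik'; rewrite -[k'](mulVKg (f i)) mulgA.
  by apply: LM => //; have := LV _ (HL _ ik); rewrite invgM invgK.
apply/setP => i; rewrite !inE; apply/asboolP/asboolP; rewrite mulgA => h1.
  by have := LM _ _ h1 (LV _ Lh); rewrite mulgK.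
exact: LM.
Qed.

Lemma transv_conj K H (T : finType) (f : T -> G) a : transv f K H ->
  transv (fun i => a * f i * a^-1) [set g | K (a^-1 * g * a)]
    [set g | H (a^-1 * g * a)].
Proof.
move=> [f1 f2]; split=> [i|k /= Kk]; first by rewrite /= !mulgE.
have [i [Hi u]] := f2 _ Kk; exists i; split=> [|j].
  by move: Hi; rewrite /= !mulgE.
by move=> /= Hj; apply: u; move: Hj; rewrite !mulgE.
Qed.

Lemma subgr_conj K a : subgr K -> subgr [set g | K (a^-1 * g * a)].
Proof.
move=> [K1 KM KV]; split=> /= [|x y Kx Ky|x Kx].
- by rewrite mulg1 mulVg.
- by have := KM _ _ Kx Ky; rewrite !mulgE.
- by have := KV _ Kx; rewrite !mulgE.
Qed.

Lemma subgrI K L : subgr K -> subgr L -> subgr (K `&` L).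
Proof.
move=> [K1 KM KV] [L1 LM LV]; split; first by split.
  by move=> x y [? ?] [? ?]; split; [exact: KM|exact: LM].
by move=> x [? ?]; split; [exact: KV|exact: LV].
Qed.

Definition setM K L : set G := [set g | exists k l, [/\ K k, L l & g = k * l]].

Lemma setM_subgr K L : subgr K -> subgr L ->
  (forall k l, K k -> L l -> L (k^-1 * l * k)) -> subgr (setM K L).
Proof.
move=> [K1 KM KV] [L1 LM LV] nKL; split.
- by exists 1, 1; rewrite mulg1.
- move=> _ _ [k [l [Kk Ll ->]]] [k' [l' [Kk' Ll' ->]]].
  exists (k * k'), (k'^-1 * l * k' * l'); split; [exact: KM|apply: LM => //|].
    exact: nKL.
  by rewrite !mulgE.
- move=> _ [k [l [Kk Ll ->]]]; exists k^-1, (k * l^-1 * k^-1); split.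
  + exact: KV.
  + by have := nKL _ _ (KV _ Kk) (LV _ Ll); rewrite invgK.
  + by rewrite !mulgE.
Qed.

End Transversals.

(** * The valuation, digits and congruences of matrices *)

Section LocalField.
Variable F : localFieldType.
Implicit Types (x y : F) (s t : int).

Definition inO s x := (x == 0) || (s <= lfval x).

Lemma lfval1 : lfval (1 : F) = 0.
Proof.
have := @lfvalM F 1 1 (oner_neq0 F) (oner_neq0 F); rewrite mulr1 => e.
by apply: (addrI (lfval (1 : F))); rewrite addr0 -e.
Qed.

Lemma lfvalV x : x != 0 -> lfval x^-1 = - lfval x.
Proof.
move=> x0; have := @lfvalM F _ _ x0 (invr_neq0 x0); rewrite mulfV // lfval1.
by move=> e; apply: (addrI (lfval x)); rewrite -e subrr.
Qed.

Lemma lfvalN x : lfval (- x) = lfval x.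
Proof.
have [->|x0] := eqVneq x 0; first by rewrite oppr0.
have n1 : (-1 : F) != 0 by rewrite oppr_eq0 oner_neq0.
have := @lfvalM F _ _ n1 n1; rewrite mulrNN mulr1 lfval1 => e.
rewrite -mulN1r lfvalM //; lia.
Qed.

Lemma inO0 s : inO s 0. Proof. by rewrite /inO eqxx. Qed.

Lemma inON s x : inO s (- x) = inO s x.
Proof. by rewrite /inO oppr_eq0 lfvalN. Qed.

Lemma inOD s x y : inO s x -> inO s y -> inO s (x + y).
Proof.
rewrite /inO; have [->|x0] := eqVneq x 0; first by rewrite add0r.
have [->|y0] := eqVneq y 0; first by rewrite addr0 (negbTE x0).
have [//|xy0] := eqVneq (x + y) 0 => /= sx sy.
by apply: le_trans (@lfvalD F _ _ x0 y0 xy0); rewrite le_min sx sy.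
Qed.

Lemma inOB s x y : inO s x -> inO s y -> inO s (x - y).
Proof. by move=> sx sy; apply: inOD; rewrite ?inON. Qed.

Lemma inOM s t x y : inO s x -> inO t y -> inO (s + t) (x * y).
Proof.
rewrite /inO mulf_eq0; have [//|x0] := eqVneq x 0.
have [//|y0] := eqVneq y 0 => /= sx sy.
rewrite lfvalM //; lia.
Qed.

Lemma inO_le s t x : s <= t -> inO t x -> inO s x.
Proof. by rewrite /inO => st; case: eqVneq => //= _; exact: le_trans. Qed.

Lemma inO0M s x y : inO 0 x -> inO s y -> inO s (x * y).
Proof. by move=> hx hy; rewrite -[s]add0r; exact: inOM. Qed.

Lemma inOM0 s x y : inO s x -> inO 0 y -> inO s (x * y).
Proof. by move=> hx hy; rewrite -[s]addr0; exact: inOM. Qed.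

Lemma inO1 : inO 0 (1 : F).
Proof. by rewrite /inO lfval1 lexx orbT. Qed.

Lemma inO_sign (n : nat) : inO 0 ((-1) ^+ n : F).
Proof. by rewrite -signr_odd; case: odd; rewrite ?expr1 ?inON ?expr0 inO1. Qed.

Lemma inO_sum s (I : Type) (r : seq I) (P : pred I) (f : I -> F) :
  (forall i, P i -> inO s (f i)) -> inO s (\sum_(i <- r | P i) f i).
Proof. by move=> h; elim/big_ind: _ => //; [exact: inO0|exact: inOD]. Qed.

Lemma inO_prod (I : Type) (r : seq I) (P : pred I) (f : I -> F) :
  (forall i, P i -> inO 0 (f i)) -> inO 0 (\prod_(i <- r | P i) f i).
Proof. by move=> h; elim/big_ind: _ => //; [exact: inO1|exact: inO0M]. Qed.

Lemma inO_prodB s (I : Type) (r : seq I) (P : pred I) (f g : I -> F) :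
  (forall i, P i -> [/\ inO 0 (f i), inO 0 (g i) & inO s (f i - g i)]) ->
  inO s (\prod_(i <- r | P i) f i - \prod_(i <- r | P i) g i).
Proof.
move=> h; elim: r => [|i r IH]; first by rewrite !big_nil subrr inO0.
rewrite !big_cons; case: ifP => // Pi; have [fi gi fgi] := h _ Pi.
set a := \prod_(_ <- _ | _) _; set b := \prod_(_ <- _ | _) _.
have -> : f i * a - g i * b = f i * (a - b) + (f i - g i) * b by ring.
apply: inOD; first exact: inO0M.
by apply: inOM0 => //; apply: inO_prod => j Pj; have [] := h _ Pj.
Qed.

Lemma inO_all0 x : (forall s : nat, inO s%:Z x) -> x = 0.
Proof.
move=> h; apply/eqP; have := h `|lfval x|.+1%N; rewrite /inO.
by case: eqVneq => //= _; lia.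
Qed.

Lemma lfval_eqmod x y : x != 0 -> inO (lfval x + 1) (y - x) ->
  y != 0 /\ lfval y = lfval x.
Proof.
move=> x0; rewrite /inO subr_eq0; case: (eqVneq y x) => [->//|yx /= h].
have y0 : y != 0.
  by apply: contraTN h => /eqP ->; rewrite sub0r lfvalN; lia.
split=> //; have d0 : y - x != 0 by rewrite subr_eq0.
have h1 : Num.min (lfval x) (lfval (y - x)) <= lfval y.
  by have := @lfvalD F x (y - x) x0 d0; rewrite addrC subrK; exact.
have h2 : Num.min (lfval y) (lfval (y - x)) <= lfval x.
  have := @lfvalD F y (- (y - x)) y0; rewrite oppr_eq0 lfvalN => /(_ d0).
  by rewrite opprB addrC subrK; exact.
lia.
Qed.

Definition unif : F := s2val (cid2 (@lfval_normalised F)).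

Lemma unif_neq0 : unif != 0.
Proof. exact: s2valP (cid2 (@lfval_normalised F)). Qed.

Lemma lfval_unif : lfval unif = 1.
Proof. exact: s2valP' (cid2 (@lfval_normalised F)). Qed.

Lemma pw_neq0 s : unif ^ s != 0.
Proof. by rewrite expfz_neq0 ?unif_neq0. Qed.

Lemma lfval_pw s : lfval (unif ^ s) = s.
Proof.
have e (n : nat) : lfval (unif ^+ n) = n.
  elim: n => [|n IH]; first by rewrite expr0 lfval1.
  by rewrite exprS lfvalM ?expf_neq0 ?unif_neq0 // IH lfval_unif; lia.
case: s => n; first by rewrite -exprnP e.
by rewrite NegzE -exprnN lfvalV ?expf_neq0 ?unif_neq0 // e.
Qed.

Lemma inO_pw s : inO s (unif ^ s).
Proof. by rewrite /inO lfval_pw lexx orbT. Qed.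

Lemma inO_pwM s t x : inO s (unif ^ t * x) = inO (s - t) x.
Proof.
rewrite /inO mulf_eq0 (negbTE (pw_neq0 _)) /=; case: eqVneq => //= x0.
rewrite lfvalM ?pw_neq0 // lfval_pw; lia.
Qed.

Definition dig : 'I_(resq F) -> F := sval (cid (@resqP F)).

Lemma dig_int i : inO 0 (dig i).
Proof. exact: (svalP (cid (@resqP F))).1. Qed.

Lemma digP x : inO 0 x -> exists! i, inO 1 (x - dig i).
Proof. exact: (svalP (cid (@resqP F))).2. Qed.

Fixpoint expansion (l : seq 'I_(resq F)) : F :=
  if l is i :: l' then dig i + unif * expansion l' else 0.

Lemma expansion_int l : inO 0 (expansion l).
Proof.
elim: l => [|i l IH] /=; first exact: inO0.
apply: inOD; first exact: dig_int.
by have := inOM (inO_pw 1) IH; rewrite expr1z; apply: inO_le; lia.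
Qed.

(** Divide by the uniformizer one digit at a time. *)
Lemma expansionP (t : nat) x : inO 0 x ->
  exists! l : t.-tuple 'I_(resq F), inO t (x - expansion l).
Proof.
elim: t x => [|t IH] x x0.
  exists [tuple]; split=> [|l _]; first by rewrite subr0.
  by apply: val_inj => /=; case: l => [[]].
have [i [xi ui]] := digP x0.
have [|l [hl ul]] := IH (unif ^ (-1) * (x - dig i)).
  by rewrite inO_pwM.
have e r : x - (dig i + unif * r) = unif ^ 1 * (unif ^ (-1) * (x - dig i) - r).
  rewrite mulrBr mulrA -expfzDr ?unif_neq0 // subrr expr0z mul1r expr1z; ring.
exists [tuple of i :: l]; split=> [|l'].
  by rewrite /= e inO_pwM; have -> : t.+1%:Z - 1 = t by lia.
case/tupleP: l' => j l'; rewrite /= => h.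
have ij : i = j.
  apply: ui; have -> : x - dig j = x - (dig j + unif * expansion l') + unif * expansion l'.
    ring.
  apply: inOD; first by apply: inO_le h; lia.
  by rewrite -[unif]expr1z inO_pwM subrr expansion_int.
subst j; move: h; rewrite e inO_pwM; have -> : t.+1%:Z - 1 = t by lia.
by move=> /ul ->; apply: val_inj.
Qed.

Definition digits (t : nat) x : t.-tuple 'I_(resq F) :=
  if pselect (inO 0 x) is left h then sval (cid (expansionP t h))
  else sval (cid (expansionP t (inO0 0))).

Lemma digitsP (t : nat) x : inO 0 x -> inO t (x - expansion (digits t x)).
Proof.
by move=> x0; rewrite /digits; case: pselect => // h; case: (cid _) => l /= [].
Qed.

Lemma digits_uniq (t : nat) x (l : t.-tuple 'I_(resq F)) :
  inO 0 x -> inO t (x - expansion l) -> digits t x = l.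
Proof.
move=> x0 h; rewrite /digits; case: pselect => // h'; case: (cid _) => l' /= [_ u].
exact: u.
Qed.

Lemma digits_eq (t : nat) x y : inO 0 x -> inO 0 y ->
  (digits t x = digits t y) <-> inO t (x - y).
Proof.
move=> x0 y0; have hx := digitsP t x0; have hy := digitsP t y0; split=> [e|h].
  have -> : x - y = (x - expansion (digits t x)) - (y - expansion (digits t y)).
    by rewrite e; ring.
  exact: inOB.
apply: digits_uniq => //.
have -> : x - expansion (digits t y) = (x - y) + (y - expansion (digits t y)) by ring.
exact: inOD.
Qed.

(** ** Matrices with entries in a fractional ideal *)

Definition mxO s m n (A : 'M[F]_(m, n)) := forall i j, inO s (A i j).

Section MxO.
Variables m n : nat.
Implicit Types A B : 'M[F]_(m, n).

Lemma mxO0 s : mxO s (0 : 'M[F]_(m, n)).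
Proof. by move=> i j; rewrite mxE inO0. Qed.

Lemma mxON s A : mxO s A -> mxO s (- A).
Proof. by move=> h i j; rewrite mxE inON. Qed.

Lemma mxOD s A B : mxO s A -> mxO s B -> mxO s (A + B).
Proof. by move=> hA hB i j; rewrite mxE inOD. Qed.

Lemma mxOB s A B : mxO s A -> mxO s B -> mxO s (A - B).
Proof. by move=> hA hB; apply: mxOD => //; exact: mxON. Qed.

Lemma mxO_le s t A : s <= t -> mxO t A -> mxO s A.
Proof. by move=> st h i j; apply: inO_le (h i j). Qed.

Lemma mxO_exists A : exists s : nat, mxO (- s%:Z) A.
Proof.
exists (\sum_i \sum_j `|lfval (A i j)|)%N => i j.
rewrite /inO; case: eqVneq => //= _.
by rewrite (bigD1 i) //= (bigD1 j) //=; lia.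
Qed.

Lemma mxOZ s t c A : inO s c -> mxO t A -> mxO (s + t) (c *: A).
Proof. by move=> hc hA i j; rewrite mxE inOM. Qed.
End MxO.

Lemma mxOM s t m n k (A : 'M[F]_(m, n)) (B : 'M[F]_(n, k)) :
  mxO s A -> mxO t B -> mxO (s + t) (A *m B).
Proof. by move=> hA hB i j; rewrite mxE; apply: inO_sum => l _; exact: inOM. Qed.

Lemma mxO0M s m n k (A : 'M[F]_(m, n)) (B : 'M[F]_(n, k)) :
  mxO 0 A -> mxO s B -> mxO s (A *m B).
Proof. by move=> hA hB; rewrite -[s]add0r; exact: mxOM. Qed.

Lemma mxOM0 s m n k (A : 'M[F]_(m, n)) (B : 'M[F]_(n, k)) :
  mxO s A -> mxO 0 B -> mxO s (A *m B).
Proof. by move=> hA hB; rewrite -[s]addr0; exact: mxOM. Qed.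

Lemma mxO1 n : mxO 0 (1%:M : 'M[F]_n).
Proof. by move=> i j; rewrite mxE; case: eqP => _; [exact: inO1|exact: inO0]. Qed.

Lemma inO_det n (A : 'M[F]_n) : mxO 0 A -> inO 0 (\det A).
Proof.
move=> hA; rewrite /determinant; apply: inO_sum => s _.
by apply: inO0M; [exact: inO_sign|exact: inO_prod].
Qed.

Lemma det_congr s n (A B : 'M[F]_n) : mxO 0 A -> mxO 0 B -> mxO s (A - B) ->
  inO s (\det A - \det B).
Proof.
move=> hA hB h; rewrite /determinant -sumrB; apply: inO_sum => p _.
rewrite -mulrBr; apply: inO0M; first exact: inO_sign.
by apply: inO_prodB => i _; split=> //; have := h i (p i); rewrite !mxE.
Qed.

Lemma mxO_adj n (A : 'M[F]_n) : mxO 0 A -> mxO 0 (\adj A).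
Proof.
move=> hA i j; rewrite mxE /cofactor; apply: inO0M; first exact: inO_sign.
by apply: inO_det => k l; rewrite !mxE.
Qed.

Lemma mxO_inv n (A : 'M[F]_n) : mxO 0 A -> \det A != 0 -> lfval (\det A) = 0 ->
  mxO 0 (invmx A).
Proof.
move=> hA d0 dv; rewrite /invmx unitmxE unitfE d0.
rewrite -[0]addr0; apply: mxOZ; last exact: mxO_adj.
by rewrite /inO lfvalV // dv oppr0 lexx orbT.
Qed.

(** The determinant is congruent to [1], hence a unit. *)
Lemma unit_1Dmx s n (X : 'M[F]_n) : 1 <= s -> mxO s X ->
  [/\ 1%:M + X \in unitmx, mxO 0 (invmx (1%:M + X)) &
      mxO s (invmx (1%:M + X) - 1%:M)].
Proof.
move=> s1 hX; set A := 1%:M + X.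
have hX0 : mxO 0 X by apply: mxO_le hX; lia.
have hA : mxO 0 A by apply: mxOD => //; exact: mxO1.
have := @det_congr 1 n A 1%:M hA (@mxO1 n); rewrite det1.
have -> : A - 1%:M = X by rewrite /A addrC addKr.
move=> /(_ (mxO_le s1 hX)) hd.
have [|d0 dv] := @lfval_eqmod 1 (\det A) (oner_neq0 _).
  by rewrite lfval1 add0r.
have uA : A \in unitmx by rewrite unitmxE unitfE.
have hI : mxO 0 (invmx A) by apply: mxO_inv; rewrite ?dv ?lfval1.
split=> //.
have -> : invmx A - 1%:M = - (invmx A *m X).
  have -> : X = A - 1%:M by rewrite /A addrC addKr.
  by rewrite mulmxBr mulVmx // mulmx1 opprB.
apply: mxON; exact: mxO0M.
Qed.

End LocalField.
Arguments unif {F}.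

(** * Congruence subgroups and the topology of GL(n) *)

Section Congruence.
Variables (F : localFieldType) (n : nat).
Implicit Types (g h k : GL F n) (A X : 'M[F]_n) (J : rel 'I_n).

Lemma glmxM g h : glmx (g * h)%g = glmx g *m glmx h. Proof. by []. Qed.
Lemma glmx1 : glmx (1%g : GL F n) = 1%:M. Proof. by []. Qed.
Lemma glmxV g : glmx g^-1%g = invmx (glmx g). Proof. by []. Qed.
Lemma glmx_inj : injective (@glmx F n). Proof. exact: val_inj. Qed.

Lemma glmxKV g : glmx g *m glmx g^-1%g = 1%:M.
Proof. by rewrite glmxV mulmxV ?gl_unit. Qed.

Lemma glmxVK g : glmx g^-1%g *m glmx g = 1%:M.
Proof. by rewrite glmxV mulVmx ?gl_unit. Qed.

Definition Kc (s : nat) : set (GL F n) :=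
  [set g | mxO s (glmx g - 1%:M) /\ mxO s (glmx g^-1%g - 1%:M)].

Lemma Kc_int s g : Kc s g -> mxO 0 (glmx g).
Proof.
move=> [h _]; rewrite -[glmx g](subrK 1%:M); apply: mxOD; last exact: mxO1.
by apply: mxO_le h; lia.
Qed.

Lemma Kc_subgr s : subgr (Kc s).
Proof.
have mul g h : mxO s (glmx g - 1%:M) -> Kc s h -> mxO s (glmx g *m glmx h - 1%:M).
  move=> hg hh; have -> : glmx g *m glmx h - 1%:M =
      (glmx g - 1%:M) *m glmx h + (glmx h - 1%:M).
    by rewrite mulmxBl mul1mx addrA subrK.
  by apply: mxOD; [apply: mxOM0 => //; exact: Kc_int hh|exact: hh.1].
split.
- by split; rewrite ?invg1 glmx1 subrr; exact: mxO0.
- move=> g h [hg hg'] [hh hh']; split; rewrite ?invgM glmxM; apply: mul => //.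
  by split; rewrite ?invgK.
- by move=> g [h1 h2]; split; rewrite ?invgK.
Qed.

Lemma Kc_le s t g : (s <= t)%N -> Kc t g -> Kc s g.
Proof. by move=> st [h1 h2]; split; [apply: mxO_le h1|apply: mxO_le h2]; lia. Qed.

Lemma Kc_normal s k g : Kc 0 k -> Kc s g -> Kc s (k^-1 * g * k)%g.
Proof.
move=> Kk; have aux g0 : mxO s (glmx g0 - 1%:M) ->
    mxO s (glmx (k^-1 * g0 * k)%g - 1%:M).
  move=> h; have -> : glmx (k^-1 * g0 * k)%g - 1%:M =
      glmx k^-1%g *m (glmx g0 - 1%:M) *m glmx k.
    by rewrite mulmxBr mulmxBl mulmx1 !glmxM glmxVK.
  apply: mxOM0; last exact: Kc_int Kk.
  by apply: mxO0M => //; have [_ _ V] := Kc_subgr 0; exact: Kc_int (V _ Kk).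
by move=> [h1 h2]; split; [exact: aux|rewrite !mulgE -mulgA mulgA; exact: aux].
Qed.

Lemma Kc_mk s X : (0 < s)%N -> mxO s X -> exists2 g, Kc s g & glmx g = 1%:M + X.
Proof.
move=> s0 hX; have [|u i0 h] := @unit_1Dmx F s n X _ hX; first by lia.
by exists (MkGL u) => //; split; rewrite //= addrC addKr.
Qed.

Lemma Kc1P s g : (0 < s)%N -> mxO s (glmx g - 1%:M) -> Kc s g.
Proof.
move=> s0 h; have [g' K' e] := Kc_mk s0 h.
by have <- : g' = g by apply: glmx_inj; rewrite e addrC subrK.
Qed.

Lemma Kc0P g : mxO 0 (glmx g) -> mxO 0 (glmx g^-1%g) -> Kc 0 g.
Proof. by move=> h h'; split; apply: mxOB => //; exact: mxO1. Qed.

Lemma Kc_sub (s : nat) g h : mxO 0 (glmx g^-1%g) -> mxO 0 (glmx h^-1%g) ->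
  mxO s (glmx h - glmx g) -> Kc s (g^-1 * h)%g.
Proof.
move=> hg hh e; split; rewrite ?invgM ?invgK glmxM.
  have -> : glmx g^-1%g *m glmx h - 1%:M = glmx g^-1%g *m (glmx h - glmx g).
    by rewrite mulmxBr glmxVK.
  exact: mxO0M.
have -> : glmx h^-1%g *m glmx g - 1%:M = - (glmx h^-1%g *m (glmx h - glmx g)).
  by rewrite mulmxBr glmxVK opprB.
by apply: mxON; exact: mxO0M.
Qed.

(** ** Unipotent-like groups cut out by a pattern of entries *)

Definition supp J X := forall i j, ~~ J i j -> X i j = 0.

Definition UJ J : set (GL F n) :=
  [set g | supp J (glmx g - 1%:M) /\ supp J (glmx g^-1%g - 1%:M)].

Lemma suppD J X Y : supp J X -> supp J Y -> supp J (X + Y).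
Proof. by move=> hX hY i j nJ; rewrite mxE hX ?hY ?addr0. Qed.

Lemma suppM J X Y : transitive J -> supp J X -> supp J Y -> supp J (X *m Y).
Proof.
move=> tJ hX hY i j nJ; rewrite mxE big1 // => l _.
have [ij|nil] := boolP (J i l); last by rewrite hX ?mul0r.
rewrite hY ?mulr0 //; apply: contra nJ; exact: tJ.
Qed.

Lemma supp_mul1 J g Y : transitive J -> supp J (glmx g - 1%:M) -> supp J Y ->
  supp J (glmx g *m Y).
Proof.
move=> tJ hg hY; rewrite -[glmx g](subrK 1%:M) mulmxDl mul1mx.
by apply: suppD => //; exact: suppM.
Qed.

Lemma UJ_subgr J : transitive J -> subgr (UJ J).
Proof.
move=> tJ; have mul g h : supp J (glmx g - 1%:M) -> supp J (glmx h - 1%:M) ->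
    supp J (glmx (g * h)%g - 1%:M).
  move=> hg hh; have -> : glmx (g * h)%g - 1%:M =
      glmx g *m (glmx h - 1%:M) + (glmx g - 1%:M).
    by rewrite mulmxBr mulmx1 glmxM addrA subrK.
  by apply: suppD => //; exact: supp_mul1.
split.
- by split=> i j _; rewrite ?invg1 glmx1 subrr mxE.
- by move=> g h [hg hg'] [hh hh']; split; rewrite ?invgM; exact: mul.
- by move=> g [h1 h2]; split; rewrite ?invgK.
Qed.

(** Whether [1 + X] is invertible, with an inverse of the same shape, for all [X] in [J] with entries in [pi^s]: true for
all [J] if [s > 0], and for all [s] if [J] is nilpotent. *)
Definition padm J (s : nat) := forall X, supp J X -> mxO s X ->
  exists2 g, Kc s g /\ UJ J g & glmx g = 1%:M + X.

Definition ranked J := exists r : 'I_n -> nat, forall i j, J i j -> (r i < r j)%N.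

Lemma padm_all s : (0 < s)%N -> padm (fun _ _ => true) s.
Proof. by move=> s0 X _ hX; have [g Kg e] := Kc_mk s0 hX; exists g. Qed.

Lemma ranked_unit J X : ranked J -> supp J X -> 1%:M + X \in unitmx.
Proof.
move=> [r rJ] hX; rewrite -row_free_unit; apply: inj_row_free => v.
rewrite mulmxDr mulmx1 => e; apply/rowP => j; rewrite mxE.
have [k] := ubnP (r j); elim: k j => // k IH j rj.
move/rowP: e => /(_ j); rewrite !mxE big1 ?addr0 // => i _.
have [Jij|nJ] := boolP (J i j); last by rewrite hX ?mulr0.
by rewrite IH ?mul0r //; apply: leq_trans (rJ _ _ Jij) _.
Qed.

Lemma ranked_inv_entry J X (i j : 'I_n) : ranked J -> supp J X ->
  (invmx (1%:M + X) - 1%:M) i j = - \sum_l X i l * invmx (1%:M + X) l j.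
Proof.
move=> rJ hX; have := mulmxV (ranked_unit rJ hX).
rewrite mulmxDl mul1mx => /matrixP /(_ i j); rewrite !mxE => <-.
by rewrite opprD addrA subrr sub0r.
Qed.

Lemma ranked_inv_supp J X : transitive J -> ranked J -> supp J X ->
  supp J (invmx (1%:M + X) - 1%:M).
Proof.
move=> tJ rJ hX i j; have [r hr] := rJ.
have [b] := ubnP (\sum_l r l - r i)%N; elim: b i j => // b IH i j bi nJ.
rewrite (ranked_inv_entry _ _ rJ hX) big1 ?oppr0 // => l _.
have [Jil|nil] := boolP (J i l); last by rewrite hX ?mul0r.
have nlj : ~~ J l j by apply: contra nJ; exact: tJ.
have := IH l j _ nlj; rewrite !mxE => /(_ _)/eqP; rewrite subr_eq0 => h.
have /eqP -> : invmx (1%:M + X) l j == (l == j)%:R.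
  apply: h; have := hr _ _ Jil; have : (r l <= \sum_l r l)%N by rewrite (bigD1 l) //= leq_addr.
  lia.
case: eqP => [lj|_]; last by rewrite mulr0.
by move: nJ; rewrite -lj Jil.
Qed.

Lemma ranked_inv_O J X (s : nat) : ranked J -> supp J X -> mxO s X ->
  mxO s (invmx (1%:M + X) - 1%:M).
Proof.
move=> rJ hX sX i j; have [r hr] := rJ.
have [b] := ubnP (\sum_l r l - r i)%N; elim: b i j => // b IH i j bi.
rewrite (ranked_inv_entry _ _ rJ hX) inON; apply: inO_sum => l _.
have [Jil|nil] := boolP (J i l); last by rewrite hX ?mul0r ?inO0.
apply: inOM0 => //; rewrite -[invmx _ l j](subrK ((1%:M : 'M[F]_n) l j)); apply: inOD.
  apply: (@inO_le _ _ s) => //; rewrite -[- _]/(- _).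
  have := IH l j; rewrite !mxE; apply.
  have := hr _ _ Jil; have : (r l <= \sum_l r l)%N by rewrite (bigD1 l) //= leq_addr.
  lia.
exact: mxO1.
Qed.

Lemma UJ_mk J X : transitive J -> ranked J -> supp J X ->
  exists2 g, UJ J g & glmx g = 1%:M + X.
Proof.
move=> tJ rJ hX; exists (MkGL (ranked_unit rJ hX)) => //.
split; last by rewrite glmxV /=; exact: ranked_inv_supp.
by have -> : glmx (MkGL (ranked_unit rJ hX)) - 1%:M = X by rewrite /= addrC addKr.
Qed.

Lemma UJP J g : transitive J -> ranked J -> supp J (glmx g - 1%:M) -> UJ J g.
Proof.
move=> tJ rJ h; have [g' U' e] := UJ_mk tJ rJ h.
by have <- : g' = g by apply: glmx_inj; rewrite e addrC subrK.
Qed.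

Lemma padm_ranked J s : transitive J -> ranked J -> padm J s.
Proof.
move=> tJ rJ X hX sX; have [g Ug e] := UJ_mk tJ rJ hX; exists g => //; split=> //.
split; first by rewrite e addrC addKr.
rewrite glmxV e; exact: ranked_inv_O rJ hX sX.
Qed.

(** The digits of the entries in [J] represent the cosets, so the index is a power of [resq F],
which is invertible in [R]. *)
Lemma UJ_Kc_transv J (s t : nat) : transitive J -> padm J s -> (s <= t)%N ->
  exists (T : finType) (f : T -> GL F n),
    transv f (UJ J `&` Kc s) (UJ J `&` Kc t) /\ exists e, #|T| = (resq F ^ e)%N.
Proof.
move=> tJ pJ st.
pose P := {p : 'I_n * 'I_n | J p.1 p.2}.
pose T := {ffun P -> (t - s).-tuple 'I_(resq F)}.
pose X (f : T) : 'M[F]_n := \matrix_(i, j)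
  (if insub (i, j) is Some p then unif ^ s * expansion (f p) else 0).
have XJ f : supp J (X f).
  by move=> i j nJ; rewrite mxE; case: insubP => //= p; rewrite (negbTE nJ).
have Xs f : mxO s (X f).
  move=> i j; rewrite mxE; case: insubP => [p _ _|_]; last exact: inO0.
  by rewrite inO_pwM subrr; exact: expansion_int.
pose g f := s2val (cid2 (pJ _ (XJ f) (Xs f))).
have gK f : Kc s (g f) /\ UJ J (g f) := s2valP (cid2 (pJ _ (XJ f) (Xs f))).
have gE f : glmx (g f) = 1%:M + X f := s2valP' (cid2 (pJ _ (XJ f) (Xs f))).
have [U1 UM UV] := UJ_subgr tJ; have [K1 KM KV] := Kc_subgr s.
have Kinv k : Kc s k -> mxO 0 (glmx k^-1%g) by move=> /KV /Kc_int.
exists T, g; split; last first.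
  exists ((t - s) * #|{: P}|)%N.
  by rewrite card_ffun card_tuple card_ord expnM.
split=> [f|k [Uk Kk]]; first by have [] := gK f.
have bd p : inO 0 (unif ^ (- s%:Z) * (glmx k - 1%:M) p.1 p.2).
  by rewrite inO_pwM; have := Kk.1 p.1 p.2; rewrite sub0r opprK.
have E f (i j : 'I_n) (Jij : J i j) : inO t ((glmx k - glmx (g f)) i j) <->
    inO (t - s)%N (unif ^ (- s%:Z) * (glmx k - 1%:M) i j - expansion (f (Sub (i, j) Jij))).
  have -> : glmx k - glmx (g f) = (glmx k - 1%:M) - X f by rewrite gE opprD addrA.
  rewrite mxE [(- X f) i j]mxE [X f i j]mxE.
  case: insubP => [p _ ep|]; last by rewrite /= Jij.
  have -> : p = Sub (i, j) Jij by apply: val_inj; rewrite ep.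
  set a := (glmx k - 1%:M) i j; set b := expansion _.
  have -> : a - unif ^ s * b = unif ^ s * (unif ^ (- s%:Z) * a - b).
    by rewrite mulrBr mulrA -expfzDr ?unif_neq0 // subrr expr0z mul1r.
  by rewrite inO_pwM subzn.
have main f : (UJ J `&` Kc t) ((g f)^-1 * k)%g <-> forall p : P,
    f p = digits (t - s) (unif ^ (- s%:Z) * (glmx k - 1%:M) (val p).1 (val p).2).
  split=> [[_ [h _]] [[i j] /= Jij]|h].
    symmetry; apply: digits_uniq; first exact: (bd (i, j)).
    apply/(E f i j Jij).
    have -> : glmx k - glmx (g f) = glmx (g f) *m (glmx ((g f)^-1 * k)%g - 1%:M).
      by rewrite mulmxBr mulmx1 glmxM mulmxA glmxKV mul1mx.
    by apply: mxO0M => //; exact: Kc_int (gK f).1.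
  split; first by apply: UM => //; apply: UV; exact: (gK f).2.
  apply: Kc_sub; [exact: Kinv (gK f).1|exact: Kinv|] => i j.
  have [Jij|nJ] := boolP (J i j); last first.
    have -> : (glmx k - glmx (g f)) i j = (glmx k - 1%:M) i j - X f i j.
      by rewrite gE !mxE opprD addrA.
    by rewrite XJ // Uk.1 // subr0 inO0.
  by apply/(E f i j Jij); rewrite h; apply: digitsP; exact: (bd (i, j)).
exists [ffun p : P => digits (t - s) (unif ^ (- s%:Z) * (glmx k - 1%:M) (val p).1 (val p).2)].
split; first by apply/main => p; rewrite ffunE.
by move=> f /main h; apply/ffunP => p; rewrite ffunE h.
Qed.

End Congruence.

Section MxTopology.
Variables (F : localFieldType) (m n : nat).
Implicit Types (M N : 'M[F]_(m, n)).

Lemma entourage_ball (s : nat) : entourage [set xy : F * F | inO s (xy.1 - xy.2)].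
Proof. by rewrite entourage_lfval; exists s. Qed.

Lemma nbhs_mxP M (A : set 'M[F]_(m, n)) :
  nbhs M A <-> exists s : nat, forall N, mxO s (N - M) -> A N.
Proof.
split=> [|[s h]].
  rewrite -filter_from_entourageE => -[E [P hP sPE] sEA].
  have cP i j : exists s : nat, forall x, inO s (x - M i j) -> P i j (M i j, x).
    have := hP i j; rewrite entourage_lfval => -[k _ kP].
    exists `|k|%N => x hx; apply: kP => /=; rewrite -/(inO k (M i j - x)) -opprB inON.
    by apply: inO_le hx; lia.
  have [s hs] := choice (fun ij : 'I_m * 'I_n => cP ij.1 ij.2).
  exists (\sum_ij s ij)%N => N hN; apply: sEA; apply/xsectionP/sPE => i j /=.
  apply: (hs (i, j)); have := hN i j; rewrite !mxE; apply: inO_le.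
  by rewrite (bigD1 (i, j)) //= lez_nat leq_addr.
rewrite -filter_from_entourageE.
exists [set MN : 'M[F]_(m, n) * 'M[F]_(m, n) | mxO s (MN.2 - MN.1)].
  exists (fun _ _ => [set xy : F * F | inO s (xy.2 - xy.1)]).
    move=> i j; have := entourage_inv (entourage_ball s); apply: filterS.
    by move=> [x y].
  by move=> [N N'] /= hN i j; have := hN i j; rewrite !mxE.
by move=> N /xsectionP /= /h.
Qed.

(** An ultrafilter singles out one of the finitely many classes modulo each power of the uniformizer, so it
is a Cauchy filter. *)
Lemma compact_mxO (s : int) : compact [set M : 'M[F]_(m, n) | mxO s M].
Proof.
rewrite compact_ultra /= => U UU US.
pose c (t : nat) M := [ffun ij : 'I_m * 'I_n => digits t (unif ^ (- s) * M ij.1 ij.2)].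
have cP t M N : mxO s M -> mxO s N -> c t M = c t N -> mxO (t%:Z + s) (M - N).
  move=> hM hN /ffunP e i j; have := e (i, j); rewrite !ffunE /= => h.
  have /digits_eq : digits t (unif ^ (- s) * M i j) = digits t (unif ^ (- s) * N i j) by [].
  rewrite !inO_pwM sub0r opprK => /(_ (hM i j) (hN i j)).
  by rewrite -mulrBr inO_pwM opprK !mxE.
have ex t : exists d, U (c t @^-1` [set d]).
  apply: contrapT => no.
  have h d : U (~` (c t @^-1` [set d])).
    by case: (in_ultra_setVsetC (c t @^-1` [set d]) UU) => // hd; case: no; exists d.
  have := @filter_forall _ _ (fun d => ~` (c t @^-1` [set d])) U _ h.
  move=> h'; have [M /(_ (c t M))] := filter_ex (h' _); exact.
have cau : cauchy U.
  move=> E [P hP sPE].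
  have cPt i j : exists t : nat, forall x y, inO (t%:Z + s) (x - y) -> P i j (x, y).
    have := hP i j; rewrite entourage_lfval => -[k _ kP].
    exists `|k - s|%N => x y hx; apply: kP => /=; rewrite -/(inO k (x - y)).
    by apply: inO_le hx; lia.
  have [t ht] := choice (fun ij : 'I_m * 'I_n => cPt ij.1 ij.2).
  pose t0 := (\sum_ij t ij)%N; have [d hd] := ex t0.
  have UA : U (c t0 @^-1` [set d] `&` [set M | mxO s M]) by apply: filterI.
  exists ((c t0 @^-1` [set d] `&` [set M | mxO s M]), (c t0 @^-1` [set d] `&` [set M | mxO s M])) => //.
  move=> [M N] /= [[cM hM] [cN hN]]; apply: sPE => i j /=.
  apply: (ht (i, j)); have := cP t0 M N hM hN; rewrite cM cN => /(_ erefl i j).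
  rewrite !mxE; apply: inO_le; rewrite lerD2r /t0 (bigD1 (i, j)) //= lez_nat leq_addr //.
have /cvg_ex [M UM] : cvg U by apply: mx_complete cau.
exists M; split=> // i j.
have : U [set N | mxO `|s| (N - M)] by apply: UM; apply/nbhs_mxP; exists `|s|%N.
move=> /(filterI US)/filter_ex [N /= [hN hNM]].
have -> : M i j = N i j - (N - M) i j by rewrite !mxE opprB addrC subrK.
by apply: inOB => //; apply: inO_le (hNM i j); lia.
Qed.

End MxTopology.

HB.instance Definition _ (F : localFieldType) n := isPointed.Build (GL F n) 1%g.

Section GLTopology.
Variables (F : localFieldType) (n : nat).
Implicit Types (g h k : GL F n).

Lemma nbhs_GL_mx g (A : set (GL F n)) :
  nbhs g A <-> exists s : nat, forall h, mxO s (glmx h - glmx g) -> A h.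
Proof.
split.
  rewrite nbhsE => -[B [[C oC <-] /= Cg] sBA].
  have : nbhs (glmx g) C by apply: open_nbhs_nbhs.
  by move=> /nbhs_mxP [s hs]; exists s => h hh; apply: sBA; exact: hs.
move=> [s hs].
have : nbhs (glmx g) [set N | mxO s (N - glmx g)] by apply/nbhs_mxP; exists s.
rewrite nbhsE => -[C [oC Cg] sC].
rewrite nbhsE; exists (@glmx F n @^-1` C); last by move=> h /sC; exact: hs.
by split=> //; exists C.
Qed.

(** The inverse of [g] has bounded entries, so a small difference stays small after
multiplication by it. *)
Lemma Kc_close g : exists b : nat, forall (s : nat) h, (b < s)%N ->
  mxO s (glmx h - glmx g) -> Kc (s - b) (g^-1 * h)%g.
Proof.
have [b hb] := mxO_exists (glmx g^-1%g); exists b => s h bs hh.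
apply: Kc1P; first by rewrite subn_gt0.
have -> : glmx (g^-1 * h)%g - 1%:M = glmx g^-1%g *m (glmx h - glmx g).
  by rewrite mulmxBr glmxVK.
by apply: mxO_le (mxOM hb hh); lia.
Qed.

Lemma nbhs_GLP g (A : set (GL F n)) :
  nbhs g A <-> exists s : nat, forall k, Kc s k -> A (g * k)%g.
Proof.
rewrite nbhs_GL_mx; split=> -[s hs].
  have [b hb] := mxO_exists (glmx g); exists (s + b)%N => k Kk; apply: hs.
  have -> : glmx (g * k)%g - glmx g = glmx g *m (glmx k - 1%:M).
    by rewrite mulmxBr mulmx1.
  by apply: mxO_le (mxOM hb Kk.1); lia.
have [b hb] := Kc_close g; exists (s + b).+1 => h hh.
rewrite -[h](mulVKg g); apply: hs; apply: (@Kc_le _ _ _ ((s + b).+1 - b)%N); first by lia.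
by apply: hb => //; lia.
Qed.

Lemma Kc_conj g (u : nat) : exists u2, forall k, Kc u2 k -> Kc u (g^-1 * k * g)%g.
Proof.
have [b1 hb1] := mxO_exists (glmx g); have [b2 hb2] := mxO_exists (glmx g^-1%g).
exists (u + b1 + b2)%N => k [h1 h2].
have aux k' : mxO (u + b1 + b2)%N (glmx k' - 1%:M) -> mxO u (glmx (g^-1 * k' * g)%g - 1%:M).
  move=> h; have -> : glmx (g^-1 * k' * g)%g - 1%:M = glmx g^-1%g *m (glmx k' - 1%:M) *m glmx g.
    by rewrite mulmxBr mulmxBl mulmx1 !glmxM glmxVK.
  by apply: mxO_le (mxOM (mxOM hb2 h) hb1); lia.
by split; [exact: aux|rewrite !mulgE -mulgA mulgA; exact: aux].
Qed.

Lemma Kc_open g (s : nat) : open [set h | Kc s (g^-1 * h)%g].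
Proof.
rewrite openE => h /= Kh; apply/nbhs_GLP; exists s => k Kk /=.
by rewrite mulgA; have [_ KM _] := @Kc_subgr F n s; exact: KM.
Qed.

Lemma compact_GL_cover (C : set (GL F n)) (s : GL F n -> nat) : compact C ->
  exists2 gs : seq (GL F n), (forall g, g \in gs -> C g) &
  forall g, C g -> exists2 h, h \in gs & Kc (s h) (h^-1 * g)%g.
Proof.
rewrite compact_cover => /(_ _ C (fun h => [set g | Kc (s h) (h^-1 * g)%g])).
case=> [h _|g Cg|D sD cD].
- exact: Kc_open.
- by exists g => //=; rewrite mulVg; have [] := @Kc_subgr F n (s g).
exists (finmap.enum_fset D) => [g gD|g /cD [h /= hD Kh]]; first by have := sD g gD; rewrite inE.
by exists h.
Qed.

Lemma fmap_ultra (T T' : Type) (f : T -> T') (U : set_system T) :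
  UltraFilter U -> UltraFilter (fmap f U).
Proof.
move=> UU; split; first exact: fmap_proper_filter.
move=> G PG sUG; apply/seteqP; split=> // A GA; rewrite /fmap /=.
case: (in_ultra_setVsetC (f @^-1` A) UU) => // h.
have /sUG GnA : fmap f U (~` A) by [].
by have [x []] := filter_ex (filterI GA GnA).
Qed.

Definition bounded_GL (b : nat) : set (GL F n) :=
  [set g | mxO (- b%:Z) (glmx g) /\ mxO (- b%:Z) (glmx g^-1%g)].

(** Along an ultrafilter the matrix and its inverse both converge, and the two limits are
inverse to each other. *)
Lemma compact_bounded_GL b : compact (bounded_GL b).
Proof.
rewrite compact_ultra /= => U UU UB.
have cvgf (f : GL F n -> 'M[F]_n) : (forall g, bounded_GL b g -> mxO (- b%:Z) (f g)) ->
    exists M, mxO (- b%:Z) M /\ forall s : nat, U [set g | mxO s (f g - M)].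
  move=> hf; have := @compact_mxO F n n (- b%:Z); rewrite compact_ultra /=.
  move=> /(_ _ (fmap_ultra f UU)) [|M [bM UM]].
    by have : U (f @^-1` [set M | mxO (- b%:Z) M]) by apply: filterS UB => g; exact: hf.
  exists M; split=> // s.
  by have : fmap f U [set N | mxO s (N - M)] by apply: UM; apply/nbhs_mxP; exists s.
have h1 g : bounded_GL b g -> mxO (- b%:Z) (glmx g) by case.
have h2 g : bounded_GL b g -> mxO (- b%:Z) (glmx g^-1%g) by case.
have [M [bM UM]] := cvgf _ h1.
have [N [bN UN]] := cvgf _ h2.
have MN : M *m N = 1%:M.
  apply/eqP; rewrite -subr_eq0; apply/eqP/matrixP => i j; rewrite [RHS]mxE.
  apply: inO_all0 => t; move: i j; rewrite -/(mxO t (M *m N - 1%:M)).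
  have [g [[Bg hM] hN]] := filter_ex (filterI (filterI UB (UM (t + b)%N)) (UN (t + b)%N)).
  have -> : M *m N - 1%:M = - ((glmx g - M) *m N + glmx g *m (glmx g^-1%g - N)).
    rewrite mulmxBl mulmxBr glmxKV; set x := glmx g *m N.
    by rewrite [x - _ + _]addrC addrA subrK opprB.
  apply: mxON; apply: mxOD; [apply: mxO_le (mxOM hM bN)|apply: mxO_le (mxOM Bg.1 hN)]; lia.
have [uM uN] := mulmx1_unit MN.
exists (MkGL uM); split.
  split=> //=; suff -> : invmx M = N by [].
  by rewrite -[invmx M]mulmx1 -MN mulmxA mulVmx // mul1mx.
by move=> A /nbhs_GL_mx [s hs]; apply: filterS (UM s) => g; exact: hs.
Qed.

Lemma bounded_GL_finite (gs : seq (GL F n)) :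
  exists b, forall g k, g \in gs -> Kc 0 k -> bounded_GL b (g * k)%g.
Proof.
elim: gs => [|g gs [b hb]]; first by exists 0%N.
have [b1 h1] := mxO_exists (glmx g); have [b2 h2] := mxO_exists (glmx g^-1%g).
exists (b + b1 + b2)%N => h k; rewrite inE => /orP[/eqP ->|hg] Kk; last first.
  by have [h3 h4] := hb _ _ hg Kk; split; [apply: mxO_le h3|apply: mxO_le h4]; lia.
have [_ _ V] := @Kc_subgr F n 0; have k0 := Kc_int Kk; have k1 := Kc_int (V _ Kk).
split; rewrite ?invgM glmxM.
  by apply: mxO_le (mxOM0 h1 k0); lia.
by apply: mxO_le (mxO0M k1 h2); lia.
Qed.

Lemma Kc0_transv (s : nat) : exists (T : finType) (f : T -> GL F n), transv f (Kc 0) (Kc s).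
Proof.
pose c g := [ffun ij : 'I_n * 'I_n => digits s (glmx g ij.1 ij.2)].
have [K1 KM KV] := @Kc_subgr F n 0.
have ce g h : Kc 0 g -> Kc 0 h -> c g = c h <-> mxO s (glmx h - glmx g).
  move=> Kg Kh; split=> [/ffunP e i j|h0].
    have := e (i, j); rewrite !ffunE /= => /digits_eq.
    by rewrite !mxE -opprB inON; apply; [exact: Kc_int Kg i j|exact: Kc_int Kh i j].
  apply/ffunP => -[i j]; rewrite !ffunE; apply/digits_eq => /=.
  - exact: Kc_int Kg i j.
  - exact: Kc_int Kh i j.
  - by rewrite -inON opprB; have := h0 i j; rewrite !mxE.
apply: (@transv_exists _ (Kc 0) (Kc s) _ c) => [g h Kg Kh e|g h Kg Kh Kgh].
  apply: Kc_sub; [exact: Kc_int (KV _ Kg)|exact: Kc_int (KV _ Kh)|].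
  exact/ce.
apply/(ce _ _ Kgh Kg); rewrite glmxM -opprB; apply: mxON.
have -> : glmx g *m glmx h - glmx g = glmx g *m (glmx h - 1%:M).
  by rewrite mulmxBr mulmx1.
by apply: mxO0M; [exact: Kc_int Kg|exact: Kh.1].
Qed.

End GLTopology.

(** * Matrix decompositions over the valuation ring *)

Section Decompositions.
Variable F : localFieldType.

(** Membership in [GL n] of the ring of integers, for matrices; it allows block computations. *)
Definition KM n (A : 'M[F]_n) := mxO 0 A /\ exists2 B, mxO 0 B & A *m B = 1%:M.

Lemma KM1 n : KM (1%:M : 'M[F]_n).
Proof. by split; [exact: mxO1|exists 1%:M; [exact: mxO1|rewrite mulmx1]]. Qed.

Lemma KM_mul n (A B : 'M[F]_n) : KM A -> KM B -> KM (A *m B).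
Proof.
move=> [hA [A' hA' AA']] [hB [B' hB' BB']]; split; first exact: mxO0M.
exists (B' *m A'); first exact: mxO0M.
by rewrite mulmxA -(mulmxA A) BB' mulmx1.
Qed.

Lemma KM_inv n (A : 'M[F]_n) : KM A -> [/\ KM (invmx A), A \in unitmx & KM A].
Proof.
move=> [hA [B hB AB]]; have [uA uB] := mulmx1_unit AB.
have e : invmx A = B by rewrite -[invmx A]mulmx1 -AB mulmxA mulVmx // mul1mx.
split=> //; last by split=> //; exists B.
by split; [rewrite e|exists A => //; exact: mulVmx].
Qed.

Lemma KM_GL n (A : 'M[F]_n) : KM A -> exists2 k : GL F n, Kc 0 k & glmx k = A.
Proof.
move=> hA; have [[hi _] uA _] := KM_inv hA; exists (MkGL uA) => //.
by apply: Kc0P => //=; exact: hA.1.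
Qed.

Lemma KM_perm n (s : {perm 'I_n}) : KM (perm_mx s : 'M[F]_n).
Proof.
have O p : mxO 0 (perm_mx p : 'M[F]_n).
  by move=> i j; rewrite !mxE; case: eqP => _; [exact: inO1|exact: inO0].
by split=> //; exists (perm_mx s^-1) => //; rewrite -perm_mxM mulgV perm_mx1.
Qed.

Lemma mxO_block s m1 m2 n1 n2 (a : 'M[F]_(m1, n1)) (b : 'M_(m1, n2))
    (c : 'M_(m2, n1)) (d : 'M_(m2, n2)) :
  mxO s a -> mxO s b -> mxO s c -> mxO s d -> mxO s (block_mx a b c d).
Proof.
move=> ha hb hc hd i j; rewrite /block_mx.
case: (split_ordP i) => i' ->; rewrite ?col_mxEu ?col_mxEd;
  by case: (split_ordP j) => j' ->; rewrite ?row_mxEl ?row_mxEr.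
Qed.

Lemma KM_diag m n (A : 'M[F]_m) (B : 'M[F]_n) : KM A -> KM B ->
  KM (block_mx A 0 0 B).
Proof.
move=> [hA [A' hA' AA']] [hB [B' hB' BB']].
split; first by apply: mxO_block => //; exact: mxO0.
exists (block_mx A' 0 0 B'); first by apply: mxO_block => //; exact: mxO0.
by rewrite mulmx_block !mul0mx !mulmx0 !addr0 !add0r AA' BB' -scalar_mx_block.
Qed.

Lemma KM_lower m n (C : 'M[F]_(n, m)) : mxO 0 C -> KM (block_mx 1%:M 0 C 1%:M).
Proof.
move=> hC; have O X : mxO 0 X -> mxO 0 (block_mx 1%:M 0 X 1%:M : 'M[F]_(m + n)).
  by move=> hX; apply: mxO_block => //; [exact: mxO1|exact: mxO0|exact: mxO1].
split; first exact: O.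
exists (block_mx 1%:M 0 (- C) 1%:M); first by apply: O; exact: mxON.
rewrite mulmx_block !mul0mx !mulmx0 !mul1mx !mulmx1 !addr0 !add0r subrr.
by rewrite -scalar_mx_block.
Qed.

Lemma KM_upper m n (C : 'M[F]_(m, n)) : mxO 0 C -> KM (block_mx 1%:M C 0 1%:M).
Proof.
move=> hC; have O X : mxO 0 X -> mxO 0 (block_mx 1%:M X 0 1%:M : 'M[F]_(m + n)).
  by move=> hX; apply: mxO_block => //; [exact: mxO1|exact: mxO0|exact: mxO1].
split; first exact: O.
exists (block_mx 1%:M (- C) 0 1%:M); first by apply: O; exact: mxON.
rewrite mulmx_block !mul0mx !mulmx0 !mul1mx !mulmx1 !addr0 !add0r addrC subrr.
by rewrite -scalar_mx_block.
Qed.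

Lemma min_val (I : finType) (f : I -> F) : (exists i, f i != 0) ->
  exists2 i0, f i0 != 0 & forall i, inO (lfval (f i0)) (f i).
Proof.
move=> [i1 h1]; case: (@Order.TotalTheory.arg_minP _ _ _ i1 (fun i => f i != 0)
  (fun i => lfval (f i)) h1) => i0 h0 hm; exists i0 => // i.
by rewrite /inO; case: eqVneq => //= fi; exact: hm.
Qed.

Lemma inO_div (a b : F) : a != 0 -> inO (lfval a) b -> inO 0 (b / a).
Proof.
move=> a0 hb; rewrite -(subrr (lfval a)); apply: inOM => //.
by rewrite /inO lfvalV // lexx orbT.
Qed.

Lemma lower_elim n (a : 'M[F]_1) (r : 'M_(1, n)) (c : 'M_(n, 1)) (D : 'M_n) :
  a 0 0 != 0 ->
  block_mx a r c D = block_mx 1%:M 0 ((a 0 0)^-1 *: c) 1%:M *m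
    block_mx a r 0 (D - (a 0 0)^-1 *: (c *m r)).
Proof.
move=> a0; rewrite mulmx_block !mul1mx !mul0mx !addr0 -!scalemxAl.
have -> : a = (a 0 0)%:M by rewrite -mx11_scalar.
rewrite mul_mx_scalar scalerA !mxE eqxx mulr1n mulVf // scale1r.
by rewrite [_ *: _ + _]addrC subrK.
Qed.

(** Column elimination with a pivot of minimal valuation only uses integral multipliers. *)
Lemma upper_tri_dec n (A : 'M[F]_n) : A \in unitmx ->
  exists K B, [/\ KM K, A = K *m B & forall i j : 'I_n, (j < i)%N -> B i j = 0].
Proof.
elim: n A => [|n IH] A uA.
  by exists 1%:M, A; split; [exact: KM1|rewrite mul1mx|case].
rewrite -add1n in A uA *.
have [i0 hi0 hmin] : exists2 i0, A i0 0 != 0 & forall i, inO (lfval (A i0 0)) (A i 0).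
  apply: (@min_val _ (fun i => A i 0)); apply: contrapT => no.
  have c0 : col 0 A = 0.
    apply/colP => i; rewrite !mxE; apply/eqP/negPn/negP => h; apply: no.
    by exists i.
  have := mulVmx uA => /(congr1 (col 0)).
  have -> : col 0 (invmx A *m A) = invmx A *m col 0 A by rewrite !colE mulmxA.
  rewrite c0 mulmx0 => /colP /(_ 0); rewrite !mxE eqxx => /eqP.
  by rewrite eq_sym oner_eq0.
pose s := tperm 0 i0; pose A' : 'M[F]_(1 + n) := row_perm s A.
have A'0 i : A' i 0 = A (s i) 0 by rewrite mxE.
have eA : A = perm_mx s^-1 *m A'.
  by rewrite /A' row_permE mulmxA -perm_mxM mulVg perm_mx1 mul1mx.
have eb := submxK A'; set a := ulsubmx A' in eb; set r := ursubmx A' in eb.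
set c := dlsubmx A' in eb; set D := drsubmx A' in eb.
have l0 : lshift n (0 : 'I_1) = 0 by apply: val_inj.
have a00 : a 0 0 = A i0 0 by rewrite !mxE l0 tpermL.
have c0 i : inO (lfval (a 0 0)) (c i 0) by rewrite a00 !mxE l0; exact: hmin.
have an : a 0 0 != 0 by rewrite a00.
have eL := lower_elim r c D an; rewrite eb in eL.
set C := _ *: c in eL; set D' := D - _ in eL.
have OC : mxO 0 C.
  by move=> i j; rewrite ord1 mxE mulrC; exact: inO_div.
have uD : D' \in unitmx.
  have uA' : A' \in unitmx by rewrite /A' row_permE unitmx_mul unitmx_perm uA.
  have : \det A' != 0 by rewrite -unitfE -unitmxE.
  rewrite eL det_mulmx det_lblock det_ublock !det1 !mul1r mulf_eq0 negb_or.
  by rewrite unitmxE unitfE => /andP[].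
have [K [B [hK eD hB]]] := IH _ uD.
exists (perm_mx s^-1 *m (block_mx 1%:M 0 C 1%:M *m block_mx 1%:M 0 0 K)), (block_mx a r 0 B); split.
- apply: KM_mul; first exact: KM_perm.
  by apply: KM_mul; [exact: KM_lower|apply: KM_diag => //; exact: KM1].
- rewrite {1}eA eL -!mulmxA; congr (_ *m (_ *m _)).
  by rewrite mulmx_block !mul1mx !mul0mx !mulmx0 !addr0 !add0r -eD.
- move=> i j; case: (split_ordP i) => i' ->; case: (split_ordP j) => j' -> /=.
  + by rewrite !ord1.
  + by rewrite !ord1.
  + by move=> _; rewrite block_mxEdl mxE.
  + by rewrite ltn_add2l => /hB; rewrite block_mxEdr.
Qed.

(** A matrix congruent to [1] has a unit as first entry: no permutation is needed for
the elimination, and the multipliers are divisible by [pi^s]. *)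
Lemma LU_dec (s : nat) n (A : 'M[F]_n) : (0 < s)%N -> mxO s (A - 1%:M) ->
  exists L U, [/\ A = L *m U, mxO s (L - 1%:M), mxO s (U - 1%:M),
    forall i j : 'I_n, (i <= j)%N -> L i j = (i == j)%:R &
    forall i j : 'I_n, (j < i)%N -> U i j = 0].
Proof.
move=> s0; elim: n A => [|n IH] A hA.
  by exists 1%:M, A; split=> //; rewrite ?mul1mx // => -[].
rewrite -add1n in A hA *.
have eb := submxK A; set a := ulsubmx A in eb; set r := ursubmx A in eb.
set c := dlsubmx A in eb; set D := drsubmx A in eb.
have hblk : mxO s (block_mx (a - 1%:M) r c (D - 1%:M)).
  have := hA; rewrite -eb [1%:M](scalar_mx_block 1 n) opp_block_mx add_block_mx.
  by rewrite !oppr0 !addr0.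
have ha : mxO s (a - 1%:M).
  by move=> i j; have := hblk (lshift _ i) (lshift _ j); rewrite block_mxEul.
have hr : mxO s r.
  by move=> i j; have := hblk (lshift _ i) (rshift _ j); rewrite block_mxEur.
have hc : mxO s c.
  by move=> i j; have := hblk (rshift _ i) (lshift _ j); rewrite block_mxEdl.
have hD : mxO s (D - 1%:M).
  by move=> i j; have := hblk (rshift _ i) (rshift _ j); rewrite block_mxEdr.
have [|an av] := @lfval_eqmod F 1 (a 0 0) (oner_neq0 _).
  by have := ha 0 0; rewrite !mxE lfval1 add0r; apply: inO_le; lia.
rewrite lfval1 in av.
have iO : inO 0 (a 0 0)^-1 by rewrite /inO lfvalV // av oppr0 lexx orbT.
have eL := lower_elim r c D an; rewrite eb in eL.
set C := _ *: c in eL; set D' := D - _ in eL.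
have OC : mxO s C by rewrite -[s%:Z]add0r; exact: mxOZ.
have OD' : mxO s (D' - 1%:M).
  have -> : D' - 1%:M = (D - 1%:M) - C *m r by rewrite /D' /C -scalemxAl addrAC.
  apply: mxOB => //; apply: mxOM0 => //; by apply: mxO_le hr.
have [L [U [eD hL hU Lt Ut]]] := IH _ OD'.
exists (block_mx 1%:M 0 C L), (block_mx a r 0 U); split.
- rewrite eL !mulmx_block !mul1mx !mul0mx !addr0 !mulmx0 !addr0 eD.
  by [].
- have -> : block_mx 1%:M 0 C L - 1%:M = block_mx 0 0 C (L - 1%:M) :> 'M_(1 + n).
    by rewrite [X in _ - X](scalar_mx_block 1 n) opp_block_mx add_block_mx subrr !oppr0 !addr0.
  by apply: mxO_block => //; exact: mxO0.
- have -> : block_mx a r 0 U - 1%:M = block_mx (a - 1%:M) r 0 (U - 1%:M) :> 'M_(1 + n).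
    by rewrite [X in _ - X](scalar_mx_block 1 n) opp_block_mx add_block_mx !oppr0 !addr0.
  by apply: mxO_block => //; exact: mxO0.
- move=> i j; case: (split_ordP i) => i' ->; case: (split_ordP j) => j' -> /=.
  + by rewrite block_mxEul mxE eq_lshift.
  + by rewrite block_mxEur mxE eq_lrshift.
  + by rewrite ord1.
  + by rewrite leq_add2l => /Lt; rewrite block_mxEdr eq_rshift.
- move=> i j; case: (split_ordP i) => i' ->; case: (split_ordP j) => j' -> /=.
  + by rewrite !ord1.
  + by rewrite !ord1.
  + by move=> _; rewrite block_mxEdl mxE.
  + by rewrite ltn_add2l => /Ut; rewrite block_mxEdr.
Qed.

Definition dmx n (x : 'I_n -> int) : 'M[F]_n := diag_mx (\row_i unif ^ (x i)).

Lemma dmxE n (x : 'I_n -> int) i j : dmx x i j = unif ^ (x i) *+ (i == j).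
Proof. by rewrite !mxE. Qed.

(** The pivot is an entry of minimal valuation in the whole matrix, so that it divides the
other entries; the diagonal comes out with increasing valuations. *)
Lemma smith_dec n (A : 'M[F]_n) s : A \in unitmx -> mxO s A ->
  exists K1 K2 x, [/\ KM K1, KM K2, A = K1 *m dmx x *m K2,
    forall i j : 'I_n, (i <= j)%N -> x i <= x j & forall i, s <= x i].
Proof.
elim: n A s => [|n IH] A s uA hA.
  exists 1%:M, 1%:M, (fun=> 0); split; try exact: KM1; try by case.
  by rewrite mul1mx mulmx1; apply/matrixP => -[].
rewrite -add1n in A uA hA *.
have [[i0 j0] /= hi0 hmin] : exists2 ij, A ij.1 ij.2 != 0 &
    forall kl, inO (lfval (A ij.1 ij.2)) (A kl.1 kl.2).
  apply: (@min_val _ (fun kl => A kl.1 kl.2)); apply: contrapT => no.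
  have A0 : A = 0.
    apply/matrixP => i j; rewrite mxE; apply/eqP/negPn/negP => h; apply: no.
    by exists (i, j).
  by move: uA; rewrite A0 unitmxE det0 ?unitr0.
pose s1 := tperm 0 i0; pose s2 := tperm 0 j0.
pose A' : 'M[F]_(1 + n) := col_perm s2 (row_perm s1 A).
have A'E i j : A' i j = A (s1 i) (s2 j) by rewrite !mxE.
have eA : A = perm_mx s1^-1 *m A' *m perm_mx s2.
  rewrite /A' col_permE row_permE !mulmxA -perm_mxM mulVg perm_mx1 mul1mx.
  by rewrite -mulmxA -perm_mxM mulVg perm_mx1 mulmx1.
have eb := submxK A'; set a := ulsubmx A' in eb; set r := ursubmx A' in eb.
set c := dlsubmx A' in eb; set D := drsubmx A' in eb.
have l0 : lshift n (0 : 'I_1) = 0 by apply: val_inj.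
have a00 : a 0 0 = A i0 j0 by rewrite !mxE l0 !tpermL.
have hA' i j : inO (lfval (a 0 0)) (A' i j) by rewrite a00 A'E; exact: (hmin (_, _)).
have an : a 0 0 != 0 by rewrite a00.
have eL := lower_elim r c D an; rewrite eb in eL.
set C := _ *: c in eL; set D' := D - _ in eL.
have OC : mxO 0 C.
  move=> i j; rewrite mxE mulrC; apply: inO_div => //.
  by have -> : c i j = A' (rshift 1 i) (lshift n j) by rewrite !mxE.
have hr : mxO (lfval (a 0 0)) r.
  by move=> i j; have -> : r i j = A' (lshift n i) (rshift 1 j) by rewrite !mxE.
pose E := (a 0 0)^-1 *: r.
have OE : mxO 0 E by move=> i j; rewrite mxE mulrC; exact: inO_div.
have OD' : mxO (lfval (a 0 0)) D'.
  apply: mxOB.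
    by move=> i j; have -> : D i j = A' (rshift 1 i) (rshift 1 j) by rewrite !mxE.
  by rewrite scalemxAl; apply: mxO0M.
have uD : D' \in unitmx.
  have uA' : A' \in unitmx.
    by rewrite /A' col_permE row_permE !unitmx_mul !unitmx_perm uA.
  have : \det A' != 0 by rewrite -unitfE -unitmxE.
  rewrite eL det_mulmx det_lblock det_ublock !det1 !mul1r mulf_eq0 negb_or.
  by rewrite unitmxE unitfE => /andP[].
have [K1 [K2 [x [h1 h2 eD xs xb]]]] := IH _ _ uD OD'.
pose v : F := unif ^ (- lfval (a 0 0)) * a 0 0.
pose y (i : 'I_(1 + n)) : int := if fintype.split i is inr j then x j else lfval (a 0 0).
have hv : KM (v%:M : 'M[F]_1).
  have v0 : v != 0 by rewrite mulf_neq0 ?pw_neq0.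
  have vv : lfval v = 0 by rewrite lfvalM ?pw_neq0 // lfval_pw addNr.
  split=> [i j|]; first by rewrite !ord1 mxE eqxx mulr1n /inO vv lexx orbT.
  exists (v^-1)%:M; last by rewrite -scalar_mxM mulfV.
  by move=> i j; rewrite !ord1 mxE eqxx mulr1n /inO lfvalV // vv lexx orbT.
have yl i : y (lshift n i) = lfval (a 0 0) by rewrite /y (unsplitK (inl i)).
have yr j : y (rshift 1 j) = x j by rewrite /y (unsplitK (inr j)).
have ey : dmx y = block_mx (unif ^ lfval (a 0 0))%:M 0 0 (dmx x).
  apply/matrixP => i j; rewrite dmxE.
  case: (split_ordP i) => i' ->; case: (split_ordP j) => j' ->; rewrite ?yl ?yr eq_shift.
  - by rewrite block_mxEul [RHS]mxE.
  - by rewrite block_mxEur [RHS]mxE.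
  - by rewrite block_mxEdl [RHS]mxE.
  - by rewrite block_mxEdr dmxE.
exists (perm_mx s1^-1 *m (block_mx 1%:M 0 C 1%:M *m block_mx v%:M 0 0 K1)),
  (block_mx 1%:M 0 0 K2 *m block_mx 1%:M E 0 1%:M *m perm_mx s2), y; split.
- apply: KM_mul; first exact: KM_perm.
  by apply: KM_mul; [exact: KM_lower|exact: KM_diag].
- apply: KM_mul; last exact: KM_perm.
  by apply: KM_mul; [apply: KM_diag => //; exact: KM1|exact: KM_upper].
- rewrite {1}eA eL ey -!mulmxA; congr (_ *m (_ *m _)); rewrite !mulmxA; congr (_ *m _).
  have ea : a = v%:M *m (unif ^ lfval (a 0 0))%:M.
    apply/matrixP => i j; rewrite !ord1 -scalar_mxM [RHS]mxE eqxx mulr1n /v.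
    by rewrite mulrAC -expfzDr ?unif_neq0 // addNr expr0z mul1r.
  rewrite !mulmx_block !mul0mx !mulmx0 !mulmx1 !addr0 !add0r !mul0mx ?addr0 -ea eD.
  congr block_mx; rewrite ?mulmx0 ?addr0 ?add0r //.
  have -> : a *m E = r.
    rewrite [X in X *m _]mx11_scalar mul_scalar_mx /E scalerA mulfV // scale1r //.
  by [].
- move=> i j; case: (split_ordP i) => i' ->; case: (split_ordP j) => j' ->; rewrite ?yl ?yr //=.
  + by rewrite !ord1.
  + by rewrite leq_add2l; exact: xs.
- have hs : s <= lfval (a 0 0).
    by have := hA i0 j0; rewrite a00 /inO (negbTE hi0).
  by move=> i; case: (split_ordP i) => i' ->; rewrite ?yl ?yr //; exact: le_trans (xb _).
Qed.

Section GLDecompositions.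
Variable n : nat.
Implicit Types (g u k : GL F n) (x y : 'I_n -> int).

Lemma dmx_unit x : dmx x \in unitmx.
Proof.
rewrite unitmxE unitfE det_diag; apply/prodf_neq0 => i _.
by rewrite mxE pw_neq0.
Qed.

Definition dg x : GL F n := MkGL (dmx_unit x).

Lemma mul_dmxE m x (A : 'M[F]_(n, m)) i j : (dmx x *m A) i j = unif ^ (x i) * A i j.
Proof. by rewrite mul_diag_mx mxE !mxE. Qed.

Lemma mul_mxdE m x (A : 'M[F]_(m, n)) i j : (A *m dmx x) i j = A i j * unif ^ (x j).
Proof. by rewrite mul_mx_diag mxE !mxE. Qed.

Lemma dgM x y : (dg x * dg y)%g = dg (fun i => x i + y i).
Proof.
apply: glmx_inj; apply/matrixP => i j; rewrite glmxM mul_dmxE !dmxE.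
by case: eqP => [->|_]; rewrite ?mulr0n ?mulr0 // !mulr1n -expfzDr ?unif_neq0.
Qed.

Lemma dg0 x : (forall i, x i = 0) -> dg x = 1%g.
Proof.
move=> h; apply: glmx_inj; apply/matrixP => i j; rewrite /= dmxE mxE h expr0z.
by [].
Qed.

Lemma dgV x : (dg x)^-1%g = dg (fun i => - x i).
Proof.
apply: mulg1_eq; rewrite dgM dg0 // => i; exact: subrr.
Qed.

Lemma dgJE x g i j :
  glmx (dg x * g * (dg x)^-1)%g i j = unif ^ (x i - x j) * glmx g i j.
Proof.
rewrite dgV !glmxM mul_mxdE mul_dmxE expfzDr ?unif_neq0 //; ring.
Qed.

Lemma dgVJE x g i j :
  glmx ((dg x)^-1 * g * dg x)%g i j = unif ^ (x j - x i) * glmx g i j.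
Proof.
rewrite dgV !glmxM mul_mxdE mul_dmxE expfzDr ?unif_neq0 //; ring.
Qed.

Definition ltJ : rel 'I_n := fun i j => (i < j)%N.

Lemma ltJ_trans : transitive ltJ. Proof. by move=> j i k; exact: ltn_trans. Qed.

Lemma ltJ_ranked : ranked ltJ. Proof. by exists (fun i => i). Qed.

Lemma upperP u : upper_unipotent u <-> UJ ltJ u.
Proof.
split=> [h|[h _] i j ji].
  apply: UJP; [exact: ltJ_trans|exact: ltJ_ranked|].
  by move=> i j; rewrite -leqNgt => /h e; rewrite !mxE e subrr.
have := h i j; rewrite /ltJ -leqNgt => /(_ ji) /eqP; rewrite !mxE subr_eq0 => /eqP ->.
by [].
Qed.

Lemma upper_subgr : subgr (@upper_unipotent F n).
Proof.
have -> : @upper_unipotent F n = UJ ltJ by apply/funext => u; apply/propext; exact: upperP.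
exact: UJ_subgr ltJ_trans.
Qed.

Lemma upper_dgJ x u : upper_unipotent u -> upper_unipotent (dg x * u * (dg x)^-1)%g.
Proof.
move=> h i j ij; rewrite dgJE h //; case: eqP => [->|_]; last by rewrite mulr0.
by rewrite subrr expr0z mulr1.
Qed.

Lemma upper_tri_diag g : (forall i j : 'I_n, (j < i)%N -> glmx g i j = 0) ->
  forall i, glmx g i i != 0.
Proof.
move=> hg i; have : \det (glmx g) != 0 by rewrite -unitfE -unitmxE gl_unit.
have tB : is_trig_mx (glmx g)^T by apply/is_trig_mxP => a c ac; rewrite mxE hg.
by rewrite -det_tr det_trig // => /prodf_neq0 /(_ i); rewrite mxE; apply.
Qed.

Lemma upper_tri_inv g : (forall i j : 'I_n, (j < i)%N -> glmx g i j = 0) ->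
  forall i j : 'I_n, (j < i)%N -> glmx g^-1%g i j = 0.
Proof.
move=> hg i j; have [b] := ubnP (j : nat); elim: b j => // b IH j jb ji.
have : (glmx g^-1%g *m glmx g) i j = 0.
  by rewrite glmxVK mxE; case: eqP ji => // ->; rewrite ltnn.
rewrite mxE (bigD1 j) //= big1 ?addr0 => [/eqP|l lj].
  by rewrite mulf_eq0 (negbTE (upper_tri_diag hg j)) orbF => /eqP.
have [jl|lj'] := ltnP j l; first by rewrite hg ?mulr0.
have {}lj : (l < j)%N by rewrite ltn_neqAle lj' andbT.
by rewrite IH ?mul0r //; [apply: leq_trans lj _|apply: ltn_trans ji].
Qed.

(** Invert the decomposition of the inverse matrix as an integral matrix times a triangular one. *)
Lemma iwasawa g : exists u x k,
  [/\ upper_unipotent u, Kc 0 k & g = (u * dg x * k)%g].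
Proof.
have [K [B [hK e hB]]] := upper_tri_dec (gl_unit g^-1%g).
have [k Kk ek] := KM_GL hK.
have uB : B \in unitmx by have := gl_unit g^-1%g; rewrite e unitmx_mul => /andP[].
pose b := MkGL uB.
have gb : (g^-1 = k * b)%g by apply: glmx_inj; rewrite glmxM ek.
have B0 i : B i i != 0 by exact: (@upper_tri_diag b).
pose x i := lfval (B i i).
pose d := diag_mx (\row_i (unif ^ (- x i) * B i i)).
have hd : KM d.
  have v0 i : unif ^ (- x i) * B i i != 0 by rewrite mulf_neq0 ?pw_neq0.
  have vv i : lfval (unif ^ (- x i) * B i i) = 0 by rewrite lfvalM ?pw_neq0 // lfval_pw addNr.
  split=> [i j|].
    by rewrite !mxE; case: eqP => _; rewrite ?mulr0n ?inO0 // mulr1n /inO vv lexx orbT.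
  exists (diag_mx (\row_i (unif ^ (- x i) * B i i)^-1)).
    move=> i j; rewrite !mxE; case: eqP => _; rewrite ?mulr0n ?inO0 // mulr1n.
    by rewrite /inO lfvalV // vv lexx orbT.
  apply/matrixP => i j; rewrite mul_diag_mx !mxE; case: eqP => [->|_].
    by rewrite !mulr1n mulfV.
  by rewrite !mulr0n mulr0.
have [kd Kkd ekd] := KM_GL hd.
pose u := ((kd * dg x)^-1 * b)%g.
have eu : upper_unipotent u.
  move=> i j ji.
  have : (glmx (kd * dg x)%g *m glmx u) i j = B i j by rewrite -glmxM mulVKg.
  have -> : glmx (kd * dg x)%g = diag_mx (\row_i B i i).
    apply/matrixP => a c; rewrite glmxM mul_mxdE ekd !mxE.
    case: eqP => [->|_]; last by rewrite !mulr0n mul0r.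
    by rewrite !mulr1n mulrAC -expfzDr ?unif_neq0 // addNr expr0z mul1r.
  rewrite mul_diag_mx mxE [in X in X * _]mxE; case: (eqVneq i j) => [->|nij].
    by move=> h; apply: (mulfI (B0 j)); rewrite mulr1.
  have ji' : (j < i)%N by rewrite ltn_neqAle ji andbT eq_sym.
  rewrite (hB _ _ ji').
  by move=> /eqP; rewrite mulf_eq0 (negbTE (B0 i)) /= => /eqP.
have [_ _ UV] := upper_subgr; have [_ KMl KV] := @Kc_subgr F n 0.
have ub : b = (kd * dg x * u)%g by rewrite mulVKg.
exists u^-1%g, (fun i => - x i), (kd^-1 * k^-1)%g; split.
- exact: UV.
- by apply: KMl; exact: KV.
- by rewrite -[LHS]invgK gb ub -dgV !mulgE.
Qed.

Lemma cartan g : exists k1 k2 x, [/\ Kc 0 k1, Kc 0 k2, g = (k1 * dg x * k2)%g &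
  forall i j : 'I_n, (i <= j)%N -> x j <= x i].
Proof.
have [s hs] := mxO_exists (glmx g^-1%g).
have [K1 [K2 [x [h1 h2 e xs _]]]] := smith_dec (gl_unit g^-1%g) hs.
have [k1 Kk1 ek1] := KM_GL h1; have [k2 Kk2 ek2] := KM_GL h2.
have [_ _ KV] := @Kc_subgr F n 0.
have gE : g = (k2^-1 * dg (fun i => - x i) * k1^-1)%g.
  rewrite -[LHS]invgK -dgV -[RHS]invgK; congr (_^-1)%g; rewrite !mulgE.
  by apply: glmx_inj; rewrite !glmxM ek1 ek2 e.
exists k2^-1%g, k1^-1%g, (fun i => - x i); split; rewrite -?gE //; try exact: KV.
by move=> i j ij; rewrite lerN2; exact: xs.
Qed.

Lemma Kc_LU (s : nat) k : (0 < s)%N -> Kc s k -> exists b v, [/\ k = (b * v)%g,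
  Kc s b, Kc s v, forall i j : 'I_n, (j < i)%N -> glmx b i j = 0 &
  forall i j : 'I_n, (i <= j)%N -> glmx v i j = (i == j)%:R].
Proof.
move=> s0 [_ hk].
have [L [U [e hL hU Lt Ut]]] := LU_dec s0 hk.
have [l Kl el] := Kc_mk s0 hL; have [b Kb eb] := Kc_mk s0 hU.
rewrite addrC subrK in el; rewrite addrC subrK in eb.
have [_ _ KV] := @Kc_subgr F n s.
have ke : (k^-1 = l * b)%g by apply: glmx_inj; rewrite glmxM el eb.
exists b^-1%g, l^-1%g; split; try exact: KV.
- by rewrite -invgM -ke invgK.
- by apply: upper_tri_inv; rewrite eb.
- have : UJ (fun i j : 'I_n => j < i)%N l^-1%g.
    have tJ : transitive (fun i j : 'I_n => j < i)%N by move=> j i c h1 h2; exact: ltn_trans h2 h1.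
    have [_ _ UV] := @UJ_subgr F n _ tJ; apply: UV; apply: UJP => //.
      by exists (fun i => n - i)%N => i j ji; have := ltn_ord i; lia.
    move=> i j; rewrite -leqNgt => ij; by rewrite el !mxE Lt // subrr.
  move=> [h _] i j ij; have := h i j; rewrite -leqNgt ij => /(_ isT) /eqP.
  by rewrite !mxE subr_eq0 => /eqP.
Qed.

End GLDecompositions.

End Decompositions.

(** * Linear algebra in spaces of arbitrary dimension *)

Section Subspaces.
Variables (R : fieldType) (V : lmodType R).
Implicit Types (U S : set V) (x y : V) (a : R).

Definition subspace U := U 0 /\ forall a x y, U x -> U y -> U (a *: x + y).

Lemma subspaceD U x y : subspace U -> U x -> U y -> U (x + y).
Proof. by move=> [_ h] Ux Uy; have := h 1 x y Ux Uy; rewrite scale1r. Qed.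

Lemma subspaceZ U a x : subspace U -> U x -> U (a *: x).
Proof. by move=> [h0 h] Ux; have := h a x 0 Ux h0; rewrite addr0. Qed.

Lemma subspaceN U x : subspace U -> U x -> U (- x).
Proof. by move=> h /(subspaceZ (-1) h); rewrite scaleN1r. Qed.

Lemma subspaceB U x y : subspace U -> U x -> U y -> U (x - y).
Proof. by move=> h Ux Uy; apply: subspaceD => //; exact: subspaceN. Qed.

Lemma subspace_sum U (I : Type) (r : seq I) (P : pred I) (f : I -> V) :
  subspace U -> (forall i, P i -> U (f i)) -> U (\sum_(i <- r | P i) f i).
Proof. by move=> h hf; elim/big_ind: _ => //; [exact: h.1|move=> *; exact: subspaceD]. Qed.

Definition span S : set V := [set x | forall U, subspace U -> S `<=` U -> U x].

Lemma span_subspace S : subspace (span S).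
Proof.
split=> [U [] //|a x y hx hy U hU SU]; have [_ h] := hU.
by apply: h; [exact: hx|exact: hy].
Qed.

Lemma sub_span S : S `<=` span S. Proof. by move=> x Sx U _; exact. Qed.

Lemma span_min S U : subspace U -> S `<=` U -> span S `<=` U.
Proof. by move=> hU SU x; exact. Qed.

Lemma span_fin (T : finType) (b : T -> V) x : span (range b) x ->
  exists c : T -> R, x = \sum_i c i *: b i.
Proof.
apply: (@span_min _ [set x | exists c : T -> R, x = \sum_i c i *: b i]).
  split=> /=; first by exists (fun=> 0); rewrite big1 // => i _; rewrite scale0r.
  move=> a _ _ [c ->] [d ->]; exists (fun i => a * c i + d i).
  by rewrite scaler_sumr -big_split /=; apply: eq_bigr => i _; rewrite scalerDl scalerA.
move=> _ [i _ <-]; exists (fun j => (j == i)%:R) => /=.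
rewrite (bigD1 i) //= eqxx scale1r big1 ?addr0 // => j /negbTE ->.
by rewrite scale0r.
Qed.

(** The form is read off from a subspace which is maximal among those avoiding the vector. *)
Lemma separating_form U x : subspace U -> ~ U x -> exists h : V -> R,
  [/\ forall a y z, h (a *: y + z) = a * h y + h z,
      forall y, U y -> h y = 0 & h x = 1].
Proof.
move=> sU nUx; pose good W := [/\ subspace W, U `<=` W & ~ W x].
have gU : good U by split.
have [|W [PW Wmax]] := @Zorn_bigcup V (fun W => W = set0 \/ good W).
  move=> Fm FP Ftot; have [[W0 [FW0 gW0]]|no] := pselect (exists W, Fm W /\ good W); last first.
    left; apply/seteqP; split=> // y [W FW Wy].
    by have [W0|gW] := FP _ FW; [rewrite W0 in Wy|case: no; exists W].
  right; split.
  - split; first by exists W0 => //; have [[]] := gW0.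
    move=> a y z [W1 F1 W1y] [W2 F2 W2z].
    have sub W W' t t' : Fm W -> W `<=` W' -> Fm W' -> W t -> W' t' ->
        (\bigcup_(X in Fm) X) (a *: t + t') /\ (\bigcup_(X in Fm) X) (a *: t' + t).
      move=> FW WW' FW' Wt Wt'; have [e|[sW' _ _]] := FP _ FW'; first by rewrite e in Wt'.
      by split; exists W' => //; apply: sW'.2 => //; exact: WW'.
    have [h|h] := Ftot _ _ F1 F2; first by have [] := sub _ _ _ _ F1 h F2 W1y W2z.
    by have [] := sub _ _ _ _ F2 h F1 W2z W1y.
  - by move=> y Uy; exists W0 => //; have [_ h _] := gW0; exact: h.
  - by move=> [W FW Wx]; have [e|[_ _]] := FP _ FW; [rewrite e in Wx|].
have {PW} [sW UW nWx] : good W.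
  case: PW => // W0; case: (Wmax U); last by right.
  by rewrite W0; split; [|move=> h; case: (h 0); exact: sU.1].
have ex y : exists a, W (y - a *: x).
  have [Wy|nWy] := pselect (W y); first by exists 0; rewrite scale0r subr0.
  pose W' := [set z | exists c w, W w /\ z = w + c *: y].
  have sW' : subspace W'.
    split; first by exists 0, 0; split; [exact: sW.1|rewrite scale0r addr0].
    move=> a _ _ [c [w [Ww ->]]] [d [w' [Ww' ->]]]; exists (a * c + d), (a *: w + w').
    split; first exact: sW.2.
    by rewrite scalerDr scalerDl scalerA addrACA.
  have WW' : W `<=` W' by move=> w Ww; exists 0, w; rewrite scale0r addr0.
  have [W'x|nW'x] := pselect (W' x); last first.
    case: (Wmax W'); last by right; split=> //; exact: subset_trans WW'.
    split=> //; apply/existsNP; exists y; apply/not_implyP; split=> //.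
    by exists 1, 0; split; [exact: sW.1|rewrite scale1r add0r].
  have [c [w [Ww e]]] := W'x.
  have c0 : c != 0 by apply/eqP => c0; apply: nWx; rewrite e c0 scale0r addr0.
  exists c^-1; have -> : y - c^-1 *: x = (- c^-1) *: w.
    by rewrite e scalerDr scalerA mulVf // scale1r opprD addrCA subrr addr0 scaleNr.
  exact: subspaceZ.
have [h hP] := choice ex.
have uniq y a : W (y - a *: x) -> h y = a.
  move=> Wa; apply/eqP; rewrite -subr_eq0; apply/negPn/negP => d0; apply: nWx.
  have : W ((h y - a) *: x).
    have -> : (h y - a) *: x = (y - a *: x) - (y - h y *: x).
      by rewrite scalerBl opprB [RHS]addrC addrA subrK.
    exact: subspaceB.
  by move=> /(subspaceZ (h y - a)^-1 sW); rewrite scalerA mulVf // scale1r.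
exists h; split=> [a y z|y Uy|].
- apply: uniq; have -> : a *: y + z - (a * h y + h z) *: x =
      a *: (y - h y *: x) + (z - h z *: x).
    by rewrite scalerBr scalerDl opprD scalerA addrACA.
  exact: sW.2.
- by apply: uniq; rewrite scale0r subr0; exact: UW.
- by apply: uniq; rewrite scale1r subrr; exact: sW.1.
Qed.

(** Finite dimension of a set of vectors: a bound on the size of independent
families. *)
Definition dep S := exists T : finType, forall x : T -> V, (forall i, S (x i)) ->
  exists c : T -> R, (exists i, c i != 0) /\ \sum_i c i *: x i = 0.

Lemma dep_sub S S' : S' `<=` S -> dep S -> dep S'.
Proof. by move=> s [T h]; exists T => x Sx; apply: h => i; exact: s. Qed.

Lemma dep_span (T : finType) (b : T -> V) S : S `<=` span (range b) -> dep S.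
Proof.
move=> Sb; exists 'I_#|T|.+1 => x Sx.
have [c hc] := choice (fun i => span_fin (Sb _ (Sx i))).
pose M : 'M[R]_(#|T|.+1, #|T|) := \matrix_(i, j) c i (enum_val j).
have : kermx M != 0.
  rewrite -mxrank_eq0 mxrank_ker -lt0n subn_gt0 ltnS; exact: rank_leq_col.
move=> /rowV0Pn [v /sub_kermxP vM v0].
exists (fun i => v 0 i); split.
  apply: contrapT => no; case/eqP: v0; apply/rowP => i; rewrite mxE.
  by apply/eqP/negPn/negP => h; apply: no; exists i.
transitivity (\sum_i \sum_j (v 0 i * c i j) *: b j).
  by apply: eq_bigr => i _; rewrite hc scaler_sumr; apply: eq_bigr => j _; rewrite scalerA.
rewrite exchange_big big1 //= => j _; rewrite -scaler_suml.
have /rowP /(_ (enum_rank j)) := vM; rewrite !mxE => e.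
rewrite (_ : \sum_i _ = 0) ?scale0r // -[RHS]e.
by apply: eq_bigr => i _; rewrite mxE enum_rankK.
Qed.

Lemma dep_basis S : subspace S -> dep S ->
  exists (T : finType) (b : T -> V), (forall i, S (b i)) /\ S `<=` span (range b).
Proof.
move=> sS [T0 hT0].
pose fr n (x : 'I_n -> V) := forall c : 'I_n -> R, \sum_i c i *: x i = 0 -> forall i, c i = 0.
pose P n := `[< exists x : 'I_n -> V, (forall i, S (x i)) /\ fr n x >].
have P0 : exists n, P n.
  exists 0%N; apply/asboolP; exists (fun=> 0); split=> [i|c _ []//].
  exact: sS.1.
have Pb n : P n -> (n <= #|T0|)%N.
  move=> /asboolP [x [Sx frx]]; rewrite leqNgt; apply/negP => lt.
  pose f (i : T0) : 'I_n := widen_ord (ltnW lt) (enum_rank i).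
  have [c [[i ci] e]] := hT0 (fun i => x (f i)) (fun i => Sx _).
  have fI : injective f by move=> i1 i2 /(congr1 val) /= /val_inj /enum_rank_inj.
  pose d j := \sum_(i | f i == j) c i.
  have : d (f i) = 0.
    apply: frx; rewrite -[RHS]e (partition_big f predT) //=.
    by apply: eq_bigr => j _; rewrite scaler_suml; apply: eq_bigr => k /eqP ->.
  rewrite /d (big_pred1 i) => [ci0|k]; first by rewrite ci0 eqxx in ci.
  by rewrite /= (inj_eq fI).
case: (ex_maxnP P0 Pb) => n /asboolP [b [Sb frb]] nmax.
exists 'I_n, b; split=> // x Sx.
pose x' (i : 'I_n.+1) := if unlift ord0 i is Some j then b j else x.
have nfr : ~ fr n.+1 x'.
  move=> fr'; have : (n.+1 <= n)%N.
    apply: nmax; apply/asboolP; exists x'; split=> // i.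
    by rewrite /x'; case: unlift.
  by rewrite ltnn.
have [c [e nc]] : exists c, \sum_i c i *: x' i = 0 /\ ~ forall i, c i = 0.
  apply: contrapT => no; apply: nfr => c e; apply: contrapT => nc; apply: no.
  by exists c.
move: e; rewrite big_ord_recl {1}/x' unlift_none => e.
have e' : \sum_(i < n) c (lift ord0 i) *: x' (lift ord0 i) = \sum_(i < n) c (lift ord0 i) *: b i.
  by apply: eq_bigr => i _; rewrite /x' liftK.
rewrite e' in e.
have c0 : c ord0 != 0.
  apply/eqP => c0; apply: nc => i; case: (unliftP ord0 i) => [j|] -> //.
  by apply: (frb (fun j => c (lift ord0 j))); rewrite -[RHS]e c0 scale0r add0r.
have -> : x = \sum_(i < n) (- (c ord0)^-1 * c (lift ord0 i)) *: b i.
  have /(congr1 (fun z => (c ord0)^-1 *: z)) := e.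
  rewrite scaler0 scalerDr scalerA mulVf // scale1r => /eqP; rewrite addr_eq0 => /eqP ->.
  rewrite scaler_sumr -sumrN; apply: eq_bigr => i _.
  by rewrite scalerA mulNr scaleNr.
apply: subspace_sum; first exact: span_subspace.
move=> i _; apply: (subspaceZ _ (span_subspace _)).
by apply: sub_span; exists i.
Qed.

End Subspaces.

Section DepMaps.
Variables (R : fieldType) (V V1 V2 : lmodType R).

Lemma lin_sum (f : {linear V -> V1}) (T : finType) (c : T -> R) (x : T -> V) :
  f (\sum_i c i *: x i) = \sum_i c i *: f (x i).
Proof. by rewrite linear_sum; apply: eq_bigr => i _; rewrite linearZ. Qed.

Lemma dep_image (f : {linear V -> V1}) (S : set V) (S1 : set V1) :
  S1 `<=` f @` S -> dep S -> dep S1.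
Proof.
move=> sub [T h]; exists T => y Sy.
have /choice [x hx] i : exists x, S x /\ f x = y i by have [x Sx e] := sub _ (Sy i); exists x.
have [c [nz e]] := h x (fun i => (hx i).1); exists c; split=> //.
transitivity (f (\sum_i c i *: x i)); last by rewrite e linear0.
by rewrite lin_sum; apply: eq_bigr => i _; rewrite (hx i).2.
Qed.

Lemma dep_pair (f : {linear V -> V1}) (g : {linear V -> V2}) S S1 S2 :
  subspace S -> f @` S `<=` S1 -> g @` S `<=` S2 ->
  (forall x, S x -> f x = 0 -> g x = 0 -> x = 0) -> dep S1 -> dep S2 -> dep S.
Proof.
move=> sS fS gS inj [T1 h1] [T2 h2]; exists (T1 * T2)%type => x Sx.
have e1 j : exists c : T1 -> R, (exists i, c i != 0) /\ \sum_i c i *: f (x (i, j)) = 0.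
  by apply: h1 => i; apply: fS; exists (x (i, j)).
have [c hc] := choice e1.
pose y j := \sum_i c j i *: x (i, j).
have Sy j : S (y j) by apply: subspace_sum => // i _; exact: subspaceZ.
have [d [[j dj] hd]] := h2 (g \o y) (fun j => gS _ (imageP _ (Sy j))).
exists (fun ij => d ij.2 * c ij.2 ij.1); split.
  by have [[i ci] _] := hc j; exists (i, j); rewrite mulf_neq0.
have -> : \sum_ij (d ij.2 * c ij.2 ij.1) *: x ij = \sum_j d j *: y j.
  transitivity (\sum_i \sum_j (d j * c j i) *: x (i, j)).
    by rewrite pair_bigA; apply: eq_bigr => -[].
  rewrite exchange_big /=.
  apply: eq_bigr => j' _; rewrite scaler_sumr.
  by apply: eq_bigr => i _; rewrite scalerA.
apply: inj.
- by apply: subspace_sum => // j' _; exact: subspaceZ.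
- rewrite lin_sum big1 // => j' _; rewrite /y lin_sum (hc j').2 scaler0 //.
- by rewrite linear_sum -[RHS]hd; apply: eq_bigr => k _; rewrite linearZ.
Qed.

End DepMaps.

Section PolyAction.
Variables (R : fieldType) (V : lmodType R).
Implicit Types (T A B : {linear V -> V}) (p q : {poly R}) (v : V).

Definition pact T p v := \sum_(i < size p) p`_i *: iter i T v.

Lemma pactE T p v n : (size p <= n)%N -> pact T p v = \sum_(i < n) p`_i *: iter i T v.
Proof.
move=> le; rewrite /pact (big_ord_widen _ (fun i => p`_i *: iter i T v) le).
rewrite big_mkcond; apply: eq_bigr => i _; case: ltnP => // h.
by rewrite nth_default // scale0r.
Qed.

Lemma iter_lin T n a x y : iter n T (a *: x + y) = a *: iter n T x + iter n T y.
Proof. by elim: n => //= n ->; rewrite linearP. Qed.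

Lemma pact_lin T p a x y : pact T p (a *: x + y) = a *: pact T p x + pact T p y.
Proof.
rewrite /pact scaler_sumr -big_split; apply: eq_bigr => i _ /=.
by rewrite iter_lin scalerDr !scalerA mulrC.
Qed.

Lemma pactv0 T p : pact T p 0 = 0.
Proof.
have := pact_lin T p (-1) 0 0; rewrite scaler0 addr0 scaleN1r => ->.
by rewrite addNr.
Qed.

Lemma pact_vD T p x y : pact T p (x + y) = pact T p x + pact T p y.
Proof. by have := pact_lin T p 1 x y; rewrite !scale1r. Qed.

Lemma pact_vZ T p a x : pact T p (a *: x) = a *: pact T p x.
Proof. by have := pact_lin T p a x 0; rewrite pactv0 !addr0. Qed.

Lemma pact_vB T p x y : pact T p (x - y) = pact T p x - pact T p y.
Proof. by rewrite pact_vD -scaleN1r pact_vZ scaleN1r. Qed.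

Lemma pact_vsum T p (I : Type) (r : seq I) (P : pred I) (f : I -> V) :
  pact T p (\sum_(i <- r | P i) f i) = \sum_(i <- r | P i) pact T p (f i).
Proof. by elim/big_rec2: _ => [|i x y _ <-]; rewrite ?pactv0 // pact_vD. Qed.

Lemma pactD T p q v : pact T (p + q) v = pact T p v + pact T q v.
Proof.
have h := size_polyD p q.
rewrite (@pactE _ p _ (maxn (size p) (size q))) ?leq_maxl //.
rewrite (@pactE _ q _ (maxn (size p) (size q))) ?leq_maxr //.
by rewrite (pactE _ _ h) -big_split; apply: eq_bigr => i _; rewrite /= coefD scalerDl.
Qed.

Lemma pactZ T a p v : pact T (a *: p) v = a *: pact T p v.
Proof.
rewrite (pactE _ _ (size_scale_leq a p)) /pact scaler_sumr.
by apply: eq_bigr => i _; rewrite coefZ scalerA.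
Qed.

Lemma pact0 T v : pact T 0 v = 0.
Proof. by rewrite /pact size_poly0 big_ord0. Qed.

Lemma pactC T a v : pact T a%:P v = a *: v.
Proof. by rewrite (@pactE _ _ _ 1) ?size_polyC_leq1 // big_ord1 coefC. Qed.

Lemma pact_mulX T p v : pact T (p * 'X) v = pact T p (T v).
Proof.
rewrite (@pactE _ _ _ (size p).+1); last first.
  by have [->|p0] := eqVneq p 0; rewrite ?mul0r ?size_poly0 // size_mulX.
rewrite big_ord_recl coefMX scale0r add0r; apply: eq_bigr => i _.
by rewrite coefMX /= -iterS iterSr.
Qed.

Lemma pact_comm T A p v : (forall x, A (T x) = T (A x)) -> pact T p (A v) = A (pact T p v).
Proof.
move=> c; rewrite /pact linear_sum; apply: eq_bigr => i _; rewrite linearZ; congr (_ *: _).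
by elim: (i : nat) => //= k ->.
Qed.

Lemma pactM T p q v : pact T (p * q) v = pact T p (pact T q v).
Proof.
elim/poly_ind: q v => [|q c IH] v; first by rewrite mulr0 !pact0 pactv0.
rewrite mulrDr pactD mulrA pact_mulX IH [p * c%:P]mulrC mul_polyC pactZ.
by rewrite pactD pact_mulX pactC pact_vD pact_vZ.
Qed.

Lemma pact_subspace T p v (U : set V) : subspace U -> (forall x, U x -> U (T x)) ->
  U v -> U (pact T p v).
Proof.
move=> sU TU Uv; apply: subspace_sum => // i _; apply: subspaceZ => //.
by elim: (i : nat) => //= k; exact: TU.
Qed.

(** The iterates of [x] under [T] stay in a finite-dimensional set, hence are dependent. *)
Lemma dep_pact T (S : set V) x : dep S -> (forall y, S y -> S (T y)) -> S x ->
  exists2 p : {poly R}, p != 0 & pact T p x = 0.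
Proof.
move=> [I h] TS Sx.
have Si i : S (iter i T x) by elim: i => //= i; exact: TS.
have [c [[j cj] e]] := h (fun i => iter (enum_rank i) T x) (fun i => Si _).
pose p := \poly_(i < #|I|) (if insub i is Some k then c (enum_val (k : 'I_#|I|)) else 0).
exists p.
  apply/eqP => /(congr1 (fun q : {poly R} => q`_(enum_rank j))).
  rewrite coef0 coef_poly ltn_ord (insubT (fun i => i < #|I|)%N (ltn_ord (enum_rank j))).
  by move=> /eqP; rewrite (_ : Sub _ _ = enum_rank j) ?enum_rankK ?(negbTE cj) //; apply: val_inj.
rewrite (@pactE _ _ _ #|I|) ?size_poly // -[RHS]e (reindex enum_rank) /=; last first.
  by exists enum_val => i _; rewrite ?enum_rankK ?enum_valK.
apply: eq_bigr => i _; congr (_ *: _).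
rewrite coef_poly ltn_ord (insubT (fun i => i < #|I|)%N (ltn_ord (enum_rank i))).
by rewrite (_ : Sub _ _ = enum_rank i) ?enum_rankK //; apply: val_inj.
Qed.

End PolyAction.

(** Split [p] into linear factors: the last nonzero vector in the chain of partial products is
an eigenvector. *)
Lemma closed_eigen (R : closedFieldType) (V : lmodType R) (T : {linear V -> V})
    (p : {poly R}) x : p != 0 -> x != 0 -> pact T p x = 0 ->
  exists c y, y != 0 /\ T y = c *: y.
Proof.
move=> p0 x0; have [r ->] := closed_field_poly_normal p.
rewrite pactZ => /eqP; rewrite scaler_eq0 lead_coef_eq0 (negbTE p0) /= => /eqP.
elim: r x x0 => [|a r IH] x x0.
  by rewrite big_nil -[1]/(1%:P) pactC scale1r => h; rewrite h eqxx in x0.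
rewrite big_cons mulrC pactM => h.
have e : pact T ('X - a%:P) x = T x - a *: x.
  rewrite -['X]mul1r -polyCN pactD pact_mulX -[1]/(1%:P) !pactC scale1r scaleNr //.
have [z|nz] := eqVneq (T x - a *: x) 0.
  by exists a, x; split=> //; apply/eqP; rewrite -subr_eq0 z.
by apply: (IH (T x - a *: x)) => //; rewrite -e.
Qed.

(** The roots of [Q] are the products of a root of [p] and a root of [q]. *)
Lemma product_recurrence (R : closedFieldType) (p q : {poly R}) : p != 0 -> q != 0 ->
  exists2 Q : {poly R}, Q != 0 & forall (V : lmodType R) (A B C : {linear V -> V}) v,
    (forall x, A (B x) = B (A x)) -> (forall x, C x = A (B x)) ->
    pact A p v = 0 -> pact B q v = 0 -> pact C Q v = 0.
Proof.
move=> p0 q0; have [r er] := closed_field_poly_normal p.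
have [s es] := closed_field_poly_normal q.
pose Qa a := \prod_(b <- s) ('X - (a * b)%:P) : {poly R}.
have pXB (V : lmodType R) (T : {linear V -> V}) a w :
    pact T ('X - a%:P) w = T w - a *: w.
  by rewrite -['X]mul1r -polyCN pactD pact_mulX -[1]/(1%:P) !pactC scale1r scaleNr.
exists (\prod_(a <- r) Qa a).
  rewrite prodf_seq_neq0; apply/allP => a _ /=.
  by rewrite /Qa prodf_seq_neq0; apply/allP => b _; rewrite /= polyXsubC_eq0.
move=> V A B C v AB CE hp hq.
have {}hp : pact A (\prod_(a <- r) ('X - a%:P)) v = 0.
  by move/eqP: hp; rewrite er pactZ scaler_eq0 lead_coef_eq0 (negbTE p0) => /eqP.
have {}hq : pact B (\prod_(b <- s) ('X - b%:P)) v = 0.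
  by move/eqP: hq; rewrite es pactZ scaler_eq0 lead_coef_eq0 (negbTE q0) => /eqP.
have CA x : C (A x) = A (C x) by rewrite !CE -AB.
have CB x : C (B x) = B (C x) by rewrite !CE AB.
(* modulo the image of [A - a], the operator [C - a b] is [a (B - b)] *)
have key a (Z : set V) : subspace Z -> (forall x, Z x -> Z (B x)) ->
    (forall x, Z x -> Z (C x)) -> forall l w, Z (A w - a *: w) ->
    Z (pact C (\prod_(b <- l) ('X - (a * b)%:P)) w -
       a ^+ size l *: pact B (\prod_(b <- l) ('X - b%:P)) w).
  move=> sZ ZB ZC; elim=> [|b l IHl] w Zw.
    by rewrite !big_nil -[1]/(1%:P) !pactC expr0 !scale1r subrr; exact: sZ.1.
  rewrite !big_cons ['X - (a * b)%:P in X in Z X]lock mulrC -lock pactM pXB.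
  rewrite [('X - b%:P) * _]mulrC pactM pXB /=.
  have -> : C w - (a * b) *: w = B (A w - a *: w) + a *: (B w - b *: w).
    by rewrite CE AB linearB [B (a *: w)]linearZ /= scalerBr scalerA addrA subrK.
  rewrite pact_vD pact_vZ exprS -scalerA -addrA -scalerBr.
  apply: subspaceD => //; first by apply: pact_subspace => //; exact: ZB.
  apply: subspaceZ => //; apply: IHl.
  have -> : A (B w - b *: w) - a *: (B w - b *: w) =
      B (A w - a *: w) - b *: (A w - a *: w).
    rewrite [A (_ - _)]linearB [B (_ - _)]linearB [A (b *: _)]linearZ [B (a *: _)]linearZ /=.
    rewrite !scalerBr !scalerA AB [b * a]mulrC !opprB addrACA [RHS]addrACA.
    by congr (_ + _); exact: addrC.
  by apply: subspaceB => //; [exact: ZB|exact: subspaceZ].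
elim: r {er} v hp hq => [|a r IH] v hp hq.
  by move: hp; rewrite !big_nil -[1]/(1%:P) !pactC !scale1r.
rewrite big_cons mulrC pactM pXB in hp; rewrite big_cons mulrC pactM.
pose Z := [set w | pact C (\prod_(a <- r) Qa a) w = 0].
have sZ : subspace Z by split=> [|c x y /= hx hy]; rewrite /Z /= ?pactv0 // pact_lin hx hy scaler0 addr0.
have ZB x : Z x -> Z (B x) by rewrite /Z /= => e; rewrite pact_comm // e linear0.
have ZC x : Z x -> Z (C x) by rewrite /Z /= => e; rewrite pact_comm // e linear0.
have /(key a Z sZ ZB ZC s) : Z (A v - a *: v).
  apply: IH => //; rewrite pact_vB pact_vZ hq scaler0 subr0 pact_comm //.
  by rewrite hq linear0.
by rewrite hq scaler0 subr0.
Qed.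

(** * Smooth representations of a filtered group *)

Section Filtered.
Variables (R : fieldType) (G : groupType) (K : nat -> set G).
Local Notation "r '#' g" := (@ract R G r g) (at level 8, g at level 2).

(** What the congruence subgroups of [GL n] and of its Levi subgroups have in common; the indices are
invertible in [R], so that one can average. *)
Record filtration := Filtration {
  filt_subgr : forall s, subgr (K s);
  filt_le : forall s t, (s <= t)%N -> K t `<=` K s;
  filt_normal : forall s k g, K 0 k -> K s g -> K s (k^-1 * g * k)%g;
  filt_tr : forall s t, (0 < s)%N -> (s <= t)%N -> exists (T : finType) (f : T -> G),
    transv f (K s) (K t) /\ (#|T|%:R != 0 :> R) }.

Hypothesis FK : filtration.

Definition fixd (r : rep R G) (s : nat) : set r := [set x | forall k, K s k -> r#k x = x].

Definition ksmooth (r : rep R G) := forall x : r, exists s, fixd s x.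

Definition adm (r : rep R G) := forall s, dep (@fixd r s).

Definition gstable (r : rep R G) (U : set r) := forall g x, U x -> U (r#g x).

Definition gen (r : rep R G) (S : set r) : set r :=
  span [set y | exists g x, S x /\ y = r#g x].

Definition fgen (r : rep R G) := exists (T : finType) (x : T -> r), forall y, gen (range x) y.

Lemma ract1E (r : rep R G) x : r#1%g x = x. Proof. exact: ract1. Qed.

Lemma ractVK (r : rep R G) g (x : r) : r#g^-1%g (r#g x) = x.
Proof. by rewrite -ractM mulVg ract1E. Qed.

Lemma ractKV (r : rep R G) g (x : r) : r#g (r#g^-1%g x) = x.
Proof. by rewrite -ractM mulgV ract1E. Qed.

Lemma fixd_subspace (r : rep R G) s : subspace (@fixd r s).
Proof.
by split=> [k _|a x y hx hy k Kk]; rewrite ?linear0 // linearP hx ?hy.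
Qed.

Lemma fixd_le (r : rep R G) s t : (s <= t)%N -> @fixd r s `<=` @fixd r t.
Proof. by move=> st x hx k /(filt_le FK st); exact: hx. Qed.

Lemma gen_subspace (r : rep R G) (S : set r) : subspace (gen S).
Proof. exact: span_subspace. Qed.

Lemma gen_sub (r : rep R G) (S : set r) : S `<=` gen S.
Proof. by move=> x Sx; apply: sub_span; exists 1%g, x; rewrite ract1E. Qed.

Lemma span_stable (r : rep R G) (S : set r) :
  (forall g x, S x -> span S (r#g x)) -> gstable (span S).
Proof.
move=> h g; apply: span_min; last by move=> x; exact: h.
split=> [|a x y hx hy]; rewrite /= ?linear0; first by have [] := span_subspace S.
by rewrite linearP; have [_] := span_subspace S; apply.
Qed.

Lemma gen_stable (r : rep R G) (S : set r) : gstable (gen S).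
Proof.
apply: span_stable => g _ [h [x [Sx ->]]]; apply: sub_span.
by exists (g * h)%g, x; rewrite ractM.
Qed.

Lemma irred_gen (r : rep R G) (x : r) : irreducible r -> x != 0 -> gen [set x] = setT.
Proof.
move=> [_ h] x0; case: (h (gen [set x])) => //.
- by have [] := gen_subspace [set x].
- by have [_] := gen_subspace [set x].
- by move=> g y; exact: gen_stable.
- by move=> e; case/eqP: x0; have := @gen_sub r [set x] x erefl; rewrite e.
Qed.

(** The average over representatives of [K s] modulo a group fixing the vector. The last property expresses that
it is an affine combination of translates of [x]. *)
Lemma avg_exists r s : ksmooth r -> (0 < s)%N -> exists e : {linear r -> r},
  [/\ forall k x, K s k -> e (r#k x) = e x, forall x, fixd s (e x),
      forall x, fixd s x -> e x = x &
      forall (U : set r) x, subspace U -> (forall k, K s k -> U (r#k x - x)) -> U (e x - x)].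
Proof.
move=> hr s0.
have lv (x : r) : exists t, (s <= t)%N /\ fixd t x.
  have [t ht] := hr x; exists (maxn s t); split; first exact: leq_maxl.
  by apply: fixd_le ht; exact: leq_maxr.
have [l hl] := choice lv.
have ltr x : exists Tf : {T : finType & T -> G},
    transv (projT2 Tf) (K s) (K (l x)) /\ (#|projT1 Tf|%:R != 0 :> R).
  by have [T [f h]] := filt_tr FK s0 (hl x).1; exists (existT _ T f).
have [tf htf] := choice ltr.
pose e x := (#|projT1 (tf x)|%:R)^-1 *: \sum_i r#(projT2 (tf x) i) x.
have sK t := filt_subgr FK t.
have eE x t (T : finType) (f : T -> G) : (s <= t)%N -> fixd t x -> transv f (K s) (K t) ->
    (#|T|%:R != 0 :> R) -> e x = (#|T|%:R)^-1 *: \sum_i r#(f i) x.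
  move=> st ht tr nz.
  have aux t1 t2 (T1 T2 : finType) (f1 : T1 -> G) (f2 : T2 -> G) : (t1 <= t2)%N ->
      (s <= t1)%N -> fixd t1 x ->
      transv f1 (K s) (K t1) -> transv f2 (K s) (K t2) -> (#|T1|%:R != 0 :> R) ->
      (#|T2|%:R)^-1 *: \sum_i r#(f2 i) x = (#|T1|%:R)^-1 *: \sum_i r#(f1 i) x.
    move=> t12 st1 fx tr1 tr2 nz1.
    have st2 := leq_trans st1 t12.
    have [[T3 [f3 tr3]] _] := transv_sub (sK s) (sK t1) (sK t2) (filt_le FK st1) (filt_le FK t12) tr2.
    have tr13 := transv_tower (sK s) (sK t1) (sK t2) (filt_le FK st1) (filt_le FK t12) tr1 tr3.
    have c2 : #|T2| = (#|T1| * #|T3|)%N.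
      rewrite -card_prod; exact: transv_card (sK s) (sK t2) (filt_le FK st2) tr2 tr13.
    have fx2 := fixd_le t12 fx.
    have fH k h : K s k -> K t2 h -> r#(k * h)%g x = r#k x.
      by move=> _ Kh; rewrite ractM fx2.
    rewrite (sum_transv (sK s) (sK t2) fH tr2 tr13).
    rewrite -(pair_bigA _ (fun i j => r#(f1 i * f3 j)%g x)) /=.
    have -> : \sum_i \sum_j r#(f1 i * f3 j)%g x = #|T3|%:R *: \sum_i r#(f1 i) x.
      rewrite scaler_sumr; apply: eq_bigr => i _.
      rewrite (eq_bigr (fun=> r#(f1 i) x)) => [|j _]; last by rewrite ractM fx //; exact: tr3.1.
      by rewrite sumr_const scaler_nat.
    rewrite c2 natrM scalerA invfM -mulrA mulVf ?mulr1 //.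
    have := nz; have [T4 [f4 [tr4 nz4]]] := filt_tr FK s0 st2.
    have := transv_card (sK s) (sK t2) (filt_le FK st2) tr2 tr4.
    by rewrite c2 => ec _; move: nz4; rewrite -ec natrM mulf_eq0 negb_or => /andP[].
  have [le1|le2] := leqP t (l x).
    rewrite /e; apply: (aux t (l x)) => //; exact: (htf x).1.
  symmetry; apply: (aux (l x) t); rewrite ?(ltnW le2) ?(hl x).1 //.
  - exact: (hl x).2.
  - exact: (htf x).1.
  - exact: (htf x).2.
have elin : linear e.
  move=> a x y; pose t := maxn (l x) (l y).
  have st : (s <= t)%N by rewrite (leq_trans (hl x).1) ?leq_maxl.
  have [T [f [tr nz]]] := filt_tr FK s0 st.
  have fx : fixd t x by apply: fixd_le (hl x).2; exact: leq_maxl.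
  have fy : fixd t y by apply: fixd_le (hl y).2; exact: leq_maxr.
  have fxy : fixd t (a *: x + y) by have [_] := fixd_subspace r t; apply.
  rewrite (eE _ _ _ _ st fxy tr nz) (eE _ _ _ _ st fx tr nz) (eE _ _ _ _ st fy tr nz).
  rewrite scalerA mulrC -scalerA -scalerDr; congr (_ *: _).
  by rewrite scaler_sumr -big_split; apply: eq_bigr => i _; rewrite linearP.
pose eL := GRing.isLinear.Build R r r *:%R e elin.
pose E : {linear r -> r} := HB.pack e eL.
exists E; split=> /= [k x Kk|x k Kk|x fx|U x sU hU].
- have [t [st ht]] : exists t, (s <= t)%N /\ fixd t x /\ fixd t (r#k x).
    exists (maxn (l x) (l (r#k x))); split.
      by rewrite (leq_trans (hl x).1) ?leq_maxl.
    split; first by apply: fixd_le (hl x).2; exact: leq_maxl.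
    by apply: fixd_le (hl (r#k x)).2; exact: leq_maxr.
  have [T [f [tr nz]]] := filt_tr FK s0 st.
  rewrite (eE _ _ _ _ st ht.2 tr nz) (eE _ _ _ _ st ht.1 tr nz); congr (_ *: _).
  have [_ KM KV] := sK s.
  have -> : \sum_i r#(f i) x = \sum_i r#(f i * k)%g x.
    have fH k0 h : K s k0 -> K t h -> r#(k0 * h)%g x = r#k0 x.
      by move=> _ Kh; rewrite ractM ht.1.
    apply: (sum_transv (sK s) (sK t) fH tr); split=> [i|g Kg].
      by apply: KM => //; exact: tr.1.
    have K0 := filt_le FK (leq0n s).
    have [i [Hi u]] := tr.2 _ (KM _ _ Kg (KV _ Kk)); exists i; split=> [|j Hj].
      by have := filt_normal FK (K0 _ Kk) Hi; rewrite !mulgE.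
    by apply: u; have := filt_normal FK (K0 _ (KV _ Kk)) Hj; rewrite !mulgE.
  by apply: eq_bigr => i _; rewrite ractM.
- have [T [f [tr nz]]] := filt_tr FK s0 (hl x).1.
  rewrite (eE _ _ _ _ (hl x).1 (hl x).2 tr nz) linearZ; congr (_ *: _).
  rewrite linear_sum /=.
  have fH k0 h : K s k0 -> K (l x) h -> r#(k0 * h)%g x = r#k0 x.
    by move=> _ Kh; rewrite ractM (hl x).2.
  rewrite -[RHS](sum_transv_mul (sK s) (sK _) fH Kk tr).
  by apply: eq_bigr => i _; rewrite ractM.
- have [T [f [tr nz]]] := filt_tr FK s0 (leqnn s).
  rewrite (eE _ _ _ _ (leqnn s) fx tr nz) (eq_bigr (fun=> x)) => [|i _].
    by rewrite sumr_const -scaler_nat scalerA mulVf // scale1r.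
  by rewrite fx //; exact: tr.1.
- have [T [f [tr nz]]] := filt_tr FK s0 (hl x).1.
  rewrite (eE _ _ _ _ (hl x).1 (hl x).2 tr nz).
  have -> : (#|T|%:R)^-1 *: \sum_i r#(f i) x - x = (#|T|%:R)^-1 *: \sum_i (r#(f i) x - x).
    by rewrite sumrB sumr_const scalerBr -scaler_nat scalerA mulVf // scale1r.
  apply: subspaceZ => //; apply: subspace_sum => // i _; apply: hU; exact: tr.1.
Qed.

Section AvgTools.
Variables (r : rep R G) (s : nat).
Hypotheses (sm : ksmooth r) (s0 : (0 < s)%N).

Definition avg : {linear r -> r} := sval (cid (avg_exists sm s0)).

Lemma avgK k x : K s k -> avg (r#k x) = avg x.
Proof. by rewrite /avg; case: (cid _) => e [h _ _ _] /=; exact: h. Qed.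

Lemma avg_fixd x : fixd s (avg x).
Proof. by rewrite /avg; case: (cid _) => e [_ h _ _] /=; exact: h. Qed.

Lemma avg_id x : fixd s x -> avg x = x.
Proof. by rewrite /avg; case: (cid _) => e [_ _ h _] /=; exact: h. Qed.

Lemma avg_affine (U : set r) x : subspace U ->
  (forall k, K s k -> U (r#k x - x)) -> U (avg x - x).
Proof. by rewrite /avg; case: (cid _) => e [_ _ _ h] /=; exact: h. Qed.

Lemma avg_inv (V : lmodType R) (phi : {linear r -> V}) x :
  (forall k y, K s k -> phi (r#k y) = phi y) -> phi (avg x) = phi x.
Proof.
move=> h; apply/eqP; rewrite -subr_eq0 -linearB; apply/eqP.
apply: (@avg_affine [set y | phi y = 0]); last by move=> k Kk /=; rewrite linearB h // subrr.
by split=> /= [|a y z hy hz]; rewrite ?linear0 // linearP hy hz scaler0 addr0.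
Qed.

Lemma avg_normal k x : K 0 k -> avg (r#k x) = r#k (avg x).
Proof.
move=> Kk; have [_ _ KV] := filt_subgr FK 0; have [_ _ KVs] := filt_subgr FK s.
have fk y : fixd s y -> fixd s (r#k y).
  move=> fy h Kh; have := fy _ (filt_normal FK Kk Kh).
  by rewrite !ractM => /(congr1 (r#k)); rewrite ractKV.
have := @avg_inv r (r#k^-1%g \o (avg \o r#k)) x; rewrite /= => e.
have := e _; rewrite [avg (_ (avg x))]avg_id ?ractVK; last by apply: fk; exact: avg_fixd.
move=> h; rewrite -[LHS](@ractKV r k) -h // => h' y Kh; congr (r#_ _).
rewrite -ractM -[(k * h')%g](mulgVK k) ractM avgK //.
by have := filt_normal FK (KV _ Kk) Kh; rewrite invgK.
Qed.

End AvgTools.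

Lemma avg_map r r' s (sm : ksmooth r) (sm' : ksmooth r') (s0 : (0 < s)%N)
    (f : {linear r -> r'}) x : equivariant f -> f (avg sm s0 x) = avg sm' s0 (f x).
Proof.
move=> ef; have := @avg_inv r s sm s0 _ (avg sm' s0 \o f) x; rewrite /= => <-.
  have fx : fixd s (f (avg sm s0 x)) by move=> k Kk; rewrite -ef avg_fixd.
  by rewrite (avg_id sm' s0 fx).
by move=> k y Kk; rewrite ef avgK.
Qed.

Lemma adm_pos r : (forall s, (0 < s)%N -> dep (@fixd r s)) -> adm r.
Proof.
by move=> h s; apply: dep_sub (h (maxn s 1) _); [apply: fixd_le; exact: leq_maxl|exact: leq_maxr].
Qed.

(** Averaging is an exact functor, so fixed vectors of a quotient lift to fixed vectors. *)
Lemma subquotient_adm r r' : subquotient r r' -> ksmooth r' -> adm r' ->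
  ksmooth r /\ adm r.
Proof.
move=> [u [[i ei inj] [p ep sp]]] sm ad.
have smu : ksmooth u.
  move=> x; have [s hs] := sm (i x); exists s => k Kk; apply: inj; rewrite ei; exact: hs.
have surj y : exists x, p x = y.
  have : (range p) y by rewrite sp.
  by move=> [x _ <-]; exists x.
split.
  move=> y; have [x <-] := surj y; have [s hs] := smu x; exists s => k Kk.
  by rewrite -ep hs.
apply: adm_pos => s s0.
have du : dep (@fixd u s).
  have sub : i @` (@fixd u s) `<=` @fixd r' s.
    by move=> _ [x hx <-] k Kk; rewrite -ei hx.
  apply: (dep_pair (fixd_subspace u s) sub sub _ (ad s) (ad s)) => x _ e _.
  by apply: inj; rewrite e linear0.
have smr : ksmooth r.
  by move=> y; have [x <-] := surj y; have [t ht] := smu x; exists t => k Kk; rewrite -ep ht.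
apply: (dep_image (f := p)) du => y hy; have [x ex] := surj y.
exists (avg smu s0 x); first exact: avg_fixd.
by rewrite (avg_map _ smr) // ex avg_id.
Qed.

End Filtered.

(** Schur's lemma: [z] preserves a finite-dimensional space of fixed vectors, where it has an
eigenvector, and an eigenspace of a central element is stable. *)
Lemma central_scalar (R : closedFieldType) (G : groupType) (K : nat -> set G)
    (r : rep R G) z : irreducible r -> ksmooth K r -> adm K r ->
  (forall g, z * g = g * z)%g -> exists2 c : R, c != 0 & forall x, ract r z x = c *: x.
Proof.
move=> hr sm ad cz; have [[x x0] hU] := hr.
have comm g y : ract r z (ract r g y) = ract r g (ract r z y) by rewrite -!ractM cz.
have [s fx] := sm x.
have Tf y : fixd K s y -> fixd K s (ract r z y) by move=> fy k Kk; rewrite -comm fy.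
have [p p0 e] := dep_pact (ad s) Tf fx.
have [c [y [y0 ey]]] := closed_eigen p0 x0 e.
have all : forall w, ract r z w = c *: w.
  have : [set w | ract r z w = c *: w] = setT.
    case: (hU [set w | ract r z w = c *: w]) => //=.
    - by rewrite linear0 scaler0.
    - by move=> a w w' hw hw'; rewrite linearP hw hw' scalerDr !scalerA mulrC.
    - by move=> g w hw; rewrite comm hw linearZ.
    - move=> e0; have : [set w | ract r z w = c *: w] y by [].
      by rewrite e0 => /eqP; rewrite (negbTE y0).
  by move=> h w; have : [set w | ract r z w = c *: w] w by rewrite h.
exists c => //; apply/eqP => c0; case/eqP: y0.
by rewrite -(ractVK z y) all c0 scale0r linear0.
Qed.

(** ** Tensor products *)

Section Tensor.
Variables (R : fieldType) (t : nat) (V_ : 'I_t -> lmodType R) (T : lmodType R).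
Variable b : (forall i, V_ i) -> T.

Lemma dfwith_id (v : forall i, V_ i) i : dfwith v i (v i) = v.
Proof. by apply/functional_extensionality_dep => j; case: dfwithP. Qed.

Hypothesis mb : multilinear b.

Lemma multilinear0 (v : forall i, V_ i) i : b (dfwith v i (0 : V_ i)) = 0.
Proof.
have := @mb v i (-1) 0 0; rewrite scaler0 addr0 scaleN1r => {1}->.
by rewrite addNr.
Qed.

(** Replace the entries one at a time. *)
Lemma multilinear_span (A_ : forall i, set (V_ i)) (S : set T) : subspace S ->
  (forall v, (forall i, A_ i (v i)) -> S (b v)) ->
  forall v, (forall i, span (A_ i) (v i)) -> S (b v).
Proof.
move=> sS hA.
have claim (k : nat) : forall v, (forall i : 'I_t, (i < k)%N -> span (A_ i) (v i)) ->
    (forall i : 'I_t, (k <= i)%N -> A_ i (v i)) -> S (b v).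
  elim: k => [|k IH] v h1 h2; first by apply: hA => i; exact: h2.
  have [kt|tk] := ltnP k t; last first.
    apply: IH => i ik; first by apply: h1; exact: leq_trans ik _.
    by have := leq_trans tk ik; rewrite leqNgt ltn_ord.
  pose i0 := Ordinal kt; pose U := [set x | S (b (dfwith v i0 x))].
  have sU : subspace U.
    split; first by rewrite /U /= multilinear0; exact: sS.1.
    by move=> a x y; rewrite /U /= mb; exact: sS.2.
  rewrite -(dfwith_id v i0).
  apply: (span_min sU _ (h1 i0 _)) => // x Ax; apply: IH => i ik.
    case: dfwithP ik => [|j _]; first by rewrite ltnn.
    by move=> jk; apply: h1; exact: ltnW.
  case: dfwithP ik => [//|j nj] kj; apply: h2.
  rewrite ltn_neqAle kj andbT; apply: contra nj => /eqP e.
  by apply/eqP; apply: val_inj.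
by move=> v hv; apply: (claim t) => i; [move=> _; exact: hv|rewrite leqNgt ltn_ord].
Qed.

End Tensor.

(** A linear form vanishing on the pure tensors solves the same universal problem as zero. *)
Lemma tensor_span (R : fieldType) t (V_ : 'I_t -> lmodType R) (T : lmodType R)
    (b : (forall i, V_ i) -> T) : is_tensor b -> forall x, span (range b) x.
Proof.
move=> [_ un] x; apply: contrapT => nx.
have [h [hl h0 h1]] := separating_form (span_subspace (range b)) nx.
have m0 : multilinear (fun _ : forall i, V_ i => 0 : R^o).
  by move=> v i a y z; rewrite scaler0 addr0.
have [f _ uf] := un R^o (fun=> 0) m0.
have hl' : linear (h : T -> R^o) by move=> a y z; rewrite hl.
pose H : {linear T -> R^o} := HB.pack h (GRing.isLinear.Build R T R^o *:%R h hl').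
have zl : linear ((fun=> 0) : T -> R^o) by move=> a y z; rewrite scaler0 addr0.
pose Z : {linear T -> R^o} := HB.pack (fun _ : T => 0 : R^o) (GRing.isLinear.Build R T R^o *:%R _ zl).
have e1 : H x = f x by apply: uf => v; apply: h0; apply: sub_span; exists v.
have e2 : Z x = f x by apply: uf.
have : h x = 0 by rewrite -[h x]/(H x) e1 -e2.
by rewrite h1 => /eqP; rewrite oner_eq0.
Qed.

(** * The filtrations of GL(n) and of the Levi subgroups *)

Section Filtrations.
Variables (F : localFieldType) (R : closedFieldType) (sq : sqrt_resq F R).

Lemma resqX_neq0 e : ((resq F ^ e)%N)%:R != 0 :> R.
Proof. by rewrite natrX expf_neq0 // (resq_neq0 sq). Qed.

Lemma GL_filt n : filtration R (@Kc F n).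
Proof.
split.
- exact: Kc_subgr.
- by move=> s t st g; exact: Kc_le.
- by move=> s k g; exact: Kc_normal.
- move=> s t s0 st.
  have tJ : transitive (fun _ _ : 'I_n => true) by [].
  have [T [f [tr [e eT]]]] := UJ_Kc_transv tJ (@padm_all F n s s0) st.
  exists T, f; split; last by rewrite eT resqX_neq0.
  have JT : UJ (fun _ _ : 'I_n => true) = [set: GL F n].
    by apply/seteqP; split=> // g _; split=> i j.
  by move: tr; rewrite JT !setTI.
Qed.

Variables (t : nat) (n_ : 'I_t -> nat).

Definition Kl (s : nat) : set (levi F n_) := [set l | forall i, Kc s (l i)].

Lemma leviME (l l' : levi F n_) i : (l * l')%g i = (l i * l' i)%g. Proof. by []. Qed.
Lemma leviVE (l : levi F n_) i : (l^-1)%g i = (l i)^-1%g. Proof. by []. Qed.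
Lemma levi_filt : filtration R Kl.
Proof.
split.
- move=> s; split=> [i|x y hx hy i|x hx i]; have [h1 h2 h3] := @Kc_subgr F (n_ i) s.
  + exact: h1.
  + exact: h2.
  + exact: h3.
- by move=> s u su l hl i; exact: Kc_le (hl i).
- by move=> s k g hk hg i; exact: Kc_normal (hk i) (hg i).
- move=> s u s0 su.
  have ex i : exists Tf : {T : finType & T -> GL F (n_ i)},
      transv (projT2 Tf) (Kc s) (Kc u) /\ (#|projT1 Tf|%:R != 0 :> R).
    by have [T [f h]] := filt_tr (GL_filt (n_ i)) s0 su; exists (existT _ T f).
  pose tf i := sval (cid (ex i)); have htf i := svalP (cid (ex i)).
  pose T := {dffun forall i, projT1 (tf i)}.
  exists T, (fun (x : T) i => projT2 (tf i) (x i)); split.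
    split=> [x i|l hl]; first exact: (htf i).1.1.
    have [x hx] : exists x : forall i, projT1 (tf i), forall i,
        Kc u ((projT2 (tf i) (x i))^-1 * l i)%g.
      have h i : exists x, Kc u ((projT2 (tf i) x)^-1 * l i)%g.
        by have [x [hx _]] := (htf i).1.2 _ (hl i); exists x.
      by exists (fun i => sval (cid (h i))) => i; exact: svalP (cid (h i)).
    exists [ffun i => x i]; split=> [i|y hy]; first by rewrite leviME leviVE ffunE.
    apply/ffunP => i; rewrite ffunE.
    have [z [_ uz]] := (htf i).1.2 _ (hl i).
    by rewrite -(uz _ (hx i)) -(uz _ (hy i)).
  rewrite card_dep_ffun.
  rewrite foldrE big_image /= natr_prod; apply/prodf_neq0 => i _.
  exact: (htf i).2.
Qed.

End Filtrations.

Section Smoothness.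
Variables (F : localFieldType) (R : closedFieldType).

Lemma smooth_ksmooth n (r : rep R (GL F n)) : smooth r -> ksmooth (@Kc F n) r.
Proof.
move=> h x; have := h x; rewrite openE => /(_ 1%g) /=.
rewrite ract1 => /(_ erefl) /nbhs_GLP [s hs]; exists s => k Kk.
by have := hs _ Kk; rewrite /= mul1g.
Qed.

Lemma Kl_nbhs t (n_ : 'I_t -> nat) s (l : levi F n_) :
  nbhs l [set l' : levi F n_ | Kl s (l^-1 * l')%g].
Proof.
have h i : nbhs l [set l' : levi F n_ | Kc s ((l i)^-1 * l' i)%g].
  have hk : nbhs (l i) [set g | Kc s ((l i)^-1 * g)%g].
    by apply/nbhs_GLP; exists s => k; rewrite /= mulKg.
  exact: (@proj_continuous _ (fun i => GL F (n_ i)) i l _ hk).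
exact: (filter_forall (nbhs_filter l) h).
Qed.

End Smoothness.

Section OuterTensor.
Variables (F : localFieldType) (R : closedFieldType) (sq : sqrt_resq F R).
Variables (t : nat) (n_ : 'I_t -> nat) (r_ : forall i, rep R (GL F (n_ i))).
Variables (s : rep R (levi F n_)) (b : (forall i, r_ i) -> s).
Hypothesis tb : is_tensor b.
Hypothesis eb : forall (l : levi F n_) v, ract s l (b v) = b (fun i => ract (r_ i) (l i) (v i)).
Local Notation Kc := (@Kc F _).
Local Notation Kl := (@Kl F t n_).

Let mb : multilinear b := tb.1.

Lemma tensor_ksmooth : (forall i, ksmooth Kc (r_ i)) -> ksmooth Kl s.
Proof.
move=> sm x; apply: (tensor_span tb x (U := [set x | exists u, fixd Kl u x])).
  split=> [|a y z [u hu] [v hv]].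
    by exists 0%N => k _; rewrite linear0.
  exists (maxn u v) => k Kk; rewrite linearP hu ?hv // => i; apply: Kc_le (Kk i).
    exact: leq_maxr.
  exact: leq_maxl.
move=> _ [v _ <-].
have [u hu] := choice (fun i => sm i (v i)).
exists (\sum_i u i)%N => k Kk; rewrite eb; congr b.
apply/functional_extensionality_dep => i; apply: hu; apply: Kc_le (Kk i).
by rewrite (bigD1 i) //= leq_addr.
Qed.

(** The average of a pure tensor is the pure tensor of the averages, so the fixed vectors are
spanned by the tensors of fixed vectors. *)
Lemma tensor_adm : (forall i, ksmooth Kc (r_ i)) -> (forall i, adm Kc (r_ i)) -> adm Kl s.
Proof.
move=> sm ad; have FG i := GL_filt sq (n_ i); have FL := levi_filt sq n_.
have sms := tensor_ksmooth sm.
apply: (adm_pos FL) => u u0.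
pose e i := avg (FG i) (sm i) u0; pose es := avg FL sms u0.
have ese v : es (b v) = b (fun i => e i (v i)).
  (* average one factor at a time *)
  pose w (k : nat) (i : 'I_t) := if (i < k)%N then e i (v i) else v i.
  have step k : es (b (w k)) = es (b (w 0%N)).
    elim: k => [//|k <-].
    have [kt|tk] := ltnP k t; last first.
      congr (es (b _)); apply/functional_extensionality_dep => i; rewrite /w.
      by rewrite !(leq_trans (ltn_ord i)) // ltnW.
    pose i0 := Ordinal kt.
    pose U := [set y | es (b (dfwith (w k) i0 y)) = 0].
    have sU : subspace U.
      split; first by rewrite /U /= multilinear0 // linear0.
      by move=> a y z; rewrite /U /= mb linearP => -> ->; rewrite scaler0 addr0.
    have lin y z : es (b (dfwith (w k) i0 (y - z))) =
        es (b (dfwith (w k) i0 y)) - es (b (dfwith (w k) i0 z)).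
      by rewrite -scaleN1r addrC mb linearP scaleN1r addrC.
    have : U (e i0 (v i0) - v i0).
      apply: avg_affine => // h Kh; rewrite /U /= lin; apply/eqP; rewrite subr_eq0; apply/eqP.
      pose l : levi F n_ := dfwith (fun=> 1%g) i0 h.
      have Kll : Kl u l.
        by move=> i; rewrite /l; case: dfwithP => // j _; have [] := @Kc_subgr F (n_ j) u.
      rewrite -[RHS](avgK FL sms u0 _ Kll) -/es eb; congr (es (b _)).
      apply/functional_extensionality_dep => i; rewrite /l.
      case: (eqVneq i0 i) => [<-|ne]; first by rewrite !dfwithin.
      by rewrite !dfwithout // ract1.
    rewrite /U /= lin => /eqP; rewrite subr_eq0 => /eqP.
    have wE : dfwith (w k) i0 (v i0) = w k.
      by rewrite -[RHS](dfwith_id _ i0) /w ltnn.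
    have wE' : dfwith (w k) i0 (e i0 (v i0)) = w k.+1.
      apply/functional_extensionality_dep => i.
      case: (eqVneq i0 i) => [<-|ne]; first by rewrite dfwithin /w /= leqnn.
      rewrite dfwithout // /w ltnS [(i <= k)%N]leq_eqVlt.
      by case: eqP => // ik; case/eqP: ne; apply: val_inj.
    by rewrite wE wE'.
  have -> : b v = b (w 0%N) by congr b.
  rewrite -(step t).
  have -> : w t = fun i => e i (v i).
    by apply/functional_extensionality_dep => i; rewrite /w ltn_ord.
  apply: avg_id => k Kk; rewrite eb; congr b.
  by apply/functional_extensionality_dep => i; apply: avg_fixd; exact: Kk.
have bas i : exists TB : {T : finType & T -> r_ i}, fixd Kc u `<=` span (range (projT2 TB)).
  have [T [B [_ h]]] := dep_basis (fixd_subspace Kc (r_ i) u) (ad i u).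
  by exists (existT _ T B).
pose TB i := sval (cid (bas i)); have hTB i := svalP (cid (bas i)).
pose T := {dffun forall i, projT1 (TB i)}.
pose B (c : T) := b (fun i => projT2 (TB i) (c i)).
apply: (@dep_span _ _ T B) => x fx.
rewrite -(avg_id FL sms u0 fx) -/es.
apply: (tensor_span tb x (U := [set x | span (range B) (es x)])).
  have [h0 h1] := span_subspace (range B).
  by split=> [|a y z /= hy hz]; rewrite /= ?linear0 // linearP; exact: h1.
move=> _ [v _ <-] /=; rewrite ese.
apply: (multilinear_span mb (span_subspace _) (A_ := fun i => range (projT2 (TB i)))).
  move=> v' hv'; apply: sub_span.
  have [c hc] : exists c : forall i, projT1 (TB i), forall i, projT2 (TB i) (c i) = v' i.
    have h i : exists c, projT2 (TB i) c = v' i by have [c _ e0] := hv' i; exists c.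
    by exists (fun i => sval (cid (h i))) => i; exact: svalP (cid (h i)).
  exists [ffun i => c i] => //; rewrite /B; congr b.
  by apply/functional_extensionality_dep => i; rewrite ffunE.
by move=> i; apply: hTB; exact: avg_fixd.
Qed.

(** One pure tensor of nonzero vectors generates, since its translates contain the tensors of
translates. *)
Lemma tensor_fgen : (forall i, irreducible (r_ i)) -> fgen s.
Proof.
move=> ir; have nz i : exists x : r_ i, x != 0 by have [] := ir i.
pose x i := sval (cid (nz i)); have x0 i : x i != 0 := svalP (cid (nz i)).
exists unit, (fun=> b x) => y.
apply: (span_min (gen_subspace _) _ (tensor_span tb y)) => _ [v _ <-].
apply: (multilinear_span mb (gen_subspace _)
  (A_ := fun i => [set y | exists g z, [set x i] z /\ y = ract (r_ i) g z])).
  move=> w hw; have h i : exists g, w i = ract (r_ i) g (x i).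
    by have [g [_ [-> e]]] := hw i; exists g.
  pose l : levi F n_ := fun i => sval (cid (h i)).
  apply: sub_span; exists l, (b x); split; first by exists tt.
  rewrite eb; congr b; apply/functional_extensionality_dep => i.
  exact: svalP (cid (h i)).
move=> i; have := irred_gen (ir i) (x0 i); rewrite /gen => ->.
by [].
Qed.

Lemma tensor_central (z : levi F n_) :
  (forall i, exists2 c : R, c != 0 & forall x, ract (r_ i) (z i) x = c *: x) ->
  exists2 c : R, c != 0 & forall x, ract s z x = c *: x.
Proof.
move=> hz; have hz' i : exists c : R, c != 0 /\ forall x, ract (r_ i) (z i) x = c *: x.
  by have [c] := hz i; exists c.
have [c hc] := choice hz'.
exists (\prod_i c i); first by apply/prodf_neq0 => i _; exact: (hc i).1.
move=> x; apply: (tensor_span tb x (U := [set x | ract s z x = (\prod_i c i) *: x])).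
  split=> [|a y w /= hy hw]; rewrite /= ?linear0 ?scaler0 // linearP hy hw.
  by rewrite scalerDr !scalerA mulrC.
move=> _ [v _ <-] /=; rewrite eb.
pose w (k : nat) (i : 'I_t) := if (i < k)%N then c i *: v i else v i.
have step k : b (w k) = (\prod_(i < t | (i < k)%N) c i) *: b v.
  elim: k => [|k IH]; first by rewrite big_pred0 // scale1r.
  have [kt|tk] := ltnP k t; last first.
    rewrite (_ : w k.+1 = w k); last first.
      apply/functional_extensionality_dep => i; rewrite /w.
      by rewrite !(leq_trans (ltn_ord i)) // ltnW.
    rewrite IH; congr (_ *: _); apply: eq_bigl => i.
    by rewrite !(leq_trans (ltn_ord i)) // ltnW.
  pose i0 := Ordinal kt.
  have -> : w k.+1 = dfwith (w k) i0 (c i0 *: v i0 + 0).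
    apply/functional_extensionality_dep => i.
    case: (eqVneq i0 i) => [<-|ne]; first by rewrite dfwithin /w /= leqnn addr0.
    rewrite dfwithout // /w ltnS [(i <= k)%N]leq_eqVlt.
    by case: eqP => // ik; case/eqP: ne; apply: val_inj.
  rewrite mb multilinear0 // addr0.
  have -> : dfwith (w k) i0 (v i0) = w k.
    by rewrite -[RHS](dfwith_id _ i0) /w ltnn.
  rewrite IH scalerA; congr (_ *: _).
  rewrite [RHS](bigD1 i0) //=; congr (_ * _); apply: eq_bigl => i.
  rewrite ltnS ltn_neqAle andbC; congr (_ && _).
have -> : (fun i => ract (r_ i) (z i) (v i)) = w t.
  by apply/functional_extensionality_dep => i; rewrite /w ltn_ord (hc i).2.
by rewrite step; congr (_ *: _); apply: eq_bigl => i; rewrite ltn_ord.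
Qed.

Lemma tensor_form (lam : forall i, r_ i -> R) :
  (forall i a x y, lam i (a *: x + y) = a * lam i x + lam i y) ->
  exists L : s -> R, (forall a x y, L (a *: x + y) = a * L x + L y) /\
    forall v, L (b v) = \prod_i lam i (v i).
Proof.
move=> ll; have [_ un] := tb.
have mc : multilinear (fun v : forall i, r_ i => \prod_i lam i (v i) : R^o).
  move=> v i a x y; rewrite (bigD1 i) //= [X in _ = _ *: X + _](bigD1 i) //= [X in _ = _ + X](bigD1 i) //=.
  rewrite !dfwithin ll mulrDl -mulrA.
  by congr (_ * (_ * _) + _ * _); apply: eq_bigr => j ji; rewrite !dfwithout // eq_sym.
have [f fb _] := un R^o _ mc.
by exists f; split=> [a x y|v]; rewrite ?fb // linearP.
Qed.

End OuterTensor.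

(** * Standard parabolic subgroups *)

Section Parabolic.
Variables (F : localFieldType) (t : nat) (n_ : 'I_t -> nat).
Local Notation N := (\sum_(i < t) n_ i)%N.
Implicit Types (p g k u : GL F N) (l m : levi F n_).
Local Notation bk := submxblock.

(** The element [p] is in the standard parabolic subgroup and [l] is its image in the Levi subgroup. *)
Definition lp p l := levi_part (erefl N) p l.

Lemma lpE p l : lp p l <-> (forall i j : 'I_t, (j < i)%N -> bk (glmx p) i j = 0) /\
  (forall i, bk (glmx p) i i = glmx (l i)).
Proof. by rewrite /lp /levi_part castmx_id. Qed.

Lemma sub_mul (A B : 'M[F]_N) i j : bk (A *m B) i j = \sum_k bk A i k *m bk B k j.
Proof.
rewrite -[A in LHS]submxblockK -[B in LHS]submxblockK mul_mxblock.
exact: (mxblockK (fun i j => _)).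
Qed.

Lemma sub_mul1 (k0 : 'I_t) (A B : 'M[F]_N) i j :
  (forall k : 'I_t, k != k0 -> bk A i k *m bk B k j = 0) -> bk (A *m B) i j = bk A i k0 *m bk B k0 j.
Proof.
by move=> h; rewrite sub_mul (bigD1 k0) //= [X in _ + X]big1 ?addr0.
Qed.

Lemma sub_one i j : bk (1%:M : 'M[F]_N) i j = if i == j then (pid_mx (n_ i)) else 0.
Proof.
apply/matrixP => a b; rewrite !mxE -val_eqE tagnat.eq_Rank.
case: eqVneq => [e|_]; last by rewrite mxE.
by case: _ / e in b *; rewrite mxE ltn_ord andbT.
Qed.

Lemma sub_one_diag i : bk (1%:M : 'M[F]_N) i i = 1%:M.
Proof. by rewrite sub_one eqxx pid_mx_1. Qed.

Lemma sub_one_off i j : i != j -> bk (1%:M : 'M[F]_N) i j = 0.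
Proof. by rewrite sub_one => /negbTE ->. Qed.

Lemma eq_sub (A B : 'M[F]_N) : (forall i j, bk A i j = bk B i j) -> A = B.
Proof.
move=> h; rewrite -[A]submxblockK -[B]submxblockK.
by apply/eq_mxblock => i j; exact: h.
Qed.

Lemma lpM p p' l l' : lp p l -> lp p' l' -> lp (p * p')%g (l * l')%g.
Proof.
rewrite !lpE => -[h1 h2] [h1' h2']; split=> [i j ji|i]; rewrite glmxM.
  rewrite sub_mul; apply: big1 => k _; have [ki|ik] := ltnP k i; first by rewrite h1 ?mul0mx.
  by rewrite h1' ?mulmx0 //; exact: leq_trans ji ik.
rewrite (sub_mul1 (k0 := i)) => [|k ki]; first by rewrite h2 h2'.
have [lt|ge] := ltnP k i; first by rewrite h1 ?mul0mx.
by rewrite h1' ?mulmx0 // ltn_neqAle ge andbT eq_sym.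
Qed.

Lemma lpV p l : lp p l -> lp p^-1%g l^-1%g.
Proof.
rewrite !lpE => -[h1 h2].
have key i j : bk (glmx p^-1%g *m glmx p) i j = bk (1%:M : 'M[F]_N) i j by rewrite glmxVK.
have low (i j : 'I_t) : (j < i)%N -> bk (glmx p^-1%g) i j = 0.
  have [b] := ubnP (j : nat); elim: b j => // b IH j jb ji.
  have := key i j; rewrite sub_one_off; last by rewrite -val_eqE /= gtn_eqF.
  rewrite (sub_mul1 (k0 := j)) => [|k kj].
    by rewrite h2 => /(congr1 (mulmx^~ (glmx (l j)^-1%g))); rewrite mul0mx -mulmxA glmxKV mulmx1.
  have [jk|kj'] := ltnP j k; first by rewrite h1 ?mulmx0.
  have lkj : (k < j)%N by rewrite ltn_neqAle kj' andbT.
  by rewrite IH ?mul0mx //; [apply: leq_trans lkj _|exact: ltn_trans ji].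
split=> // i; have := key i i; rewrite sub_one_diag (sub_mul1 (k0 := i)) => [|k ki].
  rewrite h2 => /(congr1 (mulmx^~ (glmx (l i)^-1%g))); rewrite mul1mx -mulmxA glmxKV mulmx1.
  by [].
have [ik|ki'] := ltnP i k; first by rewrite h1 ?mulmx0.
by rewrite low ?mul0mx // ltn_neqAle ki' andbT.
Qed.

Lemma lp_uniq p l l' : lp p l -> lp p l' -> l = l'.
Proof.
rewrite !lpE => -[_ h] [_ h']; apply/functional_extensionality_dep => i.
by apply: glmx_inj; rewrite -h -h'.
Qed.

Lemma mxdiag_sub l i j :
  bk (\mxdiag_i (glmx (l i))) i j = if i == j then conform_mx 0 (glmx (l i)) else 0.
Proof. by rewrite /mxdiag mxblockK. Qed.

Lemma bd_unit l : (\mxdiag_i (glmx (l i))) \in unitmx.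
Proof.
have e : \mxdiag_i (glmx (l i)) *m \mxdiag_i (glmx (l^-1%g i)) = 1%:M.
  apply: eq_sub => i j; rewrite (sub_mul1 (k0 := i)) => [|k ki]; last first.
    by rewrite mxdiag_sub eq_sym (negbTE ki) mul0mx.
  rewrite mxdiag_sub eqxx conform_mx_id mxdiag_sub; have [<-|ij] := eqVneq i j.
    by rewrite conform_mx_id leviVE glmxKV sub_one_diag.
  by rewrite mulmx0 sub_one_off.
by have [] := mulmx1_unit e.
Qed.

Definition bd l : GL F N := MkGL (bd_unit l).

Lemma bd_diag l i : bk (glmx (bd l)) i i = glmx (l i).
Proof. by rewrite mxdiag_sub eqxx conform_mx_id. Qed.

Lemma bd_off l i j : i != j -> bk (glmx (bd l)) i j = 0.
Proof. by rewrite mxdiag_sub => /negbTE ->. Qed.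

Lemma lp_bd l : lp (bd l) l.
Proof.
apply/lpE; split=> [i j ji|i]; last exact: bd_diag.
by rewrite bd_off // -val_eqE /= gtn_eqF.
Qed.

Lemma sub_bd_mul l (A : 'M[F]_N) i j : bk (glmx (bd l) *m A) i j = glmx (l i) *m bk A i j.
Proof.
rewrite (sub_mul1 (k0 := i)) ?bd_diag // => k ki.
by rewrite bd_off ?mul0mx // eq_sym.
Qed.

Lemma sub_mul_bd l (A : 'M[F]_N) i j : bk (A *m glmx (bd l)) i j = bk A i j *m glmx (l j).
Proof.
rewrite (sub_mul1 (k0 := j)) ?bd_diag // => k ki.
by rewrite bd_off ?mulmx0.
Qed.

Lemma bdM l l' : bd (l * l')%g = (bd l * bd l')%g.
Proof.
apply: glmx_inj; apply: eq_sub => i j; rewrite glmxM sub_bd_mul.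
have [->|ij] := eqVneq i j; first by rewrite !bd_diag.
by rewrite !bd_off // mulmx0.
Qed.

Lemma bd1 : bd 1%g = 1%g.
Proof.
apply: glmx_inj; apply: eq_sub => i j.
have [->|ij] := eqVneq i j; first by rewrite bd_diag sub_one_diag.
by rewrite bd_off // sub_one_off.
Qed.

Lemma bdV l : bd l^-1%g = (bd l)^-1%g.
Proof. by symmetry; apply: mulg1_eq; rewrite -bdM mulgV bd1. Qed.

Lemma mxO_sub s (A : 'M[F]_N) : (forall i j, mxO s (bk A i j)) <-> mxO s A.
Proof.
split=> [h a b|h i j a b]; last by rewrite !mxE.
by have := h _ _ (tagnat.sig2 a) (tagnat.sig2 b); rewrite !mxE !tagnat.sig2K.
Qed.

Lemma lp_Kl s p l : lp p l -> Kc s p -> Kl s l.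
Proof.
have aux p' l' : lp p' l' -> mxO s (glmx p' - 1%:M) -> forall i, mxO s (glmx (l' i) - 1%:M).
  rewrite lpE => -[_ h] hp i; have /mxO_sub /(_ i i) := hp.
  by rewrite -h -sub_one_diag; move=> h' a b; have := h' a b; rewrite !mxE.
by move=> hp [h1 h2] i; split; [exact: aux hp h1 i|have := aux _ _ (lpV hp) h2 i].
Qed.

Lemma bd_Kc s l : Kl s l -> Kc s (bd l).
Proof.
have aux l' : (forall i, mxO s (glmx (l' i) - 1%:M)) -> mxO s (glmx (bd l') - 1%:M).
  move=> h; apply/mxO_sub => i j.
  have -> : bk (glmx (bd l') - 1%:M) i j = bk (glmx (bd l')) i j - bk (1%:M : 'M[F]_N) i j.
    by apply/matrixP => a b; rewrite !mxE.
  have [->|ij] := eqVneq i j; first by rewrite bd_diag sub_one_diag.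
  by rewrite bd_off // sub_one_off // subr0; exact: mxO0.
by move=> h; split; rewrite -?bdV; apply: aux => i; have [] := h i.
Qed.

Lemma lp_upper p : (forall a b : 'I_N, (b < a)%N -> glmx p a b = 0) -> exists l, lp p l.
Proof.
move=> hp; have d0 := upper_tri_diag hp.
have ltR i j (a : 'I_(n_ i)) (b : 'I_(n_ j)) : (i < j)%N ->
    (tagnat.Rank i a < tagnat.Rank j b)%N.
  move=> ij; have := @tagnat.le_sig1 t n_ (tagnat.Rank j b) (tagnat.Rank i a).
  rewrite !tagnat.Rank1K => h; rewrite ltnNge; apply/negP => /h.
  by rewrite leEord leqNgt ij.
have un i : bk (glmx p) i i \in unitmx.
  rewrite unitmxE unitfE -det_tr det_trig.
    by apply/prodf_neq0 => a _; rewrite !mxE.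
  apply/is_trig_mxP => a b ab; rewrite !mxE hp //.
  by have := @tagnat.lt_Rank t n_ i a b; rewrite !ltEord => ->.
exists (fun i => MkGL (un i)); apply/lpE; split=> // i j ji.
by apply/matrixP => a b; rewrite !mxE hp // ltR.
Qed.

(** An upper triangular matrix is in the parabolic subgroup. *)
Lemma lp_iwasawa g : exists p l k, [/\ lp p l, Kc 0 k & g = (p * k)%g].
Proof.
have [u [x [k [hu Kk e]]]] := iwasawa g.
have [|l hl] := @lp_upper (u * dg F x)%g; last by exists (u * dg F x)%g, l, k.
by move=> a b ba; rewrite glmxM mul_mxdE hu ?(ltnW ba) // -val_eqE /= gtn_eqF // mul0r.
Qed.

(** The unipotent radical of the opposite parabolic. *)
Definition Jm : rel 'I_N := fun a b => (tagnat.sig1 b < tagnat.sig1 a)%N.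

Lemma Jm_trans : transitive Jm.
Proof. by move=> b a c h1 h2; exact: ltn_trans h2 h1. Qed.

Lemma Jm_ranked : ranked Jm.
Proof.
exists (fun a => t - tagnat.sig1 a)%N => a b; rewrite /Jm => h.
by have := ltn_ord (tagnat.sig1 a); lia.
Qed.

Lemma UJmP u : UJ Jm u <-> forall i j : 'I_t, (i <= j)%N -> bk (glmx u) i j = bk (1%:M : 'M[F]_N) i j.
Proof.
split=> [[h _] i j ij|h].
  apply/matrixP => a b; have := h (tagnat.Rank i a) (tagnat.Rank j b).
  rewrite /Jm !tagnat.Rank1K -leqNgt => /(_ ij) /eqP; rewrite !mxE subr_eq0 => /eqP ->.
  by [].
apply: UJP; [exact: Jm_trans|exact: Jm_ranked|] => a b; rewrite /Jm -leqNgt => ab.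
have /matrixP /(_ (tagnat.sig2 a) (tagnat.sig2 b)) := h _ _ ab.
by rewrite !mxE !tagnat.sig2K => ->; rewrite subrr.
Qed.

Lemma lp_UJm u l : lp u l -> UJ Jm u -> u = 1%g.
Proof.
rewrite lpE => -[h1 _] /UJmP h2; apply: glmx_inj; apply: eq_sub => i j.
have [ij|ji] := leqP i j; first exact: h2.
by rewrite h1 // sub_one_off // -val_eqE /= gtn_eqF.
Qed.

Lemma bdJ_UJm l u : UJ Jm u -> UJ Jm (bd l * u * (bd l)^-1)%g.
Proof.
move=> /UJmP h; apply/UJmP => i j ij; rewrite -bdV 2!glmxM sub_mul_bd sub_bd_mul h //.
have [->|nij] := eqVneq i j; first by rewrite sub_one_diag mulmx1 leviVE glmxKV.
by rewrite sub_one_off // mulmx0 mul0mx.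
Qed.

(** The Iwahori factorisation: regroup the triangular factors of [Kc_LU] by blocks. *)
Lemma Kc_dec s k : (0 < s)%N -> Kc s k -> exists p l u,
  [/\ lp p l, Kc s p, UJ Jm u, Kc s u & k = (p * u)%g].
Proof.
move=> s0 Kk; have [b [v [e Kb Kv hb hv]]] := Kc_LU s0 Kk.
have [lb hlb] := lp_upper hb.
have dK i : exists2 g : GL F (n_ i), Kc s g & glmx g = bk (glmx v) i i.
  have [|g Kg eg] := @Kc_mk F (n_ i) s (bk (glmx v) i i - 1%:M) s0.
    have /mxO_sub /(_ i i) := Kv.1; rewrite -sub_one_diag.
    by move=> h a c; have := h a c; rewrite !mxE.
  by exists g => //; rewrite eg addrC subrK.
pose m : levi F n_ := fun i => s2val (cid2 (dK i)).
have mK : Kl s m by move=> i; exact: s2valP (cid2 (dK i)).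
have mE i : glmx (m i) = bk (glmx v) i i by exact: s2valP' (cid2 (dK i)).
have [_ KM KV] := @Kc_subgr F N s; have Km := bd_Kc mK.
exists (b * bd m)%g, (lb * m)%g, ((bd m)^-1 * v)%g; split.
- exact: lpM hlb (lp_bd m).
- exact: KM.
- apply/UJmP => i j ij; rewrite -bdV glmxM sub_bd_mul.
  have [eij|nij] := eqVneq i j.
    by subst j; rewrite sub_one_diag -mE leviVE glmxVK.
  rewrite sub_one_off // (_ : bk (glmx v) i j = 0) ?mulmx0 //.
  apply/matrixP => a c; rewrite !mxE hv; last first.
    rewrite leqNgt; apply/negP => lt.
    have := @tagnat.le_sig1 t n_ (tagnat.Rank j c) (tagnat.Rank i a).
    rewrite !tagnat.Rank1K !leEord (ltnW lt) => /(_ isT) ji.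
    by case/eqP: nij; apply: val_inj; apply/eqP; rewrite eqn_leq ij ji.
  by rewrite -val_eqE tagnat.eq_Rank (negbTE nij).
- by apply: KM => //; exact: KV.
- by rewrite e !mulgE.
Qed.

End Parabolic.

(** * Parabolic induction *)

Section KernelDep.
Variables (R : fieldType) (V V1 : lmodType R).

Lemma dep_ker (f : {linear V -> V1}) (S : set V) (S1 : set V1) :
  subspace S -> f @` S `<=` S1 -> dep S1 -> dep (S `&` [set x | f x = 0]) -> dep S.
Proof.
move=> sS fS [T1 h1] [T2 h2]; exists (T1 * T2)%type => x Sx.
have e1 j : exists c : T1 -> R, (exists i, c i != 0) /\ \sum_i c i *: f (x (i, j)) = 0.
  by apply: h1 => i; apply: fS; exists (x (i, j)).
have [c hc] := choice e1.
pose y j := \sum_i c j i *: x (i, j).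
have Sy j : (S `&` [set x | f x = 0]) (y j).
  split; first by apply: subspace_sum => // i _; exact: subspaceZ.
  by rewrite /= /y lin_sum (hc j).2.
have [d [[j dj] hd]] := h2 y Sy.
exists (fun ij => d ij.2 * c ij.2 ij.1); split.
  by have [[i ci] _] := hc j; exists (i, j); rewrite mulf_neq0.
rewrite -[RHS]hd; transitivity (\sum_i \sum_j (d j * c j i) *: x (i, j)).
  by rewrite pair_bigA; apply: eq_bigr => -[].
rewrite exchange_big /=; apply: eq_bigr => j' _; rewrite scaler_sumr.
by apply: eq_bigr => i _; rewrite scalerA.
Qed.

Lemma dep_family (I : eqType) (l : seq I) (f : I -> {linear V -> V1}) (S : set V) (S1 : set V1) :
  subspace S -> (forall i, i \in l -> f i @` S `<=` S1) -> dep S1 ->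
  (forall x, S x -> (forall i, i \in l -> f i x = 0) -> x = 0) -> dep S.
Proof.
move=> sS fS d1; elim: l S sS fS => [|i l IH] S sS fS inj.
  exists unit => x Sx; exists (fun=> 1); split; first by exists tt; exact: oner_neq0.
  by rewrite big1 // => u _; rewrite (inj (x u)) ?scaler0.
apply: (dep_ker (f := f i) sS _ d1); first by apply: fS; exact: mem_head.
apply: IH.
- split; first by split; [exact: sS.1|rewrite /= linear0].
  move=> a x y [Sx fx] [Sy fy]; split; first exact: sS.2.
  by rewrite /= linearP fx fy scaler0 addr0.
- by move=> k kl _ [x [Sx _] <-]; apply: (fS k); [rewrite inE kl orbT|exists x].
- move=> x [Sx fx] h; apply: inj => // k; rewrite inE => /orP[/eqP ->//|]; exact: h.
Qed.

End KernelDep.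

Lemma mxB1E (F : ringType) n (A : 'M[F]_n) a b : (A - 1%:M) a b = A a b - (a == b)%:R.
Proof. by rewrite !mxE. Qed.

Section Induced.
Variables (F : localFieldType) (R : closedFieldType) (sq : sqrt_resq F R).
Variables (t : nat) (n_ : 'I_t -> nat) (s : rep R (levi F n_)).
Local Notation N := (\sum_(i < t) n_ i)%N.
Local Notation Kc := (@Kc F _).
Local Notation Kl := (@Kl F t n_).
Implicit Types (p g k v : GL F N) (u : nat) (l m : levi F n_) (w : s).

Definition dl l : R := modulus_sqrt sq l.

Lemma vdet_Kc n (k : GL F n) : Kc 0 k -> lfval (\det (glmx k)) = 0.
Proof.
move=> Kk; have [_ _ KV] := @Kc_subgr F n 0.
have h1 := inO_det (Kc_int Kk); have h2 := inO_det (Kc_int (KV _ Kk)).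
have nz (g : GL F n) : \det (glmx g) != 0 by have := gl_unit g; rewrite unitmxE unitfE.
move: h1 h2; rewrite /inO !(negbTE (nz _)) ![false || _]orFb.
by have := vdetM k k^-1%g; rewrite mulgV vdet1; move: (lfval _) (lfval _) => a b; lia.
Qed.

Lemma dl_neq0 l : dl l != 0.
Proof. by rewrite /dl /modulus_sqrt expfz_neq0 // sqrtq_neq0. Qed.

Lemma dlM l m : dl (l * m)%g = dl l * dl m.
Proof.
rewrite /dl /modulus_sqrt -expfzDr ?sqrtq_neq0 //; congr (_ ^ _).
rewrite -opprD -big_split; congr (- _); apply: eq_bigr => i _ /=.
rewrite -big_split; apply: eq_bigr => j _ /=.
have vM a : lfval (\det (glmx (l a) *m glmx (m a))) = _ := vdetM (l a) (m a).
by rewrite !vM; ring.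
Qed.

Lemma dl1 : dl 1%g = 1.
Proof.
by apply: (mulfI (dl_neq0 1%g)); rewrite -dlM mulg1 mulr1.
Qed.

Lemma dl_K l : Kl 0 l -> dl l = 1.
Proof.
move=> h; rewrite /dl /modulus_sqrt big1 ?oppr0 ?expr0z // => i _.
by rewrite big1 // => j _; rewrite !vdet_Kc ?mulr0 ?subr0.
Qed.

Variables (r : rep R (GL F N)) (j : {linear r -> (GL F N -> s)}).
Hypotheses (jeq : right_equivariant j) (jinj : injective j).
Hypothesis jran : range j = @induced_space F R sq N t n_ (erefl N) s.

Lemma ind_prop x : (forall p l g, lp p l -> j x (p * g)%g = dl l *: ract s l (j x g)) /\
  exists u, forall k g, Kc u k -> j x (g * k)%g = j x g.
Proof.
have : range j (j x) by exists x.
rewrite jran => -[h1 h2]; split=> [p l g hp|]; first exact: h1.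
have /nbhs_GLP [u hu] := h2; exists u => k g Kk.
by have := hu _ Kk g; rewrite mul1g.
Qed.

Lemma ind_mk (f : GL F N -> s) : (forall p l g, lp p l -> f (p * g)%g = dl l *: ract s l (f g)) ->
  (exists u, forall k g, Kc u k -> f (g * k)%g = f g) -> exists x, j x = f.
Proof.
move=> h1 [u hu]; have : range j f; last by move=> [x _ <-]; exists x.
rewrite jran; split=> [p l g|]; first exact: h1.
by apply/nbhs_GLP; exists u => k Kk g; rewrite mul1g hu.
Qed.

Lemma ind_fixd u x : fixd Kc u x <-> forall k g, Kc u k -> j x (g * k)%g = j x g.
Proof.
split=> [h k g Kk|h k Kk]; first by rewrite -jeq h.
by apply: jinj; apply/funext => g; rewrite jeq h.
Qed.

Lemma ind_ksmooth : ksmooth Kc r.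
Proof. by move=> x; have [_ [u hu]] := ind_prop x; exists u; apply/ind_fixd. Qed.

(** A [K_u]-fixed function is determined by its values at representatives of [K_0 / K_u], and
these values are fixed by [K_u] of the Levi subgroup. *)
Lemma ind_adm : adm Kl s -> adm Kc r.
Proof.
move=> ad; apply: (adm_pos (GL_filt sq N)) => u u0.
have [T [f tr]] := Kc0_transv F N u.
have evl g : linear (fun x => j x g) by move=> a x y; rewrite linearP.
pose ev g : {linear r -> s} := HB.pack (fun x => j x g)
  (GRing.isLinear.Build R r s *:%R (fun x => j x g) (evl g)).
apply: (dep_family (l := enum T) (f := fun i => ev (f i)) (fixd_subspace Kc r u) _ (ad u)).
  move=> i _ _ [x fx <-] l Kl_ /=.
  have Kbd := bd_Kc Kl_; have Kf := tr.1 i.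
  have [_ _ KV] := @Kc_subgr F N 0.
  have /ind_fixd h := fx.
  have := h _ (f i) (Kc_normal Kf Kbd); rewrite !mulgA mulgV mul1g.
  rewrite ((ind_prop x).1 _ _ _ (lp_bd l)) dl_K ?scale1r // => k.
  exact: Kc_le (Kl_ k).
move=> x fx h; apply: jinj; rewrite linear0; apply/funext => g.
have [p [l [k [hp Kk ->]]]] := lp_iwasawa g.
have [i [Ki _]] := tr.2 _ Kk.
have -> : (p * k)%g = (p * (f i * ((f i)^-1 * k)))%g by rewrite mulVKg.
rewrite ((ind_prop x).1 _ _ _ hp); have /ind_fixd -> // := fx.
by have := h i; rewrite mem_enum => /(_ isT) /= ->; rewrite linear0 scaler0.
Qed.

(** The function with value [w] on [U^-(pi^u)], supported on [P U^-(pi^u)]. *)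
Definition bump w (u : nat) g : s :=
  if pselect (exists plv : GL F N * levi F n_ * GL F N, [/\ lp plv.1.1 plv.1.2,
      UJ (@Jm t n_) plv.2, Kc u plv.2 & g = (plv.1.1 * plv.2)%g]) is left e
  then let plv := sval (cid e) in dl plv.1.2 *: ract s plv.1.2 w else 0.

Lemma bump_val w u p l v : lp p l -> UJ (@Jm t n_) v -> Kc u v ->
  bump w u (p * v)%g = dl l *: ract s l w.
Proof.
move=> hp Uv Kv; rewrite /bump; case: pselect => [e|no]; last first.
  by case: no; exists (p, l, v).
case: (cid e) => -[[p' l'] v'] /= [hp' Uv' Kv' e'].
have [_ UM UV] := UJ_subgr F (@Jm_trans t n_).
have eq1 : (p'^-1 * p = v' * v^-1)%g.
  by rewrite -[p](mulgK v) e' !mulgE.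
have /lp_UJm h : lp (v' * v^-1)%g (l'^-1 * l)%g by rewrite -eq1; exact: lpM (lpV hp') hp.
have vv : (v' * v^-1)%g = 1%g by apply: h; apply: UM => //; exact: UV.
have pp : p = p' by rewrite -[p](mulVKg p') eq1 vv mulg1.
by rewrite -(lp_uniq hp (l' := l')) // pp.
Qed.

Lemma bump_out w u g : (forall p l v, lp p l -> UJ (@Jm t n_) v -> Kc u v -> g <> (p * v)%g) ->
  bump w u g = 0.
Proof.
move=> h; rewrite /bump; case: pselect => [[[[p l] v] /= [h1 h2 h3 h4]]|//].
by case: (h p l v).
Qed.

Lemma bump_lin u g a w w' : bump (a *: w + w') u g = a *: bump w u g + bump w' u g.
Proof.
rewrite /bump; case: pselect => [e|_]; last by rewrite scaler0 addr0.
by rewrite linearP scalerDr !scalerA mulrC.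
Qed.

Lemma bump_P w u p l g : lp p l -> bump w u (p * g)%g = dl l *: ract s l (bump w u g).
Proof.
move=> hp; have [[p' [l' [v [h1 h2 h3 ->]]]]|no] :=
  pselect (exists p' l' v, [/\ lp p' l', UJ (@Jm t n_) v, Kc u v & g = (p' * v)%g]).
  rewrite mulgA (bump_val _ (lpM hp h1)) // (bump_val _ h1) //.
  by rewrite linearZ scalerA dlM ractM.
rewrite bump_out ?bump_out ?linear0 ?scaler0 // => p' l' v h1 h2 h3 e; apply: no.
  by exists p', l', v.
exists (p^-1 * p')%g, (l^-1 * l')%g, v; split=> //; first exact: lpM (lpV hp) h1.
by rewrite -mulgA -e mulKg.
Qed.

Lemma bump_K w (u : nat) p l k : (0 < u)%N -> fixd Kl u w -> lp p l -> Kc u k ->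
  bump w u (p * k)%g = dl l *: ract s l w.
Proof.
move=> u0 fw hp Kk; have [p' [l' [v [h1 h2 h3 h4 ->]]]] := Kc_dec u0 Kk.
rewrite mulgA (bump_val _ (lpM hp h1)) // dlM ractM fw; last exact: lp_Kl h1 h2.
by rewrite (@dl_K l') ?mulr1 // => i; apply: Kc_le (lp_Kl h1 h2 i).
Qed.

Lemma bump_outK w (u : nat) g : (forall p l k, lp p l -> Kc u k -> g <> (p * k)%g) ->
  bump w u g = 0.
Proof. by move=> h; apply: bump_out => p l v h1 _ h3; exact: h h1 h3. Qed.

Lemma bump_ind w (u : nat) : (0 < u)%N -> fixd Kl u w -> exists x, j x = bump w u.
Proof.
move=> u0 fw; apply: ind_mk => [p l g|]; first exact: bump_P.
have [_ KM KV] := @Kc_subgr F N u.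
exists u => k g Kk.
have [[p [l [k' [h1 h2 ->]]]]|no] := pselect (exists p l k', [/\ lp p l, Kc u k' & g = (p * k')%g]).
  by rewrite -mulgA !(bump_K u0 fw h1) //; exact: KM.
rewrite !bump_outK // => p l k' h1 h2 e; apply: no; first by exists p, l, k'.
exists p, l, (k' * k^-1)%g; split=> //; first by apply: KM => //; exact: KV.
by rewrite mulgA -e mulgK.
Qed.

(** The translate by [m] is supported on [P H], where [H] is the contraction of the group of level [u0]; its
translates by the cosets of [H] fill the group of level [u]. *)
Lemma bump_gen (X : set r) (v : s) (u0 u : nat) (m : levi F n_) x0 : (0 < u0)%N ->
  fixd Kl u0 v -> X x0 -> j x0 = bump v u0 ->
  (forall g, UJ (@Jm t n_) g -> Kc u0 g -> Kc u (bd m * g * (bd m)^-1)%g) ->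
  exists x, gen X x /\ j x = bump (ract s m v) u.
Proof.
move=> u00 fv Xx0 ex0 contr; pose M := bd m.
have [U1 UM UV] := UJ_subgr F (@Jm_trans t n_); have [K1 KM KV] := @Kc_subgr F N u.
pose H := [set g | UJ (@Jm t n_) g /\ Kc u0 (M^-1 * g * M)%g].
have sUu := subgrI (UJ_subgr F (@Jm_trans t n_)) (@Kc_subgr F N u).
have sH : subgr H := subgrI (UJ_subgr F (@Jm_trans t n_)) (subgr_conj M (@Kc_subgr F N u0)).
have HU : H `<=` (UJ (@Jm t n_) `&` Kc u).
  move=> g [Ug Kg]; split=> //.
  have := contr (M^-1 * g * M)%g _ Kg; rewrite -/M !mulgE; apply.
  by have := bdJ_UJm m^-1%g Ug; rewrite bdV invgK.
have [u1 [uu1 UH]] : exists u1, (u <= u1)%N /\ (UJ (@Jm t n_) `&` Kc u1) `<=` H.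
  have [u2 hu2] : exists u2, forall k, Kc u2 k -> Kc u0 (M^-1 * k * M)%g.
    exact: Kc_conj.
  exists (maxn u u2); split=> [|g [Ug Kg]]; first exact: leq_maxl.
  by split=> //; apply: hu2; apply: Kc_le Kg; exact: leq_maxr.
have [T0 [f0 [tr0 _]]] := UJ_Kc_transv (@Jm_trans t n_)
  (@padm_ranked F N _ u (@Jm_trans t n_) (@Jm_ranked t n_)) uu1.
have sU1 := subgrI (UJ_subgr F (@Jm_trans t n_)) (@Kc_subgr F N u1).
have [_ [T [f tr]]] := transv_sub sUu sH sU1 HU UH tr0.
(* [M x0] is supported on [P H], and the [f i] run over the cosets of [H] *)
pose y := \sum_i ract r (f i) (ract r M x0).
exists ((dl m)^-1 *: y); split.
  apply: (subspaceZ _ (gen_subspace X)).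
  apply: (@subspace_sum R r (gen X) T _ predT _ (gen_subspace X)).
  by move=> i _; apply: gen_stable; apply: gen_stable; exact: gen_sub.
have jy g : j y g = \sum_i bump v u0 (g * f i * M)%g.
  rewrite /y linear_sum.
  have -> : (\sum_i j (ract r (f i) (ract r M x0))) g = \sum_i j (ract r (f i) (ract r M x0)) g.
    by elim/big_rec2: _ => //= i a b _ <-.
  by apply: eq_bigr => i _; rewrite !jeq ex0.
apply/funext => g; rewrite linearZ.
transitivity ((dl m)^-1 *: j y g); first by [].
rewrite jy.
have hM := lp_bd m.
have [[p [l [v' [h1 h2 h3 ->]]]]|no] :=
  pselect (exists p l v', [/\ lp p l, UJ (@Jm t n_) v', Kc u v' & g = (p * v')%g]); last first.
  rewrite bump_out => [|p l v' h1 h2 h3 e]; last by apply: no; exists p, l, v'.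
  rewrite big1 ?scaler0 // => i _; apply: bump_out => p l v' h1 h2 h3 e; apply: no.
  have Hv' : H (M * v' * M^-1)%g.
    by split; [exact: bdJ_UJm|rewrite !mulgE].
  exists (p * M^-1)%g, (l * m^-1)%g, (M * v' * M^-1 * (f i)^-1)%g; split.
  - by rewrite /M -bdV; exact: lpM h1 (lp_bd _).
  - by apply: UM; [exact: (HU _ Hv').1|apply: UV; exact: (tr.1 i).1].
  - by apply: KM; [exact: (HU _ Hv').2|apply: KV; exact: (tr.1 i).2].
  - by rewrite !mulgE -e !mulgE.
rewrite (bump_val _ h1 h2 h3).
have inU : (UJ (@Jm t n_) `&` Kc u) v'^-1%g by split; [exact: UV|exact: KV].
have [i [Hi ui]] := tr.2 _ inU.
have [_ HM HV] := sH.
rewrite (bigD1 i) //= [X in _ *: (_ + X)]big1 ?addr0 => [|i' i'i].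
  have Hvi : H (v' * f i)%g by have := HV _ Hi; rewrite !mulgE.
  have -> : (p * v' * f i * M = p * M * (M^-1 * (v' * f i) * M))%g by rewrite !mulgE.
  rewrite (bump_val _ (lpM h1 hM)).
  - rewrite dlM ractM scalerA mulrCA mulVf ?mulr1 //; exact: dl_neq0.
  - by have := bdJ_UJm m^-1%g Hvi.1; rewrite bdV invgK.
  - exact: Hvi.2.
apply: bump_out => p' l' v2 g1 g2 g3 e; case/eqP: i'i; symmetry; apply: ui.
have Hv2 : H (M * v2 * M^-1)%g by split; [exact: bdJ_UJm|rewrite !mulgE].
have e2 : (v' * f i' = p^-1 * p' * M^-1 * (M * v2 * M^-1))%g.
  by rewrite !mulgE -[RHS]mulgA -[RHS]mulgA [(p' * _)%g]mulgA -e !mulgE.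
have e3 : (p^-1 * p' * M^-1 = v' * f i' * (M * v2 * M^-1)^-1)%g by rewrite e2 !mulgE.
have /lp_UJm e4 : lp (p^-1 * p' * M^-1)%g (l^-1 * l' * m^-1)%g.
  by apply: lpM (lpM (lpV h1) g1) _; rewrite /M -bdV; exact: lp_bd.
have e5 : (p^-1 * p' * M^-1)%g = 1%g.
  apply: e4; rewrite e3; apply: (UM _ _ _); last by apply: UV; exact: Hv2.1.
  by apply: (UM _ _ _) => //; exact: (tr.1 i').1.
have : H (v' * f i')%g by rewrite e2 e5 mul1g.
by move=> /HV; rewrite !mulgE.
Qed.

(** A central element of the Levi subgroup, more and more divisible from one block to the next. *)
Definition al (e : nat) : levi F n_ := fun i => dg F (fun _ : 'I_(n_ i) => (e * i)%N%:Z).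

Lemma bd_al e : bd (al e) = dg F (fun a : 'I_N => (e * tagnat.sig1 a)%N%:Z).
Proof.
apply: glmx_inj; apply: eq_sub => i j'.
have [<-|ij] := eqVneq i j'.
  rewrite bd_diag; apply/matrixP => a b; rewrite [RHS]mxE /= !dmxE.
  rewrite tagnat.Rank1K -[_ == _ :> 'I_N]val_eqE tagnat.eq_Rank eqxx /=.
  by [].
rewrite bd_off //; apply/matrixP => a b; rewrite [RHS]mxE /= !dmxE mxE.
by rewrite -[_ == _ :> 'I_N]val_eqE tagnat.eq_Rank (negbTE ij).
Qed.

(** The conjugation by [al e] multiplies the entries below the diagonal blocks by positive
powers of the uniformizer, which overcome the conjugation by [m] for large [e]. *)
Lemma al_contracts m (u0 u : nat) : (0 < u)%N -> exists e, forall g, UJ (@Jm t n_) g -> Kc u0 g ->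
  Kc u (bd (m * al e) * g * (bd (m * al e))^-1)%g.
Proof.
move=> upos; have [b1 hb1] := mxO_exists (glmx (bd m)).
have [b2 hb2] := mxO_exists (glmx (bd m)^-1%g).
exists (u + b1 + b2)%N => g Ug Kg; apply: Kc1P => //.
set e := (u + b1 + b2)%N; pose g' := (bd (al e) * g * (bd (al e))^-1)%g.
have hg' : mxO e (glmx g' - 1%:M).
  move=> a b; have -> : (glmx g' - 1%:M) a b =
      unif ^ ((e * tagnat.sig1 a)%N%:Z - (e * tagnat.sig1 b)%N%:Z) * (glmx g - 1%:M) a b.
    rewrite !mxB1E /g' bd_al dgJE mulrBr; congr (_ - _).
    case: eqP => [->|_]; last by rewrite mulr0.
    by rewrite subrr expr0z mul1r.
  have [Jab|nJ] := boolP (Jm a b); last by rewrite (Ug.1 _ _ nJ) mulr0 inO0.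
  rewrite inO_pwM; apply: inO_le (Kg.1 a b); move: Jab; rewrite /Jm => h.
  have : (e * (tagnat.sig1 b).+1 <= e * tagnat.sig1 a)%N by rewrite leq_mul2l h orbT.
  rewrite mulnS; lia.
have -> : glmx (bd (m * al e) * g * (bd (m * al e))^-1)%g - 1%:M =
    glmx (bd m) *m (glmx g' - 1%:M) *m glmx (bd m)^-1%g.
  rewrite mulmxBr mulmxBl mulmx1 glmxKV bdM; congr (_ - _).
  by rewrite -!glmxM /g' !mulgE.
by apply: mxO_le (mxOM (mxOM hb1 hg') hb2); rewrite /e; lia.
Qed.

(** All the bumps with values in the orbits of the generators arise from those of one fixed
level: multiply the element [m] of the Levi subgroup by [al e], which contracts the
opposite radical and acts on [s] by a scalar. Every function is a sum of translates of bumps. *)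
Lemma ind_fgen : ksmooth Kl s -> fgen s ->
  (forall e, exists2 c : R, c != 0 & forall x, ract s (al e) x = c *: x) -> fgen r.
Proof.
move=> sm [T0 [v_ gv]] hc.
have [u0 [u00 fv]] : exists u0, (0 < u0)%N /\ forall i, fixd Kl u0 (v_ i).
  have [lv hlv] := choice (fun i => sm (v_ i)).
  exists (\sum_i lv i).+1; split=> // i k Kk; apply: hlv => a; apply: Kc_le (Kk a).
  by rewrite (bigD1 i) //= ltnW // ltnS leq_addr.
have [x0 hx0] := choice (fun i => bump_ind u00 (fv i)).
exists T0, x0 => x; set X := range x0.
have bumpX u w : (0 < u)%N -> exists y, gen X y /\ j y = bump w u.
  move=> upos; apply: (gv w [set w | exists y, gen X y /\ j y = bump w u]).
    split.
      exists 0; split; first by have [] := gen_subspace X.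
      rewrite linear0; apply/funext => g.
      have := bump_lin u g (-1) 0 0; rewrite scaler0 addr0 scaleN1r => ->.
      by rewrite addNr.
    move=> a w1 w2 [y1 [g1 e1]] [y2 [g2 e2]]; exists (a *: y1 + y2); split.
      by have [_] := gen_subspace X; apply.
    by rewrite linearP e1 e2; apply/funext => g; rewrite bump_lin.
  move=> _ [m [_ [[i _ <-] ->]]].
  have [e he] := al_contracts m u0 upos; have [c c0 hce] := hc e.
  have Xi : X (x0 i) by exists i.
  have [y [gy ey]] := bump_gen u00 (fv i) Xi (hx0 i) he.
  exists (c^-1 *: y); split; first exact: (subspaceZ _ (gen_subspace X)).
  rewrite linearZ ey; apply/funext => g.
  transitivity (c^-1 *: bump (ract s (m * al e)%g (v_ i)) u g); first by [].
  rewrite ractM hce linearZ.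
  have := bump_lin u g c (ract s m (v_ i)) 0; rewrite addr0 => ->.
  have -> : bump 0 u g = 0.
    have := bump_lin u g (-1) 0 0; rewrite scaler0 addr0 scaleN1r => ->.
    by rewrite addNr.
  by rewrite addr0 scalerA mulVf // scale1r.
have [u [upos fx]] : exists u, (0 < u)%N /\ fixd Kc u x.
  have [u hu] := ind_ksmooth x; exists u.+1; split=> // k Kk; apply: hu.
  by apply: Kc_le Kk.
have [T [f tr]] := Kc0_transv F N u.
have [_ KM KV] := @Kc_subgr F N u; have /ind_fixd jx := fx.
pose su i g := exists p l k, [/\ lp p l, Kc u k & g = (p * f i * k)%g].
have su_self i : su i (f i).
  exists 1%g, 1%g, 1%g; split; last by rewrite mulg1 mul1g.
    by have := lp_bd (1%g : levi F n_); rewrite bd1.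
  by have [] := @Kc_subgr F N u.
have su_tr i i' g g' : su i g -> su i' g -> su i g' -> su i' g'.
  move=> [p [l [k [h1 h2 e]]]] [p' [l' [k' [h1' h2' e']]]] [p2 [l2 [k2 [h3 h4 ->]]]].
  have ef : f i = (p^-1 * p' * f i' * k' * k^-1)%g.
    by apply: (mulgI p); apply: (mulIg k); rewrite -e !mulgE e'.
  exists (p2 * p^-1 * p')%g, (l2 * l^-1 * l')%g, (k' * k^-1 * k2)%g; split.
  - exact: lpM (lpM h3 (lpV h1)) h1'.
  - by apply: (KM _ _ _) => //; apply: (KM _ _ _) => //; exact: KV.
  - by rewrite ef !mulgE.
have fixw i : fixd Kl u (j x (f i)).
  move=> l hl; have := jx _ (f i) (Kc_normal (tr.1 i) (bd_Kc hl)); rewrite !mulgA mulgV mul1g.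
  rewrite ((ind_prop x).1 _ _ _ (lp_bd l)) dl_K ?scale1r // => k.
  exact: Kc_le (hl k).
have [y hy] := choice (fun i => bumpX u (j x (f i)) upos).
have phi i g : j (ract r (f i)^-1%g (y i)) g = if pselect (su i g) then j x g else 0.
  rewrite jeq (hy i).2; case: pselect => [[p [l [k [h1 h2 e]]]]|no] /=.
    rewrite {}e; have Kk' : Kc u (f i * k * (f i)^-1)%g.
      have [_ _ KV0] := @Kc_subgr F N 0.
      by have := Kc_normal (KV0 _ (tr.1 i)) h2; rewrite invgK.
    have -> : (p * f i * k * (f i)^-1 = p * (f i * k * (f i)^-1))%g by rewrite !mulgE.
    by rewrite (bump_K upos (fixw i) h1) // jx // ((ind_prop x).1 _ _ _ h1).
  apply: bump_outK => p l k h1 h2 e; apply: no.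
  exists p, l, ((f i)^-1 * k * f i)%g; split=> //; first exact: Kc_normal (tr.1 i) h2.
  by rewrite !mulgE -e !mulgE.
pose c i := odflt i [pick i' | `[< su i' (f i) >]].
have cP i : su (c i) (f i).
  by rewrite /c; case: pickP => [i' /asboolP //|/(_ i) /asboolP []].
have cE i i' : su i (f i') -> c i = c i'.
  move=> h; rewrite /c; have -> : [pick i0 | `[< su i0 (f i) >]] = [pick i0 | `[< su i0 (f i') >]].
    apply: eq_pick => i0; apply/asboolP/asboolP => h0.
      exact: su_tr (su_self i) h0 h.
    exact: su_tr h h0 (su_self i).
  by case: pickP => // /(_ i') /asboolP [].
(* one summand for each double coset of [P] and [K_u] *)
have -> : x = \sum_(i | c i == i) ract r (f i)^-1%g (y i).
  apply: jinj; apply/funext => g; rewrite linear_sum.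
  have -> : (\sum_(i | c i == i) j (ract r (f i)^-1%g (y i))) g =
      \sum_(i | c i == i) j (ract r (f i)^-1%g (y i)) g.
    by elim/big_rec2: _ => //= i a b _ <-.
  have [p [l [k [h1 Kk eg]]]] := lp_iwasawa g.
  have [i [Ki _]] := tr.2 _ Kk.
  have sig : su i g by exists p, l, ((f i)^-1 * k)%g; split=> //; rewrite eg !mulgE.
  have cci : c (c i) = c i by apply: cE; exact: cP.
  have scg : su (c i) g by apply: su_tr (su_self i) (cP i) sig.
  rewrite (bigD1 (c i)) ?cci //= phi; case: pselect => [h0|//] /=.
  rewrite [X in _ = _ + X]big1 ?addr0 // => i' /andP[/eqP ci' ni]; rewrite phi.
  case: pselect => [si'|//] /=; case/eqP: ni; rewrite -ci' -cci; apply: cE.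
  by apply: su_tr scg si' (su_self (c i)).
apply: (@subspace_sum R r (gen X) T _ _ _ (gen_subspace X)) => i _.
by apply: gen_stable; exact: (hy i).1.
Qed.

End Induced.

(** * Cuspidal representations *)

Section SmoothFunctions.
Variables (F : localFieldType) (R : closedFieldType) (t : nat) (n_ : 'I_t -> nat).
Local Notation Kl := (@Kl F t n_).

(** The regular representation on smooth functions receives the coefficients of any smooth
representation. *)
Definition smooth_fun : pred (levi F n_ -> R^o) :=
  fun f => `[< exists s, forall l k, Kl s k -> f (l * k)%g = f l >].

Lemma smooth_fun_submod : submod_closed smooth_fun.
Proof.
split=> [|a f g /asboolP [s hs] /asboolP [u hu]]; first by apply/asboolP; exists 0%N.
apply/asboolP; exists (maxn s u) => l k Kk.
have e (h : levi F n_ -> R^o) (h' : levi F n_ -> R^o) l' : (a *: h + h') l' = a * h l' + h' l' by [].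
rewrite !e hs ?hu // => i; apply: Kc_le (Kk i); [exact: leq_maxr|exact: leq_maxl].
Qed.

HB.instance Definition _ := GRing.isSubmodClosed.Build R _ smooth_fun smooth_fun_submod.

Record smf := Smf { smfv :> levi F n_ -> R^o; smfP : smooth_fun smfv }.
HB.instance Definition _ := [isSub for smfv].
HB.instance Definition _ := [Choice of smf by <:].
HB.instance Definition _ := [SubChoice_isSubLmodule of smf by <:].

Lemma smf_translate (l0 : levi F n_) (f : smf) : smooth_fun (fun l => f (l * l0)%g).
Proof.
have /asboolP [s hs] := smfP f; apply/asboolP.
have [u hu] := choice (fun i => Kc_conj (l0 i) s).
exists (\sum_i u i)%N => l k Kk.
rewrite -[RHS](hs _ (l0^-1 * k * l0)%g); first by rewrite !mulgE.
move=> i; apply: hu; apply: Kc_le (Kk i).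
by rewrite (bigD1 i) //= leq_addr.
Qed.

Definition smf_act l0 (f : smf) : smf := Smf (smf_translate l0 f).

Lemma smf_ext (f g : smf) : (forall l, f l = g l) -> f = g.
Proof. by move=> h; apply: val_inj; apply/funext => l; exact: h. Qed.

Lemma smf_linE a (f g : smf) l : (a *: f + g) l = a * f l + g l.
Proof.
have -> : smfv (a *: f + g) = a *: smfv f + smfv g by rewrite -[LHS]/(val _) linearP.
by [].
Qed.

Lemma smf_act_lin l0 : linear (smf_act l0).
Proof.
move=> a f g; apply: smf_ext => l.
exact: etrans (smf_linE a f g (l * l0)%g) (esym (smf_linE a (smf_act l0 f) (smf_act l0 g) l)).
Qed.

HB.instance Definition _ l0 := GRing.isLinear.Build R smf smf *:%R (smf_act l0) (smf_act_lin l0).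

Lemma smf_act1 f : smf_act 1%g f = f.
Proof. by apply: smf_ext => l; rewrite /= mulg1. Qed.

Lemma smf_actM l l' f : smf_act (l * l')%g f = smf_act l (smf_act l' f).
Proof. by apply: smf_ext => l0; rewrite /= mulgA. Qed.

Definition smf_rep : rep R (levi F n_) := Rep smf_act1 smf_actM.

Lemma smf_smooth : smooth smf_rep.
Proof.
move=> f; rewrite openE => l /= hl.
have /asboolP [s hs] := smfP f.
apply: filterS (@Kl_nbhs F t n_ s l) => l' /= Kl'.
rewrite -[l'](mulVKg l) smf_actM; set f' := smf_act _ f.
have -> : f' = f by apply: smf_ext => l0; rewrite /= hs.
exact: hl.
Qed.

End SmoothFunctions.

Section Jacquet.
Variables (F : localFieldType) (R : closedFieldType).

(** The space [V(U)], whose quotient is the Jacquet module, for the group [U] cut out by [J]. *)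
Definition jac n (r : rep R (GL F n)) (J : rel 'I_n) : set (rspace r) :=
  span [set x | exists u w, UJ J u /\ x = ract r u w - w].

Arguments jac {n} r J.

Variables (sq : sqrt_resq F R) (n_ : 'I_2 -> nat).
Local Notation N := (\sum_(i < 2) n_ i)%N.

Definition J2 : rel 'I_N := fun a b => (tagnat.sig1 a < tagnat.sig1 b)%N.

(** Otherwise some linear form [h] is nonzero and [U]-invariant. The coefficients
[l |-> h (l g x)], as smooth functions on the Levi subgroup, then embed [r] in a parabolically induced
representation. *)
Lemma cuspidal_jac2 (r : rep R (GL F N)) : (forall i, (0 < n_ i)%N) ->
  cuspidal sq r -> jac r J2 = setT.
Proof.
move=> n0 [sm ir cus]; apply/seteqP; split=> // x _; apply: contrapT => nx.
have [h [hl h0 h1]] := separating_form (span_subspace _) nx.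
have hB y z : h (y - z) = h y - h z by rewrite -scaleN1r addrC hl mulN1r addrC.
have hU u y : UJ J2 u -> h (ract r u y) = h y.
  move=> Uu; apply/eqP; rewrite -subr_eq0 -hB; apply/eqP/h0; apply: sub_span.
  by exists u, y.
have ksm := smooth_ksmooth sm.
have tJ : transitive J2 by move=> b a c; exact: ltn_trans.
have rJ : ranked J2 by exists (fun a => tagnat.sig1 a).
have h_lp u y : lp u (1%g : levi F n_) -> h (ract r u y) = h y.
  move=> /lpE [u1 u2]; apply: hU; apply: UJP => // a b; rewrite /J2 -leqNgt => ba.
  rewrite mxB1E; apply/eqP; rewrite subr_eq0; apply/eqP.
  move: ba; rewrite leq_eqVlt => /orP[/eqP /val_inj e|lt].
    have /matrixP /(_ (tagnat.sig2 a)) := u2 (tagnat.sig1 a).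
    move=> /(_ (cast_ord (congr1 n_ e) (tagnat.sig2 b))); rewrite !mxE tagnat.sig2K.
    have -> : tagnat.Rank (tagnat.sig1 a) (cast_ord (congr1 n_ e) (tagnat.sig2 b)) = b.
      rewrite -[RHS]tagnat.sig2K; case: _ / e; congr tagnat.Rank; exact: val_inj.
    move=> ->; congr (_%:R); rewrite -!val_eqE /= [in RHS](tagnat.rect a) [in RHS](tagnat.rect b).
    have -> : (\sum_(i < 2 | (i < tagnat.sig1 a)%N) n_ i =
      \sum_(i < 2 | (i < tagnat.sig1 b)%N) n_ i)%N by rewrite e.
    by rewrite eqn_add2l.
  have /matrixP /(_ (tagnat.sig2 a) (tagnat.sig2 b)) := u1 _ _ lt.
  rewrite !mxE !tagnat.sig2K => ->; case: eqP => // e.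
  by move: lt; rewrite e ltnn.
(* the factor [dl l ^-1] cancels the normalisation of the parabolic induction *)
pose fx (x : r) (g : GL F N) (l : levi F n_) : R^o := (dl sq l)^-1 * h (ract r (bd l * g)%g x).
have fxs x' g : smooth_fun (fx x' g).
  have [s hs] := ksm (ract r g x'); apply/asboolP; exists s => l k Kk.
  rewrite /fx dlM (@dl_K _ _ sq _ _ k) ?mulr1 => [|i]; last exact: Kc_le (Kk i).
  by rewrite bdM !ractM hs //; exact: bd_Kc.
pose f (x : r) g : smf_rep F R n_ := Smf (fxs x g).
have fl : linear f.
  move=> a y z; apply/funext => g; apply: smf_ext => l.
  have -> : smfv ((a *: f y + f z) g) l = a * f y g l + f z g l by rewrite -smf_linE.
  by rewrite /= /fx linearP hl mulrDr; congr (_ + _); rewrite mulrCA.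
pose fL : {linear r -> (GL F N -> smf_rep F R n_)} :=
  HB.pack f (GRing.isLinear.Build R r _ *:%R f fl).
apply: (cus 2%N n_ erefl (smf_rep F R n_) _ n0 (@smf_smooth F R 2 n_)) => //.
have req : right_equivariant fL.
  move=> g y g'; apply: smf_ext => l.
  by rewrite /= /fx -ractM !mulgA.
exists fL; split=> //.
  have ker : [set y | fL y = 0] = [set 0] \/ [set y | fL y = 0] = setT.
    apply: ir.2 => [|a y z hy hz|g y hy]; first exact: (linear0 fL).
      by have := linearP fL a y z; rewrite /= in hy hz *; rewrite hy hz scaler0 addr0.
    by apply/funext => g'; rewrite req hy.
  have nz : fL x <> 0.
    move=> e; have : (fL x 1%g : smf F R n_) 1%g = 0 by rewrite e.
    rewrite /= /fx bd1 mulg1 ract1 h1 mulr1 => /eqP.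
    by rewrite invr_eq0 (negbTE (dl_neq0 _ _)).
  move=> y z e; apply/eqP; rewrite -subr_eq0; apply/eqP.
  have : [set y | fL y = 0] (y - z) by have := linearB fL y z; rewrite /= in e *; rewrite e subrr.
  case: ker => [->//|e' _]; case: nz.
  by have : [set y | fL y = 0] x by rewrite e'.
move=> _ [y _ <-]; split=> [p l g hp|].
  apply: smf_ext => l'.
  have -> : smfv (modulus_sqrt sq l *: ract (smf_rep F R n_) l (fL y g)) l' =
      dl sq l * fL y g (l' * l)%g.
    have := smf_linE (modulus_sqrt sq l) (ract (smf_rep F R n_) l (fL y g)) 0 l'.
    rewrite addr0 => ->; rewrite /=.
    exact: addr0.
  have fLE y0 g0 l0 : fL y0 g0 l0 = (dl sq l0)^-1 * h (ract r (bd l0 * g0)%g y0) by [].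
  rewrite !fLE dlM invfM mulrA [dl sq l * _]mulrCA mulfV ?dl_neq0 // mulr1; congr (_ * _).
  have -> : (bd l' * (p * g))%g = (bd l' * p * (bd (l' * l))^-1 * (bd (l' * l) * g))%g.
    by rewrite !mulgE.
  rewrite ractM h_lp // -bdV.
  have -> : (1%g : levi F n_) = (l' * l * (l' * l)^-1)%g by rewrite mulgV.
  by apply: lpM (lp_bd _); apply: lpM (lp_bd _) hp.
have [s hs] := ksm y; apply/nbhs_GLP; exists s => k Kk g; rewrite mul1g.
by apply: smf_ext => l; rewrite /= /fx mulgA ractM hs.
Qed.

End Jacquet.

Arguments jac {F R n} r J.

Section Contraction.
Variables (F : localFieldType) (n : nat).
Implicit Types (g : GL F n) (x : 'I_n -> int).

Lemma dgJ1E x g i j : (glmx (dg F x * g * (dg F x)^-1)%g - 1%:M) i j =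
  @unif F ^ (x i - x j) * (glmx g - 1%:M) i j.
Proof.
rewrite !mxB1E dgJE mulrBr; congr (_ - _).
by case: eqP => [->|_]; rewrite ?mulr0n ?mulr0 // subrr expr0z mulr1.
Qed.

Lemma dgVJ1E x g i j : (glmx ((dg F x)^-1 * g * dg F x)%g - 1%:M) i j =
  @unif F ^ (x j - x i) * (glmx g - 1%:M) i j.
Proof.
rewrite !mxB1E dgVJE mulrBr; congr (_ - _).
by case: eqP => [->|_]; rewrite ?mulr0n ?mulr0 // subrr expr0z mulr1.
Qed.

Lemma dgC e g : (dg F (fun=> e) * g = g * dg F (fun=> e))%g.
Proof. by apply: glmx_inj; apply/matrixP => i j; rewrite mul_dmxE mul_mxdE mulrC. Qed.

Lemma UJ_dg_Kc (J : rel 'I_n) x g (s e : nat) : (0 < s)%N -> supp J (glmx g - 1%:M) ->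
  mxO (- e%:Z) (glmx g - 1%:M) -> (forall a b, J a b -> (s + e)%:Z <= x a - x b) ->
  Kc s (dg F x * g * (dg F x)^-1)%g.
Proof.
move=> s0 sg og hx; apply: Kc1P => // a b; rewrite dgJ1E.
have [/hx le|nJ] := boolP (J a b); last by rewrite sg // mulr0; exact: inO0.
apply: inO_le (inOM (inO_pw _ _) (og a b)); lia.
Qed.

End Contraction.

Section CuspidalAdmissible.
Variables (F : localFieldType) (R : closedFieldType) (sq : sqrt_resq F R).

(** The unipotent radical of the maximal parabolic of type [(i, n - i)]. *)
Definition Ji n (i : nat) : rel 'I_n := fun a b => (a < i)%N && (i <= b)%N.

Lemma cuspidal_jac n i (r : rep R (GL F n)) : (0 < i < n)%N -> cuspidal sq r ->
  jac r (@Ji n i) = setT.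
Proof.
move=> /andP[i0 lt]; pose n_ (k : 'I_2) := if k == ord0 then i else (n - i)%N.
have n0 k : (0 < n_ k)%N by rewrite /n_; case: ifP => // _; rewrite subn_gt0.
have e : (\sum_(k < 2) n_ k)%N = n by rewrite big_ord_recl big_ord1 /n_ /= subnKC // ltnW.
move: n_ n0 e (erefl : n_ ord0 = i) => n_ n0 e n_i; move: (r) lt.
case: n / e r => _ r lt cus.
have -> : @Ji (\sum_(k < 2) n_ k)%N i = @J2 n_.
  have s0 : forall k : 'I_2, (\sum_(j < 2 | (j < k)%N) n_ j)%N = if k == ord0 then 0%N else i.
    move=> k; case: k => -[|[|//]] h; rewrite big_mkcond big_ord_recl big_ord1 /= ?addn0 //.
  have key (a : 'I_(\sum_(k < 2) n_ k)) : (a < i)%N = (tagnat.sig1 a == ord0).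
    have -> : nat_of_ord a = ((if tagnat.sig1 a == ord0 then 0%N else i) + tagnat.sig2 a)%N.
      by rewrite [LHS](tagnat.rect a) /= s0.
    case: eqP => [e|_].
      by rewrite add0n (leq_trans (ltn_ord _)) // e n_i.
    by apply/negbTE; rewrite -leqNgt leq_addr.
  apply/funext => a; apply/funext => b; rewrite /Ji /J2 [(i <= b)%N]leqNgt !key.
  by case: (tagnat.sig1 a) (tagnat.sig1 b) => -[|[|//]] h [[|[|//]] h'].
exact: (cuspidal_jac2 n0 cus).
Qed.

Variables (n : nat) (r : rep R (GL F n)) (sm : ksmooth (@Kc F n) r).
Variables (s : nat) (s0 : (0 < s)%N).
Local Notation av := (avg (GL_filt sq n) sm s0).

(** If [dg x] contracts [u] into [K_s], then [dg x] maps [u w] and [w] to vectors with the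
same average. *)
Lemma jac_kill i w : jac r (@Ji n i) w -> exists C : nat, forall x : 'I_n -> int,
  (forall a b, Ji i a b -> C%:Z <= x a - x b) -> av (ract r (dg F x) w) = 0.
Proof.
apply: (@span_min _ _ _ [set w | exists C : nat, forall x : 'I_n -> int,
  (forall a b, Ji i a b -> C%:Z <= x a - x b) -> av (ract r (dg F x) w) = 0]).
  split=> [|a y z [C hC] [D hD]]; first by exists 0%N => x _; rewrite !linear0.
  exists (maxn C D) => x hx; rewrite !linearP hC ?hD ?scaler0 ?addr0 // => b c /hx; lia.
move=> _ [u [y [Uu ->]]].
have [e he] := mxO_exists (glmx u).
exists (s + e + 1)%N => x hx; rewrite !linearB; apply/eqP; rewrite subr_eq0; apply/eqP.
rewrite -ractM; have -> : (dg F x * u = dg F x * u * (dg F x)^-1 * dg F x)%g by rewrite !mulgE.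
rewrite ractM avgK //; apply: (@UJ_dg_Kc _ _ _ _ _ _ e s0 Uu.1) => [|a b /hx]; last by lia.
move=> a b; rewrite !mxE; apply: inOB; first exact: he.
by case: (a == b); [apply: (@inO_le F _ 0); [lia|exact: inO1]|exact: inO0].
Qed.

End CuspidalAdmissible.

Section Nakayama.
Variables (R : fieldType) (V : lmodType R) (T : {linear V -> V}).

Lemma pactXn k v : pact T 'X^k v = iter k T v.
Proof.
elim: k v => [|k IH] v; first by rewrite expr0 -[1]/(1%:P) pactC scale1r.
by rewrite exprSr pact_mulX IH iterSr.
Qed.

Lemma pactN p v : pact T (- p) v = - pact T p v.
Proof. by have := pactZ T (-1) p v; rewrite !scaleN1r. Qed.

Lemma pact_sum (I : Type) (l : seq I) (Q : pred I) (f : I -> {poly R}) v :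
  pact T (\sum_(i <- l | Q i) f i) v = \sum_(i <- l | Q i) pact T (f i) v.
Proof. by elim/big_rec2: _ => [|i x y _ <-]; rewrite ?pact0 // pactD. Qed.

(** Cayley-Hamilton: multiply the relations by the adjugate matrix. *)
Lemma pact_det N (A : 'M[{poly R}]_N) (v : 'I_N -> V) :
  (forall i, \sum_j pact T (A i j) (v j) = 0) -> forall k, pact T (\det A) (v k) = 0.
Proof.
move=> h k; have : \sum_i pact T (\adj A k i) (\sum_j pact T (A i j) (v j)) = 0.
  by rewrite big1 // => i _; rewrite h pactv0.
under eq_bigr do rewrite pact_vsum; rewrite exchange_big /= (bigD1 k) //= [X in _ + X]big1.
  rewrite addr0; under eq_bigr do rewrite -pactM; rewrite -pact_sum.
  have := mul_adj_mx A => /matrixP /(_ k k); rewrite !mxE eqxx mulr1n => e.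
  by rewrite e.
move=> j /negbTE jk; under eq_bigr do rewrite -pactM; rewrite -pact_sum.
have := mul_adj_mx A => /matrixP /(_ k j); rewrite !mxE eq_sym jk mulr0n => ->.
exact: pact0.
Qed.

(** After inversion of [T], the relations say that [T - 1] is surjective on the module generated by the
[v i]; their determinant has the value [1] at [T = 1], so it is not zero. *)
Lemma pact_nakayama N (v : 'I_N -> V) :
  (forall i, exists M (P : 'I_N -> {poly R}),
     iter M T (v i) = T (\sum_j pact T (P j) (v j)) - \sum_j pact T (P j) (v j)) ->
  exists2 p : {poly R}, p != 0 & forall i, pact T p (v i) = 0.
Proof.
move=> /choice [M] /choice [P hP].
pose A : 'M[{poly R}]_N := \matrix_(i, j) ((i == j)%:R * 'X^(M i) - ('X - 1) * P i j).
exists (\det A).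
  have e : (\det A).[1] = 1.
    rewrite -[(\det A).[1]]/(horner_eval 1 (\det A)) -det_map_mx.
    have -> : map_mx (horner_eval 1) A = 1%:M.
      apply/matrixP => i j; rewrite !mxE /horner_eval !hornerE expr1n subrr mul0r subr0 mulr1.
      by case: (i == j); rewrite !hornerE.
    exact: det1.
  by apply: contraTneq (oner_neq0 R) => h; rewrite -e h horner0 eqxx.
apply: pact_det => i.
under eq_bigr do rewrite mxE pactD pactN.
rewrite sumrB; apply/eqP; rewrite subr_eq0; apply/eqP.
rewrite (bigD1 i) //= eqxx mul1r pactXn big1 => [|j /negbTE ji]; last first.
  by rewrite eq_sym ji mul0r pact0.
rewrite addr0 hP linear_sum -sumrB; apply: eq_bigr => j _.
rewrite mulrC mulrBr mulr1 pactD pact_mulX pactN; congr (_ - _).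
by rewrite (pact_comm (A := T)).
Qed.

End Nakayama.

Section CuspidalFinite.
Variables (F : localFieldType) (R : closedFieldType) (sq : sqrt_resq F R).
Variables (n : nat) (r : rep R (GL F n.+1)).
Hypothesis cr : cuspidal sq r.
Local Notation Kc := (@Kc F n.+1).

Definition scal (e : int) : GL F n.+1 := dg F (fun=> e).

Lemma scalM e e' : (scal e * scal e' = scal (e + e'))%g.
Proof. exact: dgM. Qed.

Lemma scalC e g : (scal e * g = g * scal e)%g.
Proof. exact: dgC. Qed.

Lemma scal_iter (e : nat) x : ract r (scal e) x = iter e (ract r (scal 1)) x.
Proof.
elim: e x => [|e IH] x; first by rewrite /scal dg0 // ract1.
by rewrite iterS -IH -ractM scalM; congr (ract r (scal _) x); lia.
Qed.

(** By the Cartan decomposition and [jac_kill], only finitely many classes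
[K z^e a K] contribute to the [K]-fixed vectors. *)
Lemma cuspidal_fixd_span s (x : r) : (0 < s)%N -> fixd Kc s x -> x != 0 ->
  exists (T : finType) (v : T -> r), (forall i, fixd Kc s (v i)) /\
    forall y, fixd Kc s y -> span [set u | exists e i, u = ract r (scal e) (v i)] y.
Proof.
move=> s0 fx x0; have [sm ir _] := cr; have ksm := smooth_ksmooth sm.
pose av := avg (GL_filt sq n.+1) ksm s0.
have [T [f tr]] := Kc0_transv F n.+1 s.
have killT (i : 'I_n.+1) : exists C : nat, (0 < i)%N -> forall (k : T) (y : 'I_n.+1 -> int),
    (forall a b, Ji i a b -> C%:Z <= y a - y b) -> av (ract r (dg F y) (ract r (f k) x)) = 0.
  have [i0|] := posnP i; first by exists 0%N; rewrite i0.
  move=> i0; have jT : jac r (@Ji n.+1 i) = setT by apply: cuspidal_jac cr; rewrite i0 ltn_ord.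
  have h (k : T) : exists C : nat, forall y : 'I_n.+1 -> int,
    (forall a b, Ji i a b -> C%:Z <= y a - y b) -> av (ract r (dg F y) (ract r (f k) x)) = 0.
    by apply: (jac_kill sq ksm s0 (i := i)); rewrite jT.
  have [C hC] := choice h; exists (\sum_k C k)%N => _ k y hy; apply: (hC k) => a b /hy.
  by apply: le_trans; rewrite lez_nat (bigD1 k) //= leq_addr.
have [C hC] := choice killT; pose D := (\sum_i C i)%N.
pose B := (n.+1 * D).+1.
pose vv (c : T * {ffun 'I_n.+1 -> 'I_B} * T) :=
  ract r (f c.1.1) (av (ract r (dg F (fun a => (c.1.2 a : nat)%:Z)) (ract r (f c.2) x))).
have fK k : Kc 0 (f k) by exact: tr.1.
have [_ KM KV] := @Kc_subgr F n.+1 0.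
have fixK k y : Kc 0 k -> fixd Kc s y -> fixd Kc s (ract r k y).
  move=> Kk fy h Kh; rewrite -ractM.
  have -> : (h * k = k * (k^-1 * h * k))%g by rewrite !mulgE.
  by rewrite ractM fy //; exact: Kc_normal.
exists (T * {ffun 'I_n.+1 -> 'I_B} * T)%type, vv; split=> [c|y fy].
  by apply: fixK => //; exact: avg_fixd.
rewrite -(avg_id (GL_filt sq n.+1) ksm s0 fy) -/av.
have := irred_gen ir x0 => /(congr1 (fun S => S y)) => e; have : setT y by []. rewrite -e.
apply: (@span_min _ _ _ [set y | span [set u | exists e i, u = ract r (scal e) (vv i)] (av y)]).
  have [h0 h1] := span_subspace [set u | exists e i, u = ract r (scal e) (vv i)].
  by split=> [|a u w hu hw]; rewrite /= ?linear0 // linearP; exact: h1.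
move=> _ [g [_ [-> ->]]] /=.
have [k1 [k2 [d [K1 K2 -> dm]]]] := cartan g.
have [t1 [h1 _]] := tr.2 _ K1; have [t2 [h2 _]] := tr.2 _ K2.
have e2 : ract r k2 x = ract r (f t2) x.
  by rewrite -[k2](mulVKg (f t2)) ractM fx.
have e1 z : fixd Kc s z -> ract r k1 z = ract r (f t1) z.
  by move=> integrand; rewrite -[k1](mulVKg (f t1)) ractM integrand.
rewrite !ractM e2 /av avg_normal // e1; last exact: avg_fixd.
rewrite -/av.
(* a large gap between successive exponents kills the vector; without such a gap the
   exponents are bounded up to a power of the centre *)
have [big|small] := pselect (exists i : 'I_n.+1, (0 < i)%N /\ forall a b, Ji i a b -> D%:Z <= d a - d b).
  have [i [i0 hi]] := big; rewrite (hC i i0) ?linear0; first exact: (span_subspace _).1.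
  move=> a b /hi; apply: le_trans; by rewrite lez_nat /D (bigD1 i) //= leq_addr.
have gap (k : nat) : (k < n)%N -> d (inord k) - d (inord k.+1) < D%:Z.
  move=> kn; rewrite ltNge; apply/negP => le; apply: small; exists (inord k.+1).
  rewrite inordK ?ltnS //; split=> // a b => /andP[ak kb].
  have := dm a (inord k); rewrite inordK; [move/(_ ak)|exact: ltnW].
  have := dm (inord k.+1) b; rewrite inordK; [move/(_ kb); lia|exact: kn].
have gaps (k : nat) : (k <= n)%N -> d (inord 0) - d (inord k) <= (k * D)%:Z.
  elim: k => [|k IH] kn; first by rewrite subrr.
  by have := IH (ltnW kn); have := gap k kn; lia.
have bnd a : 0 <= d a - d ord_max < B%:Z.
  have := gaps n (leqnn n); have -> : inord n = ord_max :> 'I_n.+1.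
    by apply: val_inj; rewrite /= inordK.
  have := dm (inord 0) a; rewrite inordK // => /(_ isT).
  have := dm a ord_max (leq_ord a); rewrite /B; lia.
pose c := [ffun a => inord `|d a - d ord_max|%N : 'I_B].
have -> : dg F d = (scal (d ord_max) * dg F (fun a => (c a : nat)%:Z))%g.
  rewrite dgM; congr dg; apply/funext => a; rewrite ffunE inordK; have := bnd a; lia.
rewrite ractM.
have avz z : av (ract r (scal (d ord_max)) z) = ract r (scal (d ord_max)) (av z).
  symmetry; apply: (avg_map (GL_filt sq n.+1) ksm ksm s0 (f := ract r (scal (d ord_max)))).
  by move=> h w; rewrite -!ractM scalC.
rewrite avz -ractM -scalC ractM; apply: sub_span.
by exists (d ord_max), (t1, c, t2).
Qed.

(** The centre acts by scalars, so the finite family of [cuspidal_fixd_span] spans. Indeed [z - 1] is zero or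
surjective by irreducibility, and in the second case [pact_nakayama] gives an eigenvector of [z]. *)
Lemma cuspidal_adm : adm Kc r.
Proof.
have FG := GL_filt sq n.+1.
have [sm ir _] := cr; have ksm := smooth_ksmooth sm; have [[x x0] hU] := ir.
have [t ht] := ksm x; apply: (adm_pos FG) => s1 _; pose s := maxn s1 t.+1.
have s0 : (0 < s)%N by rewrite leq_max orbT.
apply: (@dep_sub _ _ (fixd Kc s)).
  by apply: (fixd_le FG); exact: leq_maxl.
have fx : fixd Kc s x by apply: (fixd_le FG) ht; rewrite (leq_trans (leqnSn _)) // leq_maxr.
have [I [v0 [fv sp]]] := cuspidal_fixd_span s0 fx x0.
pose v (i : 'I_#|I|) := v0 (enum_val i); pose T := ract r (scal 1).
have poly_span y : fixd Kc s y -> exists M (P : 'I_#|I| -> {poly R}),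
    iter M T y = \sum_j pact T (P j) (v j).
  move=> /sp; apply: (@span_min _ _ _ [set y | exists M (P : 'I_#|I| -> {poly R}),
    iter M T y = \sum_j pact T (P j) (v j)]).
    split=> [|a y1 y2 [M1 [P1 e1]] [M2 [P2 e2]]].
      by exists 0%N, (fun=> 0); rewrite big1 // => i _; rewrite pact0.
    exists (M1 + M2)%N, (fun j => a *: ('X^M2 * P1 j) + 'X^M1 * P2 j).
    rewrite iter_lin [in iter _ _ y1]addnC !iterD e1 e2 -!pactXn !pact_vsum.
    rewrite scaler_sumr -big_split; apply: eq_bigr => j _ /=.
    by rewrite pactD pactZ !pactM.
  move=> _ [e [i ->]]; exists `|e|%N, (fun j => if j == enum_rank i then 'X^(`|(`|e|%N : int) + e|) else 0).
  rewrite (bigD1 (enum_rank i)) //= eqxx big1 => [|j /negbTE ->]; last exact: pact0.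
  rewrite addr0 pactXn /v enum_rankK -!scal_iter -ractM scalM; congr (ract r (scal _) _); lia.
(* the image of [T - 1] is a stable subspace *)
have [c hc] : exists c, forall y, T y = c *: y.
  have Tg g y : T (ract r g y) = ract r g (T y) by rewrite /T -!ractM scalC.
  have [tri|all] : [set y | exists w, y = T w - w] = [set 0] \/ [set y | exists w, y = T w - w] = setT.
    apply: hU => [|a y z [w ->] [w' ->]|g y [w ->]].
    - by exists 0; rewrite linear0 subr0.
    - by exists (a *: w + w'); rewrite linearP scalerBr opprD addrACA.
    - by exists (ract r g w); rewrite linearB Tg.
  - exists 1 => y; rewrite scale1r; apply/eqP; rewrite -subr_eq0; apply/eqP.
    have : [set y | exists w, y = T w - w] (T y - y) by exists y.
    by rewrite tri.
  have gen1 i : exists M (P : 'I_#|I| -> {poly R}),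
      iter M T (v i) = T (\sum_j pact T (P j) (v j)) - \sum_j pact T (P j) (v j).
    have : [set y | exists w, y = T w - w] (v i) by rewrite all.
    move=> [w ew]; pose y := avg FG ksm s0 w.
    have [M [P eP]] := poly_span y (avg_fixd _ _ _ _).
    have avT : avg FG ksm s0 (T w) = T y.
      by symmetry; apply: (avg_map FG ksm ksm s0 (f := T)) => g u; rewrite Tg.
    have evi : v i = T y - y.
      by rewrite -[LHS](avg_id FG ksm s0 (fv (enum_val i))) -/(v i) ew linearB avT.
    exists M, P; rewrite -eP evi -iterS.
    have := iter_lin T M (-1) y (T y); rewrite !scaleN1r addrC => ->.
    by rewrite addrC -iterSr.
  have [p p0 hp] := pact_nakayama gen1.
  have [M [P eP]] := poly_span x fx.
  have [] := @closed_eigen R r T (p * 'X^M) x _ x0.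
  - by rewrite mulf_neq0 // -size_poly_gt0 size_polyXn.
  - rewrite pactM pactXn eP pact_vsum big1 // => j _.
    by rewrite -pactM mulrC pactM hp pactv0.
  move=> c [y [y0 ey]]; exists c => w.
  have : [set w | T w = c *: w] = setT.
    case: (hU [set w | T w = c *: w]) => //=.
    - by rewrite linear0 scaler0.
    - by move=> a u u' hu hu'; rewrite linearP hu hu' scalerDr !scalerA mulrC.
    - by move=> g u hu; rewrite Tg hu linearZ.
    - move=> e0; have : [set w | T w = c *: w] y by [].
      by rewrite e0 => /eqP; rewrite (negbTE y0).
  by move=> h; have : [set w | T w = c *: w] w by rewrite h.
apply: (@dep_span _ _ _ v0) => y /sp; apply: span_min; first exact: span_subspace.
have ceq (e : nat) w : ract r (scal e) w = c ^+ e *: w.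
  rewrite scal_iter; elim: e => [|e IH]; first by rewrite scale1r.
  by rewrite iterS IH -/T hc scalerA -exprS.
have c0 : c != 0.
  apply/eqP => c0; case/eqP: x0; rewrite -(ractVK (scal 1) x) -/T hc c0 scale0r; exact: linear0.
move=> _ [e [i ->]]; have vi : span (range v0) (v0 i) by apply: sub_span; exists i.
case: e => e; first by rewrite ceq; apply: (subspaceZ _ (span_subspace _)).
have -> : ract r (scal (Negz e)) (v0 i) = (c ^+ e.+1)^-1 *: v0 i.
  rewrite -[v0 i in RHS](@ractKV _ _ r (scal e.+1)) ceq scalerA mulVf ?expf_neq0 // scale1r.
  by rewrite /scal dgV.
by apply: (subspaceZ _ (span_subspace _)).
Qed.

End CuspidalFinite.

(** * Finiteness properties of representations of Whittaker type *)

Section Chain.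
Variables (F : localFieldType) (R : closedFieldType) (sq : sqrt_resq F R).
Local Notation Kc := (@Kc F _).

Lemma twist_fixd n (r : rep R (GL F n)) e s (x : r) :
  @fixd _ _ Kc (twist sq r e) s x <-> fixd Kc s x.
Proof.
have h k : Kc s k -> ract (twist sq r e) k x = ract r k x.
  by move=> Kk; rewrite /= vdet_Kc ?mulr0 ?oppr0 ?expr0z ?scale1r //; exact: Kc_le Kk.
by split=> hx k Kk; rewrite -?h // ?hx // h // hx.
Qed.

Lemma twist_good n (r : rep R (GL F n)) e : ksmooth Kc r -> adm Kc r ->
  ksmooth Kc (twist sq r e) /\ adm Kc (twist sq r e).
Proof.
move=> sm ad; split=> [x|s].
  by have [s hs] := sm x; exists s; apply/twist_fixd.
by have [T hT] := ad s; exists T => x Sx; apply: hT => i; apply/(twist_fixd e); exact: Sx.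
Qed.

(** An irreducible subquotient of an admissible representation is admissible. *)
Lemma segment_good ell theta n (r : rep R (GL F n)) : is_generic_segment_rep sq ell theta r ->
  [/\ irreducible r, generic theta r, ksmooth Kc r, adm Kc r & (0 < n)%N].
Proof.
move=> [k [rho [a [b [k0 cus ab _ [ir gen [s [e [ts [[b0 tb eb] [j [jeq jinj jran]]]]] sub]]]]]]].
have [smr adr] : ksmooth Kc rho /\ adm Kc rho.
  case: k k0 rho cus {e ts b0 tb eb j jeq jinj jran} => // k _ rho cus; split.
    by apply: smooth_ksmooth; case: cus.
  exact: cuspidal_adm cus.
have n0 : (0 < n)%N by rewrite -e big_ord_recl /= addn_gt0 k0.
move: s j jeq jinj jran r ir gen sub n0; case: n / e => s j jeq jinj jran r ir gen sub n0.
have tw i := twist_good (a + (i : nat)%:Z) smr adr.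
have sms := tensor_ksmooth tb eb (fun i : 'I_(`|b - a|.+1) => (tw i).1).
have ads := tensor_adm sq tb eb (fun i : 'I_(`|b - a|.+1) => (tw i).1) (fun i => (tw i).2).
have smi := ind_ksmooth jeq jinj jran; have adi := ind_adm jeq jinj jran ads.
by have [] := subquotient_adm (GL_filt sq _) sub smi adi.
Qed.

(** Finite generation uses that the centres of the factors, which are irreducible and
admissible, act by scalars. *)
Lemma whittaker_good ell theta n (r : rep R (GL F n)) : whittaker_type sq ell theta r ->
  [/\ ksmooth Kc r, adm Kc r & fgen r].
Proof.
move=> [t [n_ [r_ [hr [e [s [[b tb eb] [j [jeq jinj jran]]]]]]]]].
have hg i := segment_good (hr i).
case: n / e r j jeq jinj jran => r j jeq jinj jran.
have sms : ksmooth (@Kl F t n_) s by apply: (tensor_ksmooth tb eb) => i; have [] := hg i.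
have ads : adm (@Kl F t n_) s by apply: (tensor_adm sq tb eb) => i; have [] := hg i.
split; [exact: ind_ksmooth jeq jinj jran|exact: ind_adm jeq jinj jran ads|].
apply: (ind_fgen jeq jinj jran sms).
  by apply: (tensor_fgen tb eb) => i; have [] := hg i.
move=> e; apply: (tensor_central tb eb) => i; have [ir _ sm ad _] := hg i.
by apply: (central_scalar ir sm ad) => g; exact: dgC.
Qed.

End Chain.

Section JacquetFinite.
Variables (F : localFieldType) (R : closedFieldType) (sq : sqrt_resq F R).
Variables (n : nat) (r : rep R (GL F n)) (i : nat).
Local Notation Kc := (@Kc F n).
Local Notation J := (@Ji n i).
Implicit Types (g k u : GL F n) (x w : r).

(** The element [diag (pi, ..., pi, 1, ..., 1)] with [i] entries [pi]. *)
Definition zt : GL F n := dg F (fun a : 'I_n => (a < i)%N%:Z).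

Lemma Ji_trans : transitive J.
Proof. by move=> b a c /andP[h1 h2] /andP[h3 h4]; rewrite /Ji h1 h4. Qed.

Lemma Ji_ranked : ranked J.
Proof. by exists (fun a : 'I_n => (i <= a)%N : nat) => a b /andP[h1 h2]; rewrite h2 (leqNgt i a) h1. Qed.

Lemma jac_subspace : subspace (jac r J). Proof. exact: span_subspace. Qed.

Lemma jac_in u x : UJ J u -> jac r J (ract r u x - x).
Proof. by move=> Uu; apply: sub_span; exists u, x. Qed.

Lemma jac_stable g : (forall u, UJ J u -> UJ J (g * u * g^-1)%g) ->
  forall x, jac r J x -> jac r J (ract r g x).
Proof.
move=> h; apply: (@span_min _ _ _ [set x | jac r J (ract r g x)]).
  split=> [|a x y hx hy]; rewrite /= ?linear0; first exact: jac_subspace.1.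
  by rewrite linearP; apply: jac_subspace.2.
move=> _ [u [w [Uu ->]]] /=; rewrite linearB -ractM.
have -> : (g * u = g * u * g^-1 * g)%g by rewrite !mulgE.
by rewrite ractM; apply: jac_in; exact: h.
Qed.

Lemma dg_UJ (d : 'I_n -> int) (J' : rel 'I_n) u : UJ J' u -> UJ J' (dg F d * u * (dg F d)^-1)%g.
Proof.
move=> [h1 h2]; split=> a b nJ; first by rewrite dgJ1E h1 ?mulr0.
have -> : ((dg F d * u * (dg F d)^-1)^-1 = dg F d * u^-1 * (dg F d)^-1)%g by rewrite !mulgE.
by rewrite dgJ1E h2 ?mulr0.
Qed.

(** Conjugation by the inverse of [zt] divides the upper right block by the uniformizer; once [u] is split
off, the entries of that block are in [pi^(2 s)]. *)
Lemma Kc_zt (s : nat) k : (0 < s)%N -> Kc s k ->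
  exists u k', [/\ UJ J u, Kc s k', Kc s (zt^-1 * k' * zt)%g & k = (u * k')%g].
Proof.
move=> s0 Kk; pose X : 'M[F]_n := \matrix_(a, b) (if J a b then glmx k a b else 0).
have kO a b : inO s (glmx k a b - (a == b)%:R) by have := Kk.1 a b; rewrite mxB1E.
have kJ a b : J a b -> inO s (glmx k a b).
  move=> Jab; have := kO a b; case: eqP => [e|_]; last by rewrite subr0.
  by move: Jab; rewrite /Ji e; lia.
have OX : mxO s X.
  by move=> a b; rewrite mxE; case: ifP => [|_]; [exact: kJ|exact: inO0].
have sX : supp J (- X) by move=> a b nJ; rewrite !mxE (negbTE nJ) oppr0.
have [u' Uu' eu'] := UJ_mk Ji_trans Ji_ranked sX.
have [_ _ UV] := UJ_subgr F Ji_trans.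
exists u'^-1%g, (u' * k)%g; split; [exact: UV| | |by rewrite !mulgE].
  have [_ KM _] := @Kc_subgr F n s; apply: KM => //; apply: Kc1P => // a b.
  by rewrite eu' addrC addKr mxE inON.
apply: Kc1P => // a b; rewrite dgVJ1E mxB1E glmxM eu' mulmxDl mul1mx mulNmx !mxE.
have Xk : inO s (\sum_c X a c * glmx k c b).
  by apply: inO_sum => c _; apply: (inOM0 (OX a c)); exact: (Kc_int Kk).
have [Jab|nJ] := boolP (J a b); last first.
  apply: (@inO_le F s (0 + s%:Z)); first by rewrite add0r.
  apply: inOM; first by apply: inO_le (inO_pw _ _); move: nJ; rewrite /Ji; lia.
  by rewrite addrAC; apply: inOB => //; exact: kO.
have -> : (a == b)%:R = 0 :> F.
  by case: eqP Jab => // ->; rewrite /Ji; lia.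
rewrite subr0.
apply: (@inO_le F s (-1 + (s%:Z + s%:Z))); first by lia.
apply: inOM; first by apply: inO_le (inO_pw _ _); move: Jab; rewrite /Ji; lia.
have -> : glmx k a b - \sum_c X a c * glmx k c b = - \sum_c X a c * (glmx k c b - (c == b)%:R).
  under [in RHS]eq_bigr do rewrite mulrBr; rewrite sumrB opprB; congr (_ - _).
  rewrite (bigD1 b) //= eqxx mulr1 big1 ?addr0 ?mxE ?Jab // => c /negbTE ->.
  by rewrite mulr0.
by rewrite inON; apply: inO_sum => c _; apply: inOM; [exact: OX|exact: kO].
Qed.

Lemma upper_split u : upper_unipotent u ->
  exists m v, [/\ (m * zt = zt * m)%g, forall v, UJ J v -> UJ J (m * v * m^-1)%g,
    UJ J v & u = (m * v)%g].
Proof.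
move=> hu; pose J' : rel 'I_n := fun a b => (a < b)%N && ~~ J a b.
have tJ' : transitive J'.
  by move=> b a c; rewrite /J' /Ji; lia.
have rJ' : ranked J' by exists (fun a : 'I_n => a : nat) => a b /andP[].
pose X : 'M[F]_n := \matrix_(a, b) (if J' a b then glmx u a b else 0).
have sX : supp J' X by move=> a b nJ; rewrite !mxE (negbTE nJ).
have [m Um em] := UJ_mk tJ' rJ' sX.
have Jm a b c : J' a b \/ a = b -> J b c -> J a c.
  by case=> [|-> //]; rewrite /J' /Ji; lia.
have Jm' a b c : J a b -> J' b c \/ b = c -> J a c.
  by move=> h [|<- //]; move: h; rewrite /J' /Ji; lia.
have supL g Y : UJ J' g -> supp J Y -> supp J (glmx g *m Y).
  move=> [hg _] hY a b nJ; rewrite mxE big1 // => c _.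
  have [Jcb|nJcb] := boolP (J c b); last by rewrite hY ?mulr0.
  have [h|nh] := boolP (J' a c || (a == c)).
    by case/negP: nJ; apply: Jm Jcb; case/orP: h => [|/eqP]; [left|right].
  move: nh; rewrite negb_or => /andP[nJ' /negbTE ac].
  by have := hg _ _ nJ'; rewrite mxB1E ac subr0 => ->; rewrite mul0r.
have supR g Y : UJ J' g -> supp J Y -> supp J (Y *m glmx g).
  move=> [hg _] hY a b nJ; rewrite mxE big1 // => c _.
  have [Jac|nJac] := boolP (J a c); last by rewrite hY ?mul0r.
  have [h|nh] := boolP (J' c b || (c == b)).
    by case/negP: nJ; apply: Jm' Jac _; case/orP: h => [|/eqP]; [left|right].
  move: nh; rewrite negb_or => /andP[nJ' /negbTE cb].
  by have := hg _ _ nJ'; rewrite mxB1E cb subr0 => ->; rewrite mulr0.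
have UV : UJ J' m^-1%g by have [_ _] := UJ_subgr F tJ'; apply.
exists m, (m^-1 * u)%g; split; last by rewrite mulgA mulgV mul1g.
- apply: glmx_inj; apply/matrixP => a b; rewrite !glmxM mul_mxdE mul_dmxE em !mxE.
  have [->|ab] := eqVneq a b; first by rewrite mulrC.
  case: ifP => [h|_]; last by rewrite addr0 mulr0 mul0r.
  rewrite [RHS]mulrC; congr (_ * _ ^ (_ : nat)%:Z).
  by move: h; rewrite /J' /Ji; lia.
- move=> v Uv; apply: UJP; [exact: Ji_trans|exact: Ji_ranked|].
  have -> : glmx (m * v * m^-1)%g - 1%:M = glmx m *m (glmx v - 1%:M) *m glmx m^-1%g.
    by rewrite mulmxBr mulmx1 mulmxBl -!glmxM mulgV.
  apply: supR => //; apply: supL => //; exact: Uv.1.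
- apply: UJP; [exact: Ji_trans|exact: Ji_ranked|].
  have -> : glmx (m^-1 * u)%g - 1%:M = glmx m^-1%g *m (glmx u - glmx m).
    by rewrite mulmxBr -!glmxM mulVg.
  apply: supL => // a b nJ; rewrite em !mxE /J' nJ andbT; case: ltnP => [lt|le].
    by rewrite -val_eqE /= ltn_eqF // add0r subrr.
  by rewrite hu // addr0 subrr.
Qed.

(** On the vectors fixed by [K_s], the operator [zt] agrees modulo [V(U_i)] with its composite with the
average over [K_s], which preserves a finite-dimensional space. *)
Lemma jacquet_finite : ksmooth Kc r -> adm Kc r -> fgen r ->
  exists2 p : {poly R}, p != 0 & forall x, jac r J (pact (ract r zt) p x).
Proof.
move=> sm ad [T [x gx]]; have FG := GL_filt sq n.
have [s [s0 fx]] : exists s, (0 < s)%N /\ forall i, fixd Kc s (x i).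
  have [lv hlv] := choice (fun i => sm (x i)).
  exists (\sum_i lv i).+1; split=> // j; apply: (fixd_le FG _ (hlv j)).
  by rewrite (bigD1 j) //= -addSn; lia.
pose B : {linear r -> r} := avg FG sm s0 \o ract r zt.
have BE w : fixd Kc s w -> jac r J (B w - ract r zt w).
  move=> fw; apply: avg_affine => [|k Kk]; first exact: jac_subspace.
  have [u [k' [Uu _ Kk' ->]]] := Kc_zt s0 Kk.
  have -> : ract r (u * k')%g (ract r zt w) = ract r u (ract r zt w).
    rewrite ractM; congr (ract r u _).
    rewrite -[in RHS](fw _ Kk') -!ractM; congr (ract r _ w); by rewrite !mulgE.
  exact: jac_in.
have Bf w : fixd Kc s w -> fixd Kc s (B w) by move=> _; exact: avg_fixd.
have zJ w : jac r J w -> jac r J (ract r zt w).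
  by apply: jac_stable => u Uu; exact: dg_UJ.
have Bj (k : nat) w : fixd Kc s w -> fixd Kc s (iter k B w) /\ jac r J (iter k B w - iter k (ract r zt) w).
  move=> fw; elim: k => [|k [f1 IH]]; first by rewrite subrr; split=> //; exact: jac_subspace.1.
  split; first exact: Bf.
  rewrite !iterS -[B _](subrK (ract r zt (iter k B w))) -addrA.
  apply: (subspaceD jac_subspace); first exact: BE.
  by rewrite -linearB; apply: zJ.
have Bp p w : fixd Kc s w -> pact B p w = 0 -> jac r J (pact (ract r zt) p w).
  move=> fw e; have -> : pact (ract r zt) p w = - (pact B p w - pact (ract r zt) p w).
    by rewrite e sub0r opprK.
  apply: (subspaceN jac_subspace); rewrite /pact -sumrB; apply: (subspace_sum _ jac_subspace) => k _.
  by rewrite -scalerBr; apply: (subspaceZ _ jac_subspace); exact: (Bj k w fw).2.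
have [I [v [fv spv]]] := dep_basis (fixd_subspace Kc r s) (ad s).
have [p hp] := choice (fun j => let: ex_intro2 p p0 e := dep_pact (ad s) Bf (fv j) in
  ex_intro (fun p => p != 0 /\ pact B p (v j) = 0) p (conj p0 e)).
exists (\prod_j p j) => [|y]; first by apply/prodf_neq0 => j _; exact: (hp j).1.
pose Q := [set y | jac r J (pact (ract r zt) (\prod_j p j) y)].
have sQ : subspace Q.
  split=> [|a y1 y2 h1 h2]; rewrite /Q /= ?pactv0; first exact: jac_subspace.1.
  by rewrite pact_lin; apply: jac_subspace.2.
have Qf w : fixd Kc s w -> Q w.
  move=> /spv; apply: (span_min sQ) => _ [j _ <-].
  apply: Bp => //; rewrite (bigD1 j) //= mulrC pactM (hp j).2; exact: pactv0.
have QJ w : jac r J w -> Q w.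
  by move=> hw; exact: (pact_subspace _ jac_subspace zJ hw).
apply: (span_min sQ _ (gx y)) => _ [g [_ [[j _ <-] ->]]].
have [u [d [k [Uu Kk ->]]]] := iwasawa g.
have fk : fixd Kc s (ract r k (x j)).
  move=> h Kh; rewrite -ractM; have -> : (h * k = k * (k^-1 * h * k))%g by rewrite !mulgE.
  by rewrite ractM (fx j) //; exact: Kc_normal.
(* [m] and [dg d] commute with [zt], and [v'] only contributes an element of [V(U_i)] *)
have [m [v' [cm nm Uv ->]]] := upper_split Uu.
set w := ract r k (x j) in fk.
have -> : ract r (m * v' * dg F d * k)%g (x j) = ract r (m * dg F d)%g w +
    ract r m (ract r (dg F d) (ract r ((dg F d)^-1 * v' * dg F d)%g w - w)).
  rewrite !linearB addrC /w -!ractM !mulgE subrK; congr (ract r _ (x j)); by rewrite !mulgE.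
apply: (subspaceD sQ).
  rewrite /Q /= pact_comm => [|z]; last first.
    rewrite -!ractM; congr (ract r _ z); rewrite mulgA -cm -!mulgA; congr (_ * _)%g.
    by rewrite /zt !dgM; congr dg; apply/funext => a; rewrite addrC.
  apply: jac_stable; last exact: Qf.
  move=> u' Uu'; have := nm _ (dg_UJ d Uu'); rewrite !mulgE.
  by have -> : (m * dg F d * u' * (dg F d)^-1 * m^-1 = m * dg F d * u' * (m * dg F d)^-1)%g by rewrite !mulgE.
apply: QJ; apply: (jac_stable nm); apply: jac_stable; first by move=> u' Uu'; exact: dg_UJ.
apply: jac_in; have -> : ((dg F d)^-1 * v' * dg F d = dg F (fun a => - d a) * v' * (dg F (fun a => - d a))^-1)%g.
  by rewrite -dgV invgK.
exact: dg_UJ.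
Qed.

End JacquetFinite.

(** * Existence of Whittaker functionals *)

Section Characters.
Variables (F : localFieldType) (R : closedFieldType) (theta : F -> R).
Hypothesis ht : nontrivial_smooth_character theta.

Lemma theta0 : theta 0 = 1.
Proof.
have [hM h0 _ _] := ht; apply: (mulfI (h0 0)); by rewrite -hM addr0 mulr1.
Qed.

Lemma thetaD x y : theta (x + y) = theta x * theta y. Proof. by have [->] := ht. Qed.

Lemma theta_neq0 x : theta x != 0. Proof. by have [] := ht. Qed.

Lemma thetaN x : theta (- x) = (theta x)^-1.
Proof. by apply: (mulfI (theta_neq0 x)); rewrite -thetaD subrr theta0 mulfV ?theta_neq0. Qed.

Lemma theta_sum (I : Type) (l : seq I) (P : pred I) (f : I -> F) :
  theta (\sum_(i <- l | P i) f i) = \prod_(i <- l | P i) theta (f i).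
Proof. by elim/big_rec2: _ => [|i x y _ <-]; rewrite ?theta0 ?thetaD. Qed.

Lemma theta_conductor : exists c : nat, forall x, inO c x -> theta x = 1.
Proof.
have [_ _ lc _] := ht; have : nbhs (0 : F) [set y | theta y = theta 0] := lc 0.
rewrite -nbhs_entourageE => -[E]; rewrite entourage_lfval => -[k _ hk] sE.
exists `|k|%N => x hx; rewrite -theta0; apply: sE; apply/mem_set; apply: hk => /=.
by rewrite sub0r; apply: (@inO_le F k `|k|%N); [lia|rewrite inON].
Qed.

Lemma theta_inv : nontrivial_smooth_character (fun x => (theta x)^-1).
Proof.
have [hM h0 lc [x hx]] := ht; split.
- by move=> y z; rewrite hM invfM.
- by move=> y; rewrite invr_eq0.
- by move=> y; apply: filterS (lc y) => z /= ->.
- by exists x; rewrite invr_eq1.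
Qed.

Variable n : nat.
Implicit Types u v : GL F n.
Local Notation ch := (char_of_unipotent theta).

Lemma upper_next u v (i j : 'I_n) : upper_unipotent u -> upper_unipotent v ->
  j = i.+1 :> nat -> glmx (u * v)%g i j = glmx u i j + glmx v i j.
Proof.
move=> hu hv e; have ij : i != j by rewrite -val_eqE /= e; lia.
rewrite glmxM mxE (bigD1 j) //= (bigD1 i) //= (hv j j) // (hu i i) // !eqxx mulr1 mul1r.
rewrite big1 ?addr0 // => k /andP[kj ki].
have [lt|le] := ltnP k i; first by rewrite hu 1?ltnW // -val_eqE /= gtn_eqF // mul0r.
rewrite hv ?mulr0 //; first by rewrite (negbTE kj) mulr0.
by rewrite e ltn_neqAle le andbT eq_sym.
Qed.

Lemma char_mul u v : upper_unipotent u -> upper_unipotent v -> ch (u * v)%g = ch u * ch v.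
Proof.
move=> hu hv; rewrite /char_of_unipotent -thetaD -big_split; congr theta.
apply: eq_bigr => i _ /=; rewrite -big_split; apply: eq_bigr => j /eqP e.
exact: upper_next.
Qed.

Lemma char_neq0 u : ch u != 0. Proof. exact: theta_neq0. Qed.

Lemma char_K (c : nat) u : (forall x, inO c x -> theta x = 1) -> Kc c u -> ch u = 1.
Proof.
move=> hc [Ku _]; apply: hc; apply: inO_sum => i _; apply: inO_sum => j /eqP e.
have := Ku i j; rewrite mxB1E; case: eqP => [ij|_]; last by rewrite subr0.
by move: e; rewrite ij; lia.
Qed.

End Characters.

Section Reversal.
Variables (F : localFieldType) (t : nat) (n_ : 'I_t -> nat).
Local Notation N := (\sum_(i < t) n_ i)%N.
Implicit Types (a b : 'I_N).

(** Position of [a] once the order of the blocks has been reversed. *)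
Definition pos a := (\sum_(k < t | (tagnat.sig1 a < k)%N) n_ k + tagnat.sig2 a)%N.

Lemma pos_lt a b : (tagnat.sig1 b < tagnat.sig1 a)%N -> (pos a < pos b)%N.
Proof.
move=> lt; apply: (@leq_trans (\sum_(k < t | (tagnat.sig1 b < k)%N) n_ k)%N); last exact: leq_addr.
rewrite (bigD1 (tagnat.sig1 a)) //= /pos addnC -addSn; apply: leq_add; first exact: ltn_ord.
rewrite [X in (_ <= X)%N](bigID (fun k : 'I_t => (tagnat.sig1 a < k)%N)) /=.
apply: leq_trans (leq_addr _ _); apply: eq_leq; apply: eq_bigl => k.
rewrite -val_eqE /=; lia.
Qed.

Lemma pos_eq a b : tagnat.sig1 a = tagnat.sig1 b ->
  (pos a + tagnat.sig2 b = pos b + tagnat.sig2 a)%N.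
Proof. move=> e; rewrite /pos addnAC; congr (_ + _ + _)%N.
by rewrite e. Qed.

Lemma pos_Rank k (x y : 'I_(n_ k)) :
  (pos (tagnat.Rank k x) + y = pos (tagnat.Rank k y) + x)%N.
Proof.
have e : tagnat.sig1 (tagnat.Rank k x) = tagnat.sig1 (tagnat.Rank k y).
  by rewrite !tagnat.Rank1K.
by have := pos_eq e; rewrite !tagnat.Rank2K.
Qed.

Lemma posN a : (pos a < N)%N.
Proof.
rewrite [X in (_ < X)%N](bigD1 (tagnat.sig1 a)) //= /pos addnC -addSn; apply: leq_add => //.
rewrite [X in (_ <= X)%N](bigID (fun k : 'I_t => (tagnat.sig1 a < k)%N)) /=.
apply: leq_trans (leq_addr _ _); apply: eq_leq; apply: eq_bigl => k.
rewrite -val_eqE /=; lia.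
Qed.

Lemma tagnat_inj a b : tagnat.sig1 a = tagnat.sig1 b -> tagnat.sig2 a = tagnat.sig2 b :> nat -> a = b.
Proof.
move=> e1 e2; apply: val_inj; rewrite /= [LHS](tagnat.rect a) [RHS](tagnat.rect b) e2.
by congr (_ + _)%N; rewrite e1.
Qed.

Lemma pos_inj : injective (fun a => Ordinal (posN a)).
Proof.
move=> a b /(congr1 val) /= e.
have e1 : tagnat.sig1 a = tagnat.sig1 b.
  apply: val_inj; case: (ltngtP (tagnat.sig1 a) (tagnat.sig1 b)) => // /pos_lt; lia.
by apply: tagnat_inj => //; have := pos_eq e1; lia.
Qed.

Definition sgm : {perm 'I_N} := perm pos_inj.

Lemma sgmE a : sgm a = pos a :> nat. Proof. by rewrite permE. Qed.

Lemma perm_unit : (perm_mx sgm : 'M[F]_N) \in unitmx. Proof. exact: unitmx_perm. Qed.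

Definition wr : GL F N := MkGL perm_unit.

Lemma wrJ g a b : glmx (wr * g * wr^-1)%g a b = glmx g (sgm a) (sgm b).
Proof.
rewrite 2!glmxM /= -row_permE.
have -> : invmx (perm_mx sgm) = perm_mx (sgm^-1)%g :> 'M[F]_N.
  by apply: (can_inj (mulKmx perm_unit)); rewrite mulmxV ?perm_unit // -perm_mxM mulgV perm_mx1.
by rewrite -col_permE !mxE.
Qed.

Lemma wrVJ g a b : glmx (wr^-1 * g * wr)%g (sgm a) (sgm b) = glmx g a b.
Proof. by rewrite -wrJ !mulgE. Qed.

Lemma wr_K0 : Kc 0 wr.
Proof.
apply: Kc0P => a b; rewrite ?glmxV /=.
  by rewrite !mxE; case: (_ == _); [exact: inO1|exact: inO0].
have -> : invmx (perm_mx sgm) = perm_mx (sgm^-1)%g :> 'M[F]_N.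
  by apply: (can_inj (mulKmx perm_unit)); rewrite mulmxV ?perm_unit // -perm_mxM mulgV perm_mx1.
by rewrite !mxE; case: (_ == _); [exact: inO1|exact: inO0].
Qed.

Lemma sum_blocks (V : nmodType) (f : 'I_N -> V) :
  \sum_a f a = \sum_(k < t) \sum_(x < n_ k) f (tagnat.Rank k x).
Proof.
rewrite [RHS]sig_big_dep /= (reindex _ (@tagnat.sig_bij_on _ n_)) /=.
by apply: eq_bigr => a _; rewrite -[a in LHS]tagnat.sig2K.
Qed.

Variables (R : closedFieldType) (theta : F -> R).
Hypothesis ht : nontrivial_smooth_character theta.

(** The character of the conjugate of the upper unipotent group by [wr]. *)
Definition psi (g : GL F N) : R := char_of_unipotent theta (wr^-1 * g * wr)%g.

Lemma psiE g : psi g = theta (\sum_a \sum_(b | pos b == (pos a).+1) glmx g a b).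
Proof.
rewrite /psi /char_of_unipotent; congr theta.
rewrite (reindex_inj (@perm_inj _ sgm)); apply: eq_bigr => a _ /=.
rewrite (reindex_inj (@perm_inj _ sgm)); apply: eq_big => b /=; first by rewrite !sgmE.
by rewrite wrVJ.
Qed.

Lemma psi_bd (l : levi F n_) : psi (bd l) = \prod_k char_of_unipotent theta (l k).
Proof.
rewrite psiE -(theta_sum ht); congr theta; rewrite sum_blocks; apply: eq_bigr => k _.
apply: eq_bigr => x _; rewrite big_mkcond sum_blocks (bigD1 k) //= [X in _ + X]big1 ?addr0.
  rewrite [RHS]big_mkcond; apply: eq_bigr => y _.
  have e2 := pos_Rank x y.
  have -> : (pos (tagnat.Rank k y) == (pos (tagnat.Rank k x)).+1) = (y == x.+1 :> nat).
    by apply/eqP/eqP; lia.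
  case: ifP => // _; have /matrixP /(_ x y) := bd_diag l k; rewrite [LHS]mxE; exact.
move=> k' k'k; rewrite big1 // => y _; case: ifP => // _.
have kk' : k != k' by rewrite eq_sym.
by have /matrixP /(_ x y) := bd_off l kk'; rewrite [LHS]mxE [RHS]mxE; exact.
Qed.

Lemma sgm_onto i : exists a, i = sgm a.
Proof. by exists ((sgm^-1)%g i); rewrite permKV. Qed.

Lemma Rank_onto a : exists k x, a = @tagnat.Rank t n_ k x.
Proof. by exists (tagnat.sig1 a), (tagnat.sig2 a); rewrite tagnat.sig2K. Qed.

Lemma UJm_upper v : UJ (@Jm t n_) v -> upper_unipotent (wr^-1 * v * wr)%g.
Proof.
move=> [hv _] i j; have [a ->] := sgm_onto i; have [b ->] := sgm_onto j => ij.
rewrite wrVJ (inj_eq perm_inj).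
have [/pos_lt|nJ] := boolP (Jm a b); first by rewrite -!sgmE ltnNge ij.
by have := hv _ _ nJ; rewrite mxB1E => /eqP; rewrite subr_eq0 => /eqP.
Qed.

Lemma bd_upper (l : levi F n_) : (forall k, upper_unipotent (l k)) ->
  upper_unipotent (wr^-1 * bd l * wr)%g.
Proof.
move=> hl i j; have [a ->] := sgm_onto i; have [b ->] := sgm_onto j => ij.
rewrite wrVJ (inj_eq perm_inj).
have [k [x ea]] := Rank_onto a; have [k' [y eb]] := Rank_onto b.
have -> : glmx (bd l) a b = submxblock (glmx (bd l)) k k' x y by rewrite ea eb [RHS]mxE.
rewrite -val_eqE /= ea eb tagnat.eq_Rank; have [e|kk] := eqVneq k k'; last first.
  by rewrite bd_off // mxE.
case: _ / e in y eb *; rewrite bd_diag hl //=.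
by have := pos_Rank x y; move: ij; rewrite !sgmE ea eb; lia.
Qed.

Lemma upper_bd u : upper_unipotent u -> exists (l : levi F n_) v,
  [/\ forall k, upper_unipotent (l k), UJ (@Jm t n_) v & (wr * u * wr^-1 = bd l * v)%g].
Proof.
move=> hu; set w := (wr * u * wr^-1)%g.
have wE k k' x y : submxblock (glmx w) k k' x y =
    glmx u (sgm (tagnat.Rank k x)) (sgm (tagnat.Rank k' y)) by rewrite mxE wrJ.
have sX k : supp (@ltJ (n_ k)) (submxblock (glmx w) k k - 1%:M).
  move=> x y; rewrite /ltJ -leqNgt => yx; rewrite mxB1E wE hu.
    rewrite (inj_eq perm_inj) -val_eqE /= tagnat.eq_Rank eqxx /= val_eqE; exact: subrr.
  by rewrite !sgmE; have := pos_Rank x y; lia.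
have mk k : exists g : GL F (n_ k), upper_unipotent g /\ glmx g = submxblock (glmx w) k k.
  have [g Ug e] := UJ_mk (@ltJ_trans (n_ k)) (@ltJ_ranked (n_ k)) (sX k).
  by exists g; split; [apply/upperP|rewrite e addrC subrK].
pose l : levi F n_ := fun k => sval (cid (mk k)).
have hl k : upper_unipotent (l k) /\ glmx (l k) = submxblock (glmx w) k k := svalP (cid (mk k)).
exists l, ((bd l)^-1 * w)%g; split=> [k| |]; last by rewrite mulgA mulgV mul1g.
  by have [] := hl k.
apply/UJmP => i j ij; rewrite -bdV glmxM sub_bd_mul.
have [<-|ne] := eqVneq i j; first by rewrite -(hl i).2 glmxVK sub_one_diag.
rewrite sub_one_off //; have -> : submxblock (glmx w) i j = 0; last by rewrite mulmx0.
have lt : (i < j)%N by rewrite ltn_neqAle ij andbT.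
apply/matrixP => x y; rewrite wE mxE hu.
  by rewrite (inj_eq perm_inj) -val_eqE /= tagnat.eq_Rank (negbTE ne).
by rewrite !sgmE ltnW // pos_lt // !tagnat.Rank1K.
Qed.

End Reversal.

Section Functional.
Variables (F : localFieldType) (R : closedFieldType) (sq : sqrt_resq F R).
Variables (theta : F -> R) (ht : nontrivial_smooth_character theta).
Variables (t : nat) (n_ : 'I_t -> nat) (s : rep R (levi F n_)).
Local Notation N := (\sum_(i < t) n_ i)%N.
Local Notation Kc := (@Kc F N).
Local Notation psi := (psi theta).
Local Notation W := (@wr F t n_).
Variables (r : rep R (GL F N)) (j : {linear r -> (GL F N -> s)}).
Hypotheses (jeq : right_equivariant j) (jinj : injective j).
Hypothesis jran : range j = @induced_space F R sq N t n_ (erefl N) s.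
Hypothesis sms : ksmooth (@Kl F t n_) s.
Variable L : s -> R.
Hypothesis Llin : forall a x y, L (a *: x + y) = a * L x + L y.
Hypothesis Lpsi : forall l x, (forall k, upper_unipotent (l k)) ->
  L (ract s l x) = psi (bd l) * L x.
Variable w0 : s.
Hypothesis Lw0 : L w0 != 0.

Local Notation Um := (UJ (@Jm t n_)).

Let tJ := @Jm_trans t n_.
Let rJ := @Jm_ranked t n_.

(** Conjugation by [ax C] expands the root groups which are positive for the order [pos]. *)
Definition ax (C : nat) : GL F N := dg F (fun a => (C * pos a)%N%:Z).

Definition avg_group C (u : nat) : set (GL F N) := [set g | (Um `&` Kc u) ((ax C)^-1 * g * ax C)%g].

Lemma axK C g : (ax C * ((ax C)^-1 * g * ax C) * (ax C)^-1 = g)%g.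
Proof. by rewrite !mulgE. Qed.

Lemma ax_Um C g : Um ((ax C)^-1 * g * ax C)%g <-> Um g.
Proof.
split=> Ug; first by rewrite -(axK C g); exact: dg_UJ.
by rewrite -[X in (_ * X)%g]invgK /ax dgV; exact: dg_UJ.
Qed.

Lemma avg_group_subgr C u : subgr (avg_group C u).
Proof. by apply: subgr_conj; apply: subgrI; [exact: UJ_subgr|exact: Kc_subgr]. Qed.

Lemma avg_group_transv C u : exists (T : finType) (f : T -> GL F N),
  transv f (avg_group C 0) (avg_group C u) /\ exists e, #|T| = (resq F ^ e)%N.
Proof.
have [T [f [tr e]]] := UJ_Kc_transv tJ (@padm_ranked F N _ 0 tJ rJ) (leq0n u).
exists T, (fun i => ax C * f i * (ax C)^-1)%g; split=> //; exact: transv_conj.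
Qed.

Lemma avg_group_sub C u : avg_group C u `<=` avg_group C 0.
Proof. by move=> g [Ug Kg]; split=> //; exact: Kc_le Kg. Qed.

Lemma avg_group_le C u0 : exists u1, forall u, (u1 <= u)%N -> avg_group C u `<=` Um `&` Kc u0.
Proof.
have [u1 h] := Kc_conj (ax C)^-1%g u0; exists u1 => u uu g [/ax_Um Ug Kg]; split=> //.
by rewrite -(axK C g); have := h _ (Kc_le uu Kg); rewrite invgK.
Qed.

Lemma avg_group_normal C u g h : avg_group C 0 g -> avg_group C u h -> avg_group C u (g^-1 * h * g)%g.
Proof.
move=> [Ug Kg] [Uh Kh]; have [_ UM UV] := UJ_subgr F tJ.
have e : ((ax C)^-1 * (g^-1 * h * g) * ax C = ((ax C)^-1 * g * ax C)^-1 *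
  ((ax C)^-1 * h * ax C) * ((ax C)^-1 * g * ax C))%g by rewrite !mulgE.
rewrite /avg_group /= e; split; last exact: Kc_normal.
exact: (UM _ _ (UM _ _ (UV _ Ug) Uh) Ug).
Qed.

Lemma ax_int_aux w (e C : nat) : upper_unipotent (W^-1 * w * W)%g ->
  mxO (- e%:Z) (glmx w) -> (e <= C)%N -> mxO 0 (glmx ((ax C)^-1 * w * ax C)%g).
Proof.
move=> hw he eC a b; rewrite dgVJE.
have [lt|le] := ltnP (pos a) (pos b).
  apply: (@inO_le F 0 ((C * pos b)%N%:Z - (C * pos a)%N%:Z + - e%:Z)); last exact: inOM (inO_pw _ _) (he a b).
  by have := leq_mul (leqnn C) lt; rewrite mulnS; lia.
have := hw (sgm n_ a) (sgm n_ b); rewrite !sgmE => /(_ le); rewrite wrVJ (inj_eq perm_inj) => ->.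
by case: eqP => [->|_]; rewrite ?subrr ?mulr0; [rewrite expr0z mulr1; exact: inO1|exact: inO0].
Qed.

Lemma ax_int w : upper_unipotent (W^-1 * w * W)%g ->
  exists C0, forall C, (C0 <= C)%N -> Kc 0 ((ax C)^-1 * w * ax C)%g.
Proof.
move=> hw; have [e he] := mxO_exists (glmx w); have [e' he'] := mxO_exists (glmx w^-1%g).
have hw' : upper_unipotent (W^-1 * w^-1 * W)%g.
  by have [_ _ UV] := @upper_subgr F N; have := UV _ hw; rewrite !mulgE.
exists (e + e')%N => C CC; apply: Kc0P.
  by apply: ax_int_aux he _ => //; exact: leq_trans (leq_addr _ _) CC.
have -> : (((ax C)^-1 * w * ax C)^-1 = (ax C)^-1 * w^-1 * ax C)%g by rewrite !mulgE.
by apply: ax_int_aux he' _ => //; exact: leq_trans (leq_addl _ _) CC.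
Qed.

Lemma avg_group_full v : Um v -> exists C0, forall C, (C0 <= C)%N -> avg_group C 0 v.
Proof.
move=> Uv; have [C0 h] := ax_int (UJm_upper Uv); exists C0 => C CC; split; last exact: h.
exact/ax_Um.
Qed.

Lemma avg_group_int C u : Um `&` Kc u `<=` avg_group C 0.
Proof.
move=> g [Ug Kg]; split; first exact/ax_Um.
have Kg0 : Kc 0 g by exact: Kc_le Kg.
have [_ UM UV] := UJ_subgr F tJ; have [_ _ KV] := @Kc_subgr F N 0.
have aux h : Um h -> Kc 0 h -> mxO 0 (glmx ((ax C)^-1 * h * ax C)%g).
  move=> Uh Kh; have h0 : mxO (- 0%:Z) (glmx h) by rewrite oppr0; exact: Kc_int Kh.
  exact: (ax_int_aux (UJm_upper Uh) h0 (leq0n C)).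
apply: Kc0P; first exact: aux.
have -> : (((ax C)^-1 * g * ax C)^-1 = (ax C)^-1 * g^-1 * ax C)%g by rewrite !mulgE.
by apply: aux; [exact: UV|exact: KV].
Qed.

Lemma avg_group_bd (l : levi F n_) : (forall k, upper_unipotent (l k)) -> exists C0,
  forall C u, (C0 <= C)%N -> forall g, avg_group C u g -> avg_group C u (bd l * g * (bd l)^-1)%g.
Proof.
move=> hl; have [C0 h] := ax_int (bd_upper hl); exists C0 => C u CC g [Ug Kg].
have [_ _ KV] := @Kc_subgr F N 0.
split; first by apply/ax_Um; apply: bdJ_UJm; apply/ax_Um; exact: Ug.
have := Kc_normal (KV _ (h C CC)) Kg; rewrite !mulgE.
by have -> : ((ax C)^-1 * bd l * g * (bd l)^-1 * ax C = (ax C)^-1 * bd l * ax C * (ax C)^-1 * g * ax C *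
  (ax C)^-1 * (bd l)^-1 * ax C)%g by rewrite !mulgE.
Qed.

Lemma psiM g h : upper_unipotent (W^-1 * g * W)%g ->
  upper_unipotent (W^-1 * h * W)%g -> psi (g * h)%g = psi g * psi h.
Proof. by move=> hg hh; rewrite -(char_mul ht hg hh) /psi !mulgE. Qed.

Definition phi x g : R := (psi g)^-1 * L (j x g).

Lemma L0 : L 0 = 0.
Proof. by have := Llin (-1) 0 0; rewrite scaler0 addr0 mulN1r addNr. Qed.

Lemma phi_lin a x y g : phi (a *: x + y) g = a * phi x g + phi y g.
Proof.
have e : j (a *: x + y) g = a *: j x g + j y g by rewrite linearP.
by rewrite /phi e Llin mulrDr mulrCA.
Qed.

Lemma phi_inv x : exists v, forall H, H `<=` Um `&` Kc v -> forall g k, Um g -> H k ->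
  phi x (g * k)%g = phi x g.
Proof.
have [c hc] := theta_conductor ht; have [_ [u hu]] := ind_prop jran x.
exists (maxn c u) => H sH g k Ug Hk; have [Uk Kk] := sH _ Hk.
rewrite /phi psiM; try exact: UJm_upper.
have -> : psi k = 1.
  apply: (char_K hc); apply: (Kc_normal (wr_K0 F n_)).
  by apply: Kc_le Kk; exact: leq_maxl.
by rewrite mulr1 hu //; apply: Kc_le Kk; exact: leq_maxr.
Qed.

(** The Jacquet integral over the opposite radical, against [psi], need not converge; these are the
vectors for which its truncations to [avg_group C 0] eventually vanish. *)
Definition null_avg x := exists C0, forall C, (C0 <= C)%N -> exists u0, forall u, (u0 <= u)%N ->
  forall (T : finType) (f : T -> GL F N), transv f (avg_group C 0) (avg_group C u) ->
  \sum_i phi x (f i) = 0.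

Lemma null_avg_subspace : subspace null_avg.
Proof.
split=> [|a x y [C hC] [D hD]].
  exists 0%N => C _; exists 0%N => u _ T f _; rewrite big1 // => i _.
  have e : j 0 (f i) = 0 by rewrite linear0.
  by rewrite /phi e L0 mulr0.
exists (maxn C D) => E; rewrite geq_max => /andP[/hC [u hu] /hD [v hv]].
exists (maxn u v) => k; rewrite geq_max => /andP[uk vk] T f tr.
under eq_bigr do rewrite phi_lin; rewrite big_split /= -mulr_sumr.
by rewrite (hu _ uk _ _ tr) (hv _ vk _ _ tr) mulr0 addr0.
Qed.

Lemma phiB g x y a : phi (x - a *: y) g = phi x g - a * phi y g.
Proof. by rewrite addrC -scaleNr phi_lin mulNr addrC. Qed.

(** Right translation by [v] permutes the cosets over which the average is taken, once the subgroup
contains [v]. *)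
Lemma null_avg_Um v x : Um v -> null_avg (ract r v x - psi v *: x).
Proof.
move=> Uv; have [C0 hC0] := avg_group_full Uv; exists C0 => C CC.
have [b hb] := phi_inv x; have [u1 hu1] := avg_group_le C b; exists u1 => u uu T f tr.
have Bv := hC0 _ CC; have [B1 BM BV] := avg_group_subgr C 0.
have UB g : avg_group C 0 g -> Um g by move=> [/ax_Um].
have tr' : transv (fun i => f i * v)%g (avg_group C 0) (avg_group C u).
  split=> [i|k Bk]; first by apply: BM => //; exact: tr.1.
  have [i [Hi ui]] := tr.2 _ (BM _ _ Bk (BV _ Bv)); exists i; split=> [|i' Hi'].
    by have := avg_group_normal Bv Hi; rewrite !mulgE.
  by apply: ui; have := avg_group_normal (BV _ Bv) Hi'; rewrite !mulgE.
have inv k h : avg_group C 0 k -> avg_group C u h -> phi x (k * h)%g = phi x k.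
  by move=> Bk; apply: hb; [exact: hu1|exact: UB].
have e := sum_transv (avg_group_subgr C 0) (avg_group_subgr C u) inv tr' tr.
rewrite (eq_bigr (fun i => psi v * (phi x (f i * v)%g - phi x (f i)))) => [|i _].
  by rewrite -mulr_sumr sumrB e subrr mulr0.
have fi : Um (f i) by apply: UB; exact: tr.1.
rewrite phiB mulrBr; congr (_ - _); rewrite /phi jeq psiM; try exact: UJm_upper.
by rewrite invfM mulrA [psi v * _]mulrCA mulfV ?mulr1 ?char_neq0.
Qed.

Lemma dl_upper (l : levi F n_) : (forall k, upper_unipotent (l k)) -> dl sq l = 1.
Proof.
move=> hl; have v0 k : lfval (\det (glmx (l k))) = 0.
  rewrite -det_tr det_trig; last first.
    by apply/is_trig_mxP => a b ab; rewrite mxE hl ?(ltnW ab) // -val_eqE /= gtn_eqF.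
  by rewrite big1 ?lfval1 // => a _; rewrite mxE hl // eqxx.
rewrite /dl /modulus_sqrt big1 ?oppr0 ?expr0z // => i _.
by rewrite big1 // => k _; rewrite !v0 !mulr0 subr0.
Qed.

(** Conjugation by [bd l] preserves the averaging subgroups and its modulus is [1], so that it also
permutes the cosets. *)
Lemma null_avg_bd (l : levi F n_) x : (forall k, upper_unipotent (l k)) ->
  null_avg (ract r (bd l) x - psi (bd l) *: x).
Proof.
move=> hl; have hl' k : upper_unipotent (l^-1%g k).
  by have [_ _ UV] := @upper_subgr F (n_ k); exact: UV.
have [C0 hC0] := avg_group_bd hl; have [C1 hC1] := avg_group_bd hl'.
exists (maxn C0 C1) => C; rewrite geq_max => /andP[CC0 CC1].
have [b hb] := phi_inv x; have [u1 hu1] := avg_group_le C b; exists u1 => u uu T f tr.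
have UB g : avg_group C 0 g -> Um g by move=> [/ax_Um].
have conj u' : [set g | avg_group C u' (((bd l)^-1)^-1 * g * (bd l)^-1)%g] = avg_group C u'.
  apply/seteqP; split=> g /=; rewrite invgK => Bg; last exact: hC0.
  by have := hC1 _ _ CC1 _ Bg; rewrite bdV !mulgE.
have tr' := transv_conj (bd l)^-1%g tr; rewrite !conj in tr'.
have inv k h : avg_group C 0 k -> avg_group C u h -> phi x (k * h)%g = phi x k.
  by move=> Bk; apply: hb; [exact: hu1|exact: UB].
have e := sum_transv (avg_group_subgr C 0) (avg_group_subgr C u) inv tr' tr.
rewrite (eq_bigr (fun i => psi (bd l) * (phi x ((bd l)^-1 * f i * ((bd l)^-1)^-1)%g - phi x (f i)))) => [|i _].
  by rewrite -mulr_sumr sumrB e subrr mulr0.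
rewrite phiB mulrBr; congr (_ - _).
have fi : Um (f i) by apply: UB; exact: tr.1.
set g := ((bd l)^-1 * f i * ((bd l)^-1)^-1)%g.
have Ug : Um g by rewrite /g -bdV; exact: bdJ_UJm.
have ej : (f i * bd l = bd l * g)%g by rewrite /g !mulgE.
rewrite /phi.
have -> : j (ract r (bd l) x) (f i) = dl sq l *: ract s l (j x g).
  by rewrite jeq ej; exact: (ind_prop jran x).1 (lp_bd l).
rewrite dl_upper // scale1r Lpsi //.
have -> : psi (f i) = psi g.
  have := psiM (UJm_upper fi) (bd_upper hl); rewrite ej psiM; [|exact: bd_upper|exact: UJm_upper].
  by rewrite mulrC => /(mulIf (char_neq0 ht _)).
by rewrite mulrCA.
Qed.

(** The bump supported on a small subgroup of the opposite radical has averages equal to a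
nonzero multiple of [L w0]. *)
Lemma not_null_avg : exists x, ~ null_avg x.
Proof.
have [c hc] := theta_conductor ht; have [u0 hu0] := sms w0.
pose b := (maxn c u0).+1.
have fb : fixd (@Kl F t n_) b w0.
  by apply: (fixd_le (levi_filt sq n_)) hu0; rewrite leqW // leq_maxr.
have [x ex] := bump_ind jran (isT : (0 < b)%N) fb.
exists x => -[C hC]; have [u1 hu1] := hC C (leqnn C).
have [v hv] := phi_inv x; have [u2 hu2] := avg_group_le C (maxn b v).
pose u := maxn u1 u2; have [T [f [tr [e cT]]]] := avg_group_transv C u.
have := hu1 u (leq_maxl _ _) T f tr.
have sK := avg_group_subgr C 0; have sH := avg_group_subgr C u.
pose Us := Um `&` Kc b; have sU : subgr Us by apply: subgrI; [exact: UJ_subgr|exact: Kc_subgr].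
have HU : avg_group C u `<=` Us.
  move=> g /(hu2 u (leq_maxr _ _)) [Ug Kg]; split=> //; apply: Kc_le Kg; exact: leq_maxl.
have UK : Us `<=` avg_group C 0 by exact: avg_group_int.
have UB g : avg_group C 0 g -> Um g by move=> [/ax_Um].
have [[T1 [f1 tr1]] [T2 [f2 tr2]]] := transv_sub sK sU sH UK HU tr.
have tr12 := transv_tower sK sU sH UK HU tr2 tr1.
have inv k h : avg_group C 0 k -> avg_group C u h -> phi x (k * h)%g = phi x k.
  move=> Bk; apply: hv; last exact: UB.
  move=> g /(hu2 u (leq_maxr _ _)) [Ug Kg]; split=> //; apply: Kc_le Kg; exact: leq_maxr.
(* split the cosets by those of [Us]: only the trivial one meets the support *)
rewrite (sum_transv sK sH inv tr tr12).
rewrite -(pair_bigA _ (fun i k => phi x (f2 i * f1 k)%g)) /=.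
have lp11 : lp (1%g : GL F N) (1%g : levi F n_) by have := lp_bd (1%g : levi F n_); rewrite bd1.
have [U1 UM UV] := sU; have [_ UmM UmV] := UJ_subgr F tJ.
have phiE g : Um g -> phi x g = if `[< Us g >] then L w0 else 0.
  move=> Ug; rewrite /phi ex; case: ifP => [/asboolP [_ Kg]|/asboolP nU].
    have -> : bump sq w0 b g = w0.
      have := @bump_val F R sq t n_ s w0 b 1%g 1%g g lp11 Ug Kg.
      by rewrite mul1g dl1 scale1r ract1E.
    have -> : psi g = 1; last by rewrite invr1 mul1r.
    apply: (char_K hc); apply: (Kc_normal (wr_K0 F n_)).
    by apply: Kc_le Kg; rewrite leqW // leq_maxl.
  rewrite bump_out ?L0 ?mulr0 // => p l k hp Uk Kk eg; apply: nU; split=> //.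
  have : p = 1%g.
    apply: (lp_UJm hp); have -> : p = (g * k^-1)%g by rewrite eg !mulgE.
    by apply: UmM => //; exact: UmV.
  by move=> p1; rewrite eg p1 mul1g.
have [i0 [Hi0 ui0]] := tr2.2 _ (UK _ U1).
rewrite (bigD1 i0) //= [X in _ + X]big1 ?addr0 => [|i ii0]; last first.
  rewrite big1 // => k _; rewrite phiE; last by apply: UmM; [apply: UB; exact: tr2.1|exact: (tr1.1 k).1].
  case: asboolP => // Uik; case/eqP: ii0; symmetry; apply: ui0; rewrite mulg1; apply: (UV _ _).
  by have := UM _ _ Uik (UV _ (tr1.1 k)); rewrite !mulgE.
have U0 : Us (f2 i0) by move: Hi0; rewrite mulg1 => /UV; rewrite invgK.
rewrite (eq_bigr (fun=> L w0)) => [|k _]; last first.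
  have Uk : Us (f2 i0 * f1 k)%g by apply: UM => //; exact: tr1.1.
  by rewrite phiE ?asboolT //; exact: Uk.1.
rewrite sumr_const -mulr_natl => /eqP; rewrite mulf_eq0 (negbTE Lw0) orbF => /eqP h.
have := transv_card sK sH (@avg_group_sub C u) tr tr12; rewrite card_prod cT => ce.
by have := resqX_neq0 sq e; rewrite ce natrM h mulr0 eqxx.
Qed.

(** The vectors whose averages vanish form a proper subspace containing all the
[u x - psi u x]; a linear form which vanishes on it is a Whittaker functional after a
translation by [wr]. *)
Lemma whittaker_of_levi : exists2 lam : {scalar r}, whittaker_functional theta lam & exists x, lam x != 0.
Proof.
have [v0 nv0] := not_null_avg; pose w := W.
pose S := [set y | exists u x, upper_unipotent u /\
  y = ract r (w * u * w^-1)%g x - char_of_unipotent theta u *: x].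
have SQ : span S `<=` null_avg.
  apply: span_min; first exact: null_avg_subspace.
  move=> _ [u [x [hu ->]]]; have [l [v [hl Uv e]]] := upper_bd (n_ := n_) hu.
  have -> : char_of_unipotent theta u = psi (bd l) * psi v.
    by rewrite -psiM; [rewrite -e /psi !mulgE|exact: bd_upper|exact: UJm_upper].
  rewrite e ractM.
  have -> : ract r (bd l) (ract r v x) - (psi (bd l) * psi v) *: x =
      (ract r (bd l) (ract r v x) - psi (bd l) *: ract r v x) + psi (bd l) *: (ract r v x - psi v *: x).
    by rewrite scalerBr scalerA addrA subrK.
  apply: (subspaceD null_avg_subspace); first exact: null_avg_bd.
  by apply: (subspaceZ _ null_avg_subspace); exact: null_avg_Um.
have nS : ~ span S v0 by move=> /SQ.
have [h [hl h0 h1]] := separating_form (span_subspace S) nS.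
have hB y a z : h (y - a *: z) = h y - a * h z by rewrite addrC -scaleNr hl mulNr addrC.
have ll : linear_for *%R (fun x => h (ract r w x)) by move=> a x y; rewrite linearP hl.
pose lam : {scalar r} := HB.pack (fun x => h (ract r w x)) (GRing.isLinear.Build R r R *%R _ ll).
exists lam; last by exists (ract r w^-1%g v0); rewrite /= ractKV h1 oner_neq0.
move=> u x hu; rewrite /= -ractM.
have -> : (w * u = w * u * w^-1 * w)%g by rewrite !mulgE.
rewrite ractM; apply/eqP; rewrite -subr_eq0 -hB; apply/eqP; apply: h0; apply: sub_span.
by exists u, (ract r w x).
Qed.

End Functional.

Section Existence.
Variables (F : localFieldType) (R : closedFieldType) (sq : sqrt_resq F R).
Variables (theta : F -> R) (ht : nontrivial_smooth_character theta).

(** Tensor the Whittaker functionals of the generic factors and apply [whittaker_of_levi]. *)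
Lemma whittaker_generic ell n (r : rep R (GL F n)) : whittaker_type sq ell theta r -> generic theta r.
Proof.
move=> [t [n_ [r_ [hr [e [s [[b tb eb] [j [jeq jinj jran]]]]]]]]].
have hg i := segment_good (hr i).
case: n / e r j jeq jinj jran => r j jeq jinj jran.
have sms : ksmooth (@Kl F t n_) s by apply: (tensor_ksmooth tb eb) => i; have [] := hg i.
have gi i : exists lx : {scalar r_ i} * r_ i, whittaker_functional theta lx.1 /\ lx.1 lx.2 != 0.
  by have [_ [lam hl [x hx]] _ _ _] := hg i; exists (lam, x).
pose lx i := sval (cid (gi i)); have hlx i := svalP (cid (gi i)).
have [L [Ll Lb]] := tensor_form tb (lam := fun i => (lx i).1) (fun i a x y => linearP _ a x y).
apply: (@whittaker_of_levi F R sq theta ht t n_ s r j jeq jran sms L Ll _ (b (fun i => (lx i).2))).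
  move=> l x hl; apply: (tensor_span tb x (U := [set x | L (ract s l x) = psi theta (bd l) * L x])).
    have L0 : L 0 = 0 by have := Ll (-1) 0 0; rewrite scaler0 addr0 mulN1r addNr.
    split=> [|a y z /= hy hz]; first by rewrite /= linear0 L0 mulr0.
    by rewrite linearP !Ll hy hz mulrDr mulrCA.
  move=> _ [v _ <-] /=; rewrite eb !Lb psi_bd // -big_split; apply: eq_bigr => i _ /=.
  by rewrite (hlx i).1.
by rewrite Lb; apply/prodf_neq0 => i _; exact: (hlx i).2.
Qed.

Lemma sgn_unit n : (diag_mx (\row_(i < n) ((-1) ^+ i : F))) \in unitmx.
Proof.
rewrite unitmxE det_diag unitfE; apply/prodf_neq0 => i _.
by rewrite mxE signr_eq0.
Qed.

(** Conjugation by the diagonal matrix with alternating signs inverts the character. *)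
Lemma generic_inv n (r : rep R (GL F n)) : generic theta r -> generic (fun x => (theta x)^-1) r.
Proof.
move=> [lam hl [x hx]]; pose d : GL F n := MkGL (sgn_unit n).
have dE u i k : glmx (d * u * d^-1)%g i k = (-1) ^+ i * glmx u i k * (-1) ^+ k.
  have -> : (d^-1)%g = d.
    apply: mulg1_eq; apply: glmx_inj; rewrite /= mulmx_diag; apply/matrixP => a b.
    by rewrite !mxE -expr2 sqrr_sign; case: eqP.
  by rewrite 2!glmxM /= mul_diag_mx mul_mx_diag !mxE.
have ll : linear_for *%R (fun x => lam (ract r d x)) by move=> a y z; rewrite !linearP.
pose lam' : {scalar r} := HB.pack (fun x => lam (ract r d x)) (GRing.isLinear.Build R r R *%R _ ll).
exists lam'; last by exists (ract r d^-1%g x); rewrite /= ractKV.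
move=> u y hu; rewrite /= -ractM.
have -> : (d * u = d * u * d^-1 * d)%g by rewrite !mulgE.
rewrite ractM hl; last first.
  move=> i k ki; rewrite dE hu //; case: eqP => [->|_]; last by rewrite mulr0 mul0r.
  by rewrite mulr1 -expr2 sqrr_sign.
congr (_ * _); rewrite /char_of_unipotent -(thetaN ht); congr theta.
rewrite -sumrN; apply: eq_bigr => i _; rewrite -sumrN; apply: eq_bigr => k /eqP e.
rewrite dE e exprS mulN1r mulrN [_ * glmx u i k]mulrC -mulrA -expr2 sqrr_sign mulr1.
by [].
Qed.

End Existence.

(** * Sums of finite support *)

Section FinSum.
Variables (I : choiceType) (R : fieldType).
Implicit Types (f g : I -> R).

Definition fsupp f := exists l : seq I, forall y, f y != 0 -> y \in l.

Definition fsum f : R := \sum_(y \in [set: I]) f y.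

Lemma fsum_seq (l : seq I) f : uniq l -> (forall y, f y != 0 -> y \in l) ->
  fsum f = \sum_(y <- l) f y.
Proof.
move=> ul hl; rewrite (fsbig_seq _ _ ul) /fsum; symmetry; apply: fsbig_widen => // y [_ /= nl].
by apply/eqP; apply: contra_notT nl => /hl.
Qed.

Lemma fsupp_uniq f : fsupp f -> exists2 l : seq I, uniq l & forall y, f y != 0 -> y \in l.
Proof.
by move=> [l hl]; exists (undup l); [exact: undup_uniq|move=> y /hl; rewrite mem_undup].
Qed.

Lemma fsupp_lin a f g : fsupp f -> fsupp g -> fsupp (fun y => a * f y + g y).
Proof.
move=> [l hl] [l' hl']; exists (l ++ l') => y; rewrite mem_cat.
have [e|/hl -> //] := eqVneq (f y) 0.
by rewrite e mulr0 add0r => /hl' ->; rewrite orbT.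
Qed.

Lemma fsum_lin a f g : fsupp f -> fsupp g -> fsum (fun y => a * f y + g y) = a * fsum f + fsum g.
Proof.
move=> [l hl] [l' hl']; pose L := undup (l ++ l'); have uL : uniq L by exact: undup_uniq.
have hL y : f y != 0 -> y \in L by move=> /hl h; rewrite mem_undup mem_cat h.
have hL' y : g y != 0 -> y \in L by move=> /hl' h; rewrite mem_undup mem_cat h orbT.
rewrite (fsum_seq uL hL) (fsum_seq uL hL') (@fsum_seq L) // => [|y].
  by rewrite big_split mulr_sumr.
have [e|/hL -> //] := eqVneq (f y) 0.
by rewrite e mulr0 add0r => /hL'.
Qed.

Lemma fsum_bij (h h' : I -> I) f : cancel h h' -> cancel h' h -> fsupp f ->
  fsupp (fun y => f (h y)) /\ fsum (fun y => f (h y)) = fsum f.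
Proof.
move=> hK hK' /fsupp_uniq [l ul hl]; have hl' y : f (h y) != 0 -> y \in map h' l.
  by move=> /hl h1; rewrite -(hK y) map_f.
split; first by exists (map h' l).
rewrite (fsum_seq ul hl) (@fsum_seq (map h' l)) //; last by rewrite map_inj_uniq //; exact: can_inj hK'.
by rewrite big_map; apply: eq_bigr => y _; rewrite hK'.
Qed.

End FinSum.

(** * Invariant measures on the quotient by the upper unipotent group *)

Section Quotient.
Variables (F : localFieldType) (R : closedFieldType) (sq : sqrt_resq F R) (n : nat).
Local Notation G := (GL F n).
Local Notation Kc := (@Kc F n).
Local Notation up := (@upper_unipotent F n).
Implicit Types (f phi : G -> R) (g h u k a : G) (D E P : set G).

Definition linv f := forall u g, up u -> f (u * g)%g = f g.
Definition rinv s f := forall g k, Kc s k -> f (g * k)%g = f g.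

(** Finiteness modulo [N] on the left, in a form which does not mention the topology. *)
Definition Qf f := [/\ linv f, exists s, rinv s f & exists (T : finType) (h : T -> G),
  forall g, f g != 0 -> exists i u k, [/\ up u, Kc 0 k & g = (u * h i * k)%g]].

(** Compact sets are covered by finitely many cosets of [K_0], and conversely such a coset is
compact. *)
Lemma CqP f : @Cc_quotient F R n f <-> Qf f.
Proof.
split=> [[li lc [C cC hC]]|[li [s hs] [T [h hT]]]]; last first.
  split; first exact: li.
    move=> g; apply/nbhs_GLP; exists s => k Kk /=; exact: hs.
  have [b hb] := bounded_GL_finite (codom h); exists (bounded_GL b); first exact: compact_bounded_GL.
  move=> g /hT [i [u [k [hu Kk ->]]]]; exists u, (h i * k)%g; split=> //; last by rewrite mulgA.
  by apply: hb => //; exact: codom_f.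
have loc g : exists s : nat, forall k, Kc s k -> f (g * k)%g = f g.
  by have /nbhs_GLP [s hs] := lc g; exists s.
have [sg hsg] := choice loc; split; first exact: li.
  have [gs _ cov] := compact_GL_cover sg cC.
  exists (\max_(h <- gs) sg h)%N => g k Kk.
  have K0 c k' : C c -> Kc (\max_(h <- gs) sg h)%N k' -> f (c * k')%g = f c.
    move=> Cc Kk'; have [h hh Kh] := cov _ Cc.
    have [_ KM _] := @Kc_subgr F n (sg h).
    have le : (sg h <= \max_(h <- gs) sg h)%N by exact: leq_bigmax_seq.
    rewrite -[c](mulVKg h) -mulgA !hsg //; apply: KM => //; exact: Kc_le Kk'.
  have key g' k' : Kc (\max_(h <- gs) sg h)%N k' -> f g' != 0 -> f (g' * k')%g = f g'.
    move=> Kk' /hC [u [c [hu Cc ->]]]; by rewrite -mulgA !(li u _ hu) K0.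
  have [_ _ KV] := @Kc_subgr F n (\max_(h <- gs) sg h)%N.
  have [e|nz] := eqVneq (f g) 0; last exact: key.
  have [e'|nz] := eqVneq (f (g * k)%g) 0; first by rewrite e e'.
  by have := key _ _ (KV _ Kk) nz; rewrite mulgK.
have [gs _ cov] := compact_GL_cover (fun=> 0%N) cC.
exists 'I_(size gs), (fun i : 'I_(size gs) => nth 1%g gs i) => g /hC [u [c [hu Cc ->]]].
have [h hh Kh] := cov _ Cc; have hi : (index h gs < size gs)%N by rewrite index_mem.
exists (Ordinal hi), u, (h^-1 * c)%g; split=> //=; by rewrite nth_index // !mulgE.
Qed.

Lemma Qf0 : Qf (fun=> 0).
Proof.
by split=> //; [exists 0%N|exists void, (fun _ => 1%g) => g; rewrite eqxx].
Qed.

Lemma Qf_lin c f f' : Qf f -> Qf f' -> Qf (fun g => c * f g + f' g).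
Proof.
move=> [l1 [s1 r1] [T1 [h1 c1]]] [l2 [s2 r2] [T2 [h2 c2]]]; split.
- by move=> u g hu; rewrite l1 ?l2.
- exists (maxn s1 s2) => g k Kk; rewrite r1 ?r2 //; apply: Kc_le Kk; [exact: leq_maxr|exact: leq_maxl].
- exists (T1 + T2)%type, (fun i => match i with inl i => h1 i | inr i => h2 i end) => g.
  have [e|nz _] := eqVneq (f g) 0; last by have [i h] := c1 g nz; exists (inl i).
  by rewrite e mulr0 add0r => /c2 [i h]; exists (inr i).
Qed.

Lemma Qf_tr h f : Qf f -> Qf (fun g => f (g * h)%g).
Proof.
move=> [li [s hs] [T [c hT]]]; split.
- by move=> u g hu /=; rewrite -mulgA; exact: li.
- have [s' hs'] := Kc_conj h s; exists s' => g k Kk.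
  by rewrite -[RHS](hs _ _ (hs' _ Kk)) !mulgE.
- have [s' hs'] := Kc_conj h^-1%g 0; have [I [x [x1 x2]]] := Kc0_transv F n s'.
  exists (T * I)%type, (fun i => c i.1 * x i.2 * h^-1)%g => g /hT [i [u [k [hu Kk e]]]].
  have [l [Kl _]] := x2 _ Kk; exists (i, l), u, (h * ((x l)^-1 * k) * h^-1)%g; split=> //=.
    by have := hs' _ Kl; rewrite invgK.
  by rewrite -[g](mulgK h) e !mulgE.
Qed.

Definition rst X f g : R := if `[< X g >] then f g else 0.

Definition NS a D : set G := [set g | exists u d, [/\ up u, D d & g = (u * a * d)%g]].

Lemma Qf_NS x D f s : linv f -> rinv s f -> D `<=` Kc 0 -> (forall g k, D g -> Kc s k -> D (g * k)%g) ->
  Qf (rst (NS (dg F x) D) f).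
Proof.
move=> li hs D0 DK; have [_ UM UV] := @upper_subgr F n; have [_ _ KV] := @Kc_subgr F n s; split.
- move=> u g hu; rewrite /rst li //; congr (if _ then _ else _); apply: asbool_equiv_eq; split.
    move=> [u' [d [hu' Dd e]]]; exists (u^-1 * u')%g, d; split=> //; first exact: UM (UV _ hu) hu'.
    by rewrite -[g](mulKg u) e !mulgE.
  by move=> [u' [d [hu' Dd ->]]]; exists (u * u')%g, d; split; rewrite ?mulgA //; exact: UM.
- exists s => g k Kk; rewrite /rst hs //; congr (if _ then _ else _); apply: asbool_equiv_eq; split.
    move=> [u [d [hu Dd e]]]; exists u, (d * k^-1)%g; split=> //; first exact: DK _ _ Dd (KV _ Kk).
    by rewrite -[g](mulgK k) e !mulgE.
  by move=> [u [d [hu Dd ->]]]; exists u, (d * k)%g; split; rewrite ?mulgA //; exact: DK.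
- exists unit, (fun=> dg F x) => g; rewrite /rst; case: asboolP; last by rewrite eqxx.
  by move=> [u [d [hu Dd ->]]] _; exists tt, u, d; split=> //; exact: D0.
Qed.

(** The set [N a D] is the disjoint union of the sets [N a P (t i)^-1], because [N E = N P] and [E] contains
[N] cap [D]. *)
Lemma coset_sum x D E P (T : finType) (t : T -> G) f g : subgr D -> subgr E ->
  E `<=` D -> P `<=` E -> (forall l, E l -> exists u p, [/\ up u, P p & l = (u * p)%g]) ->
  (forall u, up u -> D u -> E u) -> transv t D E ->
  rst (NS (dg F x) D) f g = \sum_i rst (NS (dg F x) P) (fun h => f (h * (t i)^-1)%g) (g * t i)%g.
Proof.
move=> [D1 DM DV] [E1 EM EV] ED PE NE NDE tr; have [U1 UM UV] := @upper_subgr F n.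
pose a := dg F x; have fgE i : f (g * t i * (t i)^-1)%g = f g by rewrite mulgK.
have sufE i : NS a P (g * t i)%g -> NS a D g.
  move=> [u [p [hu Pp e]]]; exists u, (p * (t i)^-1)%g; split=> //; last first.
    by rewrite -[g](mulgK (t i)) e !mulgE.
  by apply: DM; [apply: ED; exact: PE|apply: (DV _ _); exact: tr.1].
rewrite {1}/rst; case: asboolP => [[u [d [hu Dd eg]]]|nD]; last first.
  by rewrite big1 // => i _; rewrite /rst; case: asboolP => // /sufE.
have memE i : NS a P (g * t i)%g <-> E (d * t i)%g.
  split=> [[u' [p [hu' Pp e]]]|El].
    have ad : up (a^-1 * (u^-1 * u') * a)%g.
      by have := upper_dgJ (fun b => - x b) (UM _ _ (UV _ hu) hu'); rewrite -dgV invgK.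
    have e2 : (a^-1 * (u^-1 * u') * a = d * t i * p^-1)%g.
      have -> : p = ((u' * a)^-1 * (g * t i))%g by rewrite e !mulgE.
      by rewrite eg -/a !mulgE.
    have Dp : D (d * t i * p^-1)%g.
      exact: (DM _ _ (DM _ _ Dd (tr.1 i)) (DV _ (ED _ (PE _ Pp)))).
    have : E (d * t i * p^-1)%g by apply: NDE; [rewrite -e2|].
    by move=> /EM /(_ (PE _ Pp)); rewrite mulgVK.
  have [u' [p [hu' Pp e]]] := NE _ El; exists (u * (a * u' * a^-1))%g, p; split=> //.
    by apply: UM => //; exact: upper_dgJ.
  by rewrite eg -[RHS]mulgA -mulgA -mulgA e -/a !mulgE.
have [i0 [Hi ui]] := tr.2 _ (DV _ Dd).
rewrite (bigD1 i0) //= big1 => [|i ii0]; last first.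
  rewrite /rst; case: asboolP => // /memE El; case/eqP: ii0; symmetry; apply: ui.
  by have := EV _ El; rewrite invgM.
rewrite addr0 /rst asboolT ?fgE //; apply/memE.
by have := EV _ Hi; rewrite invgM !invgK.
Qed.

Variable mu : (G -> R) -> R.
Hypothesis hmu : quotient_measure mu.

Lemma mu_lin c f f' : Qf f -> Qf f' -> mu (fun g => c * f g + f' g) = c * mu f + mu f'.
Proof. by move=> /CqP h /CqP h'; have [lin _ _] := hmu; exact: lin. Qed.

Lemma mu_tr h f : Qf f -> mu (fun g => f (g * h)%g) = mu f.
Proof. by move=> /CqP hf; have [_ tr _] := hmu; exact: tr. Qed.

Lemma mu0 : mu (fun=> 0) = 0.
Proof.
have e : (fun=> 0 : R) = (fun g : G => -1 * 0 + 0) by apply/funext => g; rewrite mulr0 addr0.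
by rewrite e (mu_lin (-1) Qf0 Qf0) mulN1r addNr.
Qed.

Lemma mu_scale c f : Qf f -> mu (fun g => c * f g) = c * mu f.
Proof.
move=> h; rewrite -[RHS]addr0 -mu0 -(mu_lin _ h Qf0); congr mu; apply/funext => g.
by rewrite addr0.
Qed.

Lemma mu_seq (I : Type) (l : seq I) (f : I -> G -> R) : (forall i, Qf (f i)) ->
  mu (fun g => \sum_(i <- l) f i g) = \sum_(i <- l) mu (f i).
Proof.
move=> hf; suff : Qf (fun g => \sum_(i <- l) f i g) /\
    mu (fun g => \sum_(i <- l) f i g) = \sum_(i <- l) mu (f i) by case.
elim: l => [|i l [IH1 IH2]].
  have -> : (fun g => \sum_(j <- [::]) f j g) = (fun=> 0) by apply/funext => g; rewrite big_nil.
  by rewrite big_nil mu0; split=> //; exact: Qf0.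
have -> : (fun g => \sum_(j <- i :: l) f j g) = (fun g => 1 * f i g + \sum_(j <- l) f j g).
  by apply/funext => g; rewrite big_cons mul1r.
by rewrite big_cons mu_lin // IH2 mul1r; split=> //; exact: Qf_lin.
Qed.

Lemma mu_coset x D E P (T : finType) (t : T -> G) f s s' : subgr D -> subgr E ->
  E `<=` D -> P `<=` E -> (forall l, E l -> exists u p, [/\ up u, P p & l = (u * p)%g]) ->
  (forall u, up u -> D u -> E u) -> transv t D E ->
  D `<=` Kc 0 -> (forall g k, P g -> Kc s k -> P (g * k)%g) -> linv f -> rinv s' f -> (s' <= s)%N ->
  mu (rst (NS (dg F x) D) f) = \sum_i mu (rst (NS (dg F x) P) (fun h => f (h * (t i)^-1)%g)).
Proof.
move=> sD sE ED PE NE NDE tr D0 PK li ri ss.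
have Qi i : Qf (rst (NS (dg F x) P) (fun h => f (h * (t i)^-1)%g)).
  apply: (@Qf_NS _ _ _ s) => //.
  - by move=> u g hu; rewrite -mulgA; exact: li.
  - move=> g k Kk; have := Kc_normal _ Kk; have [_ _ KV] := @Kc_subgr F n 0.
    move=> /(_ (t i)^-1%g (KV _ (D0 _ (tr.1 i)))); rewrite invgK => Kk'.
    rewrite -[RHS](ri _ _ (Kc_le ss Kk')); congr f; by rewrite !mulgE.
  - by move=> g /PE /ED; exact: D0.
have -> : rst (NS (dg F x) D) f = fun g => \sum_i (fun h => rst (NS (dg F x) P)
    (fun h => f (h * (t i)^-1)%g) (h * t i)%g) g.
  by apply/funext => g; apply: coset_sum; eassumption.
rewrite mu_seq => [|i]; last exact: Qf_tr.
by apply: eq_bigr => i _; rewrite mu_tr.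
Qed.

Definition ind X := rst X (fun=> 1).

Lemma mu_coset1 x D E P (T : finType) (t : T -> G) s : subgr D -> subgr E ->
  E `<=` D -> P `<=` E -> (forall l, E l -> exists u p, [/\ up u, P p & l = (u * p)%g]) ->
  (forall u, up u -> D u -> E u) -> transv t D E ->
  D `<=` Kc 0 -> (forall g k, P g -> Kc s k -> P (g * k)%g) ->
  mu (ind (NS (dg F x) D)) = #|T|%:R * mu (ind (NS (dg F x) P)).
Proof.
move=> sD sE ED PE NE NDE tr D0 PK.
rewrite /ind (mu_coset x sD sE ED PE NE NDE tr D0 PK (s' := s)) //.
by rewrite sumr_const mulr_natl.
Qed.

Section InD.
Variables (D : set G) (s : nat).
Hypotheses (sD : subgr D) (D0 : D `<=` Kc 0) (KD : Kc s `<=` D).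

(** The group generated by [N] cap [D] and the normal subgroup [K_s]. *)
Definition LD : set G := setM (fun u => up u /\ D u) (Kc s).

Lemma LD_facts : [/\ subgr LD, LD `<=` D, Kc s `<=` LD,
  forall l, LD l -> exists u p, [/\ up u, Kc s p & l = (u * p)%g] & forall u, up u -> D u -> LD u].
Proof.
have [U1 UM UV] := @upper_subgr F n; have [D1 DM DV] := sD.
have sUD : subgr (fun u => up u /\ D u) by apply: subgrI => //; exact: upper_subgr.
have [K1 KM KV] := @Kc_subgr F n s; split.
- apply: (setM_subgr sUD (@Kc_subgr F n s)).
  by move=> k l [_ /D0 Kk]; exact: Kc_normal.
- by move=> _ [k [l [[_ Dk] Kl ->]]]; apply: DM => //; exact: KD.
- by move=> k Kk; exists 1%g, k; rewrite mul1g.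
- by move=> _ [k [l [[hk Dk] Kl ->]]]; exists k, l.
- by move=> u hu Du; exists u, 1%g; rewrite mulg1.
Qed.

Lemma LD_transv : exists (T : finType) (t : T -> G), transv t D LD.
Proof.
have [sL LD' KL _ _] := LD_facts.
have [T [f tr]] := Kc0_transv F n s.
have [[T1 [f1 tr1]] _] := transv_sub (@Kc_subgr F n 0) sD (@Kc_subgr F n s) D0 KD tr.
by have [_ h] := transv_sub sD sL (@Kc_subgr F n s) LD' KL tr1.
Qed.

End InD.



Lemma index_neq0 D E (s t : nat) (T : finType) (f : T -> G) a : (0 < s)%N -> (s <= t)%N ->
  subgr D -> subgr E -> E `<=` D -> transv f D E ->
  D = [set g | Kc s (a^-1 * g * a)%g] -> [set g | Kc t (a^-1 * g * a)%g] `<=` E -> #|T|%:R != 0 :> R.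
Proof.
move=> s0 st sD sE ED tr eD sub.
have [I [x [xtr nz]]] := filt_tr (GL_filt sq n) s0 st.
have tr2 := transv_conj a xtr; rewrite -eD in tr2.
have sH := subgr_conj a (@Kc_subgr F n t).
have [[I' [x' tr3]] _] := transv_sub sD sE sH ED sub tr2.
have tr4 := transv_tower sD sE sH ED sub tr tr3.
have := transv_card sD sH (fun g hg => ED _ (sub _ hg)) tr2 tr4.
rewrite card_prod => e; move: nz; rewrite e natrM mulf_eq0 negb_or => /andP[].
by [].
Qed.

(** ** Coordinates on the diagonal torus *)

Definition shf (i : 'I_n) (c : int) (y : 'I_n -> int) : 'I_n -> int := fun k : 'I_n => y k + ((k == i) : nat)%:Z * c.

(** The exponents of the product of the [zt i.+1 ^ y i]. *)
Definition xof (y : 'I_n -> int) : 'I_n -> int := fun a : 'I_n => \sum_(i < n | (a <= i)%N) y i.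

Definition ay y : G := dg F (xof y).

Lemma shfK i c : cancel (shf i c) (shf i (- c)).
Proof. by move=> y; apply/funext => k; rewrite /shf mulrN addrK. Qed.

Lemma shfKV i c : cancel (shf i (- c)) (shf i c).
Proof. by move=> y; apply/funext => k; rewrite /shf mulrN subrK. Qed.

Lemma ay_shf i y : ay (shf i 1 y) = (ay y * zt F n i.+1)%g.
Proof.
rewrite /ay /zt dgM; congr dg; apply/funext => a; rewrite /xof /shf big_split; congr (_ + _).
rewrite big_mkcond (bigD1 i) //= big1 ?addr0 => [|k /negbTE ki]; last by rewrite ki mul0r; case: ifP.
by rewrite eqxx mulr1 ltnS; case: ifP.
Qed.

Lemma xof_next y (a : 'I_n) (h : (a.+1 < n)%N) : xof y a = y a + xof y (Ordinal h).
Proof.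
rewrite /xof (bigD1 a) //=; congr (_ + _); apply: eq_bigl => i; rewrite -val_eqE /=; lia.
Qed.

Lemma xof_last y (a : 'I_n) : a.+1 = n -> xof y a = y a.
Proof.
move=> e; rewrite /xof (bigD1 a) //= big1 ?addr0 // => i; rewrite -val_eqE /=.
by have := ltn_ord i; lia.
Qed.

Lemma xof_inj : injective xof.
Proof.
move=> y y' e; apply/funext => a; have [h|h] := ltnP a.+1 n.
  by have := congr1 (@^~ a) e; rewrite /= !(xof_next _ h) e => /addIr.
have ea : a.+1 = n by have := ltn_ord a; lia.
by have := congr1 (@^~ a) e; rewrite /= !xof_last.
Qed.

Lemma xof_surj x : exists y, xof y = x.
Proof.
pose x' (k : nat) := if insub k is Some a then x a else 0.
have x'E (a : 'I_n) : x' a = x a by rewrite /x' valK.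
exists (fun a : 'I_n => x' a - x' a.+1); apply/funext => a; rewrite -x'E.
have [k] := ubnP (n - a); elim: k a => // k IH a.
have [h|h] := ltnP a.+1 n => ak.
  by rewrite (xof_next _ h) IH /= ?subrK //; lia.
have ea : a.+1 = n by have := ltn_ord a; lia.
have e0 : x' a.+1 = 0 by rewrite /x' insubF // ea ltnn.
by rewrite xof_last // e0 subr0.
Qed.

(** ** The measure of [N a K_s] *)

Definition ms (s : nat) y : R := mu (ind (NS (ay y) (Kc s))).

Lemma Kc_KM (s t : nat) g k : (s <= t)%N -> Kc s g -> Kc t k -> Kc s (g * k)%g.
Proof. by move=> st Kg Kk; have [_ KM _] := @Kc_subgr F n s; apply: KM => //; exact: Kc_le Kk. Qed.

Lemma Kc_sub0 (s t : nat) : (s <= t)%N -> Kc t `<=` Kc s.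
Proof. by move=> st g; exact: Kc_le. Qed.

(** Volumes at two levels differ by the index of a subgroup between them, a power of [resq F] in [R]. *)
Lemma ms_level (s t : nat) : (0 < s)%N -> (s <= t)%N -> exists2 c : R, c != 0 & forall y, ms s y = c * ms t y.
Proof.
move=> s0 st; have D0 : Kc s `<=` Kc 0 by exact: Kc_sub0.
have KD := Kc_sub0 st; have sD := @Kc_subgr F n s.
have [sL LD' KL NE NDE] := LD_facts sD D0 KD.
have [T [f tr]] := LD_transv sD D0 KD.
exists #|T|%:R => [|y].
  apply: (@index_neq0 _ _ s t T f 1%g s0 st sD sL LD' tr).
    by apply/funext => g; rewrite /= invg1 mul1g mulg1.
  by move=> g /=; rewrite invg1 mul1g mulg1 => /KL.
apply: (mu_coset1 (xof y) (s := t) sD sL LD' KL NE NDE tr D0) => g k; exact: Kc_KM.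
Qed.

(** Conjugation by [z] carries [K_1] to [H], so both volumes are multiples of that of [N a E] with [E] the
intersection of [H] and [K_1]; by the Iwahori factorisation [N a E] and [N a K_1] coincide. *)
Lemma ms_shift1 (i : 'I_n) : exists2 c : R, c != 0 & forall y, ms 1 (shf i 1 y) = c * ms 1 y.
Proof.
pose z := zt F n i.+1; pose H : set G := [set h | Kc 1 (z^-1 * h * z)%g]; pose E := H `&` Kc 1.
have sH : subgr H by exact: subgr_conj (@Kc_subgr F n 1).
have sE : subgr E by apply: subgrI => //; exact: Kc_subgr.
have [U1 UM UV] := @upper_subgr F n; have [K1 KM KV] := @Kc_subgr F n 1.
have EH : E `<=` H by move=> g [].
have zJ g : (z * (z^-1 * g * z) * z^-1 = g)%g by rewrite !mulgE.
have bnd (s : nat) g : Kc s.+1 (z^-1 * g * z)%g -> mxO s (glmx g - 1%:M).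
  move=> [Kg _] a b; rewrite -(zJ g) dgJ1E.
  apply: (@inO_le F s (-1 + s.+1%:Z)); first by lia.
  by apply: inOM (Kg a b); apply: inO_le (inO_pw _ _); lia.
have HV g (s : nat) : Kc s.+1 (z^-1 * g * z)%g -> Kc s.+1 (z^-1 * g^-1 * z)%g.
  have [_ _ KV'] := @Kc_subgr F n s.+1; move=> /KV'; by rewrite !mulgE.
have H0 : H `<=` Kc 0.
  move=> g Hg; split; first exact: bnd.
  by apply: (bnd 0%N); exact: HV.
have K2 g : Kc 2 g -> Kc 1 (z^-1 * g * z)%g.
  move=> [Kg _]; apply: Kc1P => // a b; rewrite dgVJ1E.
  apply: (@inO_le F 1 (-1 + 2)); first by lia.
  by apply: inOM (Kg a b); apply: inO_le (inO_pw _ _); lia.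
have K2E : Kc 2 `<=` E by move=> g Kg; split; [exact: K2|exact: Kc_le Kg].
have K3E : [set g | Kc 3 (z^-1 * g * z)%g] `<=` E.
  move=> g Kg; apply: K2E; split; first exact: bnd.
  by apply: (bnd 2%N); exact: HV.
have NDE u : up u -> H u -> E u.
  move=> hu Hu; split=> //; apply: Kc1P => // a b; rewrite -(zJ u) dgJ1E.
  have [ab|ba] := ltnP a b.
    apply: (@inO_le F 1 (0 + 1)); first by lia.
    by apply: inOM (Hu.1 a b); apply: inO_le (inO_pw _ _); lia.
  have := hu a b ba; rewrite -{1}(zJ u) dgJE.
  rewrite mxB1E; case: eqP => [->|_].
    by rewrite subrr expr0z !mul1r => ->; rewrite subrr inO0.
  by rewrite subr0 => ->; exact: inO0.
have [T0 [f0 tr0]] := Kc0_transv F n 2.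
have K2H : Kc 2 `<=` H by move=> g /K2E [].
have [[T1 [f1 tr1]] _] := transv_sub (@Kc_subgr F n 0) sH (@Kc_subgr F n 2) H0 K2H tr0.
have [_ [T [f tr]]] := transv_sub sH sE (@Kc_subgr F n 2) EH K2E tr1.
exists #|T|%:R => [|y].
  exact: (@index_neq0 H E 1 3 T f z isT isT sH sE EH tr erefl K3E).
have EE l : E l -> exists u p, [/\ up u, E p & l = (u * p)%g] by move=> El; exists 1%g, l; rewrite mul1g.
have PK g k : E g -> Kc 2 k -> E (g * k)%g.
  by move=> Eg /K2E Ek; have [_ EM _] := sE; exact: EM.
have e1 := mu_coset1 (xof y) sH sE EH (fun g hg => hg) EE NDE tr H0 PK.
have -> : ms 1 y = mu (ind (NS (ay y) E)).
  congr mu; apply/funext => g; rewrite /ind /rst; congr (if _ then _ else _).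
  apply: asbool_equiv_eq; split=> -[u [k [hu Kk ->]]]; last by exists u, k; split=> //; case: Kk.
  have [v [k' [Uv Kk' Hk' ek]]] := Kc_zt i.+1 (isT : (0 < 1)%N) Kk.
  have hv : up v.
    move=> a b ba; have := Uv.1 a b; rewrite mxB1E => /(_ _)/eqP; rewrite subr_eq0 => h.
    by apply/eqP; apply: h; rewrite /Ji; lia.
  exists (u * (ay y * v * (ay y)^-1))%g, k'; split=> //; first by apply: UM => //; exact: upper_dgJ.
  by rewrite ek !mulgE.
rewrite -e1 /ms ay_shf -/z.
have QH : Qf (ind (NS (ay y) H)).
  apply: (@Qf_NS _ _ _ 2) => // g k Hg Kk; have [_ HM _] := sH; apply: HM => //; exact: K2H.
rewrite -(mu_tr z^-1%g QH); congr mu; apply/funext => g; rewrite /ind /rst.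
congr (if _ then _ else _); apply: asbool_equiv_eq; split=> -[u [k [hu Kk e]]].
  exists u, (z * k * z^-1)%g; split=> //; first by rewrite /H /= !mulgE.
  by rewrite e !mulgE.
exists u, (z^-1 * k * z)%g; split=> //.
by rewrite -[g](mulgVK z) e !mulgE.
Qed.

Definition tc (i : 'I_n) : R := s2val (cid2 (ms_shift1 i)).

Lemma tc_neq0 i : tc i != 0. Proof. exact: s2valP (cid2 (ms_shift1 i)). Qed.

Lemma ms_shift (s : nat) i y : (0 < s)%N -> ms s (shf i 1 y) = tc i * ms s y.
Proof.
move=> s0; have [c c0 hc] := ms_level (isT : (0 < 1)%N) s0.
apply: (mulfI c0); rewrite -hc mulrCA -hc; exact: (s2valP' (cid2 (ms_shift1 i)) y).
Qed.


(** ** Integration in torus coordinates *)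

Lemma iwasawa_y g : exists u y k, [/\ up u, Kc 0 k & g = (u * ay y * k)%g].
Proof.
have [u [x [k [hu Kk ->]]]] := iwasawa g; have [y <-] := xof_surj x.
by exists u, y, k.
Qed.

Lemma iwasawa_uniq u u' y y' k k' : up u -> up u' -> Kc 0 k -> Kc 0 k' ->
  (u * ay y * k = u' * ay y' * k')%g -> y = y'.
Proof.
have [U1 UM UV] := @upper_subgr F n; have [K1 KM KV] := @Kc_subgr F n 0.
move=> hu hu' Kk Kk' e; apply: xof_inj; apply/funext => a.
have aux u1 u2 y1 y2 k1 k2 : up u1 -> up u2 -> Kc 0 k1 -> Kc 0 k2 ->
    (u1 * ay y1 * k1 = u2 * ay y2 * k2)%g -> xof y2 a <= xof y1 a.
  move=> h1 h2 Kk1 Kk2 e12.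
  have : Kc 0 ((ay y2)^-1 * (u2^-1 * u1) * ay y1)%g.
    have -> : ((ay y2)^-1 * (u2^-1 * u1) * ay y1 = k2 * k1^-1)%g.
      apply: (mulIg k1); rewrite mulgVK.
      have -> : ((ay y2)^-1 * (u2^-1 * u1) * ay y1 * k1 = (u2 * ay y2)^-1 * (u1 * ay y1 * k1))%g by rewrite !mulgE.
      by rewrite e12 !mulgE.
    by apply: KM => //; exact: KV.
  move=> /Kc_int /(_ a a); rewrite /ay dgV 2!glmxM mul_mxdE mul_dmxE.
  have := UM _ _ (UV _ h2) h1 => /(_ a a (leqnn _)) ->; rewrite eqxx mulr1 -expfzDr ?unif_neq0 //.
  by rewrite /inO (negbTE (@pw_neq0 F _)) /= lfval_pw; lia.
by apply/eqP; rewrite eq_le (aux u u' y y' k k') // (aux u' u y' y k' k).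
Qed.

Lemma decompose_K0 f (l : seq ('I_n -> int)) g : uniq l ->
  (forall y k, Kc 0 k -> linv f -> f (ay y * k)%g != 0 -> y \in l) -> linv f ->
  f g = \sum_(y <- l) rst (NS (ay y) (Kc 0)) f g.
Proof.
move=> ul hl li; have [u [y [k [hu Kk eg]]]] := iwasawa_y g.
have out y' : NS (ay y') (Kc 0) g -> y' = y.
  by move=> [u' [k' [hu' Kk' e]]]; apply: (iwasawa_uniq hu' hu Kk' Kk); rewrite -e -eg.
have yg : NS (ay y) (Kc 0) g by exists u, k.
have [yl|nyl] := boolP (y \in l).
  rewrite (bigD1_seq y) //= big1 ?addr0 => [|y' y'y]; first by rewrite /rst asboolT.
  by rewrite /rst; case: asboolP => // /out e; case/eqP: y'y.
have e0 : f g = 0.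
  apply/eqP; apply: contraNT nyl => nz; apply: (hl y k) => //.
  by move: nz; rewrite eg -mulgA (li u _ hu).
by rewrite e0 big1 // => y' _; rewrite /rst e0; case: ifP.
Qed.

Lemma mu_K0 (s : nat) : exists (T : finType) (t : T -> G), (forall i, Kc 0 (t i)) /\
  forall f y, linv f -> rinv s f ->
    mu (rst (NS (ay y) (Kc 0)) f) = ms s y * \sum_i f (ay y * t i)%g.
Proof.
have sD := @Kc_subgr F n 0; have [K1 KM KV] := sD.
have D0 : Kc 0 `<=` Kc 0 by [].
have KD := Kc_sub0 (leq0n s).
have [sL LD' KL NE NDE] := LD_facts sD D0 KD.
have [T [t tr]] := LD_transv sD D0 KD.
have Kt i : Kc 0 (t i)^-1%g by apply: KV; exact: tr.1.
exists T, (fun i => (t i)^-1%g); split=> // f y li ri.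
rewrite (mu_coset (xof y) (s := s) (s' := s) sD sL LD' KL NE NDE tr D0 _ li ri) // => [|g k]; last exact: Kc_KM.
rewrite mulr_sumr; apply: eq_bigr => i _; rewrite mulrC /ms /ind.
rewrite -mu_scale; last by apply: (@Qf_NS _ _ _ s) => // g k; exact: Kc_KM.
congr mu; apply/funext => g; rewrite /rst; case: asboolP => [[u [k [hu Kk ->]]]|_]; last by rewrite mulr0.
rewrite mulr1; have := Kc_normal (Kt i) Kk; rewrite invgK => Kk'.
have -> : (u * dg F (xof y) * k * (t i)^-1 = u * (dg F (xof y) * (t i)^-1 * (t i * k * (t i)^-1)))%g.
  by rewrite !mulgE.
by rewrite li //; exact: ri.
Qed.

(** Each of the finitely many translates lies over one torus element, by the uniqueness in the
Iwasawa decomposition. *)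
Lemma Qf_torus f : Qf f -> exists l : seq ('I_n -> int), uniq l /\
  forall y k, Kc 0 k -> f (ay y * k)%g != 0 -> y \in l.
Proof.
move=> [li [s hs] [T [h hT]]].
have /choice [yy hy] i : exists y, exists u k, [/\ up u, Kc 0 k & h i = (u * ay y * k)%g].
  by have [u [y [k hyp]]] := iwasawa_y (h i); exists y, u, k.
have [U1 UM UV] := @upper_subgr F n; have [K1 KM KV] := @Kc_subgr F n 0.
exists (undup (codom yy)); split=> [|y k Kk /hT [i [u [k' [hu Kk' e]]]]]; first exact: undup_uniq.
rewrite mem_undup; have [u' [k2 [hu' Kk2 e2]]] := hy i.
suff -> : y = yy i by exact: codom_f.
apply: (iwasawa_uniq U1 (UM _ _ hu hu') Kk (KM _ _ Kk2 Kk')).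
by rewrite mul1g e e2 !mulgE.
Qed.

(** Decompose [f] over the sets [N a_y K_0], and each of these into cosets of [K_s]. *)
Lemma mu_formula (s : nat) : exists (T : finType) (t : T -> G), (forall i, Kc 0 (t i)) /\
  forall f, Qf f -> rinv s f ->
    let H y := ms s y * \sum_i f (ay y * t i)%g in fsupp H /\ mu f = fsum H.
Proof.
have [T [t [Kt hmuK]]] := mu_K0 s; exists T, t; split=> // f Qff ri H.
have [li _ _] := Qff; have [l [ul hl]] := Qf_torus Qff.
have hH y : H y != 0 -> y \in l.
  apply: contraNT => ny; rewrite /H big1 ?mulr0 // => i _.
  by apply/eqP; apply: contraNT ny; exact: hl.
split; first by exists l.
rewrite (fsum_seq ul hH) -(eq_bigr _ (fun y _ => hmuK f y li ri)).
rewrite -mu_seq => [|y].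
  by congr mu; apply/funext => g; apply: decompose_K0 => // y k Kk _; exact: hl.
by apply: (@Qf_NS _ _ _ s) => // g k; exact: Kc_KM.
Qed.


(** Every [y] is reached from [0] by unit steps in the coordinates. *)
Lemma coord_const (M : ('I_n -> int) -> R) (c : 'I_n -> R) : (forall i, c i != 0) ->
  (forall i y, M (shf i 1 y) = c i * M y) -> M (fun=> 0) = 0 -> forall y, M y = 0.
Proof.
move=> c0 hM M0.
have key i (e : int) y : (M (shf i e y) == 0) = (M y == 0).
  have nat_case (k : nat) y' : (M (shf i k y') == 0) = (M y' == 0).
    elim: k y' => [|k IH] y'.
      congr (_ == _); congr M; apply/funext => a; by rewrite /shf mulr0 addr0.
    have -> : shf i k.+1 y' = shf i 1 (shf i k y').
      by apply/funext => a; rewrite /shf -addrA -mulrDr; congr (_ + _ * _); lia.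
    by rewrite hM mulf_eq0 (negbTE (c0 i)) IH.
  case: (intP e) => [|k|k]; try exact: nat_case.
  by rewrite -{2}[y](shfKV i k.+1) nat_case.
move=> y; pose z (k : nat) : 'I_n -> int := fun a : 'I_n => if (a < k)%N then y a else 0.
have zM (k : nat) : M (z k) = 0.
  elim: k => [|k IH]; first by rewrite -M0; congr M.
  have [kn|nk] := ltnP k n; last first.
    by rewrite -IH; congr M; apply/funext => a; rewrite /z !(leq_trans (ltn_ord a)) // ltnW.
  apply/eqP.
  have -> : z k.+1 = shf (Ordinal kn) (y (Ordinal kn)) (z k).
    apply/funext => a; rewrite /z /shf ltnS -val_eqE /= leq_eqVlt.
    have [e|ne] := eqVneq (a : nat) k; last by rewrite mul0r addr0.
    rewrite e ltnn mul1r add0r; congr y; exact: val_inj.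
  by rewrite key IH eqxx.
rewrite -(zM n); congr M; apply/funext => a; by rewrite /z ltn_ord.
Qed.

(** Otherwise all the weights in [mu_formula] vanish and the measure is zero. *)
Lemma ms_neq0 (s : nat) : (0 < s)%N -> ms s (fun=> 0) != 0.
Proof.
move=> s0; apply/eqP => e; have [_ _ [f /CqP Qff]] := hmu; apply/negP; rewrite negbK.
have [_ [s' hs'] _] := Qff; pose u := maxn s s'.
have [T [t [_ /(_ f Qff)]]] := mu_formula u.
have ru : rinv u f by move=> g k Kk; apply: hs'; apply: Kc_le Kk; exact: leq_maxr.
move=> /(_ ru) [fs ->].
have su : (s <= u)%N by exact: leq_maxl.
have [c c0 hc] := ms_level s0 su.
have z y : ms u y = 0.
  apply: (coord_const tc_neq0) => [i y'|]; first by apply: ms_shift; exact: leq_trans su.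
  by apply/eqP; have := hc (fun=> 0); rewrite e => /esym/eqP; rewrite mulf_eq0 (negbTE c0).
by rewrite (@fsum_seq _ _ [::]) ?big_nil // => y; rewrite z mul0r eqxx.
Qed.

(** The volume is that of [N K_t] times an index which divides a power of [resq F]. *)
Lemma mu_ND D (s t : nat) : (0 < s)%N -> (s <= t)%N -> subgr D -> D `<=` Kc s -> Kc t `<=` D ->
  mu (ind (NS 1%g D)) != 0.
Proof.
move=> s0 st sD DK KD; have D0 : D `<=` Kc 0 by move=> g /DK; exact: Kc_sub0.
have [sL LD' KL NE NDE] := LD_facts sD D0 KD.
have [T [f tr]] := LD_transv sD D0 KD.
have one : ay (fun=> 0) = 1%g by apply: dg0 => a; rewrite /xof big1.
have := mu_coset1 (xof (fun=> 0)) (s := t) sD sL LD' KL NE NDE tr D0 (fun g k => @Kc_KM t t g k (leqnn t)).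
rewrite -/(ay _) one => ->; rewrite mulf_neq0 //; last first.
  by have := ms_neq0 (leq_trans s0 st); rewrite /ms one.
have [I [x [xtr nz]]] := filt_tr (GL_filt sq n) s0 st.
have sKt := @Kc_subgr F n t; have sKs := @Kc_subgr F n s.
have [[I1 [x1 tr1]] [I2 [x2 tr2]]] := transv_sub sKs sD sKt DK KD xtr.
have [[I3 [x3 tr3]] _] := transv_sub sD sL sKt LD' KL tr1.
have tr4 := transv_tower sKs sD sKt DK KD tr2 (transv_tower sD sL sKt LD' KL tr tr3).
have := transv_card sKs sKt (Kc_sub0 st) xtr tr4.
by rewrite !card_prod => e; move: nz; rewrite e !natrM !mulf_eq0 !negb_or => /and3P[].
Qed.

End Quotient.

(** * Rationality *)

Section Recurrences.
Variable R : closedFieldType.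

Lemma pact_pact_comm (V : lmodType R) (A B : {linear V -> V}) p q v :
  (forall x, A (B x) = B (A x)) -> pact A p (pact B q v) = pact B q (pact A p v).
Proof.
move=> AB; rewrite /pact -/(pact A p _) pact_vsum; apply: eq_bigr => i _.
rewrite pact_vZ; congr (_ *: _); elim: (i : nat) => [//|k IH].
by rewrite !iterS pact_comm ?IH.
Qed.

Section Pull.
Variables (I : Type) (h : I -> I).

Definition pull_fun (f : I -> R^o) : I -> R^o := fun y => f (h y).

Lemma pull_lin : linear pull_fun. Proof. by []. Qed.

HB.instance Definition _ := GRing.isLinear.Build R (I -> R^o) (I -> R^o) *:%R pull_fun pull_lin.

Definition pull : {linear (I -> R^o) -> (I -> R^o)} := pull_fun.

Lemma iter_pull k f y : iter k pull f y = f (iter k h y).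
Proof. by elim: k f y => [|k IH] f y //; rewrite iterSr IH. Qed.

Lemma pact_pull (p : {poly R}) f y : pact pull p f y = \sum_(j < size p) p`_j * f (iter j h y).
Proof.
rewrite /pact; elim/big_rec2: _ => [//|j a b _ <-].
by rewrite -[LHS]/(p`_j * (iter j pull f y) + b y) iter_pull.
Qed.

End Pull.

(** [f] satisfies the linear recurrence with characteristic polynomial [p]. *)
Definition recur (p : {poly R}) (f : nat -> R) := forall a, \sum_(j < size p) p`_j * f (a + j)%N = 0.

Lemma recurP p f : recur p f <-> pact (pull S) p f = 0.
Proof.
split=> [h|h a].
  apply/funext => a; rewrite pact_pull -[RHS](h a); apply: eq_bigr => j _; congr (_ * f _).
  by elim: (j : nat) a => [|k IH] a; rewrite ?addn0 // iterSr IH addSnnS.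
have := congr1 (@^~ a) h; rewrite pact_pull => e; rewrite -[RHS]e; apply: eq_bigr => j _; congr (_ * f _).
by elim: (j : nat) a {e} => [|k IH] a; rewrite ?addn0 // iterSr -IH addSnnS.
Qed.

Lemma recur_mul p q : p != 0 -> q != 0 -> exists2 Q : {poly R}, Q != 0 &
  forall f g, recur p f -> recur q g -> recur Q (fun a => f a * g a).
Proof.
move=> p0 q0; have [Q Q0 hQ] := product_recurrence p0 q0; exists Q => // f g hf hg.
pose h1 (x : nat * nat) := (x.1.+1, x.2); pose h2 (x : nat * nat) := (x.1, x.2.+1).
pose h3 (x : nat * nat) := (x.1.+1, x.2.+1).
have i1 k x : iter k h1 x = ((x.1 + k)%N, x.2).
  by elim: k => [|k IH]; rewrite ?addn0 -?surjective_pairing // iterS IH /h1 /= addnS.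
have i2 k x : iter k h2 x = (x.1, (x.2 + k)%N).
  by elim: k => [|k IH]; rewrite ?addn0 -?surjective_pairing // iterS IH /h2 /= addnS.
have i3 k x : iter k h3 x = ((x.1 + k)%N, (x.2 + k)%N).
  by elim: k => [|k IH]; rewrite ?addn0 -?surjective_pairing // iterS IH /h3 /= !addnS.
pose v : nat * nat -> R^o := fun x => f x.1 * g x.2.
have e1 : pact (pull h1) p v = 0.
  apply/funext => x; transitivity ((\sum_(j < size p) p`_j * f (x.1 + j)%N) * g x.2).
    rewrite pact_pull mulr_suml; apply: eq_bigr => j _; by rewrite i1 mulrA.
  by rewrite hf mul0r.
have e2 : pact (pull h2) q v = 0.
  apply/funext => x; transitivity (f x.1 * \sum_(j < size q) q`_j * g (x.2 + j)%N).
    rewrite pact_pull mulr_sumr; apply: eq_bigr => j _; by rewrite i2 /v mulrCA.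
  by rewrite hg mulr0.
have := hQ _ (pull h1) (pull h2) (pull h3) v (fun=> erefl) (fun=> erefl) e1 e2.
move=> /(congr1 (fun F : nat * nat -> R^o => F)) e a.
have := congr1 (@^~ (a, a)) e; rewrite pact_pull => e'; rewrite -[RHS]e'.
by apply: eq_bigr => j _; rewrite i3.
Qed.

Lemma recur_geom c : recur ('X - c%:P) (fun a => c ^+ a).
Proof.
apply/recurP; rewrite pactD pactN pactC; apply/eqP; rewrite subr_eq0; apply/eqP.
rewrite -[X in pact _ X]expr1 pactXn; apply/funext => a.
by rewrite /= -[LHS]/(c ^+ a.+1) exprS.
Qed.

End Recurrences.

Section Engine.
Variables (F : localFieldType) (R : closedFieldType) (sq : sqrt_resq F R) (n : nat).
Local Notation G := (GL F n).
Local Notation Kc := (@Kc F n).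
Variable mu : (G -> R) -> R.
Hypothesis hmu : quotient_measure mu.
Implicit Types (H : ('I_n -> int) -> R^o) (i : 'I_n).

Local Notation vdet g := (lfval (\det (glmx g))).

Definition wt (y : 'I_n -> int) : int := \sum_(i < n) i.+1%:Z * y i.

Lemma wt_shf i c y : wt (shf i c y) = wt y + i.+1%:Z * c.
Proof.
rewrite /wt /shf (bigD1 i) //= [in RHS](bigD1 i) //= eqxx mul1r mulrDr -!addrA [_ * c + _]addrC.
by congr (_ + (_ + _)); apply: eq_bigr => k /negbTE ->; rewrite mul0r addr0.
Qed.

Lemma lfval_prod (I : Type) (l : seq I) (f : I -> F) : (forall x, f x != 0) ->
  lfval (\prod_(x <- l) f x) = \sum_(x <- l) lfval (f x).
Proof.
move=> h; elim: l => [|i l IH]; first by rewrite !big_nil lfval1.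
rewrite !big_cons lfvalM ?IH //.
by elim/big_ind: _ => // *; rewrite ?oner_neq0 ?mulf_neq0.
Qed.

Lemma vdet_dg x : vdet (dg F x) = \sum_(a < n) x a.
Proof.
have -> : \det (glmx (dg F x)) = \prod_(a < n) unif ^ (x a).
  rewrite det_trig; last first.
    by apply/is_trig_mxP => a b ab; rewrite dmxE -val_eqE /= ltn_eqF // mulr0n.
  by apply: eq_bigr => a _; rewrite dmxE eqxx mulr1n.
rewrite lfval_prod => [|a]; last exact: pw_neq0.
by apply: eq_bigr => a _; rewrite lfval_pw.
Qed.

Lemma vdet_ay y : vdet (ay F y) = wt y.
Proof.
rewrite vdet_dg /xof; under eq_bigr do rewrite big_mkcond.
rewrite exchange_big; apply: eq_bigr => i _ /=; rewrite -big_mkcond.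
by rewrite -(big_ord_widen n (fun=> y i) (ltn_ord i)) sumr_const card_ord -mulr_natl natz.
Qed.

Lemma vdet_upper (u : G) : upper_unipotent u -> vdet u = 0.
Proof.
move=> hu; rewrite -det_tr det_trig; last first.
  by apply/is_trig_mxP => a b ab; rewrite mxE hu ?(ltnW ab) // -val_eqE /= gtn_eqF.
by rewrite big1 ?lfval1 // => a _; rewrite mxE hu // eqxx.
Qed.


Lemma vdet_mul (g h : G) : vdet (g * h)%g = vdet g + vdet h.
Proof. exact: vdetM. Qed.

Lemma bounded_finite (C K : int) : exists l : seq ('I_n -> int),
  forall y, (forall i, C <= y i) -> wt y <= K -> y \in l.
Proof.
pose B := absz (K - C * \sum_(i < n) i.+1%:Z)%R.
exists (codom (fun (c : {ffun 'I_n -> 'I_B.+1}) (i : 'I_n) => C + (c i : nat)%:Z)) => y hC hK.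
have bnd i : (`|y i - C| <= B)%N.
  have : y i - C <= K - C * \sum_(i < n) i.+1%:Z.
    apply: (@le_trans _ _ (wt y - C * \sum_(i < n) i.+1%:Z)); last by rewrite lerD2r.
    rewrite /wt mulr_sumr -sumrB (bigD1 i) //=.
    have p (k : 'I_n) : 0 <= k.+1%:Z * y k - C * k.+1%:Z by have := hC k; nia.
    have := p i; have : 0 <= \sum_(k < n | k != i) (k.+1%:Z * y k - C * k.+1%:Z).
      by apply: sumr_ge0 => k _; exact: p.
    move: (\sum_(k < n | k != i) _) => r; have := hC i; nia.
  have := hC i; rewrite /B; lia.
have -> : y = (fun i => C + ([ffun i => inord `|y i - C|%N : 'I_B.+1] i : nat)%:Z).
  apply/funext => i; rewrite ffunE inordK ?ltnS //; have := hC i; lia.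
exact: codom_f.
Qed.

(** Conditions which leave finitely many torus elements for each valuation of the determinant. *)
Definition tame f C (s : nat) := [/\ linv f, rinv s f &
  forall y k, Kc 0 k -> f (ay F y * k)%g != 0 :> R -> forall i, C <= y i].

Definition cf (f : G -> R) (k : int) : G -> R := fun g => if vdet g == k then f g else 0.

Lemma cf_rinv f s k : rinv s f -> rinv s (cf f k).
Proof.
move=> hs g h Kh; rewrite /cf vdet_mul (vdet_Kc (Kc_le (leq0n s) Kh)) addr0.
by rewrite hs.
Qed.

Lemma cf_Qf f C s k : tame f C s -> Qf (cf f k).
Proof.
move=> [li ri bd]; have [l hl] := bounded_finite C k; split.
- by move=> u g hu; rewrite /cf vdet_mul vdet_upper // add0r li.
- by exists s; exact: cf_rinv.
exists 'I_(size l), (fun j : 'I_(size l) => ay F (nth (fun=> 0) l j)) => g.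
rewrite /cf; case: ifP => [/eqP e nz|_]; last by rewrite eqxx.
have [u [y [h [hu Kh eg]]]] := iwasawa_y g.
have yl : y \in l.
  apply: hl; first by apply: (bd y h Kh); move: nz; rewrite eg -mulgA (li u _ hu).
  by rewrite -e eg !vdet_mul vdet_ay (vdet_Kc Kh) vdet_upper // add0r addr0.
have lt : (index y l < size l)%N by rewrite index_mem.
by exists (Ordinal lt), u, h; rewrite /= nth_index.
Qed.

Definition Pf H : int -> R^o := fun k => fsum (fun y => if wt y == k then H y else 0).

(** Functions on the torus with support in an orthant. *)
Definition bb H := exists C, forall y, H y != 0 -> forall i, C <= y i.

Lemma bb_fsupp H k : bb H -> fsupp (fun y => if wt y == k then H y else 0).
Proof.
move=> [C hC]; have [l hl] := bounded_finite C k; exists l => y.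
by case: ifP => [/eqP e /hC h|_]; [apply: hl => //; rewrite e|rewrite eqxx].
Qed.

Local Notation T := (pull R (fun k : int => k + 1)).
Local Notation S i := (pull R (@shf n i 1)).

Lemma bb_lin a H H' : bb H -> bb H' -> bb (a *: H + H').
Proof.
move=> [C hC] [C' hC']; exists (Num.min C C') => y.
have -> : (a *: H + H') y = a * H y + H' y by [].
have [e|nz _ i] := eqVneq (H y) 0; last by rewrite ge_min hC.
by rewrite e mulr0 add0r => nz i; rewrite ge_min hC' // orbT.
Qed.

Lemma bb_S H i : bb H -> bb (S i H).
Proof.
move=> [C hC]; exists (C - 1) => y /hC h k; have := h k; rewrite /shf; case: (k == i); lia.
Qed.

Lemma Pf_lin a H H' : bb H -> bb H' -> Pf (a *: H + H') = a *: Pf H + Pf H'.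
Proof.
move=> hH hH'; apply/funext => k; rewrite -[RHS]/(a * Pf H k + Pf H' k) /Pf.
rewrite -fsum_lin; [|exact: bb_fsupp|exact: bb_fsupp]; congr fsum; apply/funext => y.
by case: ifP => // _; rewrite mulr0 addr0.
Qed.

Lemma Pf_S H i : bb H -> Pf (S i H) = iter i.+1 T (Pf H).
Proof.
move=> hH; apply/funext => k; rewrite iter_pull.
have -> : iter i.+1 (fun k => k + 1) k = k + i.+1%:Z.
  by elim: (i.+1) => [|j IH]; rewrite ?addr0 // iterS IH; lia.
rewrite /Pf -(fsum_bij (@shfK n i 1) (@shfKV n i 1) (bb_fsupp (k + i.+1%:Z) hH)).2.
congr fsum; apply/funext => y; rewrite wt_shf mulr1.
by rewrite (inj_eq (addIr _)).
Qed.

Lemma bb_pact H i p : bb H -> bb (pact (S i) p H).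
Proof.
elim/poly_ind: p H => [|p c IH] H hH.
  by rewrite pact0; exists 0 => y; rewrite eqxx.
rewrite pactD pact_mulX pactC addrC; apply: bb_lin => //; apply: IH; exact: bb_S.
Qed.

Lemma Pf_pact H i p : bb H -> Pf (pact (S i) p H) = pact T (p \Po 'X^(i.+1)) (Pf H).
Proof.
elim/poly_ind: p H => [|p c IH] H hH.
  rewrite comp_poly0 !pact0 /Pf; apply/funext => k; rewrite (@fsum_seq _ _ [::]) ?big_nil // => y.
  by case: ifP; rewrite eqxx.
rewrite pactD pact_mulX pactC addrC Pf_lin //; last by apply: bb_pact; exact: bb_S.
rewrite IH ?Pf_S //; last exact: bb_S.
by rewrite comp_polyD comp_polyM comp_polyX comp_polyC pactD pactM pactC pactXn addrC.
Qed.

Definition van i H := exists C, forall y, C <= y i -> H y = 0.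

Lemma van_S i k H : van i H -> van i (S k H).
Proof. by move=> [C hC]; exists C => y h; apply: hC; rewrite /shf; case: (i == k); lia. Qed.

Lemma van_pact i k p H : van i H -> van i (pact (S k) p H).
Proof.
elim/poly_ind: p H => [|p c IH] H hH; first by rewrite pact0; exists 0.
rewrite pactD pact_mulX pactC; have [C1 h1] := IH _ (van_S k hH); have [C2 h2] := hH.
exists (Num.max C1 C2) => y; rewrite ge_max => /andP[g1 g2].
have -> : forall A B : ('I_n -> int) -> R^o, (A + B) y = A y + B y by [].
by rewrite h1 // -[(c *: H) y]/(c * H y) h2 // mulr0 addr0.
Qed.

(** Pushing forward along the weight [wt], a recurrence in each torus coordinate becomes
a recurrence in one variable, since a shift of [y i] moves the weight by [i + 1]. *)
Lemma pushforward_rational (Q : 'I_n -> {poly R}) H : bb H -> (forall i, van i (pact (S i) (Q i) H)) ->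
  fsupp (pact T (\prod_(i < n) (Q i \Po 'X^(i.+1))) (Pf H)).
Proof.
move=> hH hv.
have [H' [hH' hv' ->]] : exists H', [/\ bb H', forall i, van i H' &
    pact T (\prod_(i < n) (Q i \Po 'X^(i.+1))) (Pf H) = Pf H'].
  have aux (l : seq 'I_n) : exists H', [/\ bb H', forall i, i \in l \/ van i (pact (S i) (Q i) H'),
      forall i, i \in l -> van i H' & pact T (\prod_(i <- l) (Q i \Po 'X^(i.+1))) (Pf H) = Pf H'].
    elim: l => [|i l [H' [h1 h2 h3 h4]]].
      exists H; split=> // [i|]; first by right.
      by rewrite big_nil -polyC1 pactC scale1r.
    have SC i1 i2 x : S i1 (S i2 x) = S i2 (S i1 x).
      by apply/funext => y; rewrite /= /pull_fun; congr x; apply/funext => k; rewrite /shf addrAC.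
    exists (pact (S i) (Q i) H'); split.
    - exact: bb_pact.
    - move=> k; rewrite inE; have [->|ki] := eqVneq k i; first by left.
      case: (h2 k) => [->|hk]; [by left|right].
      have -> : pact (S k) (Q k) (pact (S i) (Q i) H') = pact (S i) (Q i) (pact (S k) (Q k) H').
        apply: pact_pact_comm => x; exact: SC.
      exact: van_pact.
    - move=> k; rewrite inE => /orP[/eqP ->|kl]; last by apply: van_pact; exact: h3.
      by case: (h2 i) => // il; apply: van_pact; exact: h3.
    - by rewrite big_cons pactM h4 Pf_pact.
  have [H' [h1 h2 h3 h4]] := aux (index_enum _).
  by exists H'; split=> // i; apply: h3; rewrite mem_index_enum.
(* after all the recurrences have been applied, the support is a bounded box *)
have [C hC] := hH'; have [C' hC'] := choice hv'.
pose W := \sum_(i < n) i.+1%:Z * `|C' i|.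
have [l hl] := bounded_finite C W.
exists (map wt l) => k; apply: contraNT => nk; rewrite /Pf.
rewrite (@fsum_seq _ _ [::]) ?big_nil // => y; case: ifP => [/eqP e nz|_]; last by rewrite eqxx.
case/negP: nk; rewrite -e; apply: map_f; apply: hl; first exact: hC.
rewrite /W; apply: ler_sum => i _; rewrite ler_wpM2l //.
have : ~~ (C' i <= y i) by apply: contra nz => /hC' ->.
by rewrite -ltNge; lia.
Qed.


Lemma iter_shf i (j : nat) y : iter j (shf i 1) y = shf i j y.
Proof.
elim: j => [|j IH]; apply/funext => k; first by rewrite /shf mulr0 addr0.
by rewrite iterS IH /shf -addrA -mulrDr; congr (_ + _ * _); lia.
Qed.

Lemma ms_shf (s : nat) i (j : nat) y : (0 < s)%N -> ms mu s (shf i j y) = tc sq hmu i ^+ j * ms mu s y.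
Proof.
move=> s0; rewrite -iter_shf; elim: j => [|j IH]; first by rewrite mul1r.
by rewrite iterS (ms_shift sq hmu) // IH exprS mulrA.
Qed.

(** The common denominator depends only on the recurrences satisfied on the torus. *)
Theorem torus_rational (Q : 'I_n -> {poly R}) : (forall i, Q i != 0) -> exists2 D : {poly R}, D != 0 &
  forall f C s, (0 < s)%N -> tame f C s ->
    (forall i h, Kc 0 h -> exists C', forall y, C' <= y i ->
       recur (Q i) (fun a : nat => f (ay F (shf i a y) * h)%g)) ->
    (forall k, k < C * \sum_(i < n) i.+1%:Z -> mu (cf f k) = 0) /\
    fsupp (pact T D (fun k => mu (cf f k) : R^o)).
Proof.
move=> Q0.
have ex i : exists Q' : {poly R}, Q' != 0 /\ forall f, recur (Q i) f ->
    recur Q' (fun a => tc sq hmu i ^+ a * f a).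
  have X0 : 'X - (tc sq hmu i)%:P != 0 by rewrite polyXsubC_eq0.
  have [Q' Q'0 hQ'] := recur_mul X0 (Q0 i).
  by exists Q'; split=> // f hf; apply: hQ' => //; exact: recur_geom.
have [Q' hQ'] := choice ex.
exists (\prod_(i < n) (Q' i \Po 'X^(i.+1))).
  by apply/prodf_neq0 => i _; rewrite comp_poly_eq0 ?size_polyXn //; exact: (hQ' i).1.
move=> f C s s0 tf hf; have [li ri bd] := tf.
have [I [t [Kt form]]] := mu_formula hmu s.
pose H : ('I_n -> int) -> R^o := fun y => ms mu s y * \sum_j f (ay F y * t j)%g.
have nzH y : H y != 0 -> exists j, f (ay F y * t j)%g != 0.
  move=> nz; apply: contrapT => no; case/eqP: nz; rewrite /H big1 ?mulr0 // => j _.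
  by apply/eqP; apply: contrapT => /negP ne; apply: no; exists j.
have hH : bb H.
  by exists C => y /nzH [j] /(bd _ _ (Kt j)).
have ZE k : mu (cf f k) = Pf H k.
  have [_ ->] := form _ (cf_Qf k tf) (cf_rinv k ri).
  rewrite /Pf; congr fsum; apply/funext => y; rewrite /H /cf.
  case: ifP => [e|ne].
    by congr (_ * _); apply: eq_bigr => j _; rewrite vdet_mul vdet_ay (vdet_Kc (Kt j)) addr0 e.
  by rewrite big1 ?mulr0 // => j _; rewrite vdet_mul vdet_ay (vdet_Kc (Kt j)) addr0 ne.
have hv i : van i (pact (S i) (Q' i) H).
  have /choice [C' hC'] j := hf i _ (Kt j).
  exists (\sum_j `|C' j|) => y hy; rewrite pact_pull.
  under eq_bigr do rewrite iter_shf /H ms_shf // mulrAC mulr_sumr.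
  have r j : \sum_(a < size (Q' i)) (Q' i)`_a * (tc sq hmu i ^+ a * f (ay F (shf i a y) * t j)%g) = 0.
    have rj : recur (Q i) (fun a : nat => f (ay F (shf i a y) * t j)%g).
      apply: hC'; apply: le_trans hy.
      by rewrite (bigD1 j) //= (le_trans (ler_norm _)) // lerDl sumr_ge0.
    exact: ((hQ' i).2 _ rj 0%N).
  transitivity (ms mu s y * \sum_j \sum_(a < size (Q' i)) (Q' i)`_a * (tc sq hmu i ^+ a * f (ay F (shf i a y) * t j)%g)).
    rewrite exchange_big mulr_sumr; apply: eq_bigr => a _ /=; rewrite !mulr_suml !mulr_sumr.
    by apply: eq_bigr => j _; ring.
  by rewrite big1 ?mulr0.
split=> [k hk|].
  rewrite ZE /Pf (@fsum_seq _ _ [::]) ?big_nil // => y; case: ifP => [/eqP e nz|_]; last by rewrite eqxx.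
  have [j /(bd _ _ (Kt j)) hy] := nzH y nz; move: hk; rewrite -e ltNge => /negP [].
  rewrite /wt mulr_sumr; apply: ler_sum => i _; have := hy i; nia.
have -> : (fun k => mu (cf f k) : R^o) = Pf H by apply/funext => k; exact: ZE.
exact: pushforward_rational.
Qed.

End Engine.

(** * Whittaker functions on the torus *)

Section Whittaker.
Variables (F : localFieldType) (R : closedFieldType) (sq : sqrt_resq F R).
Variables (theta : F -> R) (ht : nontrivial_smooth_character theta).
Variables (n : nat) (r : rep R (GL F n)) (lam : {scalar r}).
Hypothesis wl : whittaker_functional theta lam.
Local Notation G := (GL F n).
Local Notation Kc := (@Kc F n).
Local Notation ch := (char_of_unipotent theta).
Implicit Types (u g h : G) (i : 'I_n) (y : 'I_n -> int).

Lemma lamM u g x : upper_unipotent u -> lam (ract r (u * g)%g x) = ch u * lam (ract r g x).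
Proof. by move=> hu; rewrite ractM wl. Qed.

Lemma lam_torus u y x : upper_unipotent u ->
  lam (ract r (ay F y) (ract r u x)) = ch (ay F y * u * (ay F y)^-1)%g * lam (ract r (ay F y) x).
Proof.
move=> hu; have e : (ay F y * u = ay F y * u * (ay F y)^-1 * ay F y)%g by rewrite !mulgE.
rewrite -ractM [LHS](congr1 (fun g => lam (ract r g x)) e); exact: (lamM _ _ (upper_dgJ _ hu)).
Qed.

Lemma ch_torus u y : ch (ay F y * u * (ay F y)^-1)%g =
  theta (\sum_(i < n) \sum_(j < n | j == i.+1 :> nat) unif ^ (y i) * glmx u i j).
Proof.
rewrite /char_of_unipotent; congr theta; apply: eq_bigr => i _; apply: eq_bigr => j /eqP e.
have h : (i.+1 < n)%N by rewrite -e ltn_ord.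
have -> : j = Ordinal h by apply: val_inj.
by rewrite dgJE (xof_next y h) addrK.
Qed.

(** The column group: matrices which differ from the identity in the column [b] only. *)
Definition Jc (A : pred 'I_n) (b : 'I_n) : rel 'I_n := fun i k => A i && (k == b).

Lemma Jc_facts (A : pred 'I_n) (b : 'I_n) : (forall i, A i -> (i < b)%N) ->
  [/\ transitive (Jc A b), ranked (Jc A b) & UJ (Jc A b) `<=` @upper_unipotent F n].
Proof.
move=> hA; split.
- by move=> j i k /andP[Ai _] /andP[_ kb]; rewrite /Jc Ai.
- by exists (fun i => i : nat) => i k /andP[/hA ib /eqP ->].
- move=> u [hu _] i k ki; have := hu i k; rewrite mxB1E => h.
  apply/eqP; rewrite -subr_eq0; apply/eqP; apply: h; apply/negP => /andP[/hA ib /eqP e].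
  by move: ki; rewrite e leqNgt ib.
Qed.

(** For very negative [y i], the torus element carries a small root element fixing [x] to an
element on which [theta] is not trivial. *)
Lemma whittaker_decay (s : nat) : exists C : int, forall x, fixd Kc s x ->
  forall y h i, (i.+1 < n)%N -> Kc 0 h -> lam (ract r (ay F y * h)%g x) != 0 -> C <= y i.
Proof.
have [_ _ _ [x0 hx0]] := ht.
have x00 : x0 != 0 by apply: contraNneq hx0 => ->; rewrite (theta0 ht).
exists (lfval x0 - s%:Z) => x fx y h i h1 Kh nz; rewrite leNgt; apply/negP => lt.
pose b := Ordinal h1; pose A := pred1 i.
have hA k : A k -> (k < b)%N by move=> /eqP ->.
have [tJ rJ uJ] := Jc_facts hA.
(* the torus element carries the root element with entry [c] to the one with entry [x0] *)
pose c := unif ^ (- y i) * x0.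
pose X : 'M[F]_n := \matrix_(a, k) (if Jc A b a k then c else 0).
have sX : supp (Jc A b) X by move=> a k nJ; rewrite mxE (negbTE nJ).
have cO : inO s c.
  rewrite /c inO_pwM /inO (negbTE x00) /=; lia.
have OX : mxO s X by move=> a k; rewrite mxE; case: ifP => _ //; exact: inO0.
have [u [Ku Uu] eu] := @padm_ranked F n _ s tJ rJ X sX OX.
have fh : ract r u (ract r h x) = ract r h x.
  rewrite -ractM; have -> : (u * h = h * (h^-1 * u * h))%g by rewrite !mulgE.
  by rewrite ractM fx //; exact: Kc_normal.
move: nz; rewrite ractM; have := lam_torus y (ract r h x) (uJ _ Uu); rewrite fh ch_torus.
rewrite (bigD1 i) //= (bigD1 b) //= eu !mxE /Jc /A /= !eqxx /=.
have ib : (i == b) = false by rewrite -val_eqE /= ltn_eqF.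
rewrite ib add0r mulrA -expfzDr ?unif_neq0 // subrr expr0z mul1r.
rewrite big1 ?addr0 => [|k /andP[/eqP k1 /negbTE kb]]; last first.
  by case/negP: (negbT kb); apply/eqP; apply: val_inj.
rewrite big1 ?addr0 => [e|k /negbTE ki]; last first.
  apply: big1 => j /eqP ej; rewrite !mxE /Jc /A /= ki /= addr0.
  by case: eqP => [kj|_]; [move: ej; rewrite -kj; lia|rewrite mulr0].
move: e => /eqP; rewrite -{1}[lam _]mul1r -subr_eq0 -mulrBl mulf_eq0 subr_eq0 eq_sym (negbTE hx0) /=.
by move=> ->.
Qed.

(** For large [y i], the torus element carries [u] into the kernel of [theta], so the two
terms of [u w - w] cancel. *)
Lemma jac_decay i x : jac r (@Ji n i.+1) x -> exists C : int, forall y, C <= y i ->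
  lam (ract r (ay F y) x) = 0.
Proof.
have [c hc] := theta_conductor ht.
apply: (@span_min _ _ _ [set x | exists C : int, forall y, C <= y i -> lam (ract r (ay F y) x) = 0]).
  split=> [|a x1 x2 [C1 h1] [C2 h2]]; first by exists 0 => y _; rewrite !linear0.
  exists (Num.max C1 C2) => y; rewrite ge_max => /andP[g1 g2].
  by rewrite !linearP /= h1 // h2 // mulr0 addr0.
move=> _ [u [w [Uu ->]]]; have [e he] := mxO_exists (glmx u).
exists (c%:Z + e%:Z) => y hy; rewrite !linearB /= lam_torus; last first.
  move=> a b ba; have := Uu.1 a b; rewrite mxB1E => h; apply/eqP; rewrite -subr_eq0; apply/eqP.
  by apply: h; rewrite /Ji; lia.
rewrite ch_torus hc ?mul1r ?subrr //.
apply: inO_sum => a _; apply: inO_sum => b /eqP eb.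
have [/andP[ai ib]|nJ] := boolP (Ji i.+1 a b).
  have -> : a = i by apply: val_inj; move: ai ib; rewrite /= eb; lia.
  apply: (@inO_le F c (y i + - e%:Z)); first by lia.
  by apply: inOM (inO_pw _ _) (he _ _).
have := Uu.1 _ _ nJ; rewrite mxB1E; case: eqP => [ab|_]; first by move: eb; rewrite ab; lia.
by rewrite subr0 => ->; rewrite mulr0; exact: inO0.
Qed.

Lemma zt_iter i (j : nat) y : ay F (shf i j y) = (ay F y * zt F n i.+1 ^+ j)%g.
Proof.
elim: j => [|j IH].
  by rewrite mulg1; congr ay; apply/funext => k; rewrite /shf mulr0 addr0.
rewrite expgSr mulgA -IH -ay_shf; congr ay; apply/funext => k.
by rewrite /shf -addrA -mulrDr; congr (_ + _ * _); lia.
Qed.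

Lemma ract_iter g (j : nat) x : iter j (ract r g) x = ract r (g ^+ j)%g x.
Proof. by elim: j => [|j IH]; rewrite ?ract1E // iterS IH -ractM -expgS. Qed.

(** Apply [jac_decay] to the vector [p (zt i) x]. *)
Lemma whittaker_recur i (p : {poly R}) x :
  (forall x, jac r (@Ji n i.+1) (pact (ract r (zt F n i.+1)) p x)) ->
  exists C : int, forall y, C <= y i -> recur p (fun a : nat => lam (ract r (ay F (shf i a y)) x)).
Proof.
move=> hp; have [C hC] := jac_decay (hp x); exists C => y hy a.
have sh2 (b : nat) : shf i (a + b)%N y = shf i b (shf i a y).
  by apply/funext => k; rewrite /shf -addrA -mulrDr; congr (_ + _ * _); lia.
have e : lam (ract r (ay F (shf i a y)) (pact (ract r (zt F n i.+1)) p x)) = 0.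
  by apply: hC; rewrite /shf eqxx mul1r; lia.
rewrite -[RHS]e /pact !linear_sum; apply: eq_bigr => j _; rewrite !linearZ /= sh2; congr (_ * lam _).
by rewrite zt_iter ractM ract_iter.
Qed.

End Whittaker.

Section Conductor.
Variables (F : localFieldType) (R : closedFieldType) (theta : F -> R).
Hypothesis ht : nontrivial_smooth_character theta.

(** The largest fractional ideal in the kernel. *)
Lemma theta_exact : exists c0 : int, forall x, (forall t, inO 0 t -> theta (x * t) = 1) <-> inO c0 x.
Proof.
have [c hc] := theta_conductor ht; have [_ _ _ [x0 hx0]] := ht.
pose P (j : nat) := `[< forall x, inO (c%:Z - j%:Z) x -> theta x = 1 >].
have P0 : exists j, P j by exists 0%N; apply/asboolP => x; rewrite subr0; exact: hc.
have Pb j : P j -> (j <= `|c%:Z - lfval x0|)%N.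
  move=> /asboolP h; rewrite leqNgt; apply/negP => lt; case/eqP: hx0; apply: h.
  by rewrite /inO; case: eqP => //= _; lia.
case: (ex_maxnP P0 Pb) => j /asboolP hj hmax; exists (c%:Z - j%:Z) => x; split=> [h|hx t ot].
  have [->|x0'] := eqVneq x 0; first exact: inO0.
  apply: contrapT => nx; have : P j.+1; last by move=> /hmax; rewrite ltnn.
  apply/asboolP => z hz; have -> : z = x * (x^-1 * z) by rewrite mulrA mulfV // mul1r.
  apply: h; have [->|z0] := eqVneq z 0; first by rewrite mulr0; exact: inO0.
  move: nx hz; rewrite /inO (negbTE x0') (negbTE z0) mulf_eq0 invr_eq0 (negbTE x0') (negbTE z0) /=.
  by rewrite lfvalM ?invr_eq0 // lfvalV //; lia.
by apply: hj; rewrite -[_ - _]addr0; exact: inOM.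
Qed.

End Conductor.

(** * Vectors whose Whittaker functions have small support *)

(** Orthogonality of a nontrivial character to the trivial one. *)
Lemma char_sum (R : fieldType) (G : groupType) (K H : set G) (phi : G -> R) (T : finType) (f : T -> G) :
  subgr K -> subgr H -> (forall k k', K k -> K k' -> phi (k * k')%g = phi k * phi k') ->
  H `<=` K -> (forall h, H h -> phi h = 1) -> transv f K H -> (exists2 k, K k & phi k != 1) ->
  \sum_i phi (f i) = 0.
Proof.
move=> sK sH hM HK h1 tr [k Kk nk].
have inv k' h : K k' -> H h -> phi (k' * h)%g = phi k' 
  by move=> Kk' Hh; rewrite hM ?(h1 h) ?mulr1 //; exact: HK.
have := sum_transv_mul sK sH inv Kk tr.
rewrite (eq_bigr (fun i => phi k * phi (f i))) => [|i _]; last by rewrite hM //; exact: tr.1.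
rewrite -mulr_sumr => /eqP; rewrite -{2}[\sum_i _]mul1r -subr_eq0 -mulrBl mulf_eq0 subr_eq0 (negbTE nk).
by move=> /eqP.
Qed.

Section Cut.
Variables (F : localFieldType) (R : closedFieldType) (sq : sqrt_resq F R).
Variables (theta : F -> R) (ht : nontrivial_smooth_character theta).
Variables (n : nat) (r : rep R (GL F n)) (sm : ksmooth (@Kc F n) r).
Local Notation G := (GL F n).
Local Notation Kc := (@Kc F n).
Variables (A : pred 'I_n) (b : 'I_n).
Hypothesis hA : forall i, A i -> (i < b)%N.
Local Notation J := (Jc A b).

Lemma Jc_col (u u' : G) i : UJ J u -> UJ J u' -> A i -> glmx (u * u')%g i b = glmx u i b + glmx u' i b.
Proof.
move=> [hu _] [hu' _] Ai; have nAb : A b = false by apply/negP => /hA; rewrite ltnn.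
have ib : i != b by apply: contraTneq Ai => ->; rewrite nAb.
rewrite glmxM mxE (bigD1 b) //= (bigD1 i) //= big1 ?addr0 => [|k /andP[kb ki]].
  have := hu' b b; have := hu i i; rewrite !mxB1E /Jc nAb (negbTE ib) andbF !eqxx => /(_ isT)/eqP.
  by rewrite subr_eq0 => /eqP -> /(_ isT)/eqP; rewrite subr_eq0 => /eqP ->; rewrite mulr1 mul1r.
have := hu i k; rewrite mxB1E /Jc (negbTE kb) andbF eq_sym (negbTE ki) subr0 => /(_ isT) ->.
by rewrite mul0r.
Qed.

(** Averaging the translates of a vector by a large compact subgroup of the column group
against a character cuts its matrix coefficients by the dual lattice. *)
Lemma cut (x0 : 'I_n -> F) (v : r) (s : nat) : exists v' (s' : nat), (s <= s')%N /\
  forall (lam : {scalar r}) h (x : 'I_n -> F),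
    (forall u w, UJ J u -> lam (ract r h (ract r u w)) =
       theta (\sum_(i | A i) x i * glmx u i b) * lam (ract r h w)) ->
    lam (ract r h v') = if `[< forall i, A i -> inO s' (x i - x0 i) >] then lam (ract r h v) else 0.
Proof.
have [tJ rJ uJ] := Jc_facts F hA; have [c0 hc0] := theta_exact ht; have [c hc] := theta_conductor ht.
have [t0 ft0] := sm v.
pose s' := maxn s `|c0|; pose M := `|s'%:Z - c0|%N.
have eM : M%:Z = s'%:Z - c0 by rewrite /M /s'; lia.
have [e he] : exists e : nat, forall i, inO (- e%:Z) (x0 i).
  have [e he] := mxO_exists (\row_i x0 i); exists e => i; by have := he 0 i; rewrite mxE.
pose d := dg F (fun i : 'I_n => if A i then - M%:Z else 0).
(* [B t] fixes [v] and lies in the kernel of the character attached to [x0] *)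
pose t := (t0 + M + c + e + 1)%N.
have nAb : A b = false by apply/negP => /hA; rewrite ltnn.
have dJ g i : A i -> glmx (d * g * d^-1)%g i b = unif ^ (- M%:Z) * glmx g i b.
  by move=> Ai; rewrite dgJE Ai nAb subr0.
pose B (u : nat) : set G := [set g | (UJ J `&` Kc u) (d^-1 * g * d)%g].
have BK u g : B u g -> g = (d * (d^-1 * g * d) * d^-1)%g by rewrite !mulgE.
have BU u : B u `<=` UJ J.
  by move=> g Bg; rewrite (BK u g Bg); case: Bg => Ug _; exact: dg_UJ.
have Bent (u : nat) g i : B u g -> A i -> inO (u%:Z - M%:Z) (glmx g i b).
  move=> [_ [Kg _]] Ai; have := Kg i b; rewrite mxB1E.
  have -> : (i == b) = false by apply: contraTF Ai => /eqP ->; rewrite nAb.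
  rewrite subr0 dgVJE Ai nAb sub0r opprK inO_pwM; by rewrite addrC.
have sB u : subgr (B u) by apply: subgr_conj; apply: subgrI; [exact: UJ_subgr|exact: Kc_subgr].
have [T [f0 [tr0 [q cT]]]] := UJ_Kc_transv tJ (@padm_ranked F n _ 0 tJ rJ) (leq0n t).
pose f i := (d * f0 i * d^-1)%g.
have tr : transv f (B 0%N) (B t) by exact: transv_conj tr0.
have Tn0 : #|T|%:R != 0 :> R by rewrite cT (resqX_neq0 sq).
pose chi (z : 'I_n -> F) u := theta (\sum_(i | A i) z i * glmx u i b).
have chiM z u u' : UJ J u -> UJ J u' -> chi z (u * u')%g = chi z u * chi z u'.
  move=> Uu Uu'; rewrite /chi -(thetaD ht) -big_split; congr theta.
  by apply: eq_bigr => i Ai /=; rewrite Jc_col // mulrDr.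
exists (#|T|%:R^-1 *: \sum_i (chi x0 (f i))^-1 *: ract r (f i) v), s'.
split=> [|lam h x hx]; first exact: leq_maxl.
pose psi u := chi (fun i => x i - x0 i) u.
have psiE u : psi u = chi x u / chi x0 u.
  rewrite /psi /chi -(thetaN ht) -(thetaD ht) -sumrN -big_split; congr theta.
  by apply: eq_bigr => i _ /=; rewrite mulrBl.
have Uf i : UJ J (f i) by apply: (BU 0%N); exact: tr.1.
have -> : lam (ract r h (#|T|%:R^-1 *: \sum_i (chi x0 (f i))^-1 *: ract r (f i) v)) =
    #|T|%:R^-1 * (\sum_i psi (f i)) * lam (ract r h v).
  rewrite linearZ linearZ /= -mulrA; congr (_ * _); rewrite !linear_sum mulr_suml.
  by apply: eq_bigr => i _; rewrite linearZ linearZ /= hx // psiE mulrA [X in X * _]mulrC.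
have psiM u u' : UJ J u -> UJ J u' -> psi (u * u')%g = psi u * psi u' by exact: chiM.
case: asboolP => [hin|nin].
  rewrite (eq_bigr (fun=> 1)) => [|i _].
    by rewrite sumr_const mulVf // mul1r.
  have := (hc0 (\sum_(k | A k) (x k - x0 k) * glmx (f i) k b)).2; rewrite /psi /chi.
  move=> h1; have -> : forall z : F, theta z = theta (z * 1) by move=> z; rewrite mulr1.
  apply: h1; last exact: inO1.
  apply: inO_sum => k Ak; apply: (@inO_le F c0 (s'%:Z + (0 - M%:Z))); first by lia.
  by apply: inOM; [exact: hin|exact: (Bent 0%N _ _ (tr.1 i) Ak)].
have [->|nz] := eqVneq (lam (ract r h v)) 0; first by rewrite mulr0.
rewrite (char_sum (phi := psi) (sB 0%N) (sB t) _ _ _ tr) ?mulr0 ?mul0r //.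
- by move=> k k' /BU Uk /BU Uk'; exact: psiM.
- by move=> g [Ug Kg]; split=> //; exact: Kc_le Kg.
- move=> g Bg; have Ug := BU _ _ Bg.
  have Kg : Kc t0 g.
    have K1 : Kc t0.+1 g; last by apply: Kc_le K1.
    apply: Kc1P => // i k; have [/andP[Ai /eqP ->]|nJ] := boolP (J i k); last by rewrite Ug.1 //; exact: inO0.
    rewrite mxB1E; have -> : (i == b) = false by apply: contraTF Ai => /eqP ->; rewrite nAb.
    by rewrite subr0; apply: inO_le (Bent _ _ _ Bg Ai); rewrite /t; lia.
  rewrite psiE; have -> : chi x0 g = 1.
    apply: hc; apply: inO_sum => i Ai.
    by apply: inO_le (inOM (he i) (Bent _ _ _ Bg Ai)); rewrite /t; lia.
  rewrite invr1 mulr1; have := hx g v Ug; rewrite ft0 // => /eqP.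
  by rewrite -{1}[lam _]mul1r -subr_eq0 -mulrBl mulf_eq0 subr_eq0 (negbTE nz) orbF => /eqP e1; exact: esym e1.
- have [i [Ai ni]] : exists i, A i /\ ~ inO s' (x i - x0 i).
    by apply: contrapT => no; apply: nin => i Ai; apply: contrapT => ni; apply: no; exists i.
  have : ~ inO c0 ((x i - x0 i) * unif ^ (- M%:Z)).
    rewrite mulrC inO_pwM => h1; apply: ni; apply: inO_le h1; lia.
  move=> /hc0 /existsNP [z /not_implyP [oz nz']].
  pose X : 'M[F]_n := \matrix_(a, k) (if (a == i) && (k == b) then z else 0).
  have sX : supp J X.
    move=> a k; rewrite mxE; case: ifP => // /andP[/eqP -> /eqP ->].
    by rewrite /Jc Ai eqxx.
  have OX : mxO 0 X by move=> a k; rewrite mxE; case: ifP => _ //; exact: inO0.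
  have [g [Kg Ug] eg] := @padm_ranked F n _ 0 tJ rJ X sX OX.
  exists (d * g * d^-1)%g; first by split; rewrite !mulgE.
  apply/eqP => e1; apply: nz'; rewrite -e1 /psi /chi (bigD1 i) //= big1 ?addr0 => [|k /andP[Ak /negbTE ki]].
    rewrite dJ // eg !mxE !eqxx /= [(i == b)](_ : _ = false) ?add0r ?mulrA //.
    by apply: contraTF Ai => /eqP ->; rewrite nAb.
  rewrite dJ // eg !mxE ki /= addr0 [(k == b)](_ : _ = false) ?mulr0 //.
  by apply: contraTF Ak => /eqP ->; rewrite nAb.
Qed.

End Cut.

Section Kirillov.
Variables (F : localFieldType) (R : closedFieldType) (sq : sqrt_resq F R).
Variables (theta : F -> R) (ht : nontrivial_smooth_character theta).
Variables (n : nat) (r : rep R (GL F n)) (sm : ksmooth (@Kc F n) r).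
Local Notation G := (GL F n).
Local Notation Kc := (@Kc F n).
Local Notation up := (@upper_unipotent F n).
Variable lam : {scalar r}.
Hypothesis wl : whittaker_functional theta lam.

(** Matrices which are trivial outside the upper left corner of size [j]. *)
Definition Pj (j : nat) : rel 'I_n := fun a b => (a < j)%N && (b < j)%N.

Lemma Pj_trans j : transitive (Pj j). Proof. by move=> b a c; rewrite /Pj; lia. Qed.

Lemma UJ_Pj j (g : G) : supp (Pj j) (glmx g - 1%:M) -> UJ (Pj j) g.
Proof.
move=> hg; split=> // a b; rewrite /Pj negb_and => /orP[na|nb].
  have -> : glmx g^-1%g - 1%:M = - ((glmx g - 1%:M) *m glmx g^-1%g) by rewrite mulmxBl glmxKV mul1mx opprB.
  rewrite !mxE big1 ?oppr0 // => k _; rewrite hg ?mul0r //.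
  by rewrite /Pj (negbTE na).
have -> : glmx g^-1%g - 1%:M = - (glmx g^-1%g *m (glmx g - 1%:M)) by rewrite mulmxBr glmxVK mulmx1 opprB.
rewrite !mxE big1 ?oppr0 // => k _; rewrite hg ?mulr0 //.
by rewrite /Pj (negbTE nb) andbF.
Qed.

(** The conjugate [h u h^-1] differs from [1] in the column [b] only, where the character sees the
entry of the row [bm]. *)
Lemma colact (A : pred 'I_n) (b bm : 'I_n) (h u : G) (w : r) : (forall i : 'I_n, A i -> (i < b)%N) -> b = bm.+1 :> nat ->
  (forall c : 'I_n, glmx h^-1%g b c = (b == c)%:R) ->
  (forall a i : 'I_n, (b <= a)%N -> A i -> glmx h a i = 0) ->
  UJ (Jc A b) u -> lam (ract r h (ract r u w)) =
    theta (\sum_(i | A i) glmx h bm i * glmx u i b) * lam (ract r h w).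
Proof.
move=> hA eb hb ha [hu _].
have e : glmx (h * u * h^-1)%g = 1%:M + glmx h *m (glmx u - 1%:M).
  have -> : glmx h *m (glmx u - 1%:M) = glmx h *m (glmx u - 1%:M) *m glmx h^-1%g.
    apply/matrixP => a c; rewrite [RHS]mxE.
    have gb k : (glmx h *m (glmx u - 1%:M)) a k = if k == b then (glmx h *m (glmx u - 1%:M)) a b else 0.
      case: eqP => [->//|kb]; rewrite mxE big1 // => l _; rewrite hu ?mulr0 // /Jc.
      by case: eqP => // _; rewrite andbF.
    move: (glmx h *m (glmx u - 1%:M)) gb => Z gb.
    rewrite (bigD1 b) //= [X in _ + X]big1 ?addr0 => [|k /negbTE kb]; last by rewrite gb kb mul0r.
    rewrite [LHS]gb; have -> : glmx h^-1%g b c = (b == c)%:R by exact: hb.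
    by rewrite eq_sym; case: eqP => _; rewrite ?mulr1 ?mulr0.
  by rewrite mulmxBr mulmx1 mulmxBl -!glmxM mulgV addrC subrK.
have ent a c : glmx (h * u * h^-1)%g a c = (a == c)%:R +
    (if c == b then \sum_(i | A i) glmx h a i * glmx u i b else 0).
  rewrite e !mxE; congr (_ + _); case: eqP => [->|cb]; last first.
    by rewrite big1 // => k _; rewrite hu ?mulr0 // /Jc; case: eqP => // _; rewrite andbF.
  rewrite [RHS]big_mkcond; apply: eq_bigr => k _.
  have [Ak|nA] := boolP (A k); last by rewrite hu ?mulr0 // /Jc (negbTE nA).
  rewrite mxB1E [(k == b)](_ : _ = false) ?subr0 //.
  by apply/negbTE; rewrite -val_eqE /= neq_ltn (hA k Ak).
have hup : up (h * u * h^-1)%g.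
  move=> a c ca; rewrite ent; case: ifP => [/eqP cb|_]; last by rewrite addr0.
  by rewrite big1 ?addr0 // => i Ai; rewrite ha ?mul0r // -cb.
rewrite -ractM; have eq1 : (h * u = h * u * h^-1 * h)%g by rewrite !mulgE.
rewrite [LHS](congr1 (fun g => lam (ract r g w)) eq1) (lamM wl) //; congr (_ * _).
rewrite /char_of_unipotent; congr theta; move: (glmx (h * u * h^-1)%g) ent => W ent.
rewrite (bigD1 bm) //= (bigD1 b) /= ?eb // ent eqxx.
rewrite [(bm == b)](_ : _ = false) ?add0r; last by rewrite -val_eqE /= eb ltn_eqF.
rewrite [X in _ + X + _]big1 ?addr0 => [|k /andP[/eqP k1 /negP kb]]; last first.
  by case: kb; apply/eqP; apply: val_inj; rewrite /= eb.
rewrite [X in _ + X]big1 ?addr0 // => i /negbTE ij; rewrite big1 // => k /eqP ek.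
rewrite ent [(i == k)](_ : _ = false); last by rewrite -val_eqE /= ek ltn_eqF.
rewrite [(k == b)](_ : _ = false) ?add0r //; apply/negbTE; apply: contraFneq ij => kb.
by rewrite -val_eqE /=; move: ek; rewrite kb /= eb => -[->].
Qed.

(** The factor [k] makes the row [jj] standard, and [u] then clears the column [jj]. *)
Lemma row_split (jj : 'I_n) (s : nat) (g : G) : (0 < s)%N -> UJ (Pj jj.+1) g ->
  (forall i : 'I_n, (i <= jj)%N -> inO s (glmx g jj i - (i == jj)%:R)) ->
  exists u g' k, [/\ up u, UJ (Pj jj) g', UJ (Pj jj.+1) k, Kc s k & g = (u * g' * k)%g].
Proof.
move=> s1 Ug hrow; have [U1 UM UV] := @upper_subgr F n.
have [P1 PM PV] := UJ_subgr F (@Pj_trans jj.+1).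
pose X : 'M[F]_n := \matrix_(a, i) (if a == jj then glmx g jj i - (i == jj)%:R else 0).
have sX : supp (Pj jj.+1) X.
  move=> a i; rewrite mxE; case: eqP => // -> nP; have := Ug.1 jj i nP.
  by rewrite mxB1E eq_sym.
have OX : mxO s X.
  move=> a i; rewrite mxE; case: eqP => // _; last exact: inO0.
  have [Ai|nA] := boolP (i <= jj)%N; first exact: hrow.
  have := Ug.1 jj i; rewrite /Pj mxB1E eq_sym => -> //; first exact: inO0.
  by rewrite negb_and orbC ltnS nA.
have [k Kk ek] := Kc_mk s1 OX.
have Uk : UJ (Pj jj.+1) k by apply: UJ_Pj; rewrite ek addrC addKr.
pose p := (g * k^-1)%g; have Up : UJ (Pj jj.+1) p by apply: PM => //; exact: PV.
have prow i : glmx p jj i = (jj == i)%:R.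
  have : row jj (glmx p) = row jj 1%:M; last by move=> /rowP /(_ i); rewrite !mxE.
  rewrite /p glmxM row_mul; have -> : row jj (glmx g) = row jj (glmx k).
    apply/rowP => l; rewrite !mxE ek !mxE eqxx [_ == l]eq_sym addrC subrK; by [].
  by rewrite -row_mul glmxKV.
pose Y : 'M[F]_n := \matrix_(a, i) (if (a < jj)%N && (i == jj) then glmx p a jj else 0).
have hY a : (fun i : 'I_n => (i < jj)%N) a -> (a < jj)%N by [].
have [tJ rJ uJ] := Jc_facts F hY.
have sY : supp (Jc (fun i : 'I_n => (i < jj)%N) jj) (- Y).
  by move=> a i; rewrite /Jc !mxE => /negbTE ->; rewrite oppr0.
have [u Uu eu] := UJ_mk tJ rJ sY.
have Pg' : UJ (Pj jj) (u * p)%g.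
  apply: UJ_Pj => a i nP; rewrite mxB1E glmxM eu mulmxDl mul1mx mulNmx.
  have sub (U V : 'M[F]_n) : (U - V) a i = U a i - V a i by rewrite !mxE.
  rewrite sub [(Y *m _) a i]mxE; have YpE : \sum_l Y a l * glmx p l i = if (a < jj)%N then glmx p a jj * (jj == i)%:R else 0.
    rewrite (bigD1 jj) //= big1 ?addr0 => [|l /negbTE lj]; last by rewrite mxE lj andbF mul0r.
    by rewrite mxE eqxx andbT; case: ifP; rewrite ?prow ?mul0r.
  rewrite YpE; have [aj|ja] := ltnP a jj.
    have [<-|ji] := eqVneq jj i.
      rewrite mulr1 subrr [(a == jj)](_ : _ = false) ?subrr //.
      by apply/negbTE; rewrite -val_eqE /= ltn_eqF.
    rewrite mulr0 subr0; have := Up.1 a i; rewrite mxB1E => -> //.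
    move: nP ji; rewrite /Pj aj /= -val_eqE /=; lia.
  rewrite subr0; have [<-|ja'] := eqVneq jj a; first by rewrite prow subrr.
  have := Up.1 a i; rewrite mxB1E => -> //; move: ja'; rewrite /Pj -val_eqE /=; lia.
exists u^-1%g, (u * p)%g, k; split=> //; last by rewrite /p !mulgE.
by apply: UV; exact: uJ.
Qed.

(** Induction on the size of the corner: cutting by the column group of the next column forces
the last row to be close to the standard one, and [row_split] moves the support into the smaller
corner. *)
Lemma kirillov (j : nat) : (exists x, lam x != 0) -> (j < n)%N -> forall r0 : nat,
  exists x (C : set G) (t : nat), [/\ subgr C, C `<=` UJ (Pj j) `&` Kc r0, UJ (Pj j) `&` Kc t `<=` C,
    forall c, C c -> lam (ract r c x) = 1 &
    forall g, UJ (Pj j) g -> (forall u c, up u -> C c -> g <> (u * c)%g) -> lam (ract r g x) = 0].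
Proof.
move=> [x1 nx1]; elim: j => [|j IH] jn r0.
  exists ((lam x1)^-1 *: x1), [set 1%g], 0%N.
  have tr1 g : UJ (Pj 0) g -> g = 1%g.
    move=> [hg _]; apply: glmx_inj; apply/matrixP => a b; have := hg a b isT.
    by rewrite mxB1E => /eqP; rewrite subr_eq0 => /eqP ->; rewrite glmx1 mxE.
  have U1 : UJ (Pj 0) (1%g : G) by have [] := UJ_subgr F (@Pj_trans 0).
  split.
  - by split=> [//|g h -> ->|g ->]; rewrite /= ?mulg1 ?invg1.
  - by move=> g /= ->; split=> //; have [] := @Kc_subgr F n r0.
  - by move=> g [/tr1 ->].
  - by move=> c /= ->; rewrite ract1E linearZ /= mulVf.
  - by move=> g /tr1 -> h; case: (h 1%g 1%g); rewrite ?mulg1 //; have [] := @upper_subgr F n.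
have [x [C [t [sC CU KC C1 C0]]]] := IH (ltnW jn) (maxn r0 1).
have [s fx] := sm x; pose b := Ordinal jn; have j1 : (j < n)%N by exact: ltnW.
pose jj := Ordinal j1; pose A : pred 'I_n := fun i => (i <= j)%N.
have hA i : A i -> (i < b)%N by rewrite /A /= ltnS.
pose x0 (i : 'I_n) : F := (i == jj)%:R.
have [x' [s' [ss hx']]] := cut sq ht sm hA x0 x (maxn (maxn r0 1) (maxn s t)).
have [rs [s1 [ss' st]]] : (r0 <= s')%N /\ (0 < s')%N /\ (s <= s')%N /\ (t <= s')%N.
  by move: ss; rewrite !geq_max; lia.
have fx' : fixd Kc s' x by move=> k Kk; apply: fx; exact: Kc_le Kk.
have [P1 PM PV] := UJ_subgr F (@Pj_trans j.+1).
have Pjj (g : G) : UJ (Pj j) g -> UJ (Pj j.+1) g.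
  by move=> [hg _]; apply: UJ_Pj => a c nP; apply: hg; apply: contra nP; rewrite /Pj; lia.
have [U1 UM UV] := @upper_subgr F n; have [K1 KM KV] := @Kc_subgr F n s'.
have rowact g u w : UJ (Pj j.+1) g -> UJ (Jc A b) u -> lam (ract r g (ract r u w)) =
    theta (\sum_(i | A i) glmx g jj i * glmx u i b) * lam (ract r g w).
  move=> [hg hg']; apply: colact => // [c|a i ba Ai].
    by have := hg' b c; rewrite mxB1E /Pj /= ltnn => /(_ isT)/eqP; rewrite subr_eq0 => /eqP.
  have ja : (j < a)%N by exact: ba.
  have := hg a i; rewrite mxB1E /Pj [(a < j.+1)%N](_ : _ = false) /=; last by rewrite ltnS leqNgt ja.
  rewrite [(a == i)](_ : _ = false) ?subr0; last first.
    by apply/negbTE; rewrite -val_eqE /= neq_ltn orbC (leq_ltn_trans Ai ja).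
  exact.
pose C' := setM C (UJ (Pj j.+1) `&` Kc s').
have C0' c : C c -> Kc 0 c by move=> /CU [_ Kk]; apply: Kc_le Kk.
have sC' : subgr C'.
  apply: setM_subgr => //; first by apply: subgrI; [exact: UJ_subgr (@Pj_trans _)|exact: Kc_subgr].
  move=> k l Ck [Ul Kl]; have Uk : UJ (Pj j.+1) k by apply: Pjj; exact: (CU _ Ck).1.
  split; last by apply: Kc_normal => //; exact: C0'.
  by apply: (PM _ _ (PM _ _ (PV _ Uk) Ul) Uk).
exists x', C', s'; split=> //.
- move=> _ [c [k [Cc [Uk Kk] ->]]]; have [Uc Kcc] := CU _ Cc; split.
    by apply: PM => //; exact: Pjj.
  have [_ KM' _] := @Kc_subgr F n r0; apply: KM'; last by apply: Kc_le Kk.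
  by apply: Kc_le Kcc; exact: leq_maxl.
- by move=> g Ug; exists 1%g, g; rewrite mul1g; split=> //; have [] := sC.
- move=> _ [c [k [Cc [Uk Kk] ->]]]; have [Uc _] := CU _ Cc.
  have Uck : UJ (Pj j.+1) (c * k)%g by apply: PM => //; exact: Pjj.
  rewrite (hx' lam _ (fun i => glmx (c * k)%g jj i)) => [|u w]; last exact: rowact.
  rewrite asboolT; last first.
    move=> i _; have -> : glmx (c * k)%g jj i = glmx k jj i.
      rewrite glmxM mxE (bigD1 jj) //= big1 ?addr0 => [|l lj]; last first.
        have := Uc.1 jj l; rewrite mxB1E /Pj ltnn eq_sym (negbTE lj) subr0 => /(_ isT) ->.
        by rewrite mul0r.
      have := Uc.1 jj jj; rewrite mxB1E /Pj ltnn eqxx => /(_ isT)/eqP; rewrite subr_eq0 => /eqP ->.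
      by rewrite mul1r.
    by have := Kk.1 jj i; rewrite mxB1E /x0 eq_sym.
  by rewrite ractM fx' // C1.
- move=> g Ug ng; rewrite (hx' lam _ (fun i => glmx g jj i)) => [|u w]; last exact: rowact.
  case: asboolP => // hrow.
  have [u [g' [k [hu Ug' Uk Kk eg]]]] := row_split (jj := jj) s1 Ug hrow.
  rewrite eg ractM fx' // (lamM wl) //.
  rewrite C0 ?mulr0 // => u1 c1 hu1 Cc1 e; apply: (ng (u * u1)%g (c1 * k)%g); first exact: UM.
    by exists c1, k.
  by rewrite eg e !mulgE.
Qed.

End Kirillov.

(** * Fractional ideals of Laurent polynomials *)

Section Laurent.
Variable R : closedFieldType.
Local Notation V := (int -> R^o).
Local Notation X := (pull R (fun k : int => k - 1)).
Local Notation T := (pull R (fun k : int => k + 1)).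
Implicit Types (p q : {poly R}) (f g z : V).

Lemma iterX (i : nat) f k : iter i X f k = f (k - i%:Z).
Proof.
rewrite iter_pull; congr f; elim: i k => [|i IH] k; first by rewrite subr0.
by rewrite iterS IH; lia.
Qed.

Lemma iterT (i : nat) f k : iter i T f k = f (k + i%:Z).
Proof.
rewrite iter_pull; congr f; elim: i k => [|i IH] k; first by rewrite addr0.
by rewrite iterS IH; lia.
Qed.

Lemma iterTX (i : nat) f : iter i T (iter i X f) = f.
Proof. by apply/funext => k; rewrite iterT iterX addrK. Qed.

Lemma iterXT (i : nat) f : iter i X (iter i T f) = f.
Proof. by apply/funext => k; rewrite iterX iterT subrK. Qed.

Lemma pactX p f k : pact X p f k = \sum_(i < size p) p`_i * f (k - i%:Z).
Proof. by rewrite pact_pull; apply: eq_bigr => i _; rewrite -iterX iter_pull. Qed.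

Lemma fsum_poly p (f : int -> R) : fsum (fun i => laurent_of_poly p i * f i) = \sum_(i < size p) p`_i * f i.
Proof.
have cov (k : int) : laurent_of_poly p k * f k != 0 -> k \in [seq i%:Z | i <- iota 0 (size p)].
  case: k => [i|i] /=; last by rewrite mul0r eqxx.
  move=> nz; apply: map_f; rewrite mem_iota add0n /= ltnNge; apply: contra nz => le.
  by rewrite nth_default ?mul0r.
rewrite (fsum_seq _ cov); last by rewrite map_inj_uniq ?iota_uniq // => i j [].
by rewrite big_map -{1}(subn0 (size p)) -/(index_iota 0 _) big_mkord.
Qed.

Lemma lmul_poly (e : nat) p f : lmul (fun k => laurent_of_poly p (k + e%:Z)) f = iter e T (pact X p f).
Proof.
apply/funext => k; rewrite iterT pactX -(fsum_poly p (fun i => f (k + e%:Z - i))).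
pose h (i : int) := laurent_of_poly p i * f (k + e%:Z - i).
have fs : fsupp h.
  exists [seq i%:Z | i <- iota 0 (size p)] => -[i|i]; last by rewrite /h mul0r eqxx.
  move=> nz; apply: map_f; rewrite mem_iota add0n /= ltnNge; apply: contra nz => le.
  by rewrite /h /= nth_default ?mul0r.
have c1 : cancel (fun i : int => i + e%:Z) (fun i => i - e%:Z) by move=> i; rewrite addrK.
have c2 : cancel (fun i : int => i - e%:Z) (fun i => i + e%:Z) by move=> i; rewrite subrK.
have [_ <-] := fsum_bij c1 c2 fs.
by rewrite /lmul -/(fsum _); congr fsum; apply/funext => i; rewrite /h; congr (_ * f _); lia.
Qed.

Lemma lmul_poly0 p f : lmul (laurent_of_poly p) f = pact X p f.
Proof.
rewrite -[RHS]/(iter 0 T (pact X p f)) -lmul_poly; congr lmul.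
by apply/funext => k; rewrite addr0.
Qed.

Lemma fsupp_laurent f : laurent_poly f <-> fsupp f.
Proof.
split=> [/finite_seqP [l e]|[l hl]].
  by exists l => y ny; have : [set k | f k != 0] y by []; rewrite e.
apply: sub_finite_set (_ : finite_set [set` l]); last exact: finite_seq.
by move=> k /hl.
Qed.

Lemma laurent_polyP f : fsupp f -> exists (e : nat) p, f = fun k => laurent_of_poly p (k + e%:Z).
Proof.
move=> [l hl]; pose e := (\sum_(i <- l) `|i|)%N.
have he k : f k != 0 -> (`|k| <= e)%N.
  move=> /hl kl; rewrite /e (big_rem k) //=; exact: leq_addr.
exists e, (\poly_(i < (2 * e).+1) f (i%:Z - e%:Z)); apply/funext => k.
have [e0|nz] := eqVneq (f k) 0.
  case ek : (k + e%:Z) => [j|j] //=; rewrite coef_poly; case: ifP => // _.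
  by have -> : j%:Z - e%:Z = k by lia.
have := he k nz => bk; have -> : k + e%:Z = (absz (k + e%:Z))%:Z by lia.
rewrite /= coef_poly; have -> : (absz (k + e%:Z)%R < (2 * e).+1)%N by lia.
by congr f; lia.
Qed.

Lemma lop_fsupp p : fsupp (laurent_of_poly p).
Proof.
exists [seq i%:Z | i <- iota 0 (size p)] => -[i|i] /=; last by rewrite eqxx.
move=> nz; apply: map_f; rewrite mem_iota add0n /= ltnNge; apply: contra nz => le.
by rewrite nth_default.
Qed.

Lemma pact_lone p : pact X p (lone R) = laurent_of_poly p.
Proof.
apply/funext => k; rewrite pactX /lone; case: k => [k|k] /=.
  have [lt|le] := ltnP k (size p); last first.
    rewrite nth_default // big1 // => i _; rewrite [(_ == 0)](_ : _ = false) ?mulr0 //.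
    by rewrite subr_eq0 eqz_nat gtn_eqF //; exact: leq_trans (ltn_ord i) le.
  rewrite (bigD1 (Ordinal lt)) //= subrr eqxx mulr1 big1 ?addr0 // => i ik.
  rewrite [(_ == 0)](_ : _ = false) ?mulr0 //; apply/eqP => e0; case/eqP: ik; apply: val_inj => /=; lia.
by rewrite big1 // => i _; rewrite [(_ == 0)](_ : _ = false) ?mulr0 //; apply/eqP; lia.
Qed.

Lemma pact_lop q p : pact X q (laurent_of_poly p) = laurent_of_poly (q * p).
Proof. by rewrite -!pact_lone pactM. Qed.

Lemma lop_inj p q : laurent_of_poly p = laurent_of_poly q -> p = q.
Proof. by move=> e; apply/polyP => i; have := congr1 (@^~ i%:Z) e. Qed.

Lemma lop_lin a p q : laurent_of_poly (a *: p + q) = a *: (laurent_of_poly p : V) + laurent_of_poly q.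
Proof. by rewrite -!pact_lone pactD pactZ. Qed.

(** Look at the lowest coefficient. *)
Lemma pact_cancel p f : p`_0 != 0 -> laurent_series f -> pact X p f = 0 -> f = 0.
Proof.
move=> p0 [k0 hk0] e; have sp : (0 < size p)%N by rewrite lt0n size_poly_eq0; apply: contraNneq p0 => ->; rewrite coef0.
have key (j : nat) : forall k, k < k0 + j%:Z -> f k = 0.
  elim: j => [|j IH] k hk; first by apply: hk0; lia.
  have [lt|ge] := ltP k (k0 + j%:Z); first exact: IH.
  have := congr1 (@^~ k) e; rewrite pactX; case: (size p) sp => // m _.
  rewrite big_ord_recl subr0 big1 ?addr0 => [|i _]; last first.
    by rewrite IH ?mulr0 // lift0; lia.
  by move/eqP; rewrite mulf_eq0 (negbTE p0) => /eqP.
by apply/funext => k; apply: (key `|k - k0|.+1); lia.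
Qed.

Lemma lspanE (S : set V) f : lspan S f <-> span S f.
Proof.
split=> [[d [c [s [hs e]]]]|].
  have -> : f = \sum_(i < d) c i *: s i.
    apply/funext => k; rewrite e.
    have aux (l : seq 'I_d) : (\sum_(i <- l) c i *: s i) k = \sum_(i <- l) c i * s i k.
      by elim: l => [|i l IH]; rewrite ?big_nil // !big_cons -IH.
    by rewrite aux.
  apply: (subspace_sum _ (span_subspace S)) => i _; apply: (subspaceZ _ (span_subspace S)).
  exact: sub_span.
apply: span_min => [|z Sz].
  split=> [|a x y [d1 [c1 [s1 [h1 e1]]]] [d2 [c2 [s2 [h2 e2]]]]].
    exists 0%N, (fun=> 0), (fun=> 0); split=> [[]//|k]; by rewrite big_ord0.
  exists (d1 + d2)%N, (fun i => match fintype.split i with inl i => a * c1 i | inr i => c2 i end),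
    (fun i => match fintype.split i with inl i => s1 i | inr i => s2 i end).
  split=> [i|k]; first by case: fintype.split.
  rewrite -[LHS]/(a * x k + y k) e1 e2 big_split_ord /= mulr_sumr; congr (_ + _).
    apply: eq_bigr => i _; case: splitP => j /= ej; last by have := ltn_ord i; lia.
    by rewrite mulrA; congr (_ * c1 _ * s1 _ _); apply: val_inj.
  apply: eq_bigr => i _; case: splitP => j /= ej; first by have := ltn_ord j; lia.
  by congr (c2 _ * s2 _ _); apply: val_inj => /=; lia.
by exists 1%N, (fun=> 1), (fun=> z); split=> // k; rewrite big_ord1 mul1r.
Qed.

Lemma laurent_subspace : subspace (@laurent_series R : set V).
Proof.
split=> [|a x y [k1 h1] [k2 h2]]; first by exists 0.
exists (Num.min k1 k2) => k; rewrite lt_min => /andP[g1 g2].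
by rewrite -[LHS]/(a * x k + y k) h1 // h2 // mulr0 addr0.
Qed.

Lemma fsupp_subspace : subspace (@fsupp int R : set V).
Proof.
split=> [|a x y hx hy]; first by exists [::] => y; rewrite eqxx.
exact: fsupp_lin.
Qed.


Lemma pactX_laurent p f : laurent_series f -> laurent_series (pact X p f).
Proof.
move=> [k0 h]; exists k0 => k hk; rewrite pactX big1 // => i _; rewrite h ?mulr0 //; lia.
Qed.

Lemma iterX_pact (e : nat) p f : iter e X (pact X p f) = pact X p (iter e X f).
Proof. by rewrite -!pactXn -!pactM mulrC. Qed.

Lemma iterX_lop (e : nat) p : iter e X (laurent_of_poly p) = laurent_of_poly ('X^e * p).
Proof. by rewrite -pactXn pact_lop. Qed.

(** The polynomial with the coefficients of [p] in the opposite order. *)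
Definition revp p : {poly R} := \poly_(i < size p) p`_((size p).-1 - i).

Lemma revp0 p : p != 0 -> (revp p)`_0 != 0.
Proof.
by move=> p0; rewrite coef_poly lt0n size_poly_eq0 p0 subn0 -lead_coefE lead_coef_eq0.
Qed.

Lemma pact_revp p f : pact X (revp p) f = iter (size p).-1 X (pact T p f).
Proof.
apply/funext => k; rewrite iterX pactX pact_pull.
have [->|p0] := eqVneq p 0; first by rewrite /revp size_poly0 !big1 //; case; rewrite ?size_poly0 // poly_def big_ord0 size_poly0.
have sr : (size (revp p) <= size p)%N by exact: size_poly.
rewrite (big_ord_widen _ (fun i => (revp p)`_i * f (k - i%:Z)) sr) big_mkcond /=.
rewrite (reindex_inj rev_ord_inj) /=; apply: eq_bigr => i _.
have ei : iter i (fun k0 : int => k0 + 1) (k - (size p).-1%:Z) = k - (size p - i.+1)%N%:Z.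
  have -> : forall (j : nat) (w : int), iter j (fun k0 : int => k0 + 1) w = w + j%:Z.
    by elim=> [|j IH] w; rewrite ?addr0 // iterS IH; lia.
  by have := ltn_ord i; move: (nat_of_ord i) => j; move: (size p) => m; lia.
have ci : (revp p)`_(size p - i.+1) = p`_i.
  have aux (m j : nat) : (j < m)%N -> (m - j.+1 < m)%N /\ (m.-1 - (m - j.+1))%N = j by lia.
  by have [h1 h2] := aux _ _ (ltn_ord i); rewrite coef_poly h1 h2.
rewrite ei ci; case: ltnP => // le; rewrite -ci nth_default ?mul0r //.
Qed.

Section Main.
Variable S : set V.
Variable D : {poly R}.
Hypotheses (D0 : D != 0).
Hypothesis SL : S `<=` (@laurent_series R : set V).
Hypothesis SD : forall f, S f -> fsupp (pact T D f).
Hypothesis SX : forall f, S f -> span S (X f).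
Hypothesis ST : forall f, S f -> span S (T f).
Hypothesis S1 : span S (lone R).

Local Notation I := (span S).
Local Notation sI := (span_subspace S).
Let E := revp D.
Let E0 : E`_0 != 0 := revp0 D0.

Lemma span_X f : I f -> I (X f).
Proof.
apply: (@span_min _ _ _ [set f | I (X f)]) => //.
by split=> [|a x y hx hy]; rewrite /= ?linear0 ?linearP; [exact: sI.1|exact: sI.2].
Qed.

Lemma span_T f : I f -> I (T f).
Proof.
apply: (@span_min _ _ _ [set f | I (T f)]) => //.
by split=> [|a x y hx hy]; rewrite /= ?linear0 ?linearP; [exact: sI.1|exact: sI.2].
Qed.

Lemma span_iterX (e : nat) f : I f -> I (iter e X f).
Proof. by move=> h; elim: e => // e; exact: span_X. Qed.

Lemma span_iterT (e : nat) f : I f -> I (iter e T f).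
Proof. by move=> h; elim: e => // e; exact: span_T. Qed.

Lemma span_pact p f : I f -> I (pact X p f).
Proof. by move=> h; exact: (pact_subspace _ sI span_X h). Qed.

Lemma span_laurent f : I f -> laurent_series f.
Proof. by apply: span_min; [exact: laurent_subspace|exact: SL]. Qed.

Lemma span_E f : I f -> fsupp (pact X E f).
Proof.
apply: (@span_min _ _ _ [set f | fsupp (pact X E f)]).
  split=> [|a x y hx hy]; first by rewrite /= pactv0; exact: fsupp_subspace.1.
  by have := fsupp_subspace.2 a _ _ hx hy; rewrite -pact_lin.
move=> f0 /SD [l hl]; exists [seq k + (size D).-1%:Z | k <- l] => k; rewrite pact_revp iterX => /hl h.
by apply/mapP; exists (k - (size D).-1%:Z) => //; rewrite subrK.
Qed.

Lemma lspan_fractional : fractional_ideal (lspan S).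
Proof.
have eI : lspan S = I by apply/seteqP; split=> f; [move/lspanE|move=> ?; apply/lspanE].
rewrite eI; split.
- exact: span_laurent.
- exact: sI.1.
- by move=> f g hf hg; have := subspaceD sI hf hg.
- move=> Q f /fsupp_laurent /laurent_polyP [e [p ->]] hf; rewrite lmul_poly.
  by apply: span_iterT; exact: span_pact.
- exists (laurent_of_poly E); split; first by apply/fsupp_laurent; exact: lop_fsupp.
    by exists 0.
  by move=> f hf; rewrite lmul_poly0; apply/fsupp_laurent; exact: span_E.
Qed.

(** Numerators of the elements of [I] over the common denominator [E]. *)
Definition numerators : set {poly R} := [set p | exists2 z, I z & pact X E z = laurent_of_poly p].

Lemma cancelE f g : laurent_series f -> laurent_series g -> pact X E f = pact X E g -> f = g.
Proof.
move=> hf hg e; apply/eqP; rewrite -subr_eq0; apply/eqP; apply: (pact_cancel E0).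
  by apply: (subspaceB laurent_subspace).
by rewrite pact_vB e subrr.
Qed.

(** After multiplication by the common denominator [E] the module becomes an ideal of polynomials. It
contains [E], so its generator divides [E] and has a nonzero constant term. *)
Lemma numerators_gen : exists2 g : {poly R}, g`_0 != 0 & exists z, [/\ I z, pact X E z = laurent_of_poly g,
  forall p, numerators p -> g %| p & exists2 P : {poly R}, P`_0 != 0 & pact X P z = lone R].
Proof.
have JE : numerators E by exists (lone R) => //; exact: pact_lone.
have En0 : E != 0 by apply: contraNneq E0 => ->; rewrite coef0.
pose Q (k : nat) := `[< exists g : {poly R}, [/\ numerators g, g != 0 & size g = k] >].
have exQ : exists k, Q k by exists (size E); apply/asboolP; exists E.
case: (ex_minnP exQ) => m /asboolP [g [[z Iz ez] gn0 sg]] mmin.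
have dv p : numerators p -> g %| p.
  move=> [w Iw ew]; apply/modp_eq0P; apply/eqP; apply: contraT => r0.
  have : Q (size (p %% g)).
    apply/asboolP; exists (p %% g); split=> //; exists (w - pact X (p %/ g) z).
      by apply: (subspaceB sI) => //; exact: span_pact.
    have -> : pact X E (w - pact X (p %/ g) z) = pact X E w - pact X (p %/ g) (pact X E z).
      by rewrite pact_vB -!pactM [E * _]mulrC.
    rewrite ew ez pact_lop.
    have -> : p %% g = (-1) *: (p %/ g * g) + p by rewrite scaleN1r {3}(divp_eq p g) addKr.
    by rewrite lop_lin scaleN1r addrC.
  by move=> /mmin; rewrite -sg leqNgt ltn_modp gn0.
have := dv E JE => /dvdpP [P eE].
have PgE : P`_0 * g`_0 = E`_0 by rewrite eE coef0M.
exists g; first by apply: contraNneq E0 => h; rewrite -PgE h mulr0.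
exists z; split=> //; exists P; first by apply: contraNneq E0 => h; rewrite -PgE h mul0r.
apply: cancelE.
- by apply: pactX_laurent; exact: span_laurent.
- exact: span_laurent.
- by rewrite -pactM mulrC pactM ez pact_lop pact_lone eE.
Qed.

Lemma laurent_cancel p f g : p`_0 != 0 -> laurent_series f -> laurent_series g ->
  pact X p f = pact X p g -> f = g.
Proof.
move=> p0 hf hg e; apply/eqP; rewrite -subr_eq0; apply/eqP; apply: (pact_cancel p0).
  by apply: (subspaceB laurent_subspace).
by rewrite pact_vB e subrr.
Qed.

Lemma euler_dvd P P' (L L' : V) : P.[0] = 1 -> P'.[0] = 1 -> pact X P L = lone R -> pact X P' L' = lone R ->
  principal_ideal L L' -> P' %| P.
Proof.
move=> P0 P0' e e' [Q /fsupp_laurent /laurent_polyP [n [q ->]]]; rewrite lmul_poly => eL.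
have : iter n X L' = pact X q L by rewrite -eL iterXT.
move=> /(congr1 (pact X (P * P'))).
rewrite -iterX_pact pactM e' pact_lone iterX_lop.
have -> : pact X (P * P') (pact X q L) = laurent_of_poly (q * P').
  by rewrite -pactM [P * P' * q]mulrC [P * P']mulrC mulrA pactM e pact_lone.
move=> /lop_inj eq; have cop : coprimep P' 'X^n.
  by apply: coprimep_expr; rewrite coprimepX /root P0' oner_eq0.
by rewrite -(Gauss_dvdpr _ cop) eq dvdp_mull.
Qed.

(** The module contains [1], so its generator is the inverse of a polynomial; two such generators
divide each other and have the same constant term. *)
Lemma lspan_euler : has_unique_euler_generator (lspan S).
Proof.
have eI : lspan S = I by apply/seteqP; split=> f; [move/lspanE|move=> ?; apply/lspanE].
have [g g0 [z [Iz ez dv [P P0 eP]]]] := numerators_gen.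
have P1 : ((P`_0)^-1 *: P).[0] = 1 by rewrite hornerZ horner_coef0 mulVf.
have euler L : euler_factor L <-> laurent_series L /\ exists2 P : {poly R}, P.[0] = 1 & pact X P L = lone R.
  by split=> -[h [Q h1 h2]]; split=> //; exists Q => //; rewrite ?lmul_poly0 // -lmul_poly0.
pose L := P`_0 *: z.
have L1 : euler_factor L /\ I = principal_ideal L.
  split.
    apply/euler; split; first by apply: (subspaceZ _ laurent_subspace); exact: span_laurent.
    by exists ((P`_0)^-1 *: P) => //; rewrite pactZ pact_vZ eP scalerA mulVf // scale1r.
  apply/seteqP; split=> [w Iw|_ [Q /fsupp_laurent /laurent_polyP [n [q ->]] <-]]; last first.
    by rewrite lmul_poly; apply: span_iterT; apply: span_pact; exact: (subspaceZ _ sI).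
  have [n [p ep]] := laurent_polyP (span_E Iw).
  have Jp : numerators p.
    exists (iter n X w); first exact: span_iterX.
    by rewrite -iterX_pact ep; apply/funext => k; rewrite iterX subrK.
  have [q eq] := dvdpP _ _ (dv p Jp).
  exists (fun k => laurent_of_poly ((P`_0)^-1 *: q) (k + n%:Z)).
    apply/fsupp_laurent; have [l hl] := lop_fsupp ((P`_0)^-1 *: q).
    exists [seq k - n%:Z | k <- l] => k /hl h; apply/mapP; exists (k + n%:Z) => //; by rewrite addrK.
  rewrite lmul_poly pactZ pact_vZ scalerA mulVf // scale1r.
  rewrite -[RHS](iterTX n); congr (iter n T _); apply: cancelE.
  - by apply: pactX_laurent; exact: span_laurent.
  - by apply: span_laurent; exact: span_iterX.
  - rewrite -pactM mulrC pactM ez pact_lop -eq -iterX_pact ep.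
    by apply/funext => k; rewrite iterX subrK.
rewrite eI; exists L; split=> // L' [/euler [lL' [P' P0' eP']] eL'].
have [/euler [lL [Q Q0 eQ]] eL] := L1.
have self (f : V) : principal_ideal f f.
  exists (laurent_of_poly 1); first by apply/fsupp_laurent; exact: lop_fsupp.
  by rewrite lmul_poly0 -polyC1 pactC scale1r.
have d1 : P' %| Q by apply: (euler_dvd Q0 P0' eQ eP'); rewrite -eL eL'.
have d2 : Q %| P' by apply: (euler_dvd P0' Q0 eP' eQ); rewrite -eL' eL.
have /eqpf_eq [c c0 ePQ] : P' %= Q by rewrite /eqp d1 d2.
have c1 : c = 1 by move: P0'; rewrite ePQ hornerZ Q0 mulr1.
apply: (@laurent_cancel Q) => //; first by rewrite -horner_coef0 Q0 oner_eq0.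
by rewrite eQ -eP' ePQ c1 scale1r.
Qed.

End Main.

End Laurent.

(** * The functions under the integral *)

Section CcMatrix.
Variables (F : localFieldType) (R : closedFieldType) (m n : nat).
Implicit Types (Phi : 'M[F]_(m, n) -> R) (M N : 'M[F]_(m, n)).

Lemma mx_cover (C : set 'M[F]_(m, n)) (s : 'M[F]_(m, n) -> nat) : compact C ->
  exists l : seq 'M[F]_(m, n), forall M, C M -> exists2 N, N \in l & mxO (s N)%:Z (M - N).
Proof.
rewrite compact_cover => /(_ _ C (fun N => [set M | mxO (s N)%:Z (M - N)])).
case=> [N _|M CM|D _ cD].
- rewrite openE => M /= hM; apply/nbhs_mxP; exists (s N) => M' h.
  have := mxOD h hM; rewrite addrA subrK; exact.
- by exists M => //=; rewrite subrr; exact: mxO0.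
exists (finmap.enum_fset D) => M /cD [N /= ND h].
by exists N.
Qed.

(** Uniform local constancy, and a bound for the support. *)
Lemma CcmxP Phi : @Cc R _ Phi <->
  (exists t : nat, forall x y, mxO t%:Z y -> Phi (x + y) = Phi x) /\
  (exists b : nat, forall x, Phi x != 0 -> mxO (- b%:Z) x).
Proof.
split=> [[lc [C cC hC]]|[[t ht] [b hb]]]; last first.
  split; last by exists [set M | mxO (- b%:Z) M]; [exact: compact_mxO|exact: hb].
  move=> x; apply/nbhs_mxP; exists t => N hN; rewrite -(subrK x N) addrC; exact: ht.
have /choice [s hs] N : exists s : nat, forall M, mxO s%:Z (M - N) -> Phi M = Phi N.
  by have /nbhs_mxP := lc N.
have [l hl] := mx_cover s cC.
pose t := \max_(N <- l) s N.
have tl N : N \in l -> (s N <= t)%N by move=> Nl; rewrite /t (big_rem N) //=; exact: leq_maxl.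
have near x y : C x -> mxO t%:Z y -> Phi (x + y) = Phi x.
  move=> /hl [N Nl h] hy; rewrite (hs N x h) (hs N) // addrAC.
  by apply: mxOD => //; apply: mxO_le hy; rewrite lez_nat tl.
split.
  exists t => x y hy; have [e|/hC/near -> //] := eqVneq (Phi x) 0.
  have [-> //|/hC h] := eqVneq (Phi (x + y)) 0.
  have := near _ (- y) h (mxON hy).
  by rewrite addrK.
have /choice [e he] N : exists e : nat, mxO (- e%:Z) N by exact: mxO_exists.
pose b := \max_(N <- l) e N.
exists b => x /hC /hl [N Nl h]; rewrite -(subrK N x); apply: mxOD.
  by apply: mxO_le h; lia.
apply: mxO_le (he N); have : (e N <= b)%N by rewrite /b (big_rem N) //=; exact: leq_maxl.
by lia.
Qed.

End CcMatrix.

Section Embedding.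
Variables (F : localFieldType) (m d n : nat) (e : (m + d)%N = n).
Implicit Types (g h : GL F m).

Definition embmx (A : 'M[F]_m) : 'M[F]_n := castmx (e, e) (block_mx A 0 0 1%:M).

Lemma embmxM A B : embmx (A *m B) = embmx A *m embmx B.
Proof.
rewrite /embmx; case: n / e; rewrite !castmx_id mulmx_block.
by rewrite !mulmx0 !mul0mx mulmx1 !addr0 !add0r.
Qed.

Lemma embmx1 : embmx 1%:M = 1%:M.
Proof. by rewrite /embmx; case: n / e; rewrite !castmx_id -scalar_mx_block. Qed.

Lemma emb_unit g : embmx (glmx g) \in unitmx.
Proof.
have : embmx (glmx g) *m embmx (glmx g^-1%g) = 1%:M by rewrite -embmxM glmxKV embmx1.
by move=> /mulmx1_unit [].
Qed.

Definition emb g : GL F n := MkGL (emb_unit g).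

Lemma embM g h : emb (g * h)%g = (emb g * emb h)%g.
Proof. by apply: glmx_inj; exact: embmxM. Qed.

Lemma glmx_emb g : glmx (emb g) = embmx (glmx g). Proof. by []. Qed.

Lemma embV g : emb g^-1%g = (emb g)^-1%g.
Proof.
rewrite -[RHS]mul1g; have -> : (1%g : GL F n) = (emb g^-1%g * emb g)%g.
  by rewrite -embM mulVg; apply: glmx_inj; rewrite glmx_emb !glmx1 embmx1.
by rewrite !mulgE.
Qed.

Definition ix (a : 'I_m) : 'I_n := cast_ord e (lshift d a).

Lemma ix_inj : injective ix.
Proof. by move=> a b /cast_ord_inj /lshift_inj. Qed.

Lemma ixE (i : 'I_n) (h : (i < m)%N) : i = ix (Ordinal h).
Proof. exact: val_inj. Qed.

Lemma embE A a b : embmx A (ix a) (ix b) = A a b.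
Proof. by rewrite /embmx castmxE /ix !cast_ordK block_mxEul. Qed.

Lemma emb_out A (i j : 'I_n) : ~~ Pj m i j -> embmx A i j = (i == j)%:R.
Proof.
rewrite /embmx /ix; case: n / e i j => i j; rewrite castmx_id /Pj.
case: (splitP i) => [a ea|a ea]; case: (splitP j) => [b eb|b eb] nP.
- by [].
- have -> : i = lshift d a by exact: val_inj.
  have -> : j = rshift m b by exact: val_inj.
  by rewrite block_mxEur mxE eq_lrshift.
- have -> : i = rshift m a by exact: val_inj.
  have -> : j = lshift d b by exact: val_inj.
  by rewrite block_mxEdl mxE eq_rlshift.
- have -> : i = rshift m a by exact: val_inj.
  have -> : j = rshift m b by exact: val_inj.
  by rewrite block_mxEdr mxE eq_rshift.
Qed.

Lemma emb_Kc (s : nat) g : Kc s g -> Kc s (emb g).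
Proof.
have aux (A : 'M[F]_m) : mxO s%:Z (A - 1%:M) -> mxO s%:Z (embmx A - 1%:M).
  move=> hA i j; rewrite mxB1E; have [/andP[hi hj]|nP] := boolP (Pj m i j).
    by rewrite (ixE hi) (ixE hj) embE (inj_eq ix_inj) -mxB1E.
  by rewrite emb_out // subrr; exact: inO0.
by move=> [h1 h2]; split; [exact: aux|rewrite -embV; exact: aux].
Qed.

Lemma emb1 : emb 1%g = (1%g : GL F n).
Proof. by apply: glmx_inj; rewrite glmx_emb !glmx1 embmx1. Qed.

Lemma emb_KcV (s : nat) g : Kc s (emb g) -> Kc s g.
Proof.
have aux (A : 'M[F]_m) : mxO s%:Z (embmx A - 1%:M) -> mxO s%:Z (A - 1%:M).
  by move=> hA a b; have := hA (ix a) (ix b); rewrite !mxB1E embE (inj_eq ix_inj).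
by move=> [h1 h2]; split; apply: aux => //; rewrite -glmx_emb embV.
Qed.

Lemma emb_Pj g : UJ (Pj m) (emb g).
Proof. by apply: UJ_Pj => i j nP; rewrite mxB1E emb_out // subrr. Qed.

Lemma emb_surj (p : GL F n) : UJ (Pj m) p -> exists g, p = emb g.
Proof.
move=> [hp hp'].
have aux (q : GL F n) : supp (Pj m) (glmx q - 1%:M) -> embmx (\matrix_(a, b) glmx q (ix a) (ix b)) = glmx q.
  move=> hq; apply/matrixP => i j; have [/andP[hi hj]|nP] := boolP (Pj m i j).
    by rewrite (ixE hi) (ixE hj) embE mxE.
  by rewrite emb_out //; have := hq i j nP; rewrite mxB1E => /eqP; rewrite subr_eq0 => /eqP.
pose A : 'M[F]_m := \matrix_(a, b) glmx p (ix a) (ix b).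
pose B : 'M[F]_m := \matrix_(a, b) glmx p^-1%g (ix a) (ix b).
have inj : injective embmx by move=> X Y eXY; apply/matrixP => a b; rewrite -!embE eXY.
have AB : A *m B = 1%:M by apply: inj; rewrite embmxM embmx1 /A /B !aux // glmxKV.
by exists (MkGL (mulmx1_unit AB).1); apply: glmx_inj; rewrite /= aux.
Qed.

Lemma emb_up g : upper_unipotent (emb g) <-> upper_unipotent g.
Proof.
split=> h a b ba; first by have := h (ix a) (ix b) ba; rewrite /= embE (inj_eq ix_inj).
rewrite /=; have [/andP[hi hj]|nP] := boolP (Pj m a b); last by rewrite emb_out.
rewrite (ixE hi) (ixE hj) embE (inj_eq ix_inj) h //.
Qed.

Lemma ix_sum (V : nmodType) (f : 'I_n -> V) : (forall i : 'I_n, (m <= i)%N -> f i = 0) ->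
  \sum_i f i = \sum_(a < m) f (ix a).
Proof.
move=> h; rewrite /ix; case: n / e f h => f h; rewrite big_split_ord /= [X in _ + X]big1 ?addr0 => [|i _].
  by apply: eq_bigr => a _; congr f; exact: val_inj.
by apply: h; rewrite /= leq_addr.
Qed.

Lemma emb_char (R : closedFieldType) (theta : F -> R) g : upper_unipotent g ->
  char_of_unipotent theta (emb g) = char_of_unipotent theta g.
Proof.
move=> hu; rewrite /char_of_unipotent; congr theta.
have out (i j : 'I_n) : j = i.+1 :> nat -> ~~ Pj m i j -> glmx (emb g) i j = 0.
  move=> ej nP; have := emb_out (glmx g) nP; rewrite -glmx_emb => ->.
  by rewrite [(i == j)](_ : _ = false) // -val_eqE /= ej ltn_eqF.
rewrite ix_sum => [|i mi]; last first.
  by apply: big1 => j /eqP ej; apply: out => //; rewrite /Pj ltnNge mi.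
apply: eq_bigr => a _; rewrite big_mkcond ix_sum => [|j mj]; last first.
  by case: ifP => // /eqP ej; apply: out => //; rewrite /Pj [(j < m)%N]ltnNge mj andbF.
by rewrite [RHS]big_mkcond; apply: eq_bigr => b _; rewrite glmx_emb embE.
Qed.

Definition ext0 (y : 'I_m -> int) (i : 'I_n) : int := if insub (i : nat) is Some a then y a else 0.

Lemma ext0E y a : ext0 y (ix a) = y a.
Proof. by rewrite /ext0 /= valK. Qed.

Lemma ext0_out y (i : 'I_n) : (m <= i)%N -> ext0 y i = 0.
Proof. by move=> h; rewrite /ext0 insubN // -leqNgt. Qed.

Lemma emb_ay y : emb (ay F y) = ay F (ext0 y).
Proof.
apply: glmx_inj; apply/matrixP => i j.
have ex (b : 'I_m) : xof (ext0 y) (ix b) = xof y b.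
  rewrite /xof big_mkcond ix_sum => [|k hk]; last by rewrite ext0_out // if_same.
  by rewrite [RHS]big_mkcond; apply: eq_bigr => c _; rewrite ext0E.
have eo (k : 'I_n) : (m <= k)%N -> xof (ext0 y) k = 0.
  by move=> hk; rewrite /xof big1 // => l hl; rewrite ext0_out //; exact: leq_trans hl.
have [/andP[hi hj]|nP] := boolP (Pj m i j).
  by rewrite (ixE hi) (ixE hj) /= embE !dmxE (inj_eq ix_inj) ex.
rewrite /= emb_out // dmxE; case: eqP nP => [<-|//]; rewrite /Pj andbb -leqNgt => h.
by rewrite eo // expr0z.
Qed.

Lemma ext0_shf a c y : ext0 (shf a c y) = shf (ix a) c (ext0 y).
Proof.
apply/funext => i; have [h|h] := ltnP i m.
  by rewrite (ixE h) /shf !ext0E (inj_eq ix_inj).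
rewrite /shf !ext0_out // [(i == ix a)](_ : _ = false) ?mul0r ?addr0 //.
by apply/negbTE; rewrite -val_eqE /= neq_ltn (leq_trans (ltn_ord a) h) orbT.
Qed.

End Embedding.

Lemma emb0 (F : localFieldType) (m : nat) (e : (m + 0)%N = m) (g : GL F m) : emb e g = g.
Proof.
apply: glmx_inj; apply/matrixP => a b; rewrite -[in RHS](embE e) /=.
by congr (embmx _ _ _ _); apply: val_inj.
Qed.

Section Zeta.
Variables (F : localFieldType) (R : closedFieldType) (sq : sqrt_resq F R).
Variables (theta : F -> R) (ht : nontrivial_smooth_character theta).
Variables (m d n : nat) (e : (m + d)%N = n) (m0 : (0 < m)%N).
Variables (pi : rep R (GL F n)) (pi' : rep R (GL F m)).
Hypotheses (sm : ksmooth (@Kc F n) pi) (ad : adm (@Kc F n) pi) (fg : fgen pi).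
Hypotheses (sm' : ksmooth (@Kc F m) pi') (ad' : adm (@Kc F m) pi') (fg' : fgen pi').
Variables (mu : (GL F m -> R) -> R) (hmu : quotient_measure mu).
Local Notation theta' := (fun x => (theta x)^-1).
Local Notation Kc := (@Kc F m).
Local Notation emb := (emb e).
Local Notation vdet g := (lfval (\det (glmx g))).
Implicit Types (lam : {scalar pi}) (kap : {scalar pi'}) (Phi : 'rV[F]_m -> R) (g h : GL F m).

(** The two families of integrals have one shape: the Schwartz function is
constant when the sizes differ. *)
Definition testfun Phi := (d = 0%N -> @Cc R _ Phi) /\ ((0 < d)%N -> Phi = fun=> 1).

Definition et : 'rV[F]_m := \row_i (i.+1 == m)%:R.

Definition integrand lam kap (v : pi) (v' : pi') Phi g : R :=
  lam (ract pi (emb g) v) * kap (ract pi' g v') * Phi (et *m glmx g).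

Lemma testfunP Phi : testfun Phi -> d = 0%N /\ @Cc R _ Phi \/ Phi = fun=> 1.
Proof. by move=> [h1 h2]; case: (posnP d) => [d0|/h2]; [left|right]; auto. Qed.

Lemma testfun_K Phi : testfun Phi -> exists s : nat, forall w k, Kc s k -> Phi (w *m glmx k) = Phi w.
Proof.
move=> /testfunP [[_ /CcmxP [[t ht'] [b hb]]]|->]; last by exists 0%N.
exists (t + b)%N => w k Kk.
have small (w0 : 'rV[F]_m) k0 : Kc (t + b)%N k0 -> mxO (- b%:Z) w0 -> Phi (w0 *m glmx k0) = Phi w0.
  move=> [K0 _] hw; have -> : w0 *m glmx k0 = w0 + w0 *m (glmx k0 - 1%:M) by rewrite mulmxBr mulmx1 addrC subrK.
  apply: ht'; apply: mxO_le (mxOM hw K0); lia.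
have [e0|/hb] := eqVneq (Phi w) 0; last exact: small.
have [-> //|/hb hw] := eqVneq (Phi (w *m glmx k)) 0.
have [_ _ KV] := @Kc_subgr F m (t + b).
by rewrite -(small _ _ (KV _ Kk) hw) -mulmxA glmxKV mulmx1.
Qed.

Lemma testfun_lim Phi w : testfun Phi -> exists C : int, forall c : int, C <= c -> Phi (unif ^ c *: w) = Phi 0.
Proof.
move=> /testfunP [[_ /CcmxP [[t ht'] _]]|->]; last by exists 0.
have [b hb] := mxO_exists w; exists (t%:Z + b%:Z) => c hc; rewrite -[_ *: _]add0r; apply: ht'.
have hw := mxOZ (inO_pw F c) hb; apply: mxO_le hw; lia.
Qed.

Lemma testfun_tr Phi h : testfun Phi -> testfun (fun w => Phi (w *m glmx h)).
Proof.
move=> [h1 h2]; split=> [/h1|/h2 -> //].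
move=> /CcmxP [[t ht'] [b hb]]; apply/CcmxP.
have [c hc] := mxO_exists (glmx h); have [c' hc'] := mxO_exists (glmx h^-1%g); split.
  exists (t + c)%N => x y hy; rewrite mulmxDl; apply: ht'.
  by apply: mxO_le (mxOM hy hc); lia.
exists (b + c')%N => x /hb hx; rewrite -(mulmx1 x) -(glmxKV h) mulmxA.
by apply: mxO_le (mxOM hx hc'); lia.
Qed.

Lemma last_uniq (a b : 'I_m) : a.+1 = m -> b.+1 = m -> a = b.
Proof. by move=> ea eb; apply: val_inj; apply: succn_inj; exact: etrans ea (esym eb). Qed.

Lemma et_ay y g (l : 'I_m) : l.+1 = m -> et *m glmx (ay F y * g)%g = unif ^ (y l) *: (et *m glmx g).
Proof.
move=> el; rewrite glmxM mulmxA scalemxAl; congr (_ *m _); apply/rowP => j.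
rewrite mul_mxdE !mxE mulrC; case: eqP => [ej|_]; last by rewrite !mulr0.
have -> := last_uniq ej el.
by rewrite xof_last.
Qed.

Lemma m_last : exists l : 'I_m, l.+1 = m.
Proof. by case: m m0 => // k _; exists ord_max. Qed.

(** The last torus coordinate is bounded below by the support of the Schwartz function if [d = 0], and by
the decay of the larger Whittaker function otherwise. *)
Lemma integrand_tame lam kap v v' Phi : whittaker_functional theta lam -> whittaker_functional theta' kap ->
  testfun Phi -> exists C s, (0 < s)%N /\ tame (integrand lam kap v v' Phi) C s.
Proof.
move=> wl wl' tf; have [s1 f1] := sm v; have [s2 f2] := sm' v'; have [s3 f3] := testfun_K tf.
have [C1 h1] := whittaker_decay ht wl s1.
have [C2 h2] : exists C2, d = 0%N -> forall w, Phi w != 0 -> mxO C2 w.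
  case: (testfunP tf) => [[d0 /CcmxP [_ [b hb]]]|ePhi]; first by exists (- b%:Z).
  case: (posnP d) => [d0|]; last by exists 0; lia.
  have /CcmxP [_ [b hb]] := tf.1 d0; by exists (- b%:Z).
exists (Num.min C1 C2), (maxn s1 (maxn s2 s3)).+1; split=> //; split.
- move=> u g hu; rewrite /integrand embM (lamM wl); last exact/emb_up.
  rewrite (lamM wl') // emb_char // glmxM mulmxA.
  have -> : et *m glmx u = et.
    apply/rowP => j; rewrite mxE; have [l el] := m_last; rewrite (bigD1 l) //= big1 ?addr0 => [|k kl].
      rewrite !mxE el eqxx mul1r hu; last by rewrite -ltnS el.
      by case: (l =P j) => [<-|lj]; rewrite ?el ?eqxx //; case: eqP => // ej; case: lj; exact: last_uniq.
    rewrite mxE [(k.+1 == m)](_ : _ = false) ?mul0r //; apply: contraNF kl => /eqP ek.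
    exact/eqP/last_uniq.
  congr (_ * _); rewrite mulrACA -[RHS]mul1r; congr (_ * _).
  by rewrite /char_of_unipotent mulfV // (theta_neq0 ht).
- move=> g k Kk; rewrite /integrand embM !ractM glmxM mulmxA; congr (_ * kap (ract _ _ _) * _).
  + rewrite f1 //; apply: emb_Kc; apply: Kc_le Kk; lia.
  + by rewrite f2 //; apply: Kc_le Kk; lia.
  + by apply: f3; apply: Kc_le Kk; lia.
- move=> y k Kk; rewrite /integrand !mulf_eq0 !negb_or embM emb_ay => /andP[/andP[nz _] nP] i.
  have [lt|ge] := ltnP i.+1 n.
    rewrite ge_min; apply/orP; left; rewrite -(ext0E e y i).
    by apply: (h1 v _ _ (emb k)) => //; exact: emb_Kc.
  have im := ltn_ord i; have d0 : d = 0%N by lia.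
  have ei : i.+1 = m by lia.
  rewrite ge_min; apply/orP; right; move: nP; rewrite (et_ay _ _ ei) => /(h2 d0).
  move=> hw; have [_ _ KV] := @Kc_subgr F m 0.
  have := mxOM0 hw (Kc_int (KV _ Kk)) 0 i.
  rewrite -scalemxAl -mulmxA glmxKV mulmx1 !mxE ei eqxx mulr1 /inO (negbTE (pw_neq0 _ _)).
  by rewrite lfval_pw.
Qed.

(** The Schwartz function only sees the last row, which tends to [0], so it is eventually
constant along each coordinate. *)
Lemma integrand_recur : exists2 Q : 'I_m -> {poly R}, (forall i, Q i != 0) &
  forall lam kap v v' Phi, whittaker_functional theta lam -> whittaker_functional theta' kap ->
  testfun Phi -> forall i h, exists C' : int, forall y, C' <= y i ->
    recur (Q i) (fun a : nat => integrand lam kap v v' Phi (ay F (shf i a y) * h)%g).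
Proof.
have /choice [Q hQ] (i : 'I_m) : exists Q : {poly R}, Q != 0 /\
  forall lam kap v v' Phi, whittaker_functional theta lam -> whittaker_functional theta' kap ->
  testfun Phi -> forall h, exists C' : int, forall y, C' <= y i ->
    recur Q (fun a : nat => integrand lam kap v v' Phi (ay F (shf i a y) * h)%g).
  have [p p0 hp] := jacquet_finite sq (ix e i).+1 sm ad fg.
  have [p' p0' hp'] := jacquet_finite sq i.+1 sm' ad' fg'.
  have [Q Q0 hQ] := recur_mul p0 p0'; exists Q; split=> // lam kap v v' Phi wl wl' tf h.
  have [C1 h1] := whittaker_recur ht wl (ract pi (emb h) v) hp.
  have [C2 h2] := whittaker_recur (theta_inv ht) wl' (ract pi' h v') hp'.
  have [C3 h3] := testfun_lim (et *m glmx h) tf.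
  exists (Num.max C1 (Num.max C2 C3)) => y; rewrite !ge_max => /and3P[g1 g2 g3].
  have [c hc] : exists c, forall a : nat, Phi (et *m glmx (ay F (shf i a y) * h)%g) = c.
    have [l el] := m_last; have [il|il] := eqVneq i l.
      exists (Phi 0) => a; rewrite (et_ay _ _ el) h3 // /shf -il eqxx; lia.
    by exists (Phi (unif ^ (y l) *: (et *m glmx h))) => a; rewrite (et_ay _ _ el) /shf [l == i]eq_sym (negbTE il) addr0.
  have r1 : recur p (fun a : nat => lam (ract pi (ay F (shf (ix e i) a (ext0 y))) (ract pi (emb h) v))).
    by apply: h1; rewrite ext0E.
  have r2 := h2 y g2; have r12 := hQ _ _ r1 r2.
  have eqf (a : nat) : integrand lam kap v v' Phi (ay F (shf i a y) * h)%g =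
      c * (lam (ract pi (ay F (shf (ix e i) a (ext0 y))) (ract pi (emb h) v)) *
           kap (ract pi' (ay F (shf i a y)) (ract pi' h v'))).
    by rewrite /integrand hc embM emb_ay (ext0_shf e) !ractM mulrC.
  move=> a; have := congr1 ( *%R c) (r12 a); rewrite mulr0 mulr_sumr => E; rewrite -[RHS]E.
  by apply: eq_bigr => j _; rewrite eqf mulrCA.
by exists Q => [i|*]; [exact: (hQ i).1|exact: (hQ _).2].
Qed.

Definition zint lam kap v v' Phi : int -> R^o :=
  fun k => mu (cf (integrand lam kap v v' Phi) k) * sqrtq sq ^ (k * d%:Z).

Definition zset : set (int -> R^o) := [set Z | exists lam kap v v' Phi,
  [/\ whittaker_functional theta lam, exists x, lam x != 0,
      whittaker_functional theta' kap, exists x, kap x != 0 &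
      testfun Phi /\ Z = zint lam kap v v' Phi]].

Local Notation X := (pull R (fun k : int => k - 1)).
Local Notation T := (pull R (fun k : int => k + 1)).

Lemma sqz_neq0 k : sqrtq sq ^ k != 0.
Proof. by rewrite expfz_neq0 // sqrtq_neq0. Qed.

(** The powers of the square root of [q] rescale the variable of the denominator. *)
Lemma zset_rational : zset `<=` (@laurent_series R : set (int -> R^o)) /\
  exists2 D : {poly R}, D != 0 & forall Z, zset Z -> fsupp (pact T D Z).
Proof.
have [Q Q0 hQ] := integrand_recur; have [D D0 hD] := torus_rational sq hmu Q0.
have main Z : zset Z -> laurent_series Z /\ exists2 z : int -> R^o, fsupp (pact T D z) &
    Z = fun k => z k * sqrtq sq ^ (k * d%:Z).
  move=> [lam [kap [v [v' [Phi [wl _ wl' _ [tf ->]]]]]]].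
  have [C [s [s0 tm]]] := integrand_tame v v' wl wl' tf.
  have [h1 h2] := hD _ _ _ s0 tm (fun i h _ => hQ lam kap v v' Phi wl wl' tf i h).
  split; last by exists (fun k => mu (cf (integrand lam kap v v' Phi) k)).
  by exists (C * \sum_(i < m) i.+1%:Z) => k hk; rewrite /zint h1 ?mul0r.
split; first by move=> Z /main [].
pose c := sqrtq sq ^ d%:Z; have c0 : c != 0 by exact: sqz_neq0.
(* [c] is the ratio of the twisting factors in consecutive degrees *)
exists (D \Po (c^-1 *: 'X)) => [|Z /main [_ [z [l hl] ->]]].
  by rewrite -size_poly_eq0 size_comp_poly2 ?size_poly_eq0 // size_scale ?invr_eq0 // size_polyX.
exists l => k nz; apply: hl; apply: contra nz => /eqP ez; apply/eqP.
have cX : c^-1 *: 'X != 0 :> {poly R} by rewrite scaler_eq0 invr_eq0 (negbTE c0) polyX_eq0.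
have -> : pact T (D \Po (c^-1 *: 'X)) (fun k : int => z k * sqrtq sq ^ (k * d%:Z)) k =
    sqrtq sq ^ (k * d%:Z) * pact T D z k; last by rewrite ez mulr0.
rewrite !pact_pull mulr_sumr size_comp_poly2; last by rewrite size_scale ?invr_eq0 // size_polyX.
apply: eq_bigr => j _; have -> : (D \Po (c^-1 *: 'X))`_j = D`_j * c^-1 ^+ j.
  rewrite comp_polyE coef_sum (bigD1 j) //= big1 ?addr0 => [|i ij].
    by rewrite exprZn !coefZ coefXn eqxx mulr1.
  by rewrite exprZn !coefZ coefXn [(_ == _)](_ : _ = false) ?mulr0 //; apply/negbTE; rewrite eq_sym; exact: ij.
have -> : iter j (fun k0 : int => k0 + 1) k = k + j%:Z.
  have itk (a : nat) : iter a (fun k0 : int => k0 + 1) k = k + a%:Z.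
    by elim: a => [|a IH]; rewrite ?addr0 // iterS IH; lia.
  exact: itk.
have ecj : sqrtq sq ^ (j%:Z * d%:Z) = c ^+ j by rewrite mulrC -exprz_exp.
rewrite mulrDl expfzDr ?sqrtq_neq0 // ecj exprVn.
have cj : c ^+ j != 0 by rewrite expf_neq0.
move: (z _) (sqrtq sq ^ _) => a b.
by field.
Qed.

(** Translation of all the data by an element whose determinant has valuation [a]. *)
Lemma zset_shift (a : int) Z : zset Z -> (exists h, vdet h = a) -> exists2 c, c != 0 &
  zset (fun k => c * Z (k + a)).
Proof.
move=> [lam [kap [v [v' [Phi [wl nl wl' nl' [tf ->]]]]]]] [h hh].
have [C [s [s0 tm]]] := integrand_tame v v' wl wl' tf.
exists (sqrtq sq ^ (- (a * d%:Z))); first exact: sqz_neq0.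
exists lam, kap, (ract pi (emb h) v), (ract pi' h v'), (fun w => Phi (w *m glmx h)); split=> //.
split; first exact: testfun_tr.
apply/funext => k; rewrite /zint mulrDl expfzDr ?sqrtq_neq0 //.
have -> : mu (cf (integrand lam kap (ract pi (emb h) v) (ract pi' h v') (fun w => Phi (w *m glmx h))) k) =
    mu (cf (integrand lam kap v v' Phi) (k + a)).
  rewrite -(mu_tr hmu h (cf_Qf (k + a) tm)); congr mu; apply/funext => g.
  rewrite /cf vdet_mul hh (inj_eq (addIr _)); case: ifP => // _.
  by rewrite /integrand embM !ractM glmxM mulmxA.
rewrite mulrC -!mulrA -expfzDr ?sqrtq_neq0 // subrr mulr1; by [].
Qed.

Lemma zset_X Z : zset Z -> span zset (X Z) /\ span zset (T Z).
Proof.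
move=> hZ; have vz : vdet (zt F m 1) = 1.
  rewrite vdet_dg (bigD1 (Ordinal m0)) //= big1 ?addr0 // => i.
  by rewrite -val_eqE /= ltnS leqn0 => /negbTE ->.
have aux (a : int) : (exists h : GL F m, vdet h = a) -> span zset (fun k => Z (k + a)).
  move=> hh; have [c c0 hc] := zset_shift hZ hh.
  have -> : (fun k => Z (k + a)) = c^-1 *: (fun k => c * Z (k + a) : R^o) :> (int -> R^o).
    by apply/funext => k; rewrite -[RHS]/(c^-1 * (c * Z (k + a))) mulKf.
  by have := subspaceZ c^-1 (span_subspace zset) (sub_span hc).
split; last by apply: aux; exists (zt F m 1).
apply: (aux (- 1)); exists (zt F m 1)^-1%g.
have := vdet_mul (zt F m 1) (zt F m 1)^-1%g; rewrite mulgV glmx1 det1 lfval1 vz; lia.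
Qed.

Lemma zset_main : span zset (lone R) ->
  fractional_ideal (lspan zset) /\ has_unique_euler_generator (lspan zset).
Proof.
move=> S1; have [SL [D D0 SD]] := zset_rational.
split; [apply: (lspan_fractional D0) => //|apply: (lspan_euler D0) => //]; by move=> Z /zset_X [].
Qed.

End Zeta.

(** * An integral equal to one *)

Section One.
Variables (F : localFieldType) (R : closedFieldType) (sq : sqrt_resq F R).
Variables (theta : F -> R) (ht : nontrivial_smooth_character theta).
Variables (m d n : nat) (e : (m + d)%N = n) (m0 : (0 < m)%N).
Variables (pi : rep R (GL F n)) (pi' : rep R (GL F m)).
Hypotheses (sm : ksmooth (@Kc F n) pi) (sm' : ksmooth (@Kc F m) pi').
Variables (mu : (GL F m -> R) -> R) (hmu : quotient_measure mu).
Local Notation theta' := (fun x => (theta x)^-1).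
Local Notation emb := (emb e).
Local Notation zset := (zset sq theta e pi pi' mu).
Variables (lam : {scalar pi}) (kap : {scalar pi'}).
Hypotheses (wl : whittaker_functional theta lam) (nl : exists x, lam x != 0).
Hypotheses (wk : whittaker_functional theta' kap) (nk : exists x, kap x != 0).
Local Notation vdet g := (lfval (\det (glmx g))).

(** On [N C] the determinant is a unit, so the only nonzero coefficient of the integral is the volume of
[N C], in degree [0]. *)
Lemma one_of_ind v v' Phi (C : set (GL F m)) (s t : nat) : (0 < s)%N -> (s <= t)%N -> subgr C ->
  C `<=` Kc s -> Kc t `<=` C -> testfun d Phi ->
  (forall u c, upper_unipotent u -> C c -> integrand e lam kap v v' Phi (u * c)%g = 1) ->
  (forall g, (forall u c, upper_unipotent u -> C c -> g <> (u * c)%g) -> integrand e lam kap v v' Phi g = 0) ->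
  span zset (lone R).
Proof.
move=> s0 st sC CK KC tf f1 f0; pose f := integrand e lam kap v v' Phi.
have fE : f = ind R (NS 1%g C).
  apply/funext => g; rewrite /ind /rst; case: asboolP => [[u [c [hu Cc ->]]]|ng].
    by rewrite mulg1; exact: f1.
  by apply: f0 => u c hu Cc eg; apply: ng; exists u, c; rewrite mulg1.
have c0 := mu_ND sq hmu s0 st sC CK KC; rewrite -fE in c0.
have cfE k : cf f k = fun g => (k == 0)%:R * f g.
  apply/funext => g; rewrite /cf fE /ind /rst; case: asboolP => [[u [c [hu Cc ->]]]|_]; last first.
    by rewrite mulr0 if_same.
  rewrite mulg1 vdet_mul vdet_upper // (vdet_Kc (Kc_le (leq0n s) (CK _ Cc))) addr0 mulr1 eq_sym.
  by case: ifP.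
have Qff : Qf f.
  rewrite fE; have -> : (1%g : GL F m) = dg F (fun=> 0) by rewrite dg0.
  apply: (Qf_NS _ (s := t)) => // [g /CK Kg|g k Cg Kk]; first exact: Kc_le Kg.
  by have [_ CM _] := sC; apply: CM => //; exact: KC.
have hz : zset (fun k => (k == 0)%:R * mu f).
  exists lam, kap, v, v', Phi; split=> //; split=> //; apply/funext => k.
  rewrite /zint -/f cfE (mu_scale hmu) //; case: eqP => [->|_]; last by rewrite !mul0r.
  by rewrite mul0r expr0z mulr1.
have -> : lone R = (mu f)^-1 *: (fun k => (k == 0)%:R * mu f : R^o) :> (int -> R^o).
  by apply/funext => k; rewrite -[RHS]/((mu f)^-1 * ((k == 0)%:R * mu f)) mulrC mulfK.
exact: subspaceZ (span_subspace zset) (sub_span hz).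
Qed.

Lemma normalized_vector : exists x' (s : nat), kap x' = 1 /\ fixd (@Kc F m) s x'.
Proof.
have [x1 nx1] := nk; have [s fs] := sm' x1.
exists ((kap x1)^-1 *: x1), s; split; first by rewrite linearZ /= mulVf.
by move=> k Kk; rewrite linearZ /= fs.
Qed.

(** A vector of [pi] from [kirillov] at the corner of size [m], and any vector of [pi'] on which [kap] is nonzero,
fixed by the small group [C]. *)
Lemma one_lt : (0 < d)%N -> span zset (lone R).
Proof.
move=> d0; have [x' [r1 [kx' fx']]] := normalized_vector.
have mn : (m < n)%N by rewrite -e; lia.
have [x [C [t [sC CU KC C1 C0]]]] := kirillov sq ht sm wl nl mn (maxn r1 1).
have [CO CM CV] := sC.
apply: (@one_of_ind x x' (fun=> 1) [set c | C (emb c)] (maxn r1 1) (maxn t (maxn r1 1))).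
- by rewrite leq_max orbT.
- exact: leq_maxr.
- split=> [|g h hg hh|g hg] /=; first by rewrite emb1.
    by rewrite embM; exact: CM.
  by rewrite embV; exact: CV.
- by move=> c /CU [_ Kk]; exact: (emb_KcV Kk).
- move=> c Kk; apply: KC; split; first exact: emb_Pj.
  by apply: emb_Kc; apply: Kc_le Kk; exact: leq_maxl.
- by split=> // d00; move: d0; rewrite d00.
- move=> u c hu Cc; rewrite /integrand embM (lamM wl); last exact/emb_up.
  rewrite (lamM wk) // C1 // emb_char // mulr1 fx'; last first.
    by apply: (@Kc_le _ _ _ (maxn r1 1)); [exact: leq_maxl|exact: (emb_KcV (CU _ Cc).2)].
  by rewrite kx' !mulr1 /char_of_unipotent mulfV // (theta_neq0 ht).
- move=> g ng; rewrite /integrand C0 ?mul0r //; first exact: emb_Pj.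
  move=> u c hu Cc eg; have [c' ec] := emb_surj e (CU _ Cc).1.
  have eu : u = emb (g * c'^-1)%g by rewrite embM embV -ec eg !mulgE.
  apply: (ng (g * c'^-1)%g c'); last by rewrite !mulgE.
    by apply/(emb_up e); rewrite -eu.
  by rewrite /= -ec.
Qed.

(** The Schwartz function restricts the last row to a neighbourhood of the standard one, and [row_split] reduces
the support to the corner of size [m - 1], where [kirillov] applies. *)
Lemma one_eq : d = 0%N -> span zset (lone R).
Proof.
move=> d0; have [x' [r1 [kx' fx']]] := normalized_vector.
have mn : (m.-1 < n)%N by move: m0; rewrite -e; lia.
have [x [C [t [sC CU KC C1 C0]]]] := kirillov sq ht sm wl nl mn (maxn r1 1).
have [sx fx] := sm x; pose s := maxn (maxn r1 1) (maxn sx t).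
have [rs1 [s0 [ss st]]] : (maxn r1 1 <= s)%N /\ (0 < s)%N /\ (sx <= s)%N /\ (t <= s)%N by rewrite /s; lia.
have fxs : fixd (@Kc F n) s x by move=> k Kk; apply: fx; exact: Kc_le Kk.
have [l el] := m_last m0; pose jj := ix e l; have ej : jj = m.-1 :> nat by rewrite -el.
have ejj : jj.+1 = m by rewrite /= el.
have [P1 PM PV] := UJ_subgr F (@Pj_trans n m); have [K1 KM KV] := @Kc_subgr F n s.
have Pjj (g : GL F n) : UJ (Pj m.-1) g -> UJ (Pj m) g.
  by move=> [hg _]; apply: UJ_Pj => a c nP; apply: hg; apply: contra nP; rewrite /Pj; lia.
pose D := setM C (UJ (Pj m) `&` Kc s).
have sD : subgr D.
  apply: setM_subgr => //; first by apply: subgrI; [exact: UJ_subgr (@Pj_trans _ _)|exact: Kc_subgr].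
  move=> k h /CU [Uk Kk] [Uh Kh]; split; last by apply: Kc_normal => //; exact: Kc_le Kk.
  by apply: (PM _ _ (PM _ _ (PV _ (Pjj _ Uk)) Uh)); exact: Pjj.
have [DO DM DV] := sD.
have DK c : D c -> Kc (maxn r1 1) c.
  move=> [c0 [k [Cc [_ Kk] ->]]]; have [_ KM' _] := @Kc_subgr F n (maxn r1 1).
  by apply: KM'; [exact: (CU _ Cc).2|exact: Kc_le Kk].
pose Phi (w : 'rV[F]_m) : R := if `[< mxO s%:Z (w - et F m) >] then 1 else 0.
have tf : testfun d Phi.
  split=> [_|]; last by rewrite d0.
  apply/CcmxP; split.
    exists s => w y hy; rewrite /Phi; congr (if _ then _ else _); apply: asbool_equiv_eq; split=> h.
      have -> : w - et F m = (w + y - et F m) - y by rewrite addrAC addrK.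
      exact: mxOB.
    by rewrite addrAC; exact: mxOD.
  exists 0%N => w; rewrite /Phi; case: asboolP => [h _|]; last by rewrite eqxx.
  rewrite -(subrK (et F m) w); apply: mxOD; first by apply: mxO_le h; lia.
  by move=> a b; rewrite mxE; case: eqP => _; [exact: inO1|exact: inO0].
have etE (A : 'M[F]_m) i : (et F m *m A) 0 i = A l i.
  rewrite mxE (bigD1 l) //= big1 ?addr0 => [|k kl]; first by rewrite mxE el eqxx mul1r.
  rewrite mxE [(k.+1 == m)](_ : _ = false) ?mul0r //; apply: contraNF kl => /eqP ek.
  exact/eqP/last_uniq.
have et0 i : et F m 0 i = (l == i)%:R.
  rewrite mxE; case: (l =P i) => [<-|li]; rewrite ?el ?eqxx //; case: eqP => // ei; case: li; exact: last_uniq.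
have PhiE g : Phi (et F m *m glmx g) = if `[< forall i : 'I_n, (i <= jj)%N -> inO s%:Z (glmx (emb g) jj i - (i == jj)%:R) >] then 1 else 0.
  rewrite /Phi; congr (if _ then _ else _); apply: asbool_equiv_eq; split=> h.
    move=> i ij; have hi : (i < m)%N by rewrite -ejj.
    rewrite (ixE e hi); move: (Ordinal hi) => i0.
    have := h 0 i0; have sub (U V : 'rV[F]_m) i1 : (U - V) 0 i1 = U 0 i1 - V 0 i1 by rewrite !mxE.
    by rewrite sub etE et0 glmx_emb embE (inj_eq (@ix_inj _ _ _ e)) eq_sym.
  move=> a i; rewrite (ord1 a).
  have sub (U V : 'rV[F]_m) : (U - V) 0 i = U 0 i - V 0 i by rewrite !mxE.
  have hi : (ix e i <= jj)%N by rewrite -ltnS ejj; exact: (ltn_ord i).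
  have := h (ix e i) hi.
  by rewrite sub etE et0 glmx_emb embE (inj_eq (@ix_inj _ _ _ e)) eq_sym.
apply: (@one_of_ind x x' Phi [set c | D (emb c)] (maxn r1 1) s) => //.
- by rewrite leq_max orbT.
- split=> [|g h hg hh|g hg] /=; first by rewrite emb1.
    by rewrite embM; exact: DM.
  by rewrite embV; exact: DV.
- by move=> c Dc; exact: (emb_KcV (DK _ Dc)).
- move=> c Kk; exists 1%g, (emb c); rewrite mul1g; split=> //; first by have [] := sC.
  by split; [exact: emb_Pj|exact: emb_Kc].
- move=> u c hu Dc; rewrite /integrand embM (lamM wl); last exact/emb_up.
  have lc : lam (ract pi (emb c) x) = 1.
    by have [c0 [k [Cc [_ Kk] ->]]] := Dc; rewrite ractM fxs // C1.
  rewrite (lamM wk) // lc emb_char // mulr1 fx'; last first.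
    by apply: (@Kc_le _ _ _ (maxn r1 1)); [exact: leq_maxl|exact: (emb_KcV (DK _ Dc))].
  rewrite kx' mulr1 /char_of_unipotent mulfV ?mul1r; last exact: theta_neq0 ht _.
  rewrite PhiE asboolT // => i ij.
  have -> : glmx (emb (u * c)%g) jj i = glmx (emb c) jj i.
    have hi : (i < m)%N by rewrite -ejj.
    rewrite (ixE e hi) !glmx_emb !embE glmxM mxE (bigD1 l) //= big1 ?addr0 => [|k kl]; first last.
      by rewrite hu ?[(l == k)]eq_sym ?(negbTE kl) ?mul0r // -ltnS el.
    by rewrite hu // eqxx mul1r.
  have [c0 [k [Cc [Uk Kk] ->]]] := Dc; have [Uc _] := CU _ Cc.
  have -> : glmx (c0 * k)%g jj i = glmx k jj i.
    rewrite glmxM mxE (bigD1 jj) //= big1 ?addr0 => [|l' lj]; last first.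
      have := Uc.1 jj l'; rewrite mxB1E /Pj ej ltnn eq_sym (negbTE lj) subr0 => /(_ isT) ->.
      by rewrite mul0r.
    have := Uc.1 jj jj; rewrite mxB1E /Pj ej ltnn eqxx => /(_ isT)/eqP; rewrite subr_eq0 => /eqP ->.
    by rewrite mul1r.
  by have := Kk.1 jj i; rewrite mxB1E eq_sym.
- move=> g ng; rewrite /integrand PhiE; case: asboolP => [hrow|_]; last by rewrite mulr0.
  have Ug : UJ (Pj jj.+1) (emb g) by rewrite ejj; exact: emb_Pj.
  have [u [g' [k [hu Ug' Uk Kk eg]]]] := row_split s0 Ug hrow.
  rewrite eg ractM fxs // (lamM wl) // C0 ?mulr0 ?mul0r //; first by rewrite -ej.
  move=> u1 c1 hu1 Cc1 e1; rewrite ejj in Uk.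
  have Dck : D (c1 * k)%g by exists c1, k.
  have Uck : UJ (Pj m) (c1 * k)%g by apply: PM => //; apply: Pjj; exact: (CU _ Cc1).1.
  have [c' ec] := emb_surj e Uck.
  have eu : (u * u1)%g = emb (g * c'^-1)%g by rewrite embM embV -ec eg e1 !mulgE.
  apply: (ng (g * c'^-1)%g c'); last by rewrite !mulgE.
    apply/(emb_up e); rewrite -eu; have [_ UM _] := @upper_subgr F n; exact: UM.
  by rewrite /= -ec.
Qed.

End One.

(** * The unipotent integration *)

Section Haar.
Variables (F : localFieldType) (R : closedFieldType) (j m : nat).
Variables (muM : ('M[F]_(j, m) -> R) -> R) (hM : haar_measure muM).
Local Notation M := 'M[F]_(j, m).
Implicit Types (L : set M) (h : M -> R) (x : M).

Definition ch L x : R := if `[< L x >] then 1 else 0.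

Lemma Cc_lin a h h' : @Cc R M h -> @Cc R M h' -> @Cc R M (fun x => a * h x + h' x).
Proof.
move=> /CcmxP [[t1 h1] [b1 c1]] /CcmxP [[t2 h2] [b2 c2]]; apply/CcmxP; split.
  exists (maxn t1 t2) => x y hy; rewrite h1 ?h2 //; apply: mxO_le hy; lia.
exists (maxn b1 b2) => x; have [e|nz _] := eqVneq (h x) 0; last by apply: mxO_le (c1 x nz); lia.
by rewrite e mulr0 add0r => /c2 hx; apply: mxO_le hx; lia.
Qed.

Lemma Cc_0 : @Cc R M (fun=> 0).
Proof. by apply/CcmxP; split; exists 0%N => // x; rewrite eqxx. Qed.

Lemma muM_0 : muM (fun=> 0) = 0.
Proof.
have [lin _ _] := hM; have := lin (-1) _ _ Cc_0 Cc_0.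
by rewrite mulr0 addr0 mulN1r addNr.
Qed.

Lemma muM_scale a h : @Cc R M h -> muM (fun x => a * h x) = a * muM h.
Proof.
have [lin _ _] := hM => ch; rewrite -[RHS]addr0 -muM_0 -(lin _ _ _ ch Cc_0).
by congr muM; apply/funext => x; rewrite addr0.
Qed.

Lemma muM_sum (I : Type) (l : seq I) (c : I -> R) (h : I -> M -> R) : (forall i, @Cc R M (h i)) ->
  muM (fun x => \sum_(i <- l) c i * h i x) = \sum_(i <- l) c i * muM (h i).
Proof.
move=> hh; suff [] : @Cc R M (fun x => \sum_(i <- l) c i * h i x) /\
  muM (fun x => \sum_(i <- l) c i * h i x) = \sum_(i <- l) c i * muM (h i) by [].
elim: l => [|i l [IH1 IH2]].
  have -> : (fun x => \sum_(i <- [::]) c i * h i x) = (fun=> 0).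
    by apply/funext => x; rewrite big_nil.
  by rewrite big_nil muM_0; split; [exact: Cc_0|].
have -> : (fun x => \sum_(i <- i :: l) c i * h i x) = (fun x => c i * h i x + \sum_(i <- l) c i * h i x).
  by apply/funext => x; rewrite big_cons.
have [lin _ _] := hM; split; first exact: Cc_lin.
by rewrite lin // IH2 big_cons.
Qed.

Section Lattice.
Variables (L : set M) (t : nat).
Hypotheses (L0 : L 0) (LB : forall x y, L x -> L y -> L (x - y)).
Hypotheses (Lt : forall x, mxO t%:Z x -> L x) (LO : forall x, L x -> mxO 0 x).

Lemma lattD x y : L x -> L y -> L (x + y).
Proof. by move=> Lx Ly; rewrite -[y]opprK; apply: (LB Lx); rewrite -[- y]add0r; exact: LB. Qed.

Lemma Cc_ch y : @Cc R M (fun x => ch L (y + x)).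
Proof.
have [c hc] := mxO_exists y; apply/CcmxP; split.
  exists t => x z hz; rewrite /ch; congr (if _ then _ else _); apply: asbool_equiv_eq.
  have Lz := Lt hz; rewrite addrA; split=> h; last exact: lattD.
  by rewrite -(addrK z (y + x)); exact: LB.
exists c => x; rewrite /ch; case: asboolP => [h _|]; last by rewrite eqxx.
have -> : x = (y + x) - y by rewrite addrAC subrr add0r.
by apply: mxOB => //; apply: mxO_le (LO h); lia.
Qed.

Lemma Cc_ch0 : @Cc R M (ch L).
Proof.
have -> : ch L = fun x => ch L (0 + x) by apply/funext => x; rewrite add0r.
exact: Cc_ch.
Qed.

(** The function is a finite combination of the characteristic functions of cosets of [L], which all have
the same volume. *)
Lemma haar_reps (b : nat) : exists l : seq M, forall h,
  (forall x y, L y -> h (x + y) = h x) -> (forall x, h x != 0 -> mxO (- b%:Z) x) ->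
  muM h = muM (ch L) * \sum_(x <- l) h x.
Proof.
have [l0 hl0] := mx_cover (fun=> t) (@compact_mxO F j m (- b%:Z)).
pose code x := find (fun y => `[< L (x - y) >]) l0.
have codeE x y : L (x - y) -> code x = code y.
  move=> h; apply: eq_find => z; apply: asbool_equiv_eq; split=> h'.
    have -> : y - z = (x - z) - (x - y) by rewrite opprB [RHS]addrC addrA subrK.
    exact: LB.
  by have := lattD h h'; rewrite addrA subrK.
pose l := [seq nth 0 l0 i | i <- iota 0 (size l0) & code (nth 0 l0 i) == i].
exists l => h hinv hb.
have eh : h = fun x => \sum_(y <- l) h y * ch L (- y + x).
  apply/funext => x; rewrite big_map big_filter.
  have [e0|nz] := eqVneq (h x) 0.
    rewrite e0 big1 // => i _; rewrite /ch; case: asboolP => [Li|_]; last by rewrite mulr0.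
    by have := hinv (nth 0 l0 i) _ Li; rewrite addNKr e0 => <-; rewrite mul0r.
  have [y yl hy] := hl0 _ (hb _ nz).
  have hx : has (fun y => `[< L (x - y) >]) l0.
    by apply/hasP; exists y => //; apply/asboolP; exact: Lt.
  pose i := code x; have Li : L (x - nth 0 l0 i) by have := nth_find 0 hx => /asboolP.
  have il : (i < size l0)%N by rewrite -has_find.
  have ci : code (nth 0 l0 i) = i by rewrite -(codeE _ _ Li).
  have eL z : - z + x = x - z by rewrite addrC.
  rewrite (big_rem i) ?mem_iota //= ci eqxx eL /ch asboolT // mulr1.
  rewrite [X in _ + X]big1_seq ?addr0 => [|k /andP[/eqP ck]].
    by rewrite -(hinv (nth 0 l0 i) _ Li) addrC subrK.
  rewrite mem_rem_uniq ?iota_uniq // inE => /andP[/eqP ki _]; rewrite eL; case: asboolP => [Lk|_]; last by rewrite mulr0.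
  by case: ki; rewrite -ck -(codeE _ _ Lk).
rewrite {1}eh muM_sum => [|y]; last exact: Cc_ch.
rewrite mulr_sumr; apply: eq_bigr => y _; rewrite mulrC; congr (_ * _).
have [_ tr _] := hM; apply: (tr (- y) (ch L)); exact: Cc_ch0.
Qed.

End Lattice.

(** If [L] had volume zero, [haar_reps] would make the integral of every [L]-invariant function vanish. *)
Lemma muM_ch_neq0 : exists t0 : nat, forall L (t : nat), L 0 -> (forall x y, L x -> L y -> L (x - y)) ->
  (forall x, mxO t%:Z x -> L x) -> (forall x, L x -> mxO t0%:Z x) -> muM (ch L) != 0.
Proof.
have [_ _ [f /CcmxP [[t0 ft] [b fb]] nf]] := hM.
exists t0 => L t L0 LB Lt LO; have LO' x : L x -> mxO 0 x by move=> /LO h; apply: mxO_le h; lia.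
have [l hl] := haar_reps L0 LB Lt LO' b.
by apply: contraNneq nf => e; rewrite (hl f) // => [|x y /LO]; [rewrite e mul0r|exact: ft].
Qed.

End Haar.

Section Lower.
Variables (F : localFieldType) (m d n : nat) (e : (m + d)%N = n).
Local Notation emb := (emb e).
Local Notation ix := (ix e).
Implicit Types (A : 'M[F]_m) (X Y : 'M[F]_(d, m)) (g : GL F m).

Definition cbm A X : 'M[F]_n := castmx (e, e) (block_mx A 0 X 1%:M).

Definition rx (i : 'I_d) : 'I_n := cast_ord e (rshift m i).

Lemma ix_or_rx (c : 'I_n) : (exists a, c = ix a) \/ exists i, c = rx i.
Proof.
have [a ea|i ei] := splitP (cast_ord (esym e) c); [left; exists a|right; exists i]; exact: val_inj.
Qed.

Lemma cbm_ul A X a b : cbm A X (ix a) (ix b) = A a b.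
Proof. by rewrite /cbm castmxE /ix !cast_ordK block_mxEul. Qed.

Lemma cbm_ur A X a i : cbm A X (ix a) (rx i) = 0.
Proof. by rewrite /cbm castmxE /ix /rx !cast_ordK block_mxEur mxE. Qed.

Lemma cbm_dl A X i a : cbm A X (rx i) (ix a) = X i a.
Proof. by rewrite /cbm castmxE /ix /rx !cast_ordK block_mxEdl. Qed.

Lemma cbm_dr A X i k : cbm A X (rx i) (rx k) = (i == k)%:R.
Proof. by rewrite /cbm castmxE /rx !cast_ordK block_mxEdr mxE. Qed.

Lemma cbmM A X B Y : cbm A X *m cbm B Y = cbm (A *m B) (X *m B + Y).
Proof.
rewrite /cbm; case: n / e; rewrite !castmx_id mulmx_block.
by rewrite !mulmx0 !mul0mx mulmx1 mul1mx !addr0 !add0r.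
Qed.

Lemma cbm1 : cbm 1%:M 0 = 1%:M.
Proof. exact: embmx1. Qed.

Lemma nm_unit X : cbm 1%:M X \in unitmx.
Proof.
have : cbm 1%:M X *m cbm 1%:M (- X) = 1%:M by rewrite cbmM !mulmx1 subrr cbm1.
by move=> /mulmx1_unit [].
Qed.

Definition nm X : GL F n := MkGL (nm_unit X).

Lemma glmx_nm X : glmx (nm X) = cbm 1%:M X. Proof. by []. Qed.

Lemma nmM X Y : nm (X + Y) = (nm X * nm Y)%g.
Proof. by apply: glmx_inj; rewrite glmxM !glmx_nm cbmM !mulmx1. Qed.

Lemma nm0 : nm 0 = (1%g : GL F n).
Proof. by apply: glmx_inj; rewrite glmx_nm cbm1 glmx1. Qed.

Lemma nmV X : (nm X)^-1%g = nm (- X).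
Proof.
rewrite -[LHS]mulg1; have -> : (1%g : GL F n) = (nm X * nm (- X))%g by rewrite -nmM subrr nm0.
by rewrite !mulgE.
Qed.

Lemma glmx_embnm g X : glmx (emb g * nm X)%g = cbm (glmx g) X.
Proof. by rewrite glmxM glmx_emb glmx_nm; have := cbmM (glmx g) 0 1%:M X; rewrite !mulmx1 add0r => <-. Qed.

Lemma glmx_embnmV g X : glmx (emb g * nm X)^-1%g = cbm (glmx g^-1%g) (- (X *m glmx g^-1%g)).
Proof.
rewrite invgM nmV -embV glmxM glmx_emb glmx_nm.
by have := cbmM 1%:M (- X) (glmx g^-1%g) 0; rewrite mul1mx mulNmx addr0 => <-.
Qed.

Lemma mxO_cbm (s : int) A X : s <= 0 -> mxO s A -> mxO s X -> mxO s (cbm A X).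
Proof.
move=> s0 hA hX a b; have [[c ->]|[c ->]] := ix_or_rx a; have [[c' ->]|[c' ->]] := ix_or_rx b.
- by rewrite cbm_ul.
- by rewrite cbm_ur; exact: inO0.
- by rewrite cbm_dl.
- by rewrite cbm_dr; case: eqP => _; [exact: inO_le (inO1 _)|exact: inO0].
Qed.

Lemma Kc_nm (s : nat) X : mxO s%:Z X -> Kc s (nm X).
Proof.
have aux Y : mxO s%:Z Y -> mxO s%:Z (cbm 1%:M Y - 1%:M).
  move=> hY a b; rewrite -cbm1 !mxE; have [[c ->]|[c ->]] := ix_or_rx a; have [[c' ->]|[c' ->]] := ix_or_rx b.
  - by rewrite !cbm_ul subrr; exact: inO0.
  - by rewrite !cbm_ur subrr; exact: inO0.
  - by rewrite !cbm_dl mxE subr0.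
  - by rewrite !cbm_dr subrr; exact: inO0.
by move=> hX; split; [exact: aux|rewrite nmV; apply: aux; exact: mxON].
Qed.

(** Conjugation by a bounded matrix costs a bounded loss of level. *)
Lemma nm_fixd (R : closedFieldType) (r : rep R (GL F n)) (s b : nat) v Y : fixd (@Kc F n) s v ->
  mxO (- b%:Z) Y -> fixd (@Kc F n) (s + 2 * b) (ract r (nm Y) v).
Proof.
move=> fv hY k Kk; rewrite -ractM; have -> : (k * nm Y = nm Y * ((nm Y)^-1 * k * nm Y))%g by rewrite !mulgE.
rewrite ractM fv //.
have hn Z : mxO (- b%:Z) Z -> mxO (- b%:Z) (glmx (nm Z)).
  move=> hZ; apply: mxO_cbm => //; first by lia.
  by apply: (@mxO_le F m m _ 0); [lia|exact: mxO1].
have aux h : mxO (s + 2 * b)%N%:Z (glmx h - 1%:M) -> mxO s%:Z (glmx ((nm Y)^-1 * h * nm Y)%g - 1%:M).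
  move=> hh; have -> : glmx ((nm Y)^-1 * h * nm Y)%g - 1%:M = glmx (nm (- Y)) *m (glmx h - 1%:M) *m glmx (nm Y).
    by rewrite mulmxBr mulmxBl mulmx1 -nmV glmxVK.
  apply: mxO_le (mxOM (mxOM (hn _ (mxON hY)) hh) (hn _ hY)); lia.
split; first by apply: aux; exact: Kk.1.
rewrite !invgM invgK mulgA; apply: aux; exact: Kk.2.
Qed.

Section Rows.
Variables (R : closedFieldType) (sq : sqrt_resq F R) (theta : F -> R) (ht : nontrivial_smooth_character theta).
Variables (r : rep R (GL F n)) (sm : ksmooth (@Kc F n) r).

Let A : pred 'I_n := fun i => (i < m)%N.

(** The rows of [X] below [j] vanish, so [colact] applies to the row of [X] of index [j]. *)
Lemma nm_colact (lam : {scalar r}) g X (j j1 : 'I_d) u w : whittaker_functional theta lam ->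
  j1 = j.+1 :> nat -> (forall i : 'I_d, (j < i)%N -> row i X = 0) -> UJ (Jc A (rx j1)) u ->
  lam (ract r (emb g * nm X)%g (ract r u w)) =
    theta (\sum_(i | A i) glmx (emb g * nm X)%g (rx j) i * glmx u i (rx j1)) * lam (ract r (emb g * nm X)%g w).
Proof.
move=> wl ej hX; apply: colact => //.
- by move=> i Ai; apply: leq_trans Ai _; rewrite /= leq_addr.
- by rewrite /= ej addnS.
- have X0 : row j1 (X *m glmx g^-1%g) = 0 by rewrite row_mul hX ?mul0mx // ej.
  move=> c; rewrite glmx_embnmV; have [[a ->]|[i ->]] := ix_or_rx c.
    rewrite cbm_dl mxE; have := congr1 (fun Z : 'rV_m => Z 0 a) X0; rewrite [LHS]mxE => ->.
    by rewrite mxE oppr0 -val_eqE /= gtn_eqF // (leq_trans (ltn_ord a)) // leq_addr.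
  by rewrite cbm_dr -(inj_eq (@rshift_inj m d)) -(inj_eq (@cast_ord_inj _ _ e)).
- move=> a i ba Ai; rewrite (ixE e Ai) glmx_embnm; have [[c ec]|[c ec]] := ix_or_rx a.
    by move: ba; rewrite ec /= leqNgt (leq_trans (ltn_ord c)) // leq_addr.
  rewrite ec cbm_dl; have jc : (j < c)%N by move: ba; rewrite ec /= leq_add2l ej.
  by have := congr1 (fun Z : 'rV_m => Z 0 (Ordinal Ai)) (hX c jc); rewrite mxE => ->; rewrite mxE.
Qed.

Lemma embnm_row g X j a : glmx (emb g * nm X)%g (rx j) (ix a) = X j a.
Proof. by rewrite glmx_embnm cbm_dl. Qed.

Definition rpart (j : 'I_d) X : 'M[F]_(d, m) := \matrix_(i, a) (if i == j then X j a else 0).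

Lemma rpart_rest (j : 'I_d) X : (forall i : 'I_d, (j < i)%N -> row i X = 0) ->
  forall i : 'I_d, (j <= i)%N -> row i (X - rpart j X) = 0.
Proof.
move=> hX i ji; apply/rowP => a; rewrite !mxE; case: eqP => [->|/eqP ij]; first by rewrite subrr.
have ji' : (j < i)%N by rewrite ltn_neqAle ji andbT eq_sym.
by have := congr1 (fun Z : 'rV_m => Z 0 a) (hX i ji'); rewrite !mxE => ->; rewrite subr0.
Qed.

(** For the last nonzero row of [X], [nm_colact] with [u] fixing [v] shows that [theta] is trivial on the
products of the row by small scalars; the other rows follow by induction. *)
Lemma nm_bounded (j : nat) : (j < d)%N -> forall s : nat, exists b : nat, forall v, fixd (@Kc F n) s v ->
  forall lam : {scalar r}, whittaker_functional theta lam -> forall g X,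
  (forall i : 'I_d, (j <= i)%N -> row i X = 0) -> lam (ract r (emb g * nm X)%g v) != 0 -> mxO (- b%:Z) X.
Proof.
have [c0 hc0] := theta_exact ht.
elim: j => [|j IH] jd s.
  exists 0%N => v _ lam _ g X X0 _ i a.
  by have := congr1 (fun Z : 'rV_m => Z 0 a) (X0 i isT); rewrite !mxE => ->; exact: inO0.
pose jj := Ordinal (ltnW jd); pose j1 := Ordinal jd.
have hA (i : 'I_n) : A i -> (i < rx j1)%N by move=> Ai; apply: leq_trans Ai _; rewrite /= leq_addr.
have [tJ rJ uJ] := Jc_facts F hA.
(* the last row is bounded in terms of the level of [v] only, and its part of [nm X] moves [v] to a vector
   of controlled level, to which the induction hypothesis applies *)
pose b0 := (`|c0| + s)%N; have [b hb] := IH (ltnW jd) (s + 2 * b0)%N.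
exists (maxn b b0) => v fv lam wl g X hX nz.
have hX' (i : 'I_d) : (jj < i)%N -> row i X = 0 by exact: hX.
have hY : mxO (- b0%:Z) (rpart jj X).
  move=> i a; rewrite mxE; case: ifP => _; last exact: inO0.
  have : inO c0 (unif ^ s%:Z * X jj a); last by rewrite inO_pwM; apply: inO_le; rewrite /b0; lia.
  apply/hc0 => t ot.
  pose Z : 'M[F]_n := \matrix_(i, k) (if (i == ix a) && (k == rx j1) then unif ^ s%:Z * t else 0).
  have sZ : supp (Jc A (rx j1)) Z.
    move=> i' k; rewrite mxE; case: ifP => // /andP[/eqP -> /eqP ->].
    by rewrite /Jc eqxx andbT /A /= ltn_ord.
  have OZ : mxO s%:Z Z.
    move=> i' k; rewrite mxE; case: ifP => _; last exact: inO0.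
    by rewrite inO_pwM subrr.
  have [u [Ku Uu] eu] := @padm_ranked F n _ s tJ rJ Z sZ OZ.
  have := @nm_colact lam g X jj j1 u v wl erefl hX' Uu; rewrite (fv u Ku) => /eqP.
  rewrite -{1}[lam _]mul1r -subr_eq0 -mulrBl mulf_eq0 subr_eq0 (negbTE nz) orbF => /eqP h1.
  have aj : (ix a == rx j1) = false by rewrite -val_eqE /= ltn_eqF // (leq_trans (ltn_ord a)) // leq_addr.
  rewrite [RHS]h1 (bigD1 (ix a)) /=; last by rewrite /A /= ltn_ord.
  rewrite embnm_row eu !mxE !eqxx /= aj add0r big1 ?addr0; first by congr theta; rewrite mulrAC mulrC mulrA [X jj a * _]mulrC.
  move=> k /andP[Ak /negbTE ka]; rewrite !mxE ka /= addr0 [(k == rx j1)](_ : _ = false) ?mulr0 //.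
  by apply/negbTE; rewrite -val_eqE /= neq_ltn (hA k Ak).
have eX : X = (X - rpart jj X) + rpart jj X by rewrite subrK.
have hX0 : mxO (- b%:Z) (X - rpart jj X).
  apply: (hb _ (nm_fixd fv hY) lam wl g _ (rpart_rest hX')).
  by rewrite -ractM -mulgA -nmM -eX.
rewrite eX; apply: mxOD; [apply: mxO_le hX0|apply: mxO_le hY]; lia.
Qed.

(** The first rows are cut before the last one, which is cut at a level where it no longer moves the vector
obtained so far. *)
Lemma nm_cut (j : nat) : (j < d)%N -> forall (t0 : nat) (v : r), exists (S : nat -> nat) (w : r),
  (forall i, t0 <= S i)%N /\ forall lam : {scalar r}, whittaker_functional theta lam -> forall g X,
  (forall i : 'I_d, (j <= i)%N -> row i X = 0) ->
  lam (ract r (emb g * nm X)%g w) =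
    if `[< forall (i : 'I_d) a, (i < j)%N -> inO (S i)%:Z (X i a) >] then lam (ract r (emb g) v) else 0.
Proof.
elim: j => [|j IH] jd t0 v.
  exists (fun=> t0), v; split=> // lam wl g X X0; have -> : X = 0.
    by apply/row_matrixP => i; rewrite X0 // row0.
  by rewrite nm0 mulg1 asboolT.
have [S [w [St hw]]] := IH (ltnW jd) t0 v; have [sw fw] := sm w.
pose jj := Ordinal (ltnW jd); pose j1 := Ordinal jd.
have hA (i : 'I_n) : A i -> (i < rx j1)%N by move=> Ai; apply: leq_trans Ai _; rewrite /= leq_addr.
(* the last row is cut at a level where its part of [nm X] fixes [w] *)
have [w' [s' [ss' hw']]] := cut sq ht sm hA (fun=> 0) w (maxn sw t0).
exists (fun i => if i == j then s' else S i), w'; split=> [i|lam wl g X hX].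
  by case: ifP => // _; move: ss'; lia.
have hX' (i : 'I_d) : (jj < i)%N -> row i X = 0 by exact: hX.
rewrite (hw' lam _ (fun i => glmx (emb g * nm X)%g (rx jj) i)) => [|u z Uu]; last exact: (@nm_colact lam g X jj j1).
have eX : X = (X - rpart jj X) + rpart jj X by rewrite subrK.
have Xrest (i : 'I_d) a : (i < j)%N -> (X - rpart jj X) i a = X i a.
  by move=> ij; rewrite !mxE -val_eqE /= ltn_eqF // subr0.
case: asboolP => [h1|n1]; last first.
  rewrite asboolF // => h; apply: n1 => i Ai; rewrite subr0 (ixE e Ai) embnm_row.
  by have := h jj (Ordinal Ai) (ltnSn _); rewrite /= eqxx.
have hj a : inO s'%:Z (X jj a).
  by have := h1 (ix a); rewrite subr0 embnm_row; apply; rewrite /A /= ltn_ord.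
have Kr : Kc sw (nm (rpart jj X)).
  apply: Kc_nm => i a; rewrite mxE; case: ifP => _; last exact: inO0.
  by apply: inO_le (hj a); move: ss'; lia.
rewrite [in LHS]eX nmM mulgA ractM (fw _ Kr) (hw lam wl g _ (rpart_rest hX')).
congr (if _ then _ else _); apply: asbool_equiv_eq; split=> h i a ij.
  have [ej|nj] := eqVneq (i : nat) j; first by have -> : i = jj by exact: val_inj.
  by rewrite -Xrest; [apply: h|]; move: ij nj; rewrite ltnS leq_eqVlt => /orP[->|].
by rewrite Xrest //; have := h i a (ltnW ij); rewrite ltn_eqF.
Qed.

End Rows.
End Lower.

(** * The two families of integrals *)

Section Equal.
Variables (F : localFieldType) (R : closedFieldType) (sq : sqrt_resq F R) (theta : F -> R).
Variables (n : nat) (pi pi' : rep R (GL F n)) (mu : (GL F n -> R) -> R).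

Lemma zeta_span_eqE : zeta_span_eq theta pi pi' mu = lspan (zset sq theta (addn0 n) pi pi' mu).
Proof.
have zE lam kap v v' Phi : zint sq (addn0 n) mu lam kap v v' Phi =
    zeta_eq mu (fun g => lam (ract pi g v)) (fun g => kap (ract pi' g v')) Phi.
  apply/funext => k; rewrite /zint mulr0 expr0z mulr1 /zeta_eq; congr mu; apply/funext => g.
  by rewrite /cf /integrand emb0.
congr lspan; apply/seteqP; split=> Z.
  move=> [W [W' [Phi [[lam [wl nl [v hv]]] [kap [wk nk [v' hv']]] cP ->]]]].
  exists lam, kap, v, v', Phi; split=> //; split; first by split.
  rewrite zE; congr (zeta_eq mu _ _ Phi); apply/funext => g; [exact: hv|exact: hv'].
move=> [lam [kap [v [v' [Phi [wl nl wk nk [[cP _] ->]]]]]]].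
exists (fun g => lam (ract pi g v)), (fun g => kap (ract pi' g v')), Phi; split=> //.
- by exists lam; split=> //; exists v.
- by exists kap; split=> //; exists v'.
- exact: cP.
Qed.

End Equal.

Section Unequal.
Variables (F : localFieldType) (R : closedFieldType) (sq : sqrt_resq F R).
Variables (theta : F -> R) (ht : nontrivial_smooth_character theta).
Variables (m n : nat) (lt_mn : (m < n)%N).
Variables (pi : rep R (GL F n)) (pi' : rep R (GL F m)).
Hypotheses (sm : ksmooth (@Kc F n) pi).
Variables (mu : (GL F m -> R) -> R) (hmu : quotient_measure mu).
Variables (j : nat) (hj : (j <= n - m - 1)%N) (muM : ('M[F]_(j, m) -> R) -> R) (hM : haar_measure muM).

Local Notation le_mn := (ltnW lt_mn).
Local Notation e := (subnKC le_mn).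
Local Notation d := (n - m)%N.
Local Notation zset := (zset sq theta e pi pi' mu).
Local Notation P x := ((pid_mx j : 'M[F]_(d, j)) *m x).
Local Notation theta' := (fun x => (theta x)^-1).

Let d0 : (0 < d)%N. Proof. by rewrite subn_gt0. Qed.
Let jd : (j < d)%N. Proof. by move: d0 hj; lia. Qed.

Lemma corner_emb g (x : 'M[F]_(j, m)) : corner le_mn g x = (emb e g * nm e (P x))%g.
Proof. by apply: glmx_inj; rewrite glmx_embnm. Qed.

Lemma pid_row (x : 'M[F]_(j, m)) (i : 'I_d) : (j <= i)%N -> row i (P x) = 0.
Proof.
move=> ji; apply/rowP => a; rewrite !mxE big1 // => k _.
by rewrite mxE [(i < j)%N]ltnNge ji andbF mul0r.
Qed.

Lemma pid_entry (x : 'M[F]_(j, m)) (i : 'I_j) a : P x (widen_ord (ltnW jd) i) a = x i a.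
Proof.
rewrite mxE (bigD1 i) //= big1 ?addr0 => [|k ki]; first by rewrite mxE eqxx /= ltn_ord mul1r.
by rewrite mxE -[(_ == _ :> nat)]/(i == k :> nat) val_eqE eq_sym (negbTE ki) mul0r.
Qed.

Lemma pid_mxO (s : int) (x : 'M[F]_(j, m)) : mxO s x <-> mxO s (P x).
Proof.
split=> h i a; last by rewrite -pid_entry.
have [lt|ge] := ltnP i j.
  have -> : i = widen_ord (ltnW jd) (Ordinal lt) by exact: val_inj.
  by rewrite pid_entry.
by have := congr1 (fun Z : 'rV_m => Z 0 a) (pid_row x ge); rewrite !mxE => ->; exact: inO0.
Qed.

Definition gens : set (int -> R^o) := [set Z | exists W W',
  [/\ whittaker_model theta pi W, whittaker_model theta' pi' W' &
      Z = zeta_lt sq le_mn muM mu W W']].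

Lemma mxO_lattice (s : nat) : [/\ mxO s%:Z (0 : 'M[F]_(j, m)),
  forall x y : 'M[F]_(j, m), mxO s%:Z x -> mxO s%:Z y -> mxO s%:Z (x - y) &
  forall x : 'M[F]_(j, m), mxO s%:Z x -> mxO 0 x].
Proof.
split=> [|x y|x h]; [exact: mxO0|exact: mxOB|by apply: mxO_le h; lia].
Qed.

Lemma mu_cf_neq0 (f : GL F m -> R) k : mu (cf f k) != 0 -> exists g, f g != 0.
Proof.
move=> nz; apply: contrapT => h; case/eqP: nz; rewrite -(mu0 hmu); congr mu; apply/funext => g.
by rewrite /cf; case: ifP => // _; apply: contrapT => /eqP nf; apply: h; exists g.
Qed.

(** The function integrated over [x] is invariant under a lattice and bounded by
[nm_bounded], so its integral is a finite sum. *)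
Lemma gens_zset : gens `<=` span zset.
Proof.
move=> _ [W [W' [[lam [wl nl [v hv]]] [kap [wk nk [v' hv']]] ->]]].
have [s fv] := sm v; have [b hb] := nm_bounded e ht pi jd s.
pose vx x := ract pi (nm e (P x)) v.
pose h k x := mu (cf (integrand e lam kap (vx x) v' (fun=> 1)) k).
have [L0 LB LO] := mxO_lattice s.
have [l hl] := haar_reps hM L0 LB (fun x hx => hx) LO b.
have hE k : muM (h k) = muM (ch R (@mxO F s%:Z j m)) * \sum_(x <- l) h k x.
  apply: hl => [x y hy|x].
    rewrite /h; congr (mu (cf (integrand _ _ _ _ _ _) _)).
    rewrite /vx mulmxDr nmM ractM.
    by rewrite fv //; apply: Kc_nm; apply/pid_mxO.
  move=> /mu_cf_neq0 [g]; rewrite /integrand !mulf_eq0 !negb_or => /andP[/andP[nz _] _].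
  apply/pid_mxO; apply: (hb v fv lam wl g); first exact: pid_row.
  by rewrite ractM.
have -> : zeta_lt sq le_mn muM mu W W' =
    \sum_(x <- l) muM (ch R (@mxO F s%:Z j m)) *: (zint sq e mu lam kap (vx x) v' (fun=> 1)).
  apply/funext => k; rewrite /zeta_lt.
  have -> : (fun x => mu (fun g => if lfval (\det (glmx g)) == k then W (corner le_mn g x) * W' g else 0)) = h k.
    apply/funext => x; rewrite /h; congr mu; apply/funext => g; rewrite /cf; case: ifP => // _.
    by rewrite /integrand hv hv' mulr1 corner_emb ractM.
  rewrite hE; elim: l {hl hE} => [|x l IH]; first by rewrite !big_nil mulr0 mul0r.
  rewrite !big_cons mulrDr mulrDl IH.
  by rewrite -[RHS]/(muM _ * (h k x * _) + _) mulrA.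
have [sp0 spD] := span_subspace zset.
elim/big_rec: _ => [|x Z _ hZ]; first exact: sp0.
apply: spD => //; apply: sub_span; exists lam, kap, (vx x), v', (fun=> 1); split=> //; split=> //.
by split=> // dd; move: d0; rewrite dd.
Qed.

(** The vector provided by [nm_cut] makes the inner integral a multiple of the characteristic
function of a lattice, whose volume is not zero. *)
Lemma zset_gens : zset `<=` span gens.
Proof.
move=> _ [lam [kap [v [v' [Phi [wl nl wk nk [tf ->]]]]]]].
have eP : Phi = fun=> 1 by exact: tf.2 d0.
have [t0 ht0] := muM_ch_neq0 hM.
have [S [w [St hw]]] := nm_cut e sq ht sm jd t0 v.
pose L : set 'M[F]_(j, m) := [set x : 'M[F]_(j, m) | forall (i : 'I_j) (a : 'I_m), inO (S i)%:Z (x i a)].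
pose t := \max_(i < j) S i.
have tS (i : 'I_j) : (S i <= t)%N by exact: leq_bigmax.
have L0 : L 0 by move=> i a; rewrite mxE; exact: inO0.
have LB x y : L x -> L y -> L (x - y) by move=> hx hy i a; rewrite !mxE; exact: inOB.
have Lt x : mxO t%:Z x -> L x by move=> hx i a; apply: inO_le (hx i a); rewrite lez_nat.
have LO x : L x -> mxO t0%:Z x by move=> hx i a; apply: inO_le (hx i a); rewrite lez_nat.
have c0 := ht0 L t L0 LB Lt LO.
pose c := muM (ch R L).
have hZ : gens (zeta_lt sq le_mn muM mu (fun g => lam (ract pi g w)) (fun g => kap (ract pi' g v'))).
  exists (fun g => lam (ract pi g w)), (fun g => kap (ract pi' g v')); split=> //.
    by exists lam; split=> //; exists w.
  by exists kap; split=> //; exists v'.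
have eZ : zint sq e mu lam kap v v' Phi = c^-1 *:
    (zeta_lt sq le_mn muM mu (fun g => lam (ract pi g w)) (fun g => kap (ract pi' g v')) : int -> R^o).
  apply/funext => k; rewrite -[RHS]/(c^-1 * zeta_lt sq le_mn muM mu _ _ k) /zeta_lt.
  have -> : (fun x => mu (fun g => if lfval (\det (glmx g)) == k then
      lam (ract pi (corner le_mn g x) w) * kap (ract pi' g v') else 0)) =
      fun x => mu (cf (integrand e lam kap v v' Phi) k) * ch R L x.
    apply/funext => x; have eL : ch R L x = if `[< forall (i : 'I_d) a, (i < j)%N -> inO (S i)%:Z (P x i a) >] then 1 else 0.
      rewrite /ch; congr (if _ then _ else _); apply: asbool_equiv_eq; split=> h i a.
        by move=> ij; have := h (Ordinal ij) a; rewrite -pid_entry; congr (inO _ (P x _ _)); exact: val_inj.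
      by rewrite -pid_entry; apply: h; exact: (ltn_ord i).
    rewrite eL; case: asboolP => hS.
      rewrite mulr1; congr mu; apply/funext => g; rewrite /cf; case: ifP => // _.
      rewrite corner_emb (hw lam wl); last exact: pid_row.
      by rewrite asboolT // /integrand eP mulr1.
    rewrite mulr0 -[RHS](mu0 hmu); congr mu; apply/funext => g; case: ifP => // _.
    rewrite corner_emb (hw lam wl); last exact: pid_row.
    by rewrite asboolF // mul0r.
  rewrite (muM_scale hM); last by apply: (Cc_ch0 R L0 LB Lt) => x /LO h; apply: mxO_le h; lia.
  by rewrite [_ * muM _]mulrC !mulrA mulVf // mul1r.
rewrite eZ; exact: subspaceZ (span_subspace gens) (sub_span hZ).
Qed.

Lemma zeta_span_ltE : zeta_span_lt sq theta le_mn pi pi' muM mu = lspan zset.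
Proof.
apply/seteqP; split=> Z /lspanE h; apply/lspanE.
  exact: (span_min (span_subspace zset) gens_zset h).
exact: (span_min (span_subspace gens) zset_gens h).
Qed.

End Unequal.

Theorem theorem3p5 (F : localFieldType) (p ell : nat) (R : closedFieldType)
    (sq : sqrt_resq F R) (theta : F -> R)
    (hp : residue_char F p) (hell : prime ell) (hellp : ell <> p)
    (hR : is_Qlbar ell R \/ is_Flbar ell R)
    (htheta : nontrivial_smooth_character theta) :
  (forall (n : nat) (pi pi' : rep R (GL F n)) (mu : (GL F n -> R) -> R),
     (0 < n)%N ->
     whittaker_type sq ell theta pi -> whittaker_type sq ell theta pi' ->
     quotient_measure mu ->
     fractional_ideal (zeta_span_eq theta pi pi' mu) /\
     has_unique_euler_generator (zeta_span_eq theta pi pi' mu)) /\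
  (forall (m n : nat) (lt_mn : (m < n)%N)
          (pi : rep R (GL F n)) (pi' : rep R (GL F m))
          (mu : (GL F m -> R) -> R)
          (muM : forall j, ('M[F]_(j, m) -> R) -> R),
     (0 < m)%N ->
     whittaker_type sq ell theta pi -> whittaker_type sq ell theta pi' ->
     quotient_measure mu -> (forall j, haar_measure (muM j)) ->
     exists I : set (int -> R),
       [/\ forall j, (j <= n - m - 1)%N ->
             zeta_span_lt sq theta (ltnW lt_mn) pi pi' (muM j) mu = I,
           fractional_ideal I & has_unique_euler_generator I]).
Proof.
have ht := htheta; split=> [n pi pi' mu n0 wpi wpi' hmu|m n lt_mn pi pi' mu muM m0 wpi wpi' hmu hM].
  have [sm ad fg] := whittaker_good wpi; have [sm' ad' fg'] := whittaker_good wpi'.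
  have [lam wl nl] := whittaker_generic ht wpi.
  have [kap wk nk] := generic_inv ht (whittaker_generic ht wpi').
  rewrite (zeta_span_eqE sq); apply: (zset_main ht) => //.
  exact: (one_eq ht n0 sm sm' hmu wl nl wk nk (erefl 0%N)).
have [sm ad fg] := whittaker_good wpi; have [sm' ad' fg'] := whittaker_good wpi'.
have [lam wl nl] := whittaker_generic ht wpi.
have [kap wk nk] := generic_inv ht (whittaker_generic ht wpi').
exists (lspan (zset sq theta (subnKC (ltnW lt_mn)) pi pi' mu)).
have dn : (0 < n - m)%N by rewrite subn_gt0.
have [h1 h2] := zset_main ht m0 sm ad fg sm' ad' fg' hmu (one_lt (e := subnKC (ltnW lt_mn)) (sq := sq) ht m0 sm sm' hmu wl nl wk nk dn).
split=> // j hj; exact: (zeta_span_ltE sq ht lt_mn pi' sm hmu hj (hM j)).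
Qed.
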